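(* Let $f\in\mathcal F$ with associated integer $\rho\ge1$, and assume that for some open interval $I\subset(0,\infty)$ the limit $$\lim_{\substack{|z|\to\infty\\ \operatorname{Im} z=-t\log|z|,\ \operatorname{Re} z>0}}\frac{\log|f(z)|}{|z|^{\rho-1}\log|z|}=\ell_f(t)$$ exists for all $t\in I$. Then $$\lim_{r\to\infty}\frac{n(t;r)}{r^\rho}=\frac{\ell_f'(t)}{2\pi\rho}$$ for all $t\in I$ for which $\ell_f'(t)$ exists.
   Context: The class $\mathcal F$: $f\in\mathcal F$ if for some integer $\rho\ge 1$ (i) $f$ is holomorphic in the closed lower half-plane $\{-\pi\le\arg z\le 0\}$ and is of order at most $\rho$ and finite type there, i.e. $f(z)=O(e^{C|z|^\rho})$ as $|z|\to\infty$, $\operatorname{Im} z\le 0$, for some constant $C$; and (ii) $\int_0^r \frac{f'(s)}{f(s)}\,ds=O(|r|^{\rho-1})$ as $r\to+\infty$ and as $r\to-\infty$ along the real axis (in particular these integrals are assumed to make sense). For $f\in\mathcal F$ and $t\ge0$, $$\ell_f(t):=\limsup_{\substack{|z|\to\infty\\ \operatorname{Im} z=-t\log|z|,\ \operatorname{Re} z>0}}\frac{\log|f(z)|}{|z|^{\rho-1}\log|z|}.$$ For $0\le t<\infty$, $n(t;r):=\#\{z: f(z)=0,\ \operatorname{Re}z>0,\ 0\ge\operatorname{Im}z\ge -t\log(1+|z|),\ |z|<r\}$, zeros counted with multiplicity. *)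

(* Defs.v *)
From Stdlib Require Import Reals List.
From Coquelicot Require Import Coquelicot.

Open Scope R_scope.

(** Order topology on [Rbar]. Coquelicot's [Rbar_locally] only filters [R], so
    it cannot express convergence of functions that may take infinite values. *)
Definition Rbar_nbhds (l : Rbar) (P : Rbar -> Prop) : Prop :=
  match l with
  | Finite x => locally x (fun y : R => P (Finite y))
  | p_infty => exists M : R, forall y : Rbar, Rbar_lt M y -> P y
  | m_infty => exists M : R, forall y : Rbar, Rbar_lt y M -> P y
  end.

Definition Rbar_limsup {T : Type} (F : (T -> Prop) -> Prop) (q : T -> Rbar) : Rbar :=
  Rbar_glb (fun y => exists A : T -> Prop,
    F A /\ y = Rbar_lub (fun v => exists z, A z /\ v = q z)).

(** The filter "|z| tends to infinity". *)
Definition C_infty (P : C -> Prop) : Prop :=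
  exists M : R, forall z : C, M < Cmod z -> P z.

Definition holomorphic_at (f : C -> C) (z : C) : Prop :=
  locally z (fun w : C => ex_derive f w).

(** [f'/f] is required to be defined and integrable on the real axis. As division
    is total, "defined" has to be imposed by [f s <> 0]. *)
Definition class_F (rho : nat) (f : C -> C) : Prop :=
  (1 <= rho)%nat /\
  (forall z : C, Im z <= 0 -> holomorphic_at f z) /\
  (exists K M : R,
     within (fun z : C => Im z <= 0) C_infty
       (fun z => Cmod (f z) <= M * exp (K * Cmod z ^ rho))) /\
  (forall s : R, f (RtoC s) <> 0%C) /\
  (forall r : R,
     ex_RInt (V := C_R_CompleteNormedModule)
       (fun s : R => (C_derive f (RtoC s) / f (RtoC s))%C) 0 r) /\
  (exists M r0 : R, forall r : R, r0 <= Rabs r ->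
     Cmod (RInt (V := C_R_CompleteNormedModule)
       (fun s : R => (C_derive f (RtoC s) / f (RtoC s))%C) 0 r)
     <= M * Rabs r ^ (rho - 1)).

Definition log_curve (t : R) : (C -> Prop) -> Prop :=
  within (fun z : C => Im z = - t * ln (Cmod z) /\ 0 < Re z) C_infty.

(** Equal to minus infinity at the zeros of [f], where [ln 0 = 0] would be wrong. *)
Definition log_abs (f : C -> C) (z : C) : Rbar :=
  if Req_EM_T (Cmod (f z)) 0 then m_infty else Finite (ln (Cmod (f z))).

Definition growth (rho : nat) (f : C -> C) (z : C) : Rbar :=
  Rbar_div (log_abs f z) (Finite (Cmod z ^ (rho - 1) * ln (Cmod z))).

Definition ell (rho : nat) (f : C -> C) (t : R) : Rbar :=
  Rbar_limsup (log_curve t) (growth rho f).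

Definition zero_order (f : C -> C) (z : C) (m : nat) : Prop :=
  exists g : C -> C,
    holomorphic_at g z /\ g z <> 0%C /\
    locally z (fun w : C => f w = ((w - z) ^ m * g w)%C).

Definition in_region (t r : R) (z : C) : Prop :=
  0 < Re z /\ - t * ln (1 + Cmod z) <= Im z <= 0 /\ Cmod z < r.

(** Number of zeros with multiplicity: supremum, over finite lists of distinct
    zeros paired with their orders, of the sum of the orders. It is [p_infty] if
    there are infinitely many zeros of finite order. *)
Definition zero_count (f : C -> C) (t r : R) : Rbar :=
  Lub_Rbar (fun x : R => exists s : list (C * nat),
    NoDup (map fst s) /\
    (forall z m, In (z, m) s -> in_region t r z /\ f z = 0%C /\ zero_order f z m) /\
    x = INR (list_sum (map snd s))).

(* Main.v *)
(** The map [w = z + i t log z] straightens the curve [Im z = - t log |z|] to the real axis. Between this curve and the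
    real axis, Green's formula for [log f] with the weight [Im (w - w ^ 2 / (2 r))] (Carleman's method) expresses the sum
    of [(Im a + t log |a|) (r - |a|)] over the zeros [a] with [|a| < r] lying above the curve through the integral of
    [log |f|] over the curve, which is governed by the hypothesis on [ell]. The other sides of the contour contribute less:
    the real axis because of the bound on the integral of [f' / f], the right side because a Phragmen-Lindelof argument
    bounds [log |f|] from above and a second Carleman formula, with a sine weight, bounds its integral from below. Hence
    the sum is asymptotic to [ell(t) r ^ (rho + 1) log r / (2 PI rho (rho + 1))]. The sum being the zero count integrated
    once over the slope and once over the radius, its double difference quotients, taken on either side of [(t, r)],
    enclose [n(t; r)], by monotonicity of the count. *)

Require Import Defs.
From Stdlib Require Import Reals Lra Lia Psatz List Permutation Classical ClassicalEpsilon.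
From Coquelicot Require Import Coquelicot.

Open Scope R_scope.

(** * Complex derivatives and contour integrals *)

(** On the curve only log |f| is known, not arg f. The weights are therefore real on the curve and
    on the right side: integrating f'/f by parts there produces log |f| alone. On the real axis the
    weight may be complex, because the bound on the integral of f'/f controls the variation of arg f
    together with log |f|. Both are O(x^(rho-1)) there, smaller by a factor log x than the growth on
    the curve; this logarithm is what makes the axis negligible. The limit hypothesis holds at each
    slope separately, without uniformity in the slope. Hence only the slopes t - d, t, t + d, t + 2d
    enter, with d fixed before r tends to infinity, and only the derivative of [ell] at t is used.
    Zeros are handled through factorizations f = prodz l * g on boxes with g zero-free there; the
    vertical sides of the contours are moved slightly so as to avoid them. The density log |a| of
    the double sum is not constant: it is at most log r, and asymptotically at least log r once the
    zeros of modulus below r / log^2 r are set aside, which are few. *)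

Notation CDer := (@is_derive C_AbsRing C_NormedModule).
Notation PDer := (@is_derive R_AbsRing C_R_NormedModule).
Notation CInt := (@RInt C_R_CompleteNormedModule).
Notation is_CInt := (@is_RInt C_R_NormedModule).
Notation ex_CInt := (@ex_RInt C_R_NormedModule).
Notation Ccont := (@continuous C_UniformSpace C_UniformSpace).
Notation Pcont := (@continuous R_UniformSpace C_UniformSpace).

Lemma locally_C_Cmod (z : C) (P : C -> Prop) :
  locally z P <-> exists d : R, 0 < d /\ forall w : C, Cmod (w - z) < d -> P w.
Proof.
split.
- intros H. apply locally_C in H. destruct H as [d Hd].
  exists d; split; [apply cond_pos|]. intros w Hw. apply Hd. exact Hw.
- intros [d [Hd H]]. apply locally_C. exists (mkposreal d Hd). intros w Hw. apply H. exact Hw.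
Qed.

Lemma continuous_C_eps {U : UniformSpace} (f : U -> C) (z : U) :
  continuous f z <->
  forall e : R, 0 < e -> locally z (fun w => Cmod (f w - f z) < e).
Proof.
split.
- intros H e He. apply (H (fun w => Cmod (w - f z) < e)).
  apply locally_C_Cmod. exists e; split; auto.
- intros H P HP. apply locally_C_Cmod in HP. destruct HP as [d [Hd HP]].
  unfold filtermap. generalize (H d Hd). apply filter_imp. intros w Hw; apply HP; exact Hw.
Qed.

Lemma is_derive_C_eps (f : C -> C) (z l : C) :
  CDer f z l <-> forall e : R, 0 < e -> exists d : R, 0 < d /\
    forall w : C, Cmod (w - z) < d -> Cmod (f w - f z - (w - z) * l) <= e * Cmod (w - z).
Proof.
split.
- intros [_ H] e He.
  assert (HL : is_filter_lim (locally (T := AbsRing_UniformSpace C_AbsRing) z) z) by (intros P HP; exact HP).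
  destruct (H z HL (mkposreal e He)) as [d Hd].
  exists d; split; [apply cond_pos|]. intros w Hw. exact (Hd w Hw).
- intros H. split; [apply is_linear_scal_l|].
  intros x Hx e.
  replace x with z.
  2:{ exact (is_filter_lim_locally_unique (V := AbsRing_NormedModule C_AbsRing) z x Hx). }
  destruct (H e (cond_pos e)) as [d [Hd Hw]].
  exists (mkposreal d Hd). intros w Hw'. exact (Hw w Hw').
Qed.

Lemma is_derive_P_eps (f : R -> C) (x : R) (l : C) :
  PDer f x l <-> forall e : R, 0 < e -> exists d : R, 0 < d /\
    forall y : R, Rabs (y - x) < d -> Cmod (f y - f x - RtoC (y - x) * l) <= e * Rabs (y - x).
Proof.
assert (E : forall (y : R) (u : C), scal y u = (RtoC y * u)%C) by (intros; apply scal_R_Cmult).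
split.
- intros [_ H] e He.
  assert (HL : is_filter_lim (locally x) x) by (intros P HP; exact HP).
  destruct (H x HL (mkposreal e He)) as [d Hd].
  exists d; split; [apply cond_pos|]. intros w Hw. generalize (Hd w Hw).
  rewrite <- E, Cmod_norm. intros K. exact K.
- intros H. split; [apply (is_linear_scal_l (V := C_R_NormedModule))|].
  intros x' Hx e.
  replace x' with x.
  2:{ exact (is_filter_lim_locally_unique (V := R_NormedModule) x x' Hx). }
  destruct (H e (cond_pos e)) as [d [Hd Hw]].
  exists (mkposreal d Hd). intros w Hw'. generalize (Hw w Hw').
  rewrite <- E, Cmod_norm. intros K. exact K.
Qed.

Lemma CDer_eq (f : C -> C) (z l l' : C) : CDer f z l -> l = l' -> CDer f z l'.
Proof. intros H <-. exact H. Qed.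

Lemma CDer_plus (f g : C -> C) (z a b : C) :
  CDer f z a -> CDer g z b -> CDer (fun w => f w + g w)%C z (a + b)%C.
Proof. intros H1 H2. exact (is_derive_plus (K := C_AbsRing) (V := C_NormedModule) f g z a b H1 H2). Qed.

Lemma CDer_minus (f g : C -> C) (z a b : C) :
  CDer f z a -> CDer g z b -> CDer (fun w => f w - g w)%C z (a - b)%C.
Proof. intros H1 H2. exact (is_derive_minus (K := C_AbsRing) (V := C_NormedModule) f g z a b H1 H2). Qed.

Lemma CDer_const (c z : C) : CDer (fun _ => c) z (RtoC 0).
Proof. exact (is_derive_const (K := C_AbsRing) (V := C_NormedModule) c z). Qed.

Lemma CDer_id (z : C) : CDer (fun w => w) z (RtoC 1).
Proof.
apply is_derive_C_eps. intros e He. exists 1; split; [lra|]. intros w _.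
assert (E : (w - z - (w - z) * RtoC 1)%C = RtoC 0) by ring. rewrite E, Cmod_0.
apply Rmult_le_pos; [lra|apply Cmod_ge_0].
Qed.

Lemma CDer_mult (f g : C -> C) (z a b : C) :
  CDer f z a -> CDer g z b -> CDer (fun w => f w * g w)%C z (a * g z + f z * b)%C.
Proof.
intros H1 H2.
assert (Hf : exists d, 0 < d /\ forall w, Cmod (w - z) < d -> Cmod (f w - f z) <= (1 + Cmod a) * Cmod (w - z)).
{ destruct (proj1 (is_derive_C_eps f z a) H1 1 Rlt_0_1) as [d [Hd H]].
  exists d; split; auto. intros w Hw. specialize (H w Hw).
  replace (f w - f z)%C with ((f w - f z - (w - z) * a) + (w - z) * a)%C by ring.
  eapply Rle_trans; [apply Cmod_triangle|]. rewrite Cmod_mult. lra. }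
rewrite is_derive_C_eps in H1, H2 |- *. intros e He.
destruct Hf as [d0 [Hd0 Hf]].
pose proof (Cmod_ge_0 a) as Pa. pose proof (Cmod_ge_0 b) as Pb.
pose proof (Cmod_ge_0 (f z)) as Pf. pose proof (Cmod_ge_0 (g z)) as Pg.
set (e1 := e / (3 * (1 + Cmod (g z)))).
set (e2 := Rmin 1 (e / (3 * (1 + Cmod (f z))))).
assert (He1 : 0 < e1) by (apply Rdiv_lt_0_compat; lra).
assert (He2 : 0 < e2) by (apply Rmin_glb_lt; [lra|]; apply Rdiv_lt_0_compat; lra).
destruct (H1 e1 He1) as [d1 [Hd1 K1]]. destruct (H2 e2 He2) as [d2 [Hd2 K2]].
set (d3 := e / (3 * (1 + Cmod a) * (1 + Cmod b))).
assert (Hd3 : 0 < d3) by (apply Rdiv_lt_0_compat; [lra|]; apply Rmult_lt_0_compat; lra).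
exists (Rmin (Rmin d0 d1) (Rmin d2 d3)). split; [repeat apply Rmin_glb_lt; assumption|].
intros w Hw.
assert (W0 : Cmod (w - z) < d0) by (eapply Rlt_le_trans; [exact Hw|]; eapply Rle_trans; apply Rmin_l).
assert (W1 : Cmod (w - z) < d1) by (eapply Rlt_le_trans; [exact Hw|]; eapply Rle_trans; [apply Rmin_l|apply Rmin_r]).
assert (W2 : Cmod (w - z) < d2) by (eapply Rlt_le_trans; [exact Hw|]; eapply Rle_trans; [apply Rmin_r|apply Rmin_l]).
assert (W3 : Cmod (w - z) < d3) by (eapply Rlt_le_trans; [exact Hw|]; eapply Rle_trans; apply Rmin_r).
specialize (Hf w W0). specialize (K1 w W1). specialize (K2 w W2).
pose proof (Cmod_ge_0 (w - z)) as Pw. set (h := Cmod (w - z)) in *.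
replace (f w * g w - f z * g z - (w - z) * (a * g z + f z * b))%C with
  ((f w - f z - (w - z) * a) * g z + f z * (g w - g z - (w - z) * b) + (f w - f z) * (g w - g z))%C by ring.
assert (Kg : Cmod (g w - g z) <= (1 + Cmod b) * h).
{ replace (g w - g z)%C with ((g w - g z - (w - z) * b) + (w - z) * b)%C by ring.
  eapply Rle_trans; [apply Cmod_triangle|]. rewrite Cmod_mult. fold h.
  assert (e2 <= 1) by apply Rmin_l. nra. }
eapply Rle_trans; [apply Cmod_triangle|].
eapply Rle_trans; [apply Rplus_le_compat_r, Cmod_triangle|]. rewrite !Cmod_mult.
assert (E1 : e1 * h * Cmod (g z) <= e / 3 * h).
{ replace (e / 3) with (e1 * (1 + Cmod (g z))) by (unfold e1; field; lra).
  assert (0 <= e1 * h) by (apply Rmult_le_pos; lra). nra. }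
assert (E2 : Cmod (f z) * (e2 * h) <= e / 3 * h).
{ assert (e2 * (1 + Cmod (f z)) <= e / 3).
  { replace (e / 3) with (e / (3 * (1 + Cmod (f z))) * (1 + Cmod (f z))) by (field; lra).
    apply Rmult_le_compat_r; [lra|apply Rmin_r]. }
  assert (0 <= e2 * h) by (apply Rmult_le_pos; lra). nra. }
assert (E3 : (1 + Cmod a) * h * ((1 + Cmod b) * h) <= e / 3 * h).
{ assert (d3 * ((1 + Cmod a) * (1 + Cmod b)) = e / 3) by (unfold d3; field; lra).
  assert (h * ((1 + Cmod a) * (1 + Cmod b)) <= d3 * ((1 + Cmod a) * (1 + Cmod b))).
  { apply Rmult_le_compat_r; [|lra]. apply Rmult_le_pos; lra. }
  assert (0 <= h) by apply Pw. nra. }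
assert (F1 : Cmod (f w - f z - (w - z) * a) * Cmod (g z) <= e1 * h * Cmod (g z)) by (apply Rmult_le_compat_r; assumption).
assert (F2 : Cmod (f z) * Cmod (g w - g z - (w - z) * b) <= Cmod (f z) * (e2 * h)) by (apply Rmult_le_compat_l; assumption).
assert (F3 : Cmod (f w - f z) * Cmod (g w - g z) <= (1 + Cmod a) * h * ((1 + Cmod b) * h))
  by (apply Rmult_le_compat; auto using Cmod_ge_0).
lra.
Qed.

Lemma CDer_continuous (f : C -> C) (z l : C) : CDer f z l -> Ccont f z.
Proof.
intros H. rewrite is_derive_C_eps in H. apply continuous_C_eps. intros e He.
destruct (H 1 Rlt_0_1) as [d [Hd K]].
pose proof (Cmod_ge_0 l) as Pl.
apply locally_C_Cmod. exists (Rmin d (e / (1 + Cmod l))). split.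
{ apply Rmin_glb_lt; auto. apply Rdiv_lt_0_compat; lra. }
intros w Hw.
assert (W1 : Cmod (w - z) < d) by (eapply Rlt_le_trans; [exact Hw|apply Rmin_l]).
assert (W2 : Cmod (w - z) < e / (1 + Cmod l)) by (eapply Rlt_le_trans; [exact Hw|apply Rmin_r]).
specialize (K w W1).
replace (f w - f z)%C with ((f w - f z - (w - z) * l) + (w - z) * l)%C by ring.
eapply Rle_lt_trans; [apply Cmod_triangle|]. rewrite Cmod_mult.
apply Rmult_lt_compat_r with (r := 1 + Cmod l) in W2; [|lra].
replace (e / (1 + Cmod l) * (1 + Cmod l)) with e in W2 by (field; lra). lra.
Qed.

(** Common core of the two chain rules: [q] is the size of the increment of the variable, real or
    complex, and [D] the linear part of the inner increment. The inner error costs at most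
    [e' * q * Cmod l], whence the bound on [e']. *)
Lemma CDer_comp_core (f : C -> C) (z l : C) (A : R) :
  CDer f z l -> 0 <= A -> forall e, 0 < e -> exists d e' : R, 0 < d /\ 0 < e' /\
  forall (w D : C) (q : R), 0 <= q < d -> Cmod D <= A * q -> Cmod (w - z - D) <= e' * q ->
  Cmod (f w - f z - D * l) <= e * q.
Proof.
intros H HA e He. rewrite is_derive_C_eps in H.
pose proof (Cmod_ge_0 l) as Pl.
destruct (H (e / (2 * (A + 1)))) as [d [Hd K]]; [apply Rdiv_lt_0_compat; lra|].
exists (d / (A + 1)), (Rmin 1 (e / (2 * (1 + Cmod l)))).
split; [apply Rdiv_lt_0_compat; lra|].
split; [apply Rmin_glb_lt; [lra|apply Rdiv_lt_0_compat; lra]|].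
intros w D q [Hq1 Hq2] HD HwD.
assert (M1 := Rmin_l 1 (e / (2 * (1 + Cmod l)))).
assert (M2 := Rmin_r 1 (e / (2 * (1 + Cmod l)))).
set (e' := Rmin 1 _) in *.
assert (Hw : Cmod (w - z) <= (A + 1) * q).
{ replace (w - z)%C with ((w - z - D) + D)%C by ring.
  eapply Rle_trans; [apply Cmod_triangle|].
  assert (e' * q <= 1 * q) by (apply Rmult_le_compat_r; lra). lra. }
assert (Hwd : Cmod (w - z) < d).
{ eapply Rle_lt_trans; [exact Hw|]. apply Rmult_lt_compat_l with (r := A + 1) in Hq2; [|lra].
  replace ((A + 1) * (d / (A + 1))) with d in Hq2 by (field; lra). exact Hq2. }
specialize (K w Hwd).
replace (f w - f z - D * l)%C with ((f w - f z - (w - z) * l) + (w - z - D) * l)%C by ring.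
eapply Rle_trans; [apply Cmod_triangle|]. rewrite Cmod_mult.
assert (E1 : e / (2 * (A + 1)) * Cmod (w - z) <= e / 2 * q).
{ replace (e / 2 * q) with (e / (2 * (A + 1)) * ((A + 1) * q)) by (field; lra).
  apply Rmult_le_compat_l; [|exact Hw]. left; apply Rdiv_lt_0_compat; lra. }
assert (E2 : Cmod (w - z - D) * Cmod l <= e / 2 * q).
{ apply Rle_trans with (e' * q * Cmod l); [apply Rmult_le_compat_r; auto|].
  apply Rle_trans with (e / (2 * (1 + Cmod l)) * q * (1 + Cmod l)).
  - apply Rmult_le_compat; try lra. 2:{ apply Rmult_le_compat_r; lra. }
    apply Rmult_le_pos; [|lra]. apply Rmin_glb; [lra|]. left; apply Rdiv_lt_0_compat; lra.
  - right; field; lra. }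
lra.
Qed.

Lemma CDer_comp (f g : C -> C) (z l m : C) :
  CDer f (g z) l -> CDer g z m -> CDer (fun w => f (g w)) z (m * l)%C.
Proof.
intros Hf Hg. apply is_derive_C_eps. intros e He.
destruct (CDer_comp_core f (g z) l (Cmod m) Hf (Cmod_ge_0 m) e He) as [d [e' [Hd [He' K]]]].
rewrite is_derive_C_eps in Hg. destruct (Hg e' He') as [d2 [Hd2 K2]].
exists (Rmin d d2). split; [apply Rmin_glb_lt; auto|]. intros w Hw.
assert (W1 := Rlt_le_trans _ _ _ Hw (Rmin_l d d2)).
assert (W2 := Rlt_le_trans _ _ _ Hw (Rmin_r d d2)).
rewrite (Cmult_assoc (w - z) m l). apply K; auto.
- split; [apply Cmod_ge_0|exact W1].
- rewrite Cmod_mult. lra.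
Qed.

Lemma PDer_comp (f : C -> C) (g : R -> C) (x : R) (l m : C) :
  CDer f (g x) l -> PDer g x m -> PDer (fun w => f (g w)) x (m * l)%C.
Proof.
intros Hf Hg. apply is_derive_P_eps. intros e He.
destruct (CDer_comp_core f (g x) l (Cmod m) Hf (Cmod_ge_0 m) e He) as [d [e' [Hd [He' K]]]].
rewrite is_derive_P_eps in Hg. destruct (Hg e' He') as [d2 [Hd2 K2]].
exists (Rmin d d2). split; [apply Rmin_glb_lt; auto|]. intros w Hw.
assert (W1 := Rlt_le_trans _ _ _ Hw (Rmin_l d d2)).
assert (W2 := Rlt_le_trans _ _ _ Hw (Rmin_r d d2)).
rewrite (Cmult_assoc (RtoC (w - x)) m l). apply K; auto.
- split; [apply Rabs_pos|exact W1].
- rewrite Cmod_mult, Cmod_R. lra.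
Qed.

Lemma CDer_inv (z : C) : z <> RtoC 0 -> CDer Cinv z (- / (z * z))%C.
Proof.
intros Hz. apply is_derive_C_eps. intros e He.
assert (Pz : 0 < Cmod z) by (apply Cmod_gt_0; exact Hz).
set (r := Cmod z) in *.
assert (Pr : 0 < r ^ 3) by (apply pow_lt; lra).
exists (Rmin (r / 2) (e * r ^ 3 / 2)). split.
{ apply Rmin_glb_lt; [lra|]. apply Rdiv_lt_0_compat; [|lra]. apply Rmult_lt_0_compat; lra. }
intros w Hw.
assert (W1 := Rlt_le_trans _ _ _ Hw (Rmin_l (r / 2) (e * r ^ 3 / 2))).
assert (W2 := Rlt_le_trans _ _ _ Hw (Rmin_r (r / 2) (e * r ^ 3 / 2))).
assert (Pw : r / 2 <= Cmod w).
{ assert (Cmod z <= Cmod w + Cmod (w - z)).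
  { rewrite <- (Cmod_opp (w - z)). replace z with (w + - (w - z))%C at 1 by ring. apply Cmod_triangle. }
  fold r in H. lra. }
assert (Hw0 : w <> RtoC 0) by (apply Cmod_gt_0; lra).
replace (/ w - / z - (w - z) * - / (z * z))%C with ((w - z) * (w - z) * (/ w * / (z * z)))%C by (field; auto).
rewrite !Cmod_mult, Cmod_inv, Cmod_inv, Cmod_mult by (try apply Cmult_neq_0; auto).
fold r. pose proof (Cmod_ge_0 (w - z)) as Ph. set (h := Cmod (w - z)) in *.
assert (Q1 : / Cmod w <= 2 / r).
{ replace (2 / r) with (/ (r / 2)) by (field; lra). apply Rinv_le_contravar; lra. }
assert (Q2 : 0 < / (r * r)) by (apply Rinv_0_lt_compat; nra).
assert (Q3 : 0 < / Cmod w) by (apply Rinv_0_lt_compat; lra).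
rewrite Rmult_assoc, (Rmult_comm e). apply Rmult_le_compat_l; auto.
apply Rle_trans with (e * r ^ 3 / 2 * (2 / r * / (r * r))).
- apply Rmult_le_compat; try lra. { apply Rmult_le_pos; lra. } apply Rmult_le_compat_r; lra.
- right; field; lra.
Qed.

Lemma CDer_div (f g : C -> C) (z a b : C) : g z <> RtoC 0 ->
  CDer f z a -> CDer g z b -> CDer (fun w => f w / g w)%C z ((a * g z - f z * b) / (g z * g z))%C.
Proof.
intros Hz Hf Hg.
eapply CDer_eq.
- apply CDer_mult; [exact Hf|]. exact (CDer_comp Cinv g z _ b (CDer_inv _ Hz) Hg).
- cbv beta. field. exact Hz.
Qed.

Lemma CDer_scal (c : C) (f : C -> C) (z a : C) : CDer f z a -> CDer (fun w => c * f w)%C z (c * a)%C.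
Proof.
intros H. eapply CDer_eq; [apply CDer_mult; [apply CDer_const|exact H]|]. cbv beta. ring.
Qed.

Lemma PDer_affine (p q : C) (x : R) : PDer (fun s => p + RtoC s * q)%C x q.
Proof.
apply is_derive_P_eps. intros e He. exists 1; split; [lra|]. intros y _.
rewrite RtoC_minus.
assert (E : (p + RtoC y * q - (p + RtoC x * q) - (RtoC y - RtoC x) * q)%C = RtoC 0) by ring.
rewrite E, Cmod_0. apply Rmult_le_pos; [lra|apply Rabs_pos].
Qed.

Lemma PDer_pair (p q : R -> R) (x a b : R) :
  is_derive p x a -> is_derive q x b -> PDer (fun s => (p s, q s)) x (a, b).
Proof.
intros Hp Hq. apply is_derive_P_eps. intros e He.
assert (KK : forall g l, is_derive g x l -> exists d, 0 < d /\ forall y, Rabs (y - x) < d ->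
   Rabs (g y - g x - (y - x) * l) <= e / 2 * Rabs (y - x)).
{ intros g l [_ H]. assert (He2 : 0 < e / 2) by lra.
  destruct (H x (fun P HP => HP) (mkposreal _ He2)) as [d Hd].
  exists d; split; [apply cond_pos|]. intros y Hy. exact (Hd y Hy). }
destruct (KK p a Hp) as [d1 [Hd1 K1]]. destruct (KK q b Hq) as [d2 [Hd2 K2]].
exists (Rmin d1 d2); split; [apply Rmin_glb_lt; auto|]. intros y Hy.
specialize (K1 y (Rlt_le_trans _ _ _ Hy (Rmin_l d1 d2))).
specialize (K2 y (Rlt_le_trans _ _ _ Hy (Rmin_r d1 d2))).
replace ((p y, q y) - (p x, q x) - RtoC (y - x) * (a, b))%C with
  (RtoC (p y - p x - (y - x) * a) + RtoC (q y - q x - (y - x) * b) * Ci)%C.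
2:{ unfold Cminus, Cplus, Copp, Cmult, RtoC, Ci; simpl; f_equal; ring. }
eapply Rle_trans; [apply Cmod_triangle|]. rewrite Cmod_mult, !Cmod_R, Cmod_Ci. lra.
Qed.

Lemma PDer_fst (f : R -> C) (x : R) (l : C) : PDer f x l -> is_derive (fun s => fst (f s)) x (fst l).
Proof.
intros H. rewrite is_derive_P_eps in H. split; [apply is_linear_scal_l|].
intros x' Hx e. rewrite <- (is_filter_lim_locally_unique (V := R_NormedModule) x x' Hx).
destruct (H e (cond_pos e)) as [d [Hd K]]. exists (mkposreal d Hd). intros y Hy.
eapply Rle_trans; [|exact (K y Hy)].
eapply Rle_trans; [|apply re_le_Cmod]. right. unfold norm, minus, plus, opp, scal; simpl. unfold mult, abs; simpl.
f_equal; ring.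
Qed.

Lemma PDer_snd (f : R -> C) (x : R) (l : C) : PDer f x l -> is_derive (fun s => snd (f s)) x (snd l).
Proof.
intros H. rewrite is_derive_P_eps in H. split; [apply is_linear_scal_l|].
intros x' Hx e. rewrite <- (is_filter_lim_locally_unique (V := R_NormedModule) x x' Hx).
destruct (H e (cond_pos e)) as [d [Hd K]]. exists (mkposreal d Hd). intros y Hy.
eapply Rle_trans; [|exact (K y Hy)].
eapply Rle_trans; [|eapply Rle_trans; [apply Rmax_r|apply Rmax_Cmod]]. right. unfold norm, minus, plus, opp, scal; simpl. unfold mult, abs; simpl.
f_equal; ring.
Qed.

(** Continuity of the derivatives in the first variable gives real differentiability; the
    Cauchy-Riemann relations, built into the hypotheses on the second variable, turn the linear part
    into a complex multiplication. *)
Lemma CDer_Cauchy_Riemann (p q dx dy : R -> R -> R) (x y : R) :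
  locally_2d (fun a b => is_derive (fun s => p s b) a (dx a b)) x y ->
  locally_2d (fun a b => is_derive (fun s => q s b) a (dy a b)) x y ->
  is_derive (fun s => p x s) y (- dy x y) -> is_derive (fun s => q x s) y (dx x y) ->
  continuity_2d_pt dx x y -> continuity_2d_pt dy x y ->
  CDer (fun z => (p (fst z) (snd z), q (fst z) (snd z))) (x, y) (dx x y, dy x y).
Proof.
intros Hpx Hqx Hpy Hqy Cx Cy.
assert (KK : forall g gx gy, locally_2d (fun a b => is_derive (fun s => g s b) a (gx a b)) x y ->
  is_derive (fun s => g x s) y gy -> continuity_2d_pt gx x y -> forall e, 0 < e -> exists d, 0 < d /\ forall w : C,
  Cmod (w - (x, y)) < d -> Rabs (g (fst w) (snd w) - g x y - ((fst w - x) * gx x y + (snd w - y) * gy)) <= e * Cmod (w - (x, y))).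
{ intros g gx gy H1 H2 H3 e He.
  assert (D : filterdiff (fun u : R * R => g (fst u) (snd u)) (locally (x, y))
         (fun u : R * R => plus (scal (fst u) (gx x y)) (scal (snd u) gy))).
  { apply (is_derive_filterdiff g x y gx gy); auto.
    - apply locally_2d_locally in H1. exact H1.
    - apply continuity_2d_pt_filterlim in H3. exact H3. }
  destruct D as [_ D]. destruct (D (x, y) (fun P HP => HP) (mkposreal e He)) as [d Hd].
  exists d; split; [apply cond_pos|]. intros w Hw.
  assert (B : ball (x, y) d w).
  { pose proof (Rmax_Cmod (w - (x, y))%C) as M. split.
    - apply Rle_lt_trans with (2 := Hw). eapply Rle_trans; [|exact M]. apply Rmax_l.
    - apply Rle_lt_trans with (2 := Hw). eapply Rle_trans; [|exact M]. apply Rmax_r. }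
  eapply Rle_trans; [exact (Hd w B)|]. right. change (e * @norm _ C_R_NormedModule (w - (x, y))%C = e * Cmod (w - (x, y))).
  rewrite Cmod_norm. reflexivity. }
apply is_derive_C_eps. intros e He. assert (He2 : 0 < e / 2) by lra.
destruct (KK p dx _ Hpx Hpy Cx _ He2) as [d1 [Hd1 K1]].
destruct (KK q dy _ Hqx Hqy Cy _ He2) as [d2 [Hd2 K2]].
exists (Rmin d1 d2); split; [apply Rmin_glb_lt; auto|]. intros w Hw.
specialize (K1 w (Rlt_le_trans _ _ _ Hw (Rmin_l d1 d2))).
specialize (K2 w (Rlt_le_trans _ _ _ Hw (Rmin_r d1 d2))).
destruct w as [a b]; simpl in *.
replace ((p a b, q a b) - (p x y, q x y) - ((a, b) - (x, y)) * (dx x y, dy x y))%C with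
  (RtoC (p a b - p x y - ((a - x) * dx x y + (b - y) * - dy x y))
   + RtoC (q a b - q x y - ((a - x) * dy x y + (b - y) * dx x y)) * Ci)%C.
2:{ unfold Cminus, Cplus, Copp, Cmult, RtoC, Ci; simpl; f_equal; ring. }
eapply Rle_trans; [apply Cmod_triangle|]. rewrite Cmod_mult, !Cmod_R, Cmod_Ci. lra.
Qed.

(** * Elementary functions of a complex variable *)

Lemma continuous_pair_C {U : UniformSpace} (p q : U -> R) (x : U) :
  continuous p x -> continuous q x -> continuous (fun s => (p s, q s) : C) x.
Proof.
intros Hp Hq P [d Hd].
assert (A1 : locally x (fun s => ball (p x) d (p s))) by exact (Hp _ (locally_ball (p x) d)).
assert (A2 : locally x (fun s => ball (q x) d (q s))) by exact (Hq _ (locally_ball (q x) d)).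
unfold filtermap. generalize (filter_and _ _ A1 A2). apply filter_imp. intros s [K1 K2]. apply Hd. split; assumption.
Qed.

Lemma continuous_fst_C {U : UniformSpace} (f : U -> C) (x : U) :
  continuous f x -> continuous (fun s => fst (f s)) x.
Proof. intros H. apply (continuous_comp f fst); auto. destruct (f x); apply continuous_fst. Qed.

Lemma continuous_snd_C {U : UniformSpace} (f : U -> C) (x : U) :
  continuous f x -> continuous (fun s => snd (f s)) x.
Proof. intros H. apply (continuous_comp f snd); auto. destruct (f x); apply continuous_snd. Qed.

Lemma continuous_Cplus {U : UniformSpace} (f g : U -> C) (x : U) :
  continuous f x -> continuous g x -> continuous (fun s => f s + g s)%C x.
Proof. intros Hf Hg. exact (continuous_plus (V := C_R_NormedModule) f g x Hf Hg). Qed.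

Lemma continuous_Cminus {U : UniformSpace} (f g : U -> C) (x : U) :
  continuous f x -> continuous g x -> continuous (fun s => f s - g s)%C x.
Proof. intros Hf Hg. exact (continuous_minus (V := C_R_NormedModule) f g x Hf Hg). Qed.

Lemma continuous_Cmult {U : UniformSpace} (f g : U -> C) (x : U) :
  continuous f x -> continuous g x -> continuous (fun s => f s * g s)%C x.
Proof.
intros Hf Hg.
assert (F1 := continuous_fst_C f x Hf). assert (F2 := continuous_snd_C f x Hf).
assert (G1 := continuous_fst_C g x Hg). assert (G2 := continuous_snd_C g x Hg).
apply continuous_pair_C.
- apply (continuous_minus (V := R_NormedModule)); apply (continuous_mult (K := R_AbsRing)); assumption.
- apply (continuous_plus (V := R_NormedModule)); apply (continuous_mult (K := R_AbsRing)); assumption.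
Qed.

Lemma continuous_Cinv {U : UniformSpace} (f : U -> C) (x : U) :
  continuous f x -> f x <> RtoC 0 -> continuous (fun s => / f s)%C x.
Proof.
intros Hf Hx. apply (continuous_comp f Cinv); auto.
apply CDer_continuous with (1 := CDer_inv (f x) Hx).
Qed.

Lemma continuous_Cdiv {U : UniformSpace} (f g : U -> C) (x : U) :
  continuous f x -> continuous g x -> g x <> RtoC 0 -> continuous (fun s => f s / g s)%C x.
Proof. intros. apply continuous_Cmult; auto. apply continuous_Cinv; auto. Qed.

Lemma continuous_RtoC {U : UniformSpace} (f : U -> R) (x : U) :
  continuous f x -> continuous (fun s => RtoC (f s)) x.
Proof. intros. apply continuous_pair_C; auto. apply continuous_const. Qed.

Lemma continuous_Cmod {U : UniformSpace} (f : U -> C) (x : U) :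
  continuous f x -> continuous (fun s => Cmod (f s)) x.
Proof.
intros H. apply continuous_ext with (fun s => @norm _ C_R_NormedModule (f s)).
{ intros; symmetry; apply Cmod_norm. }
apply (continuous_comp f (@norm _ C_R_NormedModule)); auto. exact (@filterlim_norm R_AbsRing C_R_NormedModule (f x)).
Qed.

Lemma PDer_continuous (f : R -> C) (x : R) (l : C) : PDer f x l -> Pcont f x.
Proof. intros H. apply (ex_derive_continuous (V := C_R_NormedModule) f x). exists l; exact H. Qed.

Definition Cexp (z : C) : C := (exp (fst z) * cos (snd z), exp (fst z) * sin (snd z)).
Definition Csin (z : C) : C := (sin (fst z) * cosh (snd z), cos (fst z) * sinh (snd z)).
Definition Ccos (z : C) : C := (cos (fst z) * cosh (snd z), - (sin (fst z) * sinh (snd z))).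

Lemma locally_2d_true (P : R -> R -> Prop) (x y : R) : (forall a b, P a b) -> locally_2d P x y.
Proof. intros H. exists (mkposreal 1 Rlt_0_1). auto. Qed.

Lemma continuity_2d_pt_prod (f g : R -> R) (x y : R) :
  continuity f -> continuity g -> continuity_2d_pt (fun a b => f a * g b) x y.
Proof.
intros Hf Hg. apply continuity_2d_pt_mult; apply continuity_1d_2d_pt_comp; auto.
apply continuity_2d_pt_id1. apply continuity_2d_pt_id2.
Qed.

Lemma continuity_cosh : continuity cosh.
Proof. apply derivable_continuous, derivable_cosh. Qed.
Lemma continuity_sinh : continuity sinh.
Proof. apply derivable_continuous, derivable_sinh. Qed.

Lemma CDer_Cexp (z : C) : CDer Cexp z (Cexp z).
Proof.
destruct z as [x y].
apply (CDer_Cauchy_Riemann (fun a b => exp a * cos b) (fun a b => exp a * sin b)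
  (fun a b => exp a * cos b) (fun a b => exp a * sin b)).
- apply locally_2d_true; intros; auto_derive; auto; ring.
- apply locally_2d_true; intros; auto_derive; auto; ring.
- auto_derive; auto; ring.
- auto_derive; auto; ring.
- apply continuity_2d_pt_prod; apply derivable_continuous; [apply derivable_exp|apply derivable_cos].
- apply continuity_2d_pt_prod; apply derivable_continuous; [apply derivable_exp|apply derivable_sin].
Qed.

Lemma Cmod_Cexp (z : C) : Cmod (Cexp z) = exp (fst z).
Proof.
unfold Cmod, Cexp; simpl. replace (_ + _) with ((exp (fst z))² * ((sin (snd z))² + (cos (snd z))²)).
2:{ unfold Rsqr; ring. } rewrite sin2_cos2, Rmult_1_r. apply sqrt_Rsqr. left; apply exp_pos.
Qed.

Lemma CDer_Csin (z : C) : CDer Csin z (Ccos z).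
Proof.
destruct z as [x y].
apply (CDer_Cauchy_Riemann (fun a b => sin a * cosh b) (fun a b => cos a * sinh b)
  (fun a b => cos a * cosh b) (fun a b => - (sin a * sinh b))); unfold cosh, sinh.
- apply locally_2d_true; intros; auto_derive; auto; field.
- apply locally_2d_true; intros; auto_derive; auto; field.
- auto_derive; auto; field.
- auto_derive; auto; field.
- apply (continuity_2d_pt_prod cos cosh); [apply continuity_cos|apply continuity_cosh].
- apply continuity_2d_pt_opp, (continuity_2d_pt_prod sin sinh); [apply continuity_sin|apply continuity_sinh].
Qed.

Definition slit (z : C) : Prop := 0 < fst z \/ snd z <> 0.
(** The principal argument through tan (arg z / 2) = y / (|z| + x), a single formula on the plane
    cut along the nonpositive real axis. *)
Definition Arg (z : C) : R := 2 * atan (snd z / (Cmod z + fst z)).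
Definition Clog (z : C) : C := (ln (Cmod z), Arg z).

Lemma slit_pos (z : C) : slit z -> 0 < Cmod z /\ 0 < Cmod z + fst z.
Proof.
intros Hz.
assert (E := Cmod2_alt z). unfold Re, Im in E. pose proof (Cmod_ge_0 z).
destruct Hz as [H1|H1].
- assert (0 < fst z ^ 2) by nra. nra.
- assert (0 < snd z ^ 2) by nra. nra.
Qed.

Lemma slit_locally (x y : R) : slit (x, y) -> locally_2d (fun a b => slit (a, b)) x y.
Proof.
intros [H|H]; simpl in H.
- exists (mkposreal _ H). simpl. intros u v Hu Hv. left; simpl. apply Rabs_def2 in Hu. lra.
- apply Rabs_pos_lt in H. exists (mkposreal _ H). simpl. intros u v Hu Hv. right; simpl. intros ->.
  rewrite Rminus_0_l, Rabs_Ropp in Hv. lra.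
Qed.

Lemma Arg_cos_sin (z : C) : slit z -> fst z = Cmod z * cos (Arg z) /\ snd z = Cmod z * sin (Arg z).
Proof.
intros Hz. destruct (slit_pos z Hz) as [P1 P2].
assert (E := Cmod2_alt z). unfold Re, Im in E. unfold Arg. set (s := Cmod z) in *.
set (t := snd z / (s + fst z)).
assert (Ht : 1 + t² = 2 * s / (s + fst z)).
{ unfold t, Rsqr. apply Rmult_eq_reg_r with ((s + fst z) * (s + fst z)); [|nra].
  field_simplify; [|lra|lra]. nra. }
assert (Pt : 0 < 1 + t²) by (pose proof (Rle_0_sqr t); lra).
assert (Hs : sqrt (1 + t²) * sqrt (1 + t²) = 1 + t²) by (apply sqrt_sqrt; lra).
assert (Ps : 0 < sqrt (1 + t²)) by (apply sqrt_lt_R0; auto).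
rewrite cos_2a_cos, sin_2a, cos_atan, sin_atan. split.
- replace (2 * (1 / sqrt (1 + t²)) * (1 / sqrt (1 + t²)) - 1) with (2 / (1 + t²) - 1).
  2:{ rewrite <- Hs at 1. field. lra. }
  rewrite Ht. field. lra.
- replace (2 * (t / sqrt (1 + t²)) * (1 / sqrt (1 + t²))) with (2 * t / (1 + t²)).
  2:{ rewrite <- Hs at 1. field. lra. }
  rewrite Ht. unfold t. field. lra.
Qed.

Lemma Arg_bound (z : C) : - PI < Arg z < PI.
Proof. unfold Arg. pose proof (atan_bound (snd z / (Cmod z + fst z))). lra. Qed.

Lemma Arg_pos (z : C) : slit z -> 0 <= snd z -> 0 <= Arg z.
Proof.
intros Hz H. destruct (slit_pos z Hz) as [P1 P2]. unfold Arg.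
rewrite <- (Rmult_0_r 2), <- atan_0. apply Rmult_le_compat_l; [lra|].
assert (0 <= snd z / (Cmod z + fst z)) by (apply Rdiv_le_0_compat; lra).
destruct H0 as [H0|<-]; [left; apply atan_increasing; auto|right; auto].
Qed.

Lemma Arg_neg (z : C) : slit z -> snd z <= 0 -> Arg z <= 0.
Proof.
intros Hz H. destruct (slit_pos z Hz) as [P1 P2]. unfold Arg.
rewrite <- (Rmult_0_r 2), <- atan_0. apply Rmult_le_compat_l; [lra|].
assert (0 <= - snd z / (Cmod z + fst z)) by (apply Rdiv_le_0_compat; lra).
assert (snd z / (Cmod z + fst z) <= 0).
{ replace (snd z / (Cmod z + fst z)) with (- (- snd z / (Cmod z + fst z))) by (field; lra). lra. }
destruct H1 as [H1| ->]; [left; apply atan_increasing; auto|right; auto].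
Qed.

Lemma Arg_right (z : C) : 0 <= fst z -> slit z -> - (PI / 2) <= Arg z <= PI / 2.
Proof.
intros H Hz. destruct (slit_pos z Hz) as [P1 P2]. unfold Arg.
assert (K : Rabs (snd z) <= Cmod z) by (eapply Rle_trans; [apply Rmax_r|apply Rmax_Cmod]).
apply Rabs_le_between in K.
assert (M : forall a b, a <= b -> atan a <= atan b).
{ intros a b [Hab| ->]; [left; apply atan_increasing; auto|lra]. }
assert (snd z / (Cmod z + fst z) <= 1).
{ apply Rmult_le_reg_r with (Cmod z + fst z); [lra|]. unfold Rdiv. rewrite Rmult_assoc, Rinv_l; lra. }
assert (-1 <= snd z / (Cmod z + fst z)).
{ apply Rmult_le_reg_r with (Cmod z + fst z); [lra|]. unfold Rdiv. rewrite Rmult_assoc, Rinv_l; lra. }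
apply M in H0. apply M in H1. replace (-1) with (- (1)) in H1 by ring. rewrite atan_opp in H1. rewrite atan_1 in H0, H1. lra.
Qed.

Lemma CDer_Clog (z : C) : slit z -> CDer Clog z (/ z)%C.
Proof.
intros Hz. destruct z as [x y].
assert (KX : forall a b, slit (a, b) ->
  is_derive (fun s => ln (Cmod (s, b))) a (a / (a ^ 2 + b ^ 2)) /\
  is_derive (fun s => Arg (s, b)) a (- b / (a ^ 2 + b ^ 2)) /\
  is_derive (fun s => ln (Cmod (a, s))) b (b / (a ^ 2 + b ^ 2)) /\
  is_derive (fun s => Arg (a, s)) b (a / (a ^ 2 + b ^ 2))).
{ intros a b Hab. destruct (slit_pos _ Hab) as [P1 P2].
  assert (E := Cmod2_alt (a, b)). unfold Arg, Cmod, Re, Im in *. cbn [fst snd] in *.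
  assert (P3 : 0 < a ^ 2 + b ^ 2) by nra.
  assert (S : sqrt (a ^ 2 + b ^ 2) * sqrt (a ^ 2 + b ^ 2) = a ^ 2 + b ^ 2) by (apply sqrt_sqrt; lra).
  assert (Q : 0 < 1 + (b / (sqrt (a ^ 2 + b ^ 2) + a))²).
  { pose proof (Rle_0_sqr (b / (sqrt (a ^ 2 + b ^ 2) + a))). lra. }
  assert (Q2 : (sqrt (a ^ 2 + b ^ 2) + a) ^ 2 + b ^ 2 = 2 * sqrt (a ^ 2 + b ^ 2) * (sqrt (a ^ 2 + b ^ 2) + a)) by nra.
  split; [|split; [|split]].
  - auto_derive.
    { replace (a * (a * 1) + b * (b * 1)) with (a ^ 2 + b ^ 2) by ring. repeat split; auto; lra. }
    replace (a * (a * 1) + b * (b * 1)) with (a ^ 2 + b ^ 2) by ring.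
    replace (a / (a ^ 2 + b ^ 2)) with (a / (sqrt (a ^ 2 + b ^ 2) * sqrt (a ^ 2 + b ^ 2))) by (rewrite S; auto).
    field. lra.
  - auto_derive.
    { replace (a * (a * 1) + b * (b * 1)) with (a ^ 2 + b ^ 2) by ring. repeat split; auto; lra. }
    replace (a * (a * 1) + b * (b * 1)) with (a ^ 2 + b ^ 2) by ring.
    set (s := sqrt (a ^ 2 + b ^ 2)) in *. rewrite <- S. field_simplify_eq.
    2:{ repeat split; try lra; nra. }
    rewrite E. ring.
  - auto_derive.
    { replace (a * (a * 1) + b * (b * 1)) with (a ^ 2 + b ^ 2) by ring. repeat split; auto; lra. }
    replace (a * (a * 1) + b * (b * 1)) with (a ^ 2 + b ^ 2) by ring.
    replace (b / (a ^ 2 + b ^ 2)) with (b / (sqrt (a ^ 2 + b ^ 2) * sqrt (a ^ 2 + b ^ 2))) by (rewrite S; auto).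
    field. lra.
  - auto_derive.
    { replace (a * (a * 1) + b * (b * 1)) with (a ^ 2 + b ^ 2) by ring. repeat split; auto; lra. }
    replace (a * (a * 1) + b * (b * 1)) with (a ^ 2 + b ^ 2) by ring.
    set (s := sqrt (a ^ 2 + b ^ 2)) in *. rewrite <- S. field_simplify_eq.
    2:{ repeat split; try lra; nra. }
    replace (s ^ 3) with (s * s ^ 2) by ring. rewrite E. ring. }
assert (L := slit_locally x y Hz).
destruct (KX x y Hz) as [_ [_ [K3 K4]]].
assert (P3 : 0 < x ^ 2 + y ^ 2).
{ destruct (slit_pos _ Hz) as [P1 P2]. assert (E := Cmod2_alt (x, y)). simpl in E. nra. }
assert (CI : continuity_2d_pt (fun a b => / (a ^ 2 + b ^ 2)) x y).
{ apply continuity_2d_pt_inv; [|lra]. simpl.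
  apply continuity_2d_pt_plus; repeat apply continuity_2d_pt_mult;
    try apply continuity_2d_pt_id1; try apply continuity_2d_pt_id2; apply continuity_2d_pt_const. }
apply (CDer_Cauchy_Riemann (fun a b => ln (Cmod (a, b))) (fun a b => Arg (a, b))
  (fun a b => a / (a ^ 2 + b ^ 2)) (fun a b => - b / (a ^ 2 + b ^ 2))) in K4.
- apply is_derive_ext with (2 := K4). intros [a b]; reflexivity.
- revert L. apply locally_2d_impl, locally_2d_true. intros a b Hab. apply (KX a b Hab).
- revert L. apply locally_2d_impl, locally_2d_true. intros a b Hab. apply (KX a b Hab).
- replace (- (- y / (x ^ 2 + y ^ 2))) with (y / (x ^ 2 + y ^ 2)) by (field; lra). exact K3.
- apply continuity_2d_pt_mult; [apply continuity_2d_pt_id1|exact CI].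
- apply continuity_2d_pt_mult; [apply continuity_2d_pt_opp, continuity_2d_pt_id2|exact CI].
Qed.

(** * Goursat's theorem on rectangles *)

Definition box (x1 x2 y1 y2 : R) (z : C) : Prop := x1 <= fst z <= x2 /\ y1 <= snd z <= y2.
Definition obox (x1 x2 y1 y2 : R) (z : C) : Prop := x1 < fst z < x2 /\ y1 < snd z < y2.

(** The counterclockwise integral over the boundary of the rectangle; on vertical sides dz = [Ci]
    ds. *)
Definition rect_int (f : C -> C) (x1 x2 y1 y2 : R) : C :=
  (CInt (fun s => f (s, y1)) x1 x2 + CInt (fun s => Ci * f (x2, s)) y1 y2
   - CInt (fun s => f (s, y2)) x1 x2 - CInt (fun s => Ci * f (x1, s)) y1 y2)%C.

Lemma CInt_unique (f : R -> C) (a b : R) (l : C) : is_CInt f a b l -> CInt f a b = l.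
Proof. intros H. exact (is_RInt_unique (V := C_R_CompleteNormedModule) f a b l H). Qed.

Lemma ex_CInt_cont (f : R -> C) (a b : R) : a <= b -> (forall s, a <= s <= b -> Pcont f s) -> ex_CInt f a b.
Proof.
intros Hab H. apply (ex_RInt_continuous (V := C_R_CompleteNormedModule)).
rewrite Rmin_left, Rmax_right by exact Hab. exact H.
Qed.

Lemma CInt_ext (f g : R -> C) (a b : R) : a <= b -> (forall s, a <= s <= b -> f s = g s) -> CInt f a b = CInt g a b.
Proof.
intros Hab H. apply RInt_ext. rewrite Rmin_left, Rmax_right by exact Hab. intros; apply H; lra.
Qed.

Lemma CInt_Chasles (f : R -> C) (a b c : R) : ex_CInt f a b -> ex_CInt f b c ->
  CInt f a c = (CInt f a b + CInt f b c)%C.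
Proof. intros H1 H2. symmetry. exact (RInt_Chasles (V := C_R_CompleteNormedModule) f a b c H1 H2). Qed.

Lemma CInt_plus (f g : R -> C) (a b : R) : ex_CInt f a b -> ex_CInt g a b ->
  CInt (fun s => f s + g s)%C a b = (CInt f a b + CInt g a b)%C.
Proof. intros H1 H2. exact (RInt_plus (V := C_R_CompleteNormedModule) f g a b H1 H2). Qed.

Lemma CInt_minus (f g : R -> C) (a b : R) : ex_CInt f a b -> ex_CInt g a b ->
  CInt (fun s => f s - g s)%C a b = (CInt f a b - CInt g a b)%C.
Proof. intros H1 H2. exact (RInt_minus (V := C_R_CompleteNormedModule) f g a b H1 H2). Qed.

Lemma is_CInt_scal (c : C) (f : R -> C) (a b : R) (l : C) : is_CInt f a b l ->
  is_CInt (fun s => c * f s)%C a b (c * l)%C.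
Proof.
intros H.
assert (H1 := is_RInt_fct_extend_fst f a b l H). assert (H2 := is_RInt_fct_extend_snd f a b l H).
destruct c as [p q]. apply (is_RInt_fct_extend_pair (U := R_NormedModule) (V := R_NormedModule)); cbn [fst snd Cmult].
- apply (is_RInt_minus (V := R_NormedModule)); apply (is_RInt_scal (V := R_NormedModule)); assumption.
- apply (is_RInt_plus (V := R_NormedModule)); apply (is_RInt_scal (V := R_NormedModule)); assumption.
Qed.

Lemma CInt_scal (c : C) (f : R -> C) (a b : R) : ex_CInt f a b ->
  CInt (fun s => c * f s)%C a b = (c * CInt f a b)%C.
Proof.
intros H. apply CInt_unique, is_CInt_scal. exact (RInt_correct (V := C_R_CompleteNormedModule) f a b H).
Qed.

Lemma CInt_bound (f : R -> C) (a b M : R) : a <= b -> ex_CInt f a b ->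
  (forall s, a <= s <= b -> Cmod (f s) <= M) -> Cmod (CInt f a b) <= M * (b - a).
Proof.
intros Hab Hex H. rewrite Cmod_norm, Rmult_comm.
apply (norm_RInt_le_const (V := C_R_NormedModule) f a b (CInt f a b) M Hab).
- intros s Hs. rewrite <- Cmod_norm. apply H; exact Hs.
- exact (RInt_correct (V := C_R_CompleteNormedModule) f a b Hex).
Qed.

Lemma path_FTC (F f : C -> C) (g dg : R -> C) (a b : R) : a <= b ->
  (forall s, a <= s <= b -> CDer F (g s) (f (g s)) /\ PDer g s (dg s) /\ Pcont (fun s => f (g s)) s /\ Pcont dg s) ->
  is_CInt (fun s => dg s * f (g s))%C a b (F (g b) - F (g a))%C.
Proof.
intros Hab H.
apply (is_RInt_derive (V := C_R_CompleteNormedModule) (fun s => F (g s))); rewrite Rmin_left, Rmax_right by exact Hab.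
- intros s Hs. destruct (H s Hs) as [H1 [H2 _]]. exact (PDer_comp F g s _ _ H1 H2).
- intros s Hs. destruct (H s Hs) as [_ [_ [H3 H4]]]. apply (continuous_Cmult dg (fun s => f (g s))); assumption.
Qed.

Lemma PDer_horizontal (y s : R) : PDer (fun s => (s, y)) s (RtoC 1).
Proof. apply (PDer_pair (fun s => s) (fun _ => y)); auto_derive; auto. Qed.

Lemma PDer_vertical (x s : R) : PDer (fun s => (x, s)) s Ci.
Proof. apply (PDer_pair (fun _ => x) (fun s => s)); auto_derive; auto. Qed.

Lemma Pcont_horizontal (f : C -> C) (s y : R) : Ccont f (s, y) -> Pcont (fun s => f (s, y)) s.
Proof.
intros H. apply (continuous_comp (fun s => (s, y) : C) f); auto.
apply PDer_continuous with (1 := PDer_horizontal y s).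
Qed.

Lemma Pcont_vertical (f : C -> C) (x s : R) : Ccont f (x, s) -> Pcont (fun s => f (x, s)) s.
Proof.
intros H. apply (continuous_comp (fun s => (x, s) : C) f); auto.
apply PDer_continuous with (1 := PDer_vertical x s).
Qed.

Lemma Pcont_vertical_Ci (f : C -> C) (x s : R) : Ccont f (x, s) -> Pcont (fun s => Ci * f (x, s))%C s.
Proof. intros H. apply continuous_Cmult; [apply continuous_const|apply Pcont_vertical; auto]. Qed.

Lemma ex_horizontal (f : C -> C) (a b y : R) : a <= b ->
  (forall s, a <= s <= b -> Ccont f (s, y)) -> ex_CInt (fun s => f (s, y)) a b.
Proof. intros Hab H. apply ex_CInt_cont; auto. intros; apply Pcont_horizontal; auto. Qed.

Lemma ex_vertical (f : C -> C) (a b x : R) : a <= b ->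
  (forall s, a <= s <= b -> Ccont f (x, s)) -> ex_CInt (fun s => Ci * f (x, s))%C a b.
Proof. intros Hab H. apply ex_CInt_cont; auto. intros; apply Pcont_vertical_Ci; auto. Qed.

Definition cont_on (D : C -> Prop) (f : C -> C) : Prop := forall z, D z -> Ccont f z.

Lemma is_CInt_horizontal (F f : C -> C) (a b y : R) : a <= b ->
  (forall s, a <= s <= b -> CDer F (s, y) (f (s, y)) /\ Ccont f (s, y)) ->
  CInt (fun s => f (s, y)) a b = (F (b, y) - F (a, y))%C.
Proof.
intros Hab H. apply CInt_unique.
apply (is_RInt_ext (V := C_R_NormedModule)) with (fun s => RtoC 1 * f (s, y))%C.
{ intros; apply Cmult_1_l. }
apply (path_FTC F f (fun s => (s, y)) (fun _ => RtoC 1)); auto.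
intros s Hs. destruct (H s Hs) as [H1 H2]. split; [|split; [|split]]; auto.
- apply PDer_horizontal.
- apply Pcont_horizontal; auto.
- apply continuous_const.
Qed.

Lemma is_CInt_vertical (F f : C -> C) (a b x : R) : a <= b ->
  (forall s, a <= s <= b -> CDer F (x, s) (f (x, s)) /\ Ccont f (x, s)) ->
  CInt (fun s => Ci * f (x, s))%C a b = (F (x, b) - F (x, a))%C.
Proof.
intros Hab H. apply CInt_unique.
apply (path_FTC F f (fun s => (x, s)) (fun _ => Ci)); auto.
intros s Hs. destruct (H s Hs) as [H1 H2]. split; [|split; [|split]]; auto.
- apply PDer_vertical.
- apply Pcont_vertical; auto.
- apply continuous_const.
Qed.

Ltac inbox := unfold box, obox in *; cbn [fst snd] in *; lra.

Lemma rect_int_primitive (F f : C -> C) (x1 x2 y1 y2 : R) : x1 <= x2 -> y1 <= y2 ->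
  (forall z, box x1 x2 y1 y2 z -> CDer F z (f z)) -> cont_on (box x1 x2 y1 y2) f -> rect_int f x1 x2 y1 y2 = RtoC 0.
Proof.
intros Hx Hy HF Hf. unfold rect_int.
rewrite (is_CInt_horizontal F f x1 x2 y1), (is_CInt_horizontal F f x1 x2 y2),
  (is_CInt_vertical F f y1 y2 x1), (is_CInt_vertical F f y1 y2 x2); auto; try ring;
  intros s Hs; split; first [apply HF|apply Hf]; inbox.
Qed.

Definition bdry (x1 x2 y1 y2 : R) (z : C) : Prop :=
  box x1 x2 y1 y2 z /\ (fst z = x1 \/ fst z = x2 \/ snd z = y1 \/ snd z = y2).

Lemma cont_bdry (x1 x2 y1 y2 : R) (f : C -> C) : cont_on (box x1 x2 y1 y2) f -> cont_on (bdry x1 x2 y1 y2) f.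
Proof. intros H z [Hz _]. exact (H z Hz). Qed.

Ltac inbdry := split; [inbox|cbn [fst snd]; tauto].

Lemma rect_int_plus (f g : C -> C) (x1 x2 y1 y2 : R) : x1 <= x2 -> y1 <= y2 ->
  cont_on (bdry x1 x2 y1 y2) f -> cont_on (bdry x1 x2 y1 y2) g ->
  rect_int (fun z => f z + g z)%C x1 x2 y1 y2 = (rect_int f x1 x2 y1 y2 + rect_int g x1 x2 y1 y2)%C.
Proof.
intros Hx Hy Hf Hg. unfold rect_int.
assert (E : forall x, x = x1 \/ x = x2 -> CInt (fun s => Ci * (f (x, s) + g (x, s)))%C y1 y2 =
  (CInt (fun s => Ci * f (x, s))%C y1 y2 + CInt (fun s => Ci * g (x, s))%C y1 y2)%C).
{ intros x Hx'. rewrite <- CInt_plus.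
  - apply CInt_ext; auto; intros; ring.
  - apply ex_vertical; auto; intros; apply Hf; inbdry.
  - apply ex_vertical; auto; intros; apply Hg; inbdry. }
rewrite !E by auto.
rewrite (CInt_plus (fun s => f (s, y1)) (fun s => g (s, y1))), (CInt_plus (fun s => f (s, y2)) (fun s => g (s, y2)));
  [ring|..]; apply ex_horizontal; auto; intros; [apply Hf|apply Hg|apply Hf|apply Hg]; inbdry.
Qed.

Lemma rect_int_bound (f : C -> C) (x1 x2 y1 y2 M : R) : x1 <= x2 -> y1 <= y2 ->
  cont_on (bdry x1 x2 y1 y2) f -> (forall z, bdry x1 x2 y1 y2 z -> Cmod (f z) <= M) ->
  Cmod (rect_int f x1 x2 y1 y2) <= M * (2 * ((x2 - x1) + (y2 - y1))).
Proof.
intros Hx Hy Hf HM. unfold rect_int.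
assert (H1 : forall y, y = y1 \/ y = y2 -> Cmod (CInt (fun s => f (s, y)) x1 x2) <= M * (x2 - x1)).
{ intros y Hy'. apply CInt_bound; auto.
  - apply ex_horizontal; auto. intros; apply Hf; inbdry.
  - intros; apply HM; inbdry. }
assert (H2 : forall x, x = x1 \/ x = x2 -> Cmod (CInt (fun s => Ci * f (x, s))%C y1 y2) <= M * (y2 - y1)).
{ intros x Hx'. apply CInt_bound; auto.
  - apply ex_vertical; auto. intros; apply Hf; inbdry.
  - intros; rewrite Cmod_mult, Cmod_Ci, Rmult_1_l. apply HM; inbdry. }
unfold Cminus. eapply Rle_trans; [apply Cmod_triangle|]. rewrite Cmod_opp.
eapply Rle_trans; [apply Rplus_le_compat_r, Cmod_triangle|]. rewrite Cmod_opp.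
eapply Rle_trans; [apply Rplus_le_compat_r, Rplus_le_compat_r, Cmod_triangle|].
pose proof (H1 y1 ltac:(auto)). pose proof (H1 y2 ltac:(auto)).
pose proof (H2 x1 ltac:(auto)). pose proof (H2 x2 ltac:(auto)). lra.
Qed.

Lemma rect_int_split_x (f : C -> C) (x1 x x2 y1 y2 : R) : x1 <= x <= x2 -> y1 <= y2 ->
  cont_on (box x1 x2 y1 y2) f -> rect_int f x1 x2 y1 y2 = (rect_int f x1 x y1 y2 + rect_int f x x2 y1 y2)%C.
Proof.
intros Hx Hy Hf. unfold rect_int.
rewrite (CInt_Chasles (fun s => f (s, y1)) x1 x x2), (CInt_Chasles (fun s => f (s, y2)) x1 x x2);
  [ring|..]; apply ex_horizontal; try lra; intros; apply Hf; inbox.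
Qed.

Lemma rect_int_split_y (f : C -> C) (x1 x2 y1 y y2 : R) : x1 <= x2 -> y1 <= y <= y2 ->
  cont_on (box x1 x2 y1 y2) f -> rect_int f x1 x2 y1 y2 = (rect_int f x1 x2 y1 y + rect_int f x1 x2 y y2)%C.
Proof.
intros Hx Hy Hf. unfold rect_int.
rewrite (CInt_Chasles (fun s => Ci * f (x1, s))%C y1 y y2), (CInt_Chasles (fun s => Ci * f (x2, s))%C y1 y y2);
  [ring|..]; apply ex_vertical; try lra; intros; apply Hf; inbox.
Qed.

Lemma rect_int_ext (f g : C -> C) (x1 x2 y1 y2 : R) : x1 <= x2 -> y1 <= y2 ->
  (forall z, bdry x1 x2 y1 y2 z -> f z = g z) -> rect_int f x1 x2 y1 y2 = rect_int g x1 x2 y1 y2.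
Proof.
intros Hx Hy H. unfold rect_int.
rewrite (CInt_ext (fun s => f (s, y1)) (fun s => g (s, y1))),
 (CInt_ext (fun s => f (s, y2)) (fun s => g (s, y2))),
 (CInt_ext (fun s => Ci * f (x1, s))%C (fun s => Ci * g (x1, s))%C),
 (CInt_ext (fun s => Ci * f (x2, s))%C (fun s => Ci * g (x2, s))%C); auto;
 intros; try (f_equal; apply H; inbdry); apply H; inbdry.
Qed.

Lemma Cmod_box (x1 x2 y1 y2 : R) (z w : C) : box x1 x2 y1 y2 z -> box x1 x2 y1 y2 w ->
  Cmod (w - z) <= (x2 - x1) + (y2 - y1).
Proof.
intros Hz Hw. destruct z as [a b], w as [c d].
replace ((c, d) - (a, b))%C with (RtoC (c - a) + RtoC (d - b) * Ci)%C.
2:{ unfold Cminus, Cplus, Copp, Cmult, RtoC, Ci; simpl; f_equal; ring. }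
eapply Rle_trans; [apply Cmod_triangle|]. rewrite Cmod_mult, !Cmod_R, Cmod_Ci.
apply Rplus_le_compat; [|rewrite Rmult_1_r]; apply Rabs_le; inbox.
Qed.

Definition holo_on (D : C -> Prop) (f : C -> C) : Prop := forall z, D z -> exists l : C, CDer f z l.

Lemma holo_cont (D : C -> Prop) (f : C -> C) : holo_on D f -> cont_on D f.
Proof. intros H z Hz. destruct (H z Hz) as [l Hl]. apply CDer_continuous with (1 := Hl). Qed.

Ltac destruct_Rle D := match goal with |- context [Rle_dec ?a ?b] => destruct (Rle_dec a b) as [D|D] end.

(** One bisection step, which selects a quarter whose integral has modulus at least
    [kappa / 4 ^ S n]. The fourth quarter is the default: when the other three fail the test, the
    triangle inequality guarantees the bound for it. *)
Definition quarter (f : C -> C) (W H kappa : R) (n : nat) (p : R * R) : R * R :=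
  let w := W / 2 ^ S n in let h := H / 2 ^ S n in
  if Rle_dec (kappa / 4 ^ S n) (Cmod (rect_int f (fst p) (fst p + w) (snd p) (snd p + h))) then p
  else if Rle_dec (kappa / 4 ^ S n) (Cmod (rect_int f (fst p + w) (fst p + w + w) (snd p) (snd p + h))) then (fst p + w, snd p)
  else if Rle_dec (kappa / 4 ^ S n) (Cmod (rect_int f (fst p) (fst p + w) (snd p + h) (snd p + h + h))) then (fst p, snd p + h)
  else (fst p + w, snd p + h).

Fixpoint corner (f : C -> C) (X Y W H kappa : R) (n : nat) : R * R :=
  match n with O => (X, Y) | S m => quarter f W H kappa m (corner f X Y W H kappa m) end.

(** Bisection keeps an integral of modulus at least [kappa / 4 ^ n] on nested rectangles. At their
    common point f is affine up to [e] times the distance, and the affine part has a primitive, so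
    the same integral is of order at most [e / 4 ^ n]: a contradiction for small [e]. *)
Theorem Goursat (f : C -> C) (x1 x2 y1 y2 : R) : x1 <= x2 -> y1 <= y2 ->
  holo_on (box x1 x2 y1 y2) f -> rect_int f x1 x2 y1 y2 = RtoC 0.
Proof.
intros Hx Hy Hf. apply Cmod_eq_0.
set (kappa := Cmod (rect_int f x1 x2 y1 y2)).
destruct (Req_dec kappa 0) as [E|E]; [exact E|exfalso].
assert (Pk : 0 < kappa) by (pose proof (Cmod_ge_0 (rect_int f x1 x2 y1 y2)); fold kappa in H; lra).
set (W := x2 - x1). set (H := y2 - y1).
assert (PW : 0 <= W) by (unfold W; lra). assert (PH : 0 <= H) by (unfold H; lra).
assert (Cf := holo_cont _ _ Hf).
set (p := corner f x1 y1 W H kappa).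
assert (P2 : forall n, 0 < 2 ^ n) by (intros; apply pow_lt; lra).
assert (P4 : forall n, 4 ^ n = 2 ^ n * 2 ^ n) by (intros; rewrite <- Rpow_mult_distr; f_equal; lra).
assert (HS : forall V n, V / 2 ^ n = V / 2 ^ S n + V / 2 ^ S n).
{ intros V n. simpl. field. apply Rgt_not_eq, P2. }
assert (PV : forall V n, 0 <= V -> 0 <= V / 2 ^ n).
{ intros V n HV. apply Rdiv_le_0_compat; auto. }
assert (Inv : forall n, x1 <= fst (p n) /\ fst (p n) + W / 2 ^ n <= x2 /\ y1 <= snd (p n) /\ snd (p n) + H / 2 ^ n <= y2
   /\ kappa / 4 ^ n <= Cmod (rect_int f (fst (p n)) (fst (p n) + W / 2 ^ n) (snd (p n)) (snd (p n) + H / 2 ^ n))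
   /\ fst (p n) <= fst (p (S n)) /\ fst (p (S n)) + W / 2 ^ S n <= fst (p n) + W / 2 ^ n
   /\ snd (p n) <= snd (p (S n)) /\ snd (p (S n)) + H / 2 ^ S n <= snd (p n) + H / 2 ^ n).
{ assert (Mono : forall n, fst (p n) <= fst (p (S n)) /\ fst (p (S n)) + W / 2 ^ S n <= fst (p n) + W / 2 ^ n
   /\ snd (p n) <= snd (p (S n)) /\ snd (p (S n)) + H / 2 ^ S n <= snd (p n) + H / 2 ^ n).
  { intros n. rewrite (HS W n), (HS H n). pose proof (PV W (S n) PW). pose proof (PV H (S n) PH).
    change (p (S n)) with (quarter f W H kappa n (p n)). unfold quarter.
    destruct_Rle D1; [|destruct_Rle D2; [|destruct_Rle D3]]; cbn [fst snd]; lra. }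
  intros n. cut (x1 <= fst (p n) /\ fst (p n) + W / 2 ^ n <= x2 /\ y1 <= snd (p n) /\ snd (p n) + H / 2 ^ n <= y2
   /\ kappa / 4 ^ n <= Cmod (rect_int f (fst (p n)) (fst (p n) + W / 2 ^ n) (snd (p n)) (snd (p n) + H / 2 ^ n))).
  { intros K. specialize (Mono n). tauto. }
  induction n as [|n IH].
  - simpl. unfold W, H, Rdiv. rewrite Rinv_1, !Rmult_1_r.
    replace (x1 + (x2 - x1)) with x2 by ring. replace (y1 + (y2 - y1)) with y2 by ring.
    fold kappa. lra.
  - destruct IH as [I1 [I2 [I3 [I4 I5]]]]. specialize (Mono n).
    split; [lra|]. split; [lra|]. split; [lra|]. split; [lra|].
    clear Mono. change (p (S n)) with (quarter f W H kappa n (p n)). unfold quarter.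
    set (a := fst (p n)) in *. set (b := snd (p n)) in *.
    rewrite (HS W n), (HS H n) in *. pose proof (PV W (S n) PW) as Q1. pose proof (PV H (S n) PH) as Q2.
    set (w := W / 2 ^ S n) in *. set (h := H / 2 ^ S n) in *.
    assert (SP : rect_int f a (a + (w + w)) b (b + (h + h)) =
      (rect_int f a (a + w) b (b + h) + rect_int f (a + w) (a + w + w) b (b + h)
      + rect_int f a (a + w) (b + h) (b + h + h) + rect_int f (a + w) (a + w + w) (b + h) (b + h + h))%C).
    { rewrite <- !Rplus_assoc.
      assert (Sub : forall a1 a2 b1 b2, a <= a1 -> a2 <= a + w + w -> b <= b1 -> b2 <= b + h + h -> cont_on (box a1 a2 b1 b2) f).
      { intros a1 a2 b1 b2 T1 T2 T3 T4 z Hz. apply Cf. inbox. }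
      rewrite (rect_int_split_y f a (a + w + w) b (b + h) (b + h + h)); try lra; [|apply Sub; lra].
      rewrite (rect_int_split_x f a (a + w) (a + w + w) b (b + h)); try lra; [|apply Sub; lra].
      rewrite (rect_int_split_x f a (a + w) (a + w + w) (b + h) (b + h + h)); try lra; [|apply Sub; lra].
      ring. }
    rewrite SP in I5.
    assert (Ek : kappa / 4 ^ n = 4 * (kappa / 4 ^ S n)) by (simpl; field; apply pow_nonzero; lra).
    rewrite Ek in I5.
    destruct_Rle D1; [exact D1|]. destruct_Rle D2; [exact D2|].
    destruct_Rle D3; [exact D3|]. cbn [fst snd].
    apply Rnot_le_lt in D1. apply Rnot_le_lt in D2. apply Rnot_le_lt in D3.
    pose proof (Cmod_triangle (rect_int f a (a + w) b (b + h) + rect_int f (a + w) (a + w + w) b (b + h)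
      + rect_int f a (a + w) (b + h) (b + h + h)) (rect_int f (a + w) (a + w + w) (b + h) (b + h + h))) as T1.
    pose proof (Cmod_triangle (rect_int f a (a + w) b (b + h) + rect_int f (a + w) (a + w + w) b (b + h))
      (rect_int f a (a + w) (b + h) (b + h + h))) as T2.
    pose proof (Cmod_triangle (rect_int f a (a + w) b (b + h)) (rect_int f (a + w) (a + w + w) b (b + h))) as T3. lra. }
(* Lower ends increase while upper ends decrease, so the corners converge to a point common to all
   the rectangles. *)
assert (Lim : forall (u : nat -> R) (V : R), 0 <= V -> (forall n, u n <= u (S n) /\ u (S n) + V / 2 ^ S n <= u n + V / 2 ^ n) ->
   exists l, forall n, u n <= l <= u n + V / 2 ^ n).
{ intros u V HV Hu.
  assert (Up : forall n k, u n <= u (n + k)%nat /\ u (n + k)%nat + V / 2 ^ (n + k) <= u n + V / 2 ^ n).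
  { intros n k. induction k as [|k IHk]; [rewrite Nat.add_0_r; lra|].
    rewrite Nat.add_succ_r. specialize (Hu (n + k)%nat). lra. }
  destruct (ex_finite_lim_seq_incr u (u 0%nat + V)) as [l Hl].
  { intros n; apply Hu. }
  { intros n. destruct (Up 0%nat n) as [_ U]. pose proof (PV V n HV). simpl in U. unfold Rdiv in U at 2. rewrite Rinv_1 in U. unfold Rdiv in *. lra. }
  exists l. intros n. split.
  - apply (is_lim_seq_le (fun _ => u n) (fun k => u (k + n)%nat) (u n) l).
    + intros k. rewrite Nat.add_comm. apply Up.
    + apply is_lim_seq_const.
      apply (is_lim_seq_incr_n u n l); exact Hl.
  - apply (is_lim_seq_le (fun k => u (k + n)%nat) (fun _ => u n + V / 2 ^ n) l (u n + V / 2 ^ n)).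
    + intros k. destruct (Up n k) as [_ U]. rewrite Nat.add_comm. pose proof (PV V (n + k)%nat HV). lra.
    + apply (is_lim_seq_incr_n u n l); exact Hl.
    + apply is_lim_seq_const. }
destruct (Lim (fun n => fst (p n)) W PW) as [lx Hlx]. { intros n. pose proof (Inv n). tauto. }
destruct (Lim (fun n => snd (p n)) H PH) as [ly Hly]. { intros n. pose proof (Inv n). tauto. }
assert (Hbox : box x1 x2 y1 y2 (lx, ly)).
{ pose proof (Inv 0%nat). specialize (Hlx 0%nat). specialize (Hly 0%nat). inbox. }
destruct (Hf _ Hbox) as [l Hl].
set (L := W + H). assert (PL : 0 <= L) by (unfold L; lra).
(* The integral over the n-th rectangle is at most [e * (L / 2 ^ n)] times the perimeter
   [2 * (L / 2 ^ n)]; this [e] makes the product smaller than [kappa / 4 ^ n], even if [L = 0]. *)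
set (e := kappa / (2 * L * L + 1)).
assert (Pd : 0 < 2 * L * L + 1) by nra.
assert (Pe : 0 < e) by (apply Rdiv_lt_0_compat; lra).
destruct (proj1 (is_derive_C_eps f (lx, ly) l) Hl e Pe) as [d [Hd K]].
destruct (pow_lt_1_zero (/ 2)) with (y := d / (L + 1)) as [n Hn].
{ rewrite Rabs_pos_eq; lra. } { apply Rdiv_lt_0_compat; lra. }
specialize (Hn n (Nat.le_refl n)).
assert (Ln : L / 2 ^ n < d).
{ rewrite Rabs_pos_eq in Hn by (apply pow_le; lra). rewrite pow_inv in Hn.
  apply Rmult_lt_compat_l with (r := L + 1) in Hn; [|lra].
  replace ((L + 1) * (d / (L + 1))) with d in Hn by (field; lra).
  unfold Rdiv. pose proof (Rinv_0_lt_compat _ (P2 n)). lra. }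
destruct (Inv n) as [I1 [I2 [I3 [I4 [I5 _]]]]]. specialize (Hlx n). specialize (Hly n). cbv beta in Hlx, Hly.
set (a := fst (p n)) in *. set (b := snd (p n)) in *.
pose proof (PV W n PW) as Q1. pose proof (PV H n PH) as Q2.
set (w := W / 2 ^ n) in *. set (h := H / 2 ^ n) in *.
assert (ELn : L / 2 ^ n = w + h) by (unfold L, w, h; field; apply Rgt_not_eq, P2).
assert (Hz : box a (a + w) b (b + h) (lx, ly)) by inbox.
set (g := fun z : C => (f (lx, ly) + (z - (lx, ly)) * l)%C).
set (G := fun z : C => (f (lx, ly) * z + / RtoC 2 * ((z - (lx, ly)) * (z - (lx, ly))) * l)%C).
assert (N2 : RtoC 2 <> RtoC 0) by (intros Q; apply RtoC_inj in Q; lra).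
assert (DG : forall z, CDer G z (g z)).
{ intros z. unfold G, g. eapply CDer_eq.
  - apply CDer_plus; [apply CDer_scal, CDer_id|].
    apply CDer_mult; [|apply CDer_const]. apply CDer_scal.
    apply CDer_mult; (apply CDer_minus; [apply CDer_id|apply CDer_const]).
  - cbv beta. field; exact N2. }
assert (Dg : forall z, CDer g z l).
{ intros z. unfold g. eapply CDer_eq.
  - apply CDer_plus; [apply CDer_const|]. apply CDer_mult; [|apply CDer_const].
    apply CDer_minus; [apply CDer_id|apply CDer_const].
  - cbv beta. ring. }
assert (Cg : forall D, cont_on D g) by (intros D z _; apply CDer_continuous with (1 := Dg z)).
assert (Cf' : cont_on (box a (a + w) b (b + h)) f) by (intros z Hz'; apply Cf; inbox).
assert (E1 : rect_int f a (a + w) b (b + h) = rect_int (fun z => f z - g z)%C a (a + w) b (b + h)).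
{ assert (E0 : rect_int g a (a + w) b (b + h) = RtoC 0).
  { apply (rect_int_primitive G g); try lra. intros; apply DG. apply Cg. }
  rewrite <- (Cplus_0_r (rect_int (fun z => f z - g z)%C a (a + w) b (b + h))), <- E0.
  rewrite <- (rect_int_plus (fun z => f z - g z)%C g); [|lra|lra| |apply Cg].
  - apply rect_int_ext; try lra. intros; ring.
  - intros z [Hz' _]. apply continuous_Cminus; [apply Cf'; exact Hz'|apply (Cg (fun _ => True)); exact I]. }
rewrite E1 in I5.
assert (B : Cmod (rect_int (fun z => f z - g z)%C a (a + w) b (b + h)) <= (e * (w + h)) * (2 * ((a + w - a) + (b + h - b)))).
{ apply rect_int_bound; try lra.
  - intros z [Hz' _]. apply continuous_Cminus; [apply Cf'; exact Hz'|apply (Cg (fun _ => True)); exact I].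
  - intros z [Hz' _]. pose proof (Cmod_box _ _ _ _ _ _ Hz Hz') as Hd'.
    replace (a + w - a + (b + h - b)) with (w + h) in Hd' by ring.
    eapply Rle_trans; [|apply Rmult_le_compat_l; [lra|exact Hd']].
    replace (f z - g z)%C with (f z - f (lx, ly) - (z - (lx, ly)) * l)%C by (unfold g; ring).
    apply K. lra. }
replace (a + w - a + (b + h - b)) with (w + h) in B by ring. rewrite <- ELn in B.
assert (F : e * (L / 2 ^ n) * (2 * (L / 2 ^ n)) = kappa / 4 ^ n * (2 * L * L / (2 * L * L + 1))).
{ unfold e. rewrite P4. field. split; [lra|apply Rgt_not_eq, P2]. }
assert (G1 : 2 * L * L / (2 * L * L + 1) < 1).
{ apply Rmult_lt_reg_r with (2 * L * L + 1); [lra|]. unfold Rdiv. rewrite Rmult_assoc, Rinv_l; lra. }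
assert (G2 : 0 < kappa / 4 ^ n) by (apply Rdiv_lt_0_compat; [lra|apply pow_lt; lra]).
nra.
Qed.

(** * Contours made of four arcs *)

Record arc := Arc { pt : R -> C; vel : R -> C; lo : R; hi : R }.

Definition arc_ok (g : arc) : Prop :=
  lo g <= hi g /\ forall s, lo g <= s <= hi g -> PDer (pt g) s (vel g s) /\ Pcont (vel g) s.

Definition on_arc (g : arc) (z : C) : Prop := exists s, lo g <= s <= hi g /\ z = pt g s.

Definition aint (f : C -> C) (g : arc) : C := CInt (fun s => vel g s * f (pt g s))%C (lo g) (hi g).

Record loop := Loop { bot : arc; rgt : arc; top : arc; lft : arc }.

Definition loop_ok (L : loop) : Prop :=
  (arc_ok (bot L) /\ arc_ok (rgt L) /\ arc_ok (top L) /\ arc_ok (lft L)) /\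
  pt (bot L) (lo (bot L)) = pt (lft L) (lo (lft L)) /\
  pt (bot L) (hi (bot L)) = pt (rgt L) (lo (rgt L)) /\
  pt (rgt L) (hi (rgt L)) = pt (top L) (hi (top L)) /\
  pt (lft L) (hi (lft L)) = pt (top L) (lo (top L)).

Definition on_loop (L : loop) (z : C) : Prop :=
  on_arc (bot L) z \/ on_arc (rgt L) z \/ on_arc (top L) z \/ on_arc (lft L) z.

(** Counterclockwise contour integral: the top and left arcs are traversed backwards. *)
Definition lint (f : C -> C) (L : loop) : C :=
  (aint f (bot L) + aint f (rgt L) - aint f (top L) - aint f (lft L))%C.

Lemma arc_cont (f : C -> C) (g : arc) : arc_ok g -> cont_on (on_arc g) f ->
  forall s, lo g <= s <= hi g -> Pcont (fun s => vel g s * f (pt g s))%C s.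
Proof.
intros [Hg H] Hf s Hs. destruct (H s Hs) as [H1 H2]. apply continuous_Cmult; [exact H2|].
apply (continuous_comp (pt g) f).
- apply PDer_continuous with (1 := H1).
- apply Hf. exists s; auto.
Qed.

Lemma arc_ex (f : C -> C) (g : arc) : arc_ok g -> cont_on (on_arc g) f ->
  ex_CInt (fun s => vel g s * f (pt g s))%C (lo g) (hi g).
Proof. intros Hg Hf. apply ex_CInt_cont; [apply Hg|]. apply arc_cont; auto. Qed.

Lemma aint_plus (f h : C -> C) (g : arc) : arc_ok g -> cont_on (on_arc g) f -> cont_on (on_arc g) h ->
  aint (fun z => f z + h z)%C g = (aint f g + aint h g)%C.
Proof.
intros Hg Hf Hh. unfold aint.
rewrite <- (CInt_plus (fun s => vel g s * f (pt g s))%C (fun s => vel g s * h (pt g s))%C) by (apply arc_ex; auto).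
apply CInt_ext; [apply Hg|]. intros; ring.
Qed.

Lemma aint_scal (c : C) (f : C -> C) (g : arc) : arc_ok g -> cont_on (on_arc g) f ->
  aint (fun z => c * f z)%C g = (c * aint f g)%C.
Proof.
intros Hg Hf. unfold aint. rewrite <- (CInt_scal c (fun s => vel g s * f (pt g s))%C) by (apply arc_ex; auto).
apply CInt_ext; [apply Hg|]. intros; ring.
Qed.

Lemma aint_ext (f h : C -> C) (g : arc) : arc_ok g -> (forall z, on_arc g z -> f z = h z) -> aint f g = aint h g.
Proof.
intros Hg H. apply CInt_ext; [apply Hg|]. intros s Hs. f_equal. apply H. exists s; auto.
Qed.

Lemma aint_primitive (F f : C -> C) (g : arc) : arc_ok g ->
  (forall z, on_arc g z -> CDer F z (f z)) -> cont_on (on_arc g) f ->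
  aint f g = (F (pt g (hi g)) - F (pt g (lo g)))%C.
Proof.
intros Hg HF Hf. apply CInt_unique, path_FTC; [apply Hg|]. intros s Hs.
destruct (proj2 Hg s Hs) as [H1 H2].
assert (O : on_arc g (pt g s)) by (exists s; auto).
split; [exact (HF _ O)|split; [exact H1|split; [|exact H2]]].
apply (continuous_comp (pt g) f); [apply PDer_continuous with (1 := H1)|apply Hf; auto].
Qed.

Lemma lint_plus (f h : C -> C) (L : loop) : loop_ok L -> cont_on (on_loop L) f -> cont_on (on_loop L) h ->
  lint (fun z => f z + h z)%C L = (lint f L + lint h L)%C.
Proof.
intros [[K1 [K2 [K3 K4]]] _] Hf Hh. unfold lint.
assert (Sub : forall (P : C -> Prop) k, (forall z, P z -> on_loop L z) -> cont_on (on_loop L) k -> cont_on P k).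
{ intros P k H Hk z Hz. apply Hk, H, Hz. }
rewrite (aint_plus f h (bot L)), (aint_plus f h (rgt L)), (aint_plus f h (top L)), (aint_plus f h (lft L));
  [ring|..]; auto; (eapply Sub; [|eassumption]); unfold on_loop; tauto.
Qed.

Lemma lint_scal (c : C) (f : C -> C) (L : loop) : loop_ok L -> cont_on (on_loop L) f ->
  lint (fun z => c * f z)%C L = (c * lint f L)%C.
Proof.
intros [[K1 [K2 [K3 K4]]] _] Hf. unfold lint.
rewrite !aint_scal; auto; try ring; intros z Hz; apply Hf; unfold on_loop; tauto.
Qed.

Lemma lint_ext (f h : C -> C) (L : loop) : loop_ok L -> (forall z, on_loop L z -> f z = h z) -> lint f L = lint h L.
Proof.
intros [[K1 [K2 [K3 K4]]] _] H. unfold lint.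
rewrite (aint_ext f h (bot L)), (aint_ext f h (rgt L)), (aint_ext f h (top L)), (aint_ext f h (lft L)); auto;
  intros; apply H; unfold on_loop; tauto.
Qed.

Lemma lint_primitive (F f : C -> C) (L : loop) : loop_ok L ->
  (forall z, on_loop L z -> CDer F z (f z)) -> cont_on (on_loop L) f -> lint f L = RtoC 0.
Proof.
intros [[K1 [K2 [K3 K4]]] [E1 [E2 [E3 E4]]]] HF Hf. unfold lint.
assert (A : forall g, arc_ok g -> (forall z, on_arc g z -> on_loop L z) ->
  aint f g = (F (pt g (hi g)) - F (pt g (lo g)))%C).
{ intros g Hg H. apply aint_primitive; auto. intros z Hz. apply Hf, H, Hz. }
rewrite !A by (auto; unfold on_loop; tauto).
rewrite E1, E2, E3, E4. ring.
Qed.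

(** The last hypothesis excludes the closed second quadrant, where a quarter turn crosses the cut.
    The difference of the arguments has cosine 0 and sine 1, and the sign estimates on both
    arguments leave only PI / 2. *)
Lemma Arg_Ci (p : C) : slit p -> slit (Ci * p)%C -> 0 < fst p \/ snd p < 0 -> Arg (Ci * p)%C = Arg p + PI / 2.
Proof.
intros H1 H2 H3.
destruct (slit_pos _ H1) as [P1 _].
destruct (Arg_cos_sin p H1) as [A1 A2]. destruct (Arg_cos_sin _ H2) as [B1 B2].
assert (M : Cmod (Ci * p) = Cmod p) by (rewrite Cmod_mult, Cmod_Ci; ring). rewrite M in B1, B2.
pose proof (Arg_bound p) as BA. pose proof (Arg_bound (Ci * p)) as BB.
assert (Q1 : 0 <= snd p -> 0 <= Arg p) by (apply Arg_pos; auto).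
assert (Q2 : snd p <= 0 -> Arg p <= 0) by (apply Arg_neg; auto).
assert (Q3 : 0 <= fst p -> 0 <= Arg (Ci * p)%C) by (intros; apply Arg_pos; auto; destruct p; simpl in *; lra).
assert (Q4 : fst p <= 0 -> Arg (Ci * p)%C <= 0) by (intros; apply Arg_neg; auto; destruct p; simpl in *; lra).
assert (Q5 : 0 <= fst p -> - (PI / 2) <= Arg p <= PI / 2) by (intros; apply Arg_right; auto).
assert (Q6 : snd p <= 0 -> - (PI / 2) <= Arg (Ci * p)%C <= PI / 2).
{ intros; apply Arg_right; auto. destruct p; simpl in *; lra. }
replace (fst (Ci * p)%C) with (- snd p) in B1 by (destruct p; simpl; ring).
replace (snd (Ci * p)%C) with (fst p) in B2 by (destruct p; simpl; ring).
set (a := Arg p) in *. set (b := Arg (Ci * p)%C) in *. set (r := Cmod p) in *.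
assert (C1 : cos (b - a) = 0).
{ apply Rmult_eq_reg_l with (r * r); [|nra]. rewrite cos_minus.
  replace (r * r * (cos b * cos a + sin b * sin a)) with ((r * cos b) * (r * cos a) + (r * sin b) * (r * sin a)) by ring.
  rewrite <- A1, <- A2, <- B1, <- B2. ring. }
assert (S1 : sin (b - a) = 1).
{ apply Rmult_eq_reg_l with (r * r); [|nra]. rewrite sin_minus.
  replace (r * r * (sin b * cos a - cos b * sin a)) with ((r * sin b) * (r * cos a) - (r * cos b) * (r * sin a)) by ring.
  rewrite <- A1, <- A2, <- B1, <- B2.
  assert (E := Cmod2_alt p). unfold Re, Im in E. fold r in E. nra. }
set (d := b - a) in *.
assert (Pi := PI_RGT_0).
assert (D : - (PI / 2) <= d <= 3 * PI / 2).
{ unfold d. destruct (Rle_or_lt 0 (fst p)) as [X|X], (Rle_or_lt 0 (snd p)) as [Y|Y];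
   repeat match goal with H : ?A -> _, K : ?A |- _ => specialize (H K) | H : ?x <= 0 -> _, K : ?x < 0 |- _ => specialize (H (Rlt_le _ _ K)) end;
   try lra. }
destruct (Rle_or_lt d PI) as [HD|HD].
- assert (d = PI / 2); [|unfold d in *; lra].
  destruct (Rle_or_lt 0 d) as [H0|H0].
  + apply cos_inj; try lra. rewrite C1, cos_PI2. reflexivity.
  + assert (sin d < 0) by (apply sin_lt_0_var; lra). lra.
- assert (sin d < 0) by (apply sin_lt_0; lra). lra.
Qed.

Lemma Clog_rot (c z : C) : c <> RtoC 0 -> slit (c * z)%C -> CDer (fun w => Clog (c * w)%C) z (/ z)%C.
Proof.
intros Hc Hz. assert (Hz0 : z <> RtoC 0).
{ intros ->. rewrite Cmult_0_r in Hz. destruct Hz as [Hz|Hz]; simpl in Hz; lra. }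
eapply CDer_eq.
- apply (CDer_comp Clog (fun w => c * w)%C); [apply CDer_Clog; exact Hz|apply CDer_scal, CDer_id].
- field. auto.
Qed.

(** The unit [c] turns the cut of the logarithm away from the arc, along which [Clog (c * (z - a))]
    is then a primitive. *)
Lemma aint_log (c a : C) (g : arc) : Cmod c = 1 -> arc_ok g -> (forall z, on_arc g z -> slit (c * (z - a))%C) ->
  aint (fun z => / (z - a))%C g =
   (Clog (c * (pt g (hi g) - a)) - Clog (c * (pt g (lo g) - a)))%C.
Proof.
intros Hc Hg H.
assert (Hc0 : c <> RtoC 0) by (apply Cmod_gt_0; lra).
assert (N : forall z, on_arc g z -> (z - a)%C <> RtoC 0).
{ intros z Hz E. specialize (H z Hz). rewrite E, Cmult_0_r in H. destruct H as [H|H]; simpl in H; lra. }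
apply (aint_primitive (fun z => Clog (c * (z - a))%C)); auto.
- intros z Hz. eapply CDer_eq.
  + apply (CDer_comp (fun w => Clog (c * w)%C) (fun z => z - a)%C).
    * apply Clog_rot; auto.
    * apply CDer_minus; [apply CDer_id|apply CDer_const].
  + cbv beta. field. auto.
- intros z Hz. apply continuous_Cinv; auto. apply continuous_Cminus; [apply continuous_id|apply continuous_const].
Qed.

Lemma lint_no_winding (c a : C) (L : loop) : Cmod c = 1 -> loop_ok L ->
  (forall z, on_loop L z -> slit (c * (z - a))%C) -> lint (fun z => / (z - a))%C L = RtoC 0.
Proof.
intros Hc HL H. destruct HL as [[K1 [K2 [K3 K4]]] [E1 [E2 [E3 E4]]]]. unfold lint.
rewrite !(aint_log c a); auto; try (intros; apply H; unfold on_loop; tauto).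
rewrite E1, E2, E3, E4. ring.
Qed.

(* Each arc avoids one ray issued from [a], so that a branch of the logarithm is available along it;
   consecutive branches agree at the first three corners and differ by [2 PI] at the last one. *)
Lemma lint_winding (a : C) (L : loop) : loop_ok L ->
  (forall z, on_arc (bot L) z -> slit (Ci * (z - a))%C) ->
  (forall z, on_arc (rgt L) z -> slit (z - a)%C) ->
  (forall z, on_arc (top L) z -> slit (- Ci * (z - a))%C) ->
  (forall z, on_arc (lft L) z -> slit (- (z - a))%C) ->
  (let p := (pt (bot L) (hi (bot L)) - a)%C in 0 < fst p \/ snd p < 0) ->
  (let p := (pt (top L) (hi (top L)) - a)%C in 0 < fst p \/ 0 < snd p) ->
  (let p := (pt (top L) (lo (top L)) - a)%C in fst p < 0 \/ 0 < snd p) ->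
  (let p := (pt (bot L) (lo (bot L)) - a)%C in fst p < 0 \/ snd p < 0) ->
  lint (fun z => / (z - a))%C L = (RtoC (2 * PI) * Ci)%C.
Proof.
intros [[K1 [K2 [K3 K4]]] [E1 [E2 [E3 E4]]]] S1 S2 S3 S4 C1 C2 C3 C4.
assert (O1 : forall g, arc_ok g -> on_arc g (pt g (lo g)) /\ on_arc g (pt g (hi g))).
{ intros g [Hg _]. split; eexists; split; try reflexivity; lra. }
destruct (O1 _ K1) as [B1 B2]. destruct (O1 _ K2) as [R1 R2]. destruct (O1 _ K3) as [T1 T2]. destruct (O1 _ K4) as [L1 L2].
unfold lint.
rewrite (aint_log Ci a (bot L)), (aint_log (RtoC 1) a (rgt L)), (aint_log (- Ci) a (top L)), (aint_log (- RtoC 1) a (lft L)); auto.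
2:{ rewrite Cmod_opp, Cmod_1; auto. }
2:{ intros z Hz. replace (- RtoC 1 * (z - a))%C with (- (z - a))%C by ring. auto. }
2:{ rewrite Cmod_opp, Cmod_Ci; auto. }
2:{ apply Cmod_1. }
2:{ intros z Hz. rewrite Cmult_1_l. auto. }
2:{ apply Cmod_Ci. }
rewrite <- E1, <- E2, E3, E4 in *.
apply S1 in B1. apply S1 in B2. apply S2 in R1. apply S2 in R2. apply S3 in T1. apply S3 in T2. apply S4 in L1. apply S4 in L2.
set (p1 := (pt (bot L) (hi (bot L)) - a)%C) in *.
set (p2 := (pt (top L) (hi (top L)) - a)%C) in *.
set (p3 := (pt (top L) (lo (top L)) - a)%C) in *.
set (p4 := (pt (bot L) (lo (bot L)) - a)%C) in *.
assert (M : forall c p, Cmod c = 1 -> Cmod (c * p) = Cmod p) by (intros c p Hc; rewrite Cmod_mult, Hc; ring).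
assert (M1 : Cmod (- RtoC 1) = 1) by (rewrite Cmod_opp; apply Cmod_1).
assert (M2 : Cmod (- Ci) = 1) by (rewrite Cmod_opp; apply Cmod_Ci).
unfold Clog. rewrite !M by first [apply Cmod_Ci|apply Cmod_1|exact M1|exact M2].
rewrite !Cmult_1_l. replace (- RtoC 1 * p3)%C with (- p3)%C by ring. replace (- RtoC 1 * p4)%C with (- p4)%C by ring.
assert (A1 := Arg_Ci p1 R1 B2 C1).
assert (A2 : Arg p2 = Arg (- Ci * p2)%C + PI / 2).
{ assert (E : p2 = (Ci * (- Ci * p2))%C) by (destruct p2; unfold Cmult, Copp, Ci; simpl; f_equal; ring).
  rewrite E at 1. apply Arg_Ci; auto. rewrite <- E; auto. destruct p2; simpl in *; lra. }
assert (A3 : Arg (- Ci * p3)%C = Arg (- p3)%C + PI / 2).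
{ assert (E : (- Ci * p3)%C = (Ci * - p3)%C) by ring.
  rewrite E. apply Arg_Ci; auto. rewrite <- E; auto. destruct p3; simpl in *; lra. }
assert (A4 : Arg (- p4)%C = Arg (Ci * p4)%C + PI / 2).
{ assert (E : (- p4)%C = (Ci * (Ci * p4))%C) by (destruct p4; unfold Cmult, Copp, Ci; simpl; f_equal; ring).
  rewrite E. apply Arg_Ci; auto. rewrite <- E; auto. destruct p4; simpl in *; lra. }
unfold Cminus, Cplus, Copp, Cmult, RtoC, Ci; simpl. f_equal; [ring|].
unfold Cmult, Copp, Ci, RtoC in A1, A2, A3, A4. simpl in *. lra.
Qed.

(** * Cauchy's formula *)

Definition rect_loop (x1 x2 y1 y2 : R) : loop :=
  Loop (Arc (fun s => (s, y1)) (fun _ => RtoC 1) x1 x2) (Arc (fun s => (x2, s)) (fun _ => Ci) y1 y2)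
       (Arc (fun s => (s, y2)) (fun _ => RtoC 1) x1 x2) (Arc (fun s => (x1, s)) (fun _ => Ci) y1 y2).

Lemma rect_loop_ok (x1 x2 y1 y2 : R) : x1 <= x2 -> y1 <= y2 -> loop_ok (rect_loop x1 x2 y1 y2).
Proof.
intros Hx Hy. split; [|repeat split].
split; [|split; [|split]]; (split; [assumption|]); intros s Hs; split;
  first [apply PDer_horizontal|apply PDer_vertical|apply continuous_const].
Qed.

Lemma on_rect_loop (x1 x2 y1 y2 : R) (z : C) : x1 <= x2 -> y1 <= y2 ->
  on_loop (rect_loop x1 x2 y1 y2) z -> bdry x1 x2 y1 y2 z.
Proof.
intros Hx Hy [[s [Hs ->]]|[[s [Hs ->]]|[[s [Hs ->]]|[s [Hs ->]]]]]; cbn [bot rgt top lft lo hi pt rect_loop] in *; inbdry.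
Qed.

Lemma rect_int_lint (f : C -> C) (x1 x2 y1 y2 : R) : x1 <= x2 -> y1 <= y2 ->
  rect_int f x1 x2 y1 y2 = lint f (rect_loop x1 x2 y1 y2).
Proof.
intros Hx Hy. unfold rect_int, lint, aint. cbn [bot rgt top lft lo hi pt vel rect_loop].
f_equal. f_equal. f_equal.
- apply CInt_ext; auto. intros; ring.
- apply CInt_ext; auto. intros; ring.
Qed.

Lemma rect_int_winding (x1 x2 y1 y2 : R) (a : C) : obox x1 x2 y1 y2 a ->
  rect_int (fun z => / (z - a))%C x1 x2 y1 y2 = (RtoC (2 * PI) * Ci)%C.
Proof.
intros Ha. assert (x1 <= x2) by inbox. assert (y1 <= y2) by inbox.
rewrite rect_int_lint by auto. destruct a as [p q].
apply lint_winding; [apply rect_loop_ok; auto|..];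
 cbn [bot rgt top lft lo hi pt rect_loop];
 try (intros z [s [Hs ->]]); cbn [lo hi pt] in *; unfold slit; simpl; unfold obox in Ha; simpl in Ha; try (left; lra); try (right; lra).
Qed.

Definition unif_cont_box (x1 x2 y1 y2 : R) (f : C -> C) : Prop :=
  forall e, 0 < e -> exists d, 0 < d /\ forall z w, box x1 x2 y1 y2 z -> box x1 x2 y1 y2 w ->
    Rabs (fst w - fst z) < d -> Rabs (snd w - snd z) < d -> Cmod (f w - f z) < e.

Lemma unif_cont (x1 x2 y1 y2 : R) (f : C -> C) : cont_on (box x1 x2 y1 y2) f -> unif_cont_box x1 x2 y1 y2 f.
Proof.
intros Hf e He.
assert (U : forall pr : C -> R, (forall z, box x1 x2 y1 y2 z -> continuous (fun w => pr (f w)) z) ->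
  exists d, 0 < d /\ forall z w, box x1 x2 y1 y2 z -> box x1 x2 y1 y2 w ->
    Rabs (fst w - fst z) < d -> Rabs (snd w - snd z) < d -> Rabs (pr (f w) - pr (f z)) < e / 2).
{ intros pr Hp. assert (He2 : 0 < e / 2) by lra.
  destruct (uniform_continuity_2d (fun a b => pr (f (a, b))) x1 x2 y1 y2) with (eps := mkposreal _ He2) as [d Hd].
  - intros x y Hx Hy. apply continuity_2d_pt_filterlim.
    apply filterlim_ext with (fun w => pr (f w)); [intros [u v]; reflexivity|].
    apply (Hp (x, y)). split; auto.
  - exists d; split; [apply cond_pos|]. intros [a b] [u v] [Hz1 Hz2] [Hw1 Hw2] D1 D2. apply Hd; auto. }
destruct (U fst) as [d1 [Hd1 U1]]. { intros z Hz. apply continuous_fst_C, Hf, Hz. }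
destruct (U snd) as [d2 [Hd2 U2]]. { intros z Hz. apply continuous_snd_C, Hf, Hz. }
exists (Rmin d1 d2). split; [apply Rmin_glb_lt; auto|]. intros z w Hz Hw D1 D2.
pose proof (Rmin_l d1 d2). pose proof (Rmin_r d1 d2).
specialize (U1 z w Hz Hw ltac:(lra) ltac:(lra)). specialize (U2 z w Hz Hw ltac:(lra) ltac:(lra)).
replace (f w - f z)%C with (RtoC (fst (f w) - fst (f z)) + RtoC (snd (f w) - snd (f z)) * Ci)%C.
2:{ destruct (f w), (f z); unfold Cminus, Cplus, Copp, Cmult, RtoC, Ci; simpl; f_equal; ring. }
eapply Rle_lt_trans; [apply Cmod_triangle|]. rewrite Cmod_mult, !Cmod_R, Cmod_Ci. lra.
Qed.

Lemma rect_int_degenerate (f : C -> C) (x y1 y2 : R) : rect_int f x x y1 y2 = RtoC 0.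
Proof.
unfold rect_int. rewrite !(RInt_point (V := C_R_CompleteNormedModule)).
change (@zero C_R_CompleteNormedModule) with (RtoC 0). ring.
Qed.

(** The horizontal sides are short, and the vertical ones nearly cancel by uniform continuity. *)
Lemma rect_int_thin (f : C -> C) (x1 x2 y1 y2 a : R) : y1 <= y2 -> x1 <= a <= x2 -> cont_on (box x1 x2 y1 y2) f ->
  forall e, 0 < e -> exists d, 0 < d /\ forall p q, x1 <= p <= a -> a <= q <= x2 -> q - p < d ->
    Cmod (rect_int f p q y1 y2) <= e.
Proof.
intros Hy Ha Hf e He.
set (K := Cmod (f (a, y1)) + Cmod (f (a, y2))).
assert (PK : 0 <= K) by (unfold K; pose proof (Cmod_ge_0 (f (a, y1))); pose proof (Cmod_ge_0 (f (a, y2))); lra).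
set (e1 := e / (2 * (y2 - y1 + 1))).
assert (He1 : 0 < e1) by (apply Rdiv_lt_0_compat; lra).
destruct (unif_cont x1 x2 y1 y2 f Hf e1 He1) as [d0 [Hd0 U]].
set (d1 := e / (2 * (K + 2 * e1 + 1))).
assert (Hd1 : 0 < d1) by (apply Rdiv_lt_0_compat; lra).
exists (Rmin d0 d1). split; [apply Rmin_glb_lt; auto|]. intros p q Hp Hq Hpq.
pose proof (Rmin_l d0 d1). pose proof (Rmin_r d0 d1).
assert (H1 : forall y, y = y1 \/ y = y2 -> Cmod (CInt (fun s => f (s, y)) p q) <= (Cmod (f (a, y)) + e1) * (q - p)).
{ intros y Hy'. apply CInt_bound; try lra.
  - apply ex_horizontal; try lra. intros; apply Hf; inbox.
  - intros s Hs. replace (f (s, y)) with (f (a, y) + (f (s, y) - f (a, y)))%C by ring.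
    eapply Rle_trans; [apply Cmod_triangle|]. apply Rplus_le_compat_l. left. apply U; try inbox; cbn [fst snd].
    + apply Rabs_def1; lra.
    + rewrite Rminus_diag, Rabs_R0. lra. }
assert (H2 : Cmod (CInt (fun s => Ci * f (q, s))%C y1 y2 - CInt (fun s => Ci * f (p, s))%C y1 y2) <= e1 * (y2 - y1)).
{ rewrite <- CInt_minus.
  2,3: apply ex_vertical; try lra; intros; apply Hf; inbox.
  apply CInt_bound; try lra.
  - apply (ex_RInt_minus (V := C_R_NormedModule)); apply ex_vertical; try lra; intros; apply Hf; inbox.
  - intros s Hs. replace (Ci * f (q, s) - Ci * f (p, s))%C with (Ci * (f (q, s) - f (p, s)))%C by ring.
    rewrite Cmod_mult, Cmod_Ci, Rmult_1_l. left; apply U; try inbox; cbn [fst snd].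
    + apply Rabs_def1; lra.
    + rewrite Rminus_diag, Rabs_R0. lra. }
unfold rect_int.
replace (CInt (fun s => f (s, y1)) p q + CInt (fun s => Ci * f (q, s)) y1 y2 - CInt (fun s => f (s, y2)) p q - CInt (fun s => Ci * f (p, s)) y1 y2)%C
 with (CInt (fun s => f (s, y1)) p q + - CInt (fun s => f (s, y2)) p q + (CInt (fun s => Ci * f (q, s)) y1 y2 - CInt (fun s => Ci * f (p, s)) y1 y2))%C by ring.
eapply Rle_trans; [apply Cmod_triangle|]. eapply Rle_trans; [apply Rplus_le_compat_r, Cmod_triangle|]. rewrite Cmod_opp.
pose proof (H1 y1 ltac:(auto)). pose proof (H1 y2 ltac:(auto)).
assert (Q1 : (K + 2 * e1) * (q - p) <= e / 2).
{ apply Rle_trans with ((K + 2 * e1 + 1) * d1).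
  - apply Rmult_le_compat; lra.
  - unfold d1. right. field. lra. }
assert (Q2 : e1 * (y2 - y1) <= e / 2).
{ apply Rle_trans with (e1 * (y2 - y1 + 1)); [apply Rmult_le_compat_l; lra|]. unfold e1. right; field; lra. }
unfold K in Q1. lra.
Qed.

(** Goursat's theorem applies on both sides of a thin strip around the line Re z = a, and the
    integral over the strip is small by continuity. This serves difference quotients, continuous but
    not yet known to be differentiable at their base point. *)
Lemma rect_int_exceptional (f : C -> C) (x1 x2 y1 y2 a : R) : x1 <= x2 -> y1 <= y2 ->
  cont_on (box x1 x2 y1 y2) f -> holo_on (fun z => box x1 x2 y1 y2 z /\ fst z <> a) f ->
  rect_int f x1 x2 y1 y2 = RtoC 0.
Proof.
intros Hx Hy Hf Hh.
destruct (Rlt_le_dec a x1) as [H1|H1]; [apply Goursat; auto; intros z Hz; apply Hh; split; [auto|inbox]|].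
destruct (Rlt_le_dec x2 a) as [H2|H2]; [apply Goursat; auto; intros z Hz; apply Hh; split; [auto|inbox]|].
apply Cmod_eq_0. destruct (Rle_lt_or_eq_dec 0 _ (Cmod_ge_0 (rect_int f x1 x2 y1 y2))) as [P|P]; [exfalso|auto].
destruct (rect_int_thin f x1 x2 y1 y2 a Hy (conj H1 H2) Hf _ (Rdiv_lt_0_compat _ 2 P Rlt_0_2)) as [d [Hd T]].
(* Each edge of the strip either stays off the exceptional line or coincides with an edge of the
   rectangle, which leaves a degenerate piece on that side. *)
assert (Hp : exists p, x1 <= p <= a /\ a - p < d / 2 /\ (p = x1 \/ p < a)).
{ exists (Rmax x1 (a - d / 3)). unfold Rmax. destruct Rle_dec; lra. }
assert (Hq : exists q, a <= q <= x2 /\ q - a < d / 2 /\ (q = x2 \/ a < q)).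
{ exists (Rmin x2 (a + d / 3)). unfold Rmin. destruct Rle_dec; lra. }
destruct Hp as [p [Hp1 [Hp2 Hp3]]]. destruct Hq as [q [Hq1 [Hq2 Hq3]]].
assert (E : rect_int f x1 x2 y1 y2 = rect_int f p q y1 y2).
{ rewrite (rect_int_split_x f x1 p x2), (rect_int_split_x f p q x2); try lra; auto.
  2:{ intros z Hz; apply Hf; inbox. }
  assert (E1 : rect_int f x1 p y1 y2 = RtoC 0).
  { destruct Hp3 as [->|Hp3]; [apply rect_int_degenerate|]. apply Goursat; try lra. intros z Hz; apply Hh; split; inbox. }
  assert (E2 : rect_int f q x2 y1 y2 = RtoC 0).
  { destruct Hq3 as [->|Hq3]; [apply rect_int_degenerate|]. apply Goursat; try lra. intros z Hz; apply Hh; split; inbox. }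
  rewrite E1, E2. ring. }
specialize (T p q ltac:(lra) ltac:(lra) ltac:(lra)). rewrite <- E in T. lra.
Qed.

Definition dquot (f : C -> C) (a z : C) : C :=
  if Ceq_dec z a then C_derive f a else ((f z - f a) / (z - a))%C.

Lemma dquot_mul (f : C -> C) (a z : C) : (f z - f a)%C = ((z - a) * dquot f a z)%C.
Proof.
unfold dquot. destruct Ceq_dec as [->|H]; [ring|]. field. intros E. apply H, Ceq_minus, E.
Qed.

Lemma dquot_off (f : C -> C) (a z l : C) : z <> a -> CDer f z l -> exists m, CDer (dquot f a) z m.
Proof.
intros Hz Hl.
exists ((l * (z - a) - (f z - f a) * RtoC 1) / ((z - a) * (z - a)))%C.
apply (is_derive_ext_loc (V := C_NormedModule)) with (fun w => (f w - f a) / (w - a))%C.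
- apply locally_C. apply locally_C_Cmod. exists (Cmod (z - a)). split.
  { apply Cmod_gt_0. intros E. apply Hz, Ceq_minus, E. }
  intros w Hw. unfold dquot. destruct Ceq_dec as [->|]; [|reflexivity].
  rewrite <- Cmod_opp in Hw. replace (- (a - z))%C with (z - a)%C in Hw by ring. lra.
- eapply CDer_eq.
  + apply (CDer_div (fun w => f w - f a)%C (fun w => w - a)%C).
    * intros E. apply Hz, Ceq_minus, E.
    * apply CDer_minus; [exact Hl|apply CDer_const].
    * apply CDer_minus; [apply CDer_id|apply CDer_const].
  + f_equal. ring.
Qed.

Lemma dquot_cont (f : C -> C) (a l : C) : CDer f a l -> Ccont (dquot f a) a.
Proof.
intros Hl. assert (El := is_C_derive_unique f a l Hl).
rewrite is_derive_C_eps in Hl. apply continuous_C_eps. intros e He.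
destruct (Hl (e / 2)) as [d [Hd K]]; [lra|]. apply locally_C_Cmod. exists d; split; auto. intros w Hw.
unfold dquot. destruct (Ceq_dec a a) as [_|N]; [|congruence].
destruct Ceq_dec as [->|N]; [replace (C_derive f a - C_derive f a)%C with (RtoC 0) by ring; rewrite Cmod_0; lra|].
assert (N' : (w - a)%C <> RtoC 0) by (intros E; apply N, Ceq_minus, E).
assert (P : 0 < Cmod (w - a)) by (apply Cmod_gt_0; auto).
specialize (K w Hw). rewrite El.
replace ((f w - f a) / (w - a) - l)%C with ((f w - f a - (w - a) * l) / (w - a))%C by (field; auto).
rewrite Cmod_div by auto. apply Rle_lt_trans with (e / 2); [|lra].
apply Rmult_le_reg_r with (Cmod (w - a)); auto. unfold Rdiv. rewrite Rmult_assoc, Rinv_l; lra.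
Qed.

Lemma dquot_cont_on (D : C -> Prop) (f : C -> C) (a : C) : D a -> holo_on D f -> cont_on D (dquot f a).
Proof.
intros Ha Hf z Hz. destruct (Ceq_dec z a) as [->|N].
- destruct (Hf a Ha) as [l Hl]. apply dquot_cont with (1 := Hl).
- destruct (Hf z Hz) as [l Hl]. destruct (dquot_off f a z l N Hl) as [m Hm]. apply CDer_continuous with (1 := Hm).
Qed.

Lemma fst_neq_neq (z a : C) : fst z <> fst a -> z <> a.
Proof. intros H E. apply H. rewrite E. reflexivity. Qed.

Lemma rect_int_dquot (f : C -> C) (a : C) (x1 x2 y1 y2 : R) : x1 <= x2 -> y1 <= y2 ->
  (exists l, CDer f a l) -> holo_on (box x1 x2 y1 y2) f -> rect_int (dquot f a) x1 x2 y1 y2 = RtoC 0.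
Proof.
intros Hx Hy [l Hl] Hf. apply rect_int_exceptional with (fst a); auto.
- intros z Hz. apply (dquot_cont_on (fun w => box x1 x2 y1 y2 w \/ w = a)); auto.
  intros w [Hw| ->]; [auto|eexists; exact Hl].
- intros z [Hz N]. destruct (Hf z Hz) as [m Hm]. apply (dquot_off f a z m); auto. apply fst_neq_neq; auto.
Qed.

Lemma bdry_neq (x1 x2 y1 y2 : R) (a z : C) : obox x1 x2 y1 y2 a -> bdry x1 x2 y1 y2 z -> (z - a)%C <> RtoC 0.
Proof.
intros Ha [Hz1 Hz2] E. apply Ceq_minus in E. subst z. inbox.
Qed.

(** On the boundary f z / (z - a) is [dquot f a z] plus f a / (z - a): the former has zero integral,
    the latter yields the winding number. *)
Theorem Cauchy_formula (f : C -> C) (x1 x2 y1 y2 : R) (a : C) : obox x1 x2 y1 y2 a ->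
  holo_on (box x1 x2 y1 y2) f ->
  rect_int (fun z => f z / (z - a))%C x1 x2 y1 y2 = (RtoC (2 * PI) * Ci * f a)%C.
Proof.
intros Ha Hf. assert (Hx : x1 <= x2) by inbox. assert (Hy : y1 <= y2) by inbox.
assert (Ba : box x1 x2 y1 y2 a) by inbox.
assert (N := bdry_neq x1 x2 y1 y2 a). specialize (N) with (1 := Ha).
rewrite (rect_int_ext _ (fun z => dquot f a z + f a * / (z - a))%C); auto.
2:{ intros z Hz. specialize (N z Hz). assert (E := dquot_mul f a z).
    replace (f z) with (f z - f a + f a)%C by ring. rewrite E. field. exact N. }
assert (C1 : cont_on (bdry x1 x2 y1 y2) (fun z => / (z - a))%C).
{ intros z Hz. apply continuous_Cinv; [|apply N; auto]. apply continuous_Cminus; [apply continuous_id|apply continuous_const]. }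
rewrite rect_int_plus; auto.
- rewrite (rect_int_dquot f a) by auto.
  rewrite rect_int_lint, lint_scal, <- rect_int_lint, rect_int_winding; auto; [ring|apply rect_loop_ok; auto|].
  intros z Hz. apply C1, on_rect_loop; auto.
- apply cont_bdry, dquot_cont_on; auto.
- intros z Hz. apply continuous_Cmult; [apply continuous_const|apply C1; auto].
Qed.

(** * Differentiability of Cauchy integrals *)

Lemma Cmod_le_sum (z : C) : Cmod z <= Rabs (fst z) + Rabs (snd z).
Proof.
assert (E : z = (RtoC (fst z) + RtoC (snd z) * Ci)%C).
{ destruct z. unfold Cplus, Cmult, RtoC, Ci; simpl; f_equal; ring. }
rewrite E at 1.
eapply Rle_trans; [apply Cmod_triangle|]. rewrite Cmod_mult, !Cmod_R, Cmod_Ci. lra.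
Qed.

Lemma Rabs_fst_le (z : C) : Rabs (fst z) <= Cmod z.
Proof. eapply Rle_trans; [apply Rmax_l|apply Rmax_Cmod]. Qed.

Lemma Rabs_snd_le (z : C) : Rabs (snd z) <= Cmod z.
Proof. eapply Rle_trans; [apply Rmax_r|apply Rmax_Cmod]. Qed.

Lemma rect_int_scal (c : C) (f : C -> C) (x1 x2 y1 y2 : R) : x1 <= x2 -> y1 <= y2 ->
  cont_on (bdry x1 x2 y1 y2) f -> rect_int (fun z => c * f z)%C x1 x2 y1 y2 = (c * rect_int f x1 x2 y1 y2)%C.
Proof.
intros Hx Hy Hf. rewrite !rect_int_lint, lint_scal; auto. apply rect_loop_ok; auto.
intros z Hz; apply Hf, on_rect_loop; auto.
Qed.

Lemma continuous_bounded (f : R -> C) (a b : R) : a <= b -> (forall s, a <= s <= b -> Pcont f s) ->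
  exists M, forall s, a <= s <= b -> Cmod (f s) <= M.
Proof.
intros Hab Hf. destruct (continuity_ab_maj (fun s => Cmod (f s)) a b Hab) as [m [Hm _]].
- intros c Hc. apply continuity_pt_filterlim. apply (continuous_Cmod f c), Hf, Hc.
- exists (Cmod (f m)). exact Hm.
Qed.

Lemma bdry_bounded (f : C -> C) (x1 x2 y1 y2 : R) : x1 <= x2 -> y1 <= y2 ->
  cont_on (bdry x1 x2 y1 y2) f -> exists M, 0 <= M /\ forall z, bdry x1 x2 y1 y2 z -> Cmod (f z) <= M.
Proof.
intros Hx Hy Hf.
assert (H : forall y, y = y1 \/ y = y2 -> exists M, forall s, x1 <= s <= x2 -> Cmod (f (s, y)) <= M).
{ intros y Hy'. apply (continuous_bounded (fun s => f (s, y))); auto. intros s Hs. apply Pcont_horizontal, Hf. inbdry. }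
assert (V : forall x, x = x1 \/ x = x2 -> exists M, forall s, y1 <= s <= y2 -> Cmod (f (x, s)) <= M).
{ intros x Hx'. apply (continuous_bounded (fun s => f (x, s))); auto. intros s Hs. apply Pcont_vertical, Hf. inbdry. }
destruct (H y1) as [M1 H1]; auto. destruct (H y2) as [M2 H2]; auto.
destruct (V x1) as [M3 H3]; auto. destruct (V x2) as [M4 H4]; auto.
exists (Rmax 0 (Rmax (Rmax M1 M2) (Rmax M3 M4))). split; [apply Rmax_l|].
assert (Q1 := Rmax_r 0 (Rmax (Rmax M1 M2) (Rmax M3 M4))).
assert (Q2 := Rmax_l (Rmax M1 M2) (Rmax M3 M4)). assert (Q3 := Rmax_r (Rmax M1 M2) (Rmax M3 M4)).
assert (Q4 := Rmax_l M1 M2). assert (Q5 := Rmax_r M1 M2). assert (Q6 := Rmax_l M3 M4). assert (Q7 := Rmax_r M3 M4).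
intros [x y] [[Hzx Hzy] Hz]. cbn [fst snd] in *.
destruct Hz as [->|[->|[->|Hz]]]; [specialize (H3 y Hzy)|specialize (H4 y Hzy)|specialize (H1 x Hzx)|subst y; specialize (H2 x Hzx)]; lra.
Qed.

Lemma bdry_dist (x1 x2 y1 y2 : R) (a : C) : obox x1 x2 y1 y2 a ->
  exists r, 0 < r /\ (forall w, Cmod (w - a) < r -> obox x1 x2 y1 y2 w) /\
  forall z w, bdry x1 x2 y1 y2 z -> Cmod (w - a) < r -> r <= Cmod (z - w).
Proof.
intros [Ha1 Ha2].
set (r0 := Rmin (Rmin (fst a - x1) (x2 - fst a)) (Rmin (snd a - y1) (y2 - snd a))).
assert (R0 : 0 < r0) by (repeat apply Rmin_glb_lt; lra).
assert (Q1 : r0 <= fst a - x1) by (eapply Rle_trans; apply Rmin_l).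
assert (Q2 : r0 <= x2 - fst a) by (eapply Rle_trans; [apply Rmin_l|apply Rmin_r]).
assert (Q3 : r0 <= snd a - y1) by (eapply Rle_trans; [apply Rmin_r|apply Rmin_l]).
assert (Q4 : r0 <= y2 - snd a) by (eapply Rle_trans; [apply Rmin_r|apply Rmin_r]).
exists (r0 / 2). split; [lra|].
assert (W : forall w : C, Cmod (w - a) < r0 / 2 -> Rabs (fst w - fst a) < r0 / 2 /\ Rabs (snd w - snd a) < r0 / 2).
{ intros w Hw. split; eapply Rle_lt_trans; try exact Hw; [apply (Rabs_fst_le (w - a))|apply (Rabs_snd_le (w - a))]. }
split.
- intros w Hw. destruct (W w Hw) as [W1 W2]. apply Rabs_def2 in W1. apply Rabs_def2 in W2. split; lra.
- intros z w [Hz Hz'] Hw. destruct (W w Hw) as [W1 W2]. apply Rabs_def2 in W1. apply Rabs_def2 in W2.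
  assert (F1 := Rabs_fst_le (z - w)). assert (F2 := Rabs_snd_le (z - w)).
  change (fst (z - w)%C) with (fst z - fst w) in F1. change (snd (z - w)%C) with (snd z - snd w) in F2.
  destruct Hz' as [E|[E|[E|E]]]; rewrite E in *.
  + eapply Rle_trans; [|exact F1]. rewrite Rabs_left; lra.
  + eapply Rle_trans; [|exact F1]. rewrite Rabs_pos_eq; lra.
  + eapply Rle_trans; [|exact F2]. rewrite Rabs_left; lra.
  + eapply Rle_trans; [|exact F2]. rewrite Rabs_pos_eq; lra.
Qed.

(** Differentiation under the contour integral: a remainder quadratic in the increment, uniformly on
    the boundary, is integrated over the perimeter [P]. *)
Lemma CDer_RI (K : C -> C -> C) (K' : C -> C) (x1 x2 y1 y2 M d : R) (z : C) : x1 <= x2 -> y1 <= y2 -> 0 < d -> 0 <= M ->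
  (forall w, Cmod (w - z) < d -> cont_on (bdry x1 x2 y1 y2) (K w)) -> cont_on (bdry x1 x2 y1 y2) K' ->
  (forall t w, bdry x1 x2 y1 y2 t -> Cmod (w - z) < d ->
     Cmod (K w t - K z t - (w - z) * K' t) <= M * (Cmod (w - z) * Cmod (w - z))) ->
  CDer (fun w => rect_int (K w) x1 x2 y1 y2) z (rect_int K' x1 x2 y1 y2).
Proof.
intros Hx Hy Hd HM HK HK' HB. apply is_derive_C_eps. intros e He.
set (P := 2 * ((x2 - x1) + (y2 - y1))). assert (HP : 0 <= P) by (unfold P; lra).
exists (Rmin d (e / (M * P + 1))). split.
{ apply Rmin_glb_lt; auto. apply Rdiv_lt_0_compat; auto. assert (0 <= M * P) by (apply Rmult_le_pos; auto). lra. }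
intros w Hw. assert (W1 := Rlt_le_trans _ _ _ Hw (Rmin_l _ _)). assert (W2 := Rlt_le_trans _ _ _ Hw (Rmin_r _ _)).
assert (Kz : cont_on (bdry x1 x2 y1 y2) (K z)).
{ apply HK. replace (z - z)%C with (RtoC 0) by ring. rewrite Cmod_0; auto. }
assert (Kw := HK w W1).
replace (rect_int (K w) x1 x2 y1 y2 - rect_int (K z) x1 x2 y1 y2 - (w - z) * rect_int K' x1 x2 y1 y2)%C with
  (rect_int (fun t => K w t + (- RtoC 1 * K z t + - (w - z) * K' t))%C x1 x2 y1 y2).
2:{ assert (A1 : forall c k, cont_on (bdry x1 x2 y1 y2) k -> cont_on (bdry x1 x2 y1 y2) (fun t => c * k t)%C).
    { intros c k Hk t Ht. apply continuous_Cmult; [apply continuous_const|apply Hk, Ht]. }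
    rewrite rect_int_plus, rect_int_plus, !rect_int_scal; auto; [ring|].
    intros t Ht. apply continuous_Cplus; apply A1; auto. }
eapply Rle_trans.
- apply rect_int_bound with (M := M * (Cmod (w - z) * Cmod (w - z))); auto.
  + intros t Ht. apply continuous_Cplus; [apply Kw, Ht|]. apply continuous_Cplus.
    * apply continuous_Cmult; [apply continuous_const|apply Kz, Ht].
    * apply continuous_Cmult; [apply continuous_const|apply HK', Ht].
  + intros t Ht. replace (K w t + (- RtoC 1 * K z t + - (w - z) * K' t))%C with (K w t - K z t - (w - z) * K' t)%C by ring. auto.
- fold P. pose proof (Cmod_ge_0 (w - z)) as Ph. set (h := Cmod (w - z)) in *.
  assert (MP : 0 <= M * P) by (apply Rmult_le_pos; auto).
  apply Rmult_lt_compat_r with (r := M * P + 1) in W2; [|lra].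
  replace (e / (M * P + 1) * (M * P + 1)) with e in W2 by (field; lra).
  replace (M * (h * h) * P) with ((h * (M * P)) * h) by ring. apply Rmult_le_compat_r; lra.
Qed.

Lemma Cinv_pow_bound (c : C) (r : R) : 0 < r -> r <= Cmod c -> Cmod (/ c) <= / r.
Proof.
intros Hr H. rewrite Cmod_inv; [|apply Cmod_gt_0; lra]. apply Rinv_le_contravar; auto.
Qed.

(** Both remainders are exact multiples of (w - z)^2, with coefficients bounded through [bdry_dist].
    The second formula is what makes the derivative of a holomorphic function differentiable in its
    turn. *)
Lemma rect_int_Cauchy_derive (f : C -> C) (x1 x2 y1 y2 : R) (z : C) : obox x1 x2 y1 y2 z -> cont_on (bdry x1 x2 y1 y2) f ->
  CDer (fun w => rect_int (fun t => f t * / (t - w))%C x1 x2 y1 y2) z (rect_int (fun t => f t * (/ (t - z) * / (t - z)))%C x1 x2 y1 y2) /\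
  CDer (fun w => rect_int (fun t => f t * (/ (t - w) * / (t - w)))%C x1 x2 y1 y2) z
    (rect_int (fun t => f t * (RtoC 2 * (/ (t - z) * / (t - z) * / (t - z))))%C x1 x2 y1 y2).
Proof.
intros Hz Hf. assert (Hx : x1 <= x2) by inbox. assert (Hy : y1 <= y2) by inbox.
destruct (bdry_dist _ _ _ _ _ Hz) as [r [Hr [_ HD]]].
destruct (bdry_bounded f x1 x2 y1 y2 Hx Hy Hf) as [M [HM HB]].
assert (Z0 : Cmod (z - z) < r) by (replace (z - z)%C with (RtoC 0) by ring; rewrite Cmod_0; auto).
assert (NN : forall t w, bdry x1 x2 y1 y2 t -> Cmod (w - z) < r -> (t - w)%C <> RtoC 0).
{ intros t w Ht Hw. apply Cmod_gt_0. specialize (HD t w Ht Hw). lra. }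
assert (CI : forall w, Cmod (w - z) < r -> cont_on (bdry x1 x2 y1 y2) (fun t => / (t - w))%C).
{ intros w Hw t Ht. apply continuous_Cinv; [|apply NN; auto]. apply continuous_Cminus; [apply continuous_id|apply continuous_const]. }
assert (Ir : 0 < / r) by (apply Rinv_0_lt_compat; auto).
split.
- apply CDer_RI with (d := r) (M := M * (/ r * (/ r * / r))); auto.
  + repeat apply Rmult_le_pos; lra.
  + intros w Hw t Ht. apply continuous_Cmult; [apply Hf, Ht|apply CI; auto].
  + intros t Ht. apply continuous_Cmult; [apply Hf, Ht|apply continuous_Cmult; apply CI; auto].
  + intros t w Ht Hw.
    replace (f t * / (t - w) - f t * / (t - z) - (w - z) * (f t * (/ (t - z) * / (t - z))))%C with
      (f t * (/ (t - w) * (/ (t - z) * / (t - z))) * ((w - z) * (w - z)))%C.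
    2:{ field. split; apply NN; auto. }
    rewrite !Cmod_mult. apply Rmult_le_compat_r; [apply Rmult_le_pos; apply Cmod_ge_0|].
    assert (B1 := Cinv_pow_bound _ _ Hr (HD t w Ht Hw)). assert (B2 := Cinv_pow_bound _ _ Hr (HD t z Ht Z0)).
    repeat apply Rmult_le_compat; repeat apply Rmult_le_pos; auto using Cmod_ge_0.
- apply CDer_RI with (d := r) (M := M * (3 * (/ r * / r * (/ r * / r)))); auto.
  + repeat apply Rmult_le_pos; lra.
  + intros w Hw t Ht. apply continuous_Cmult; [apply Hf, Ht|apply continuous_Cmult; apply CI; auto].
  + intros t Ht. apply continuous_Cmult; [apply Hf, Ht|]. apply continuous_Cmult; [apply continuous_const|].
    apply continuous_Cmult; [apply continuous_Cmult|]; apply CI; auto.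
  + intros t w Ht Hw.
    replace (f t * (/ (t - w) * / (t - w)) - f t * (/ (t - z) * / (t - z)) - (w - z) * (f t * (RtoC 2 * (/ (t - z) * / (t - z) * / (t - z)))))%C with
      (f t * (/ (t - w) * / (t - w) * (/ (t - z) * / (t - z)) + RtoC 2 * (/ (t - w) * / (t - z) * (/ (t - z) * / (t - z)))) * ((w - z) * (w - z)))%C.
    2:{ field. split; apply NN; auto. }
    rewrite (Cmod_mult _ ((w - z) * (w - z))), (Cmod_mult (f t)), (Cmod_mult (w - z)).
    apply Rmult_le_compat_r; [apply Rmult_le_pos; apply Cmod_ge_0|].
    assert (B1 := Cinv_pow_bound _ _ Hr (HD t w Ht Hw)). assert (B2 := Cinv_pow_bound _ _ Hr (HD t z Ht Z0)).
    apply Rmult_le_compat; auto using Cmod_ge_0.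
    eapply Rle_trans; [apply Cmod_triangle|]. rewrite !Cmod_mult, Cmod_R, (Rabs_pos_eq 2) by lra.
    assert (B3 : Cmod (/ (t - w)) * Cmod (/ (t - w)) * (Cmod (/ (t - z)) * Cmod (/ (t - z))) <= / r * / r * (/ r * / r)).
    { repeat apply Rmult_le_compat; repeat apply Rmult_le_pos; auto using Cmod_ge_0. }
    assert (B4 : Cmod (/ (t - w)) * Cmod (/ (t - z)) * (Cmod (/ (t - z)) * Cmod (/ (t - z))) <= / r * / r * (/ r * / r)).
    { repeat apply Rmult_le_compat; repeat apply Rmult_le_pos; auto using Cmod_ge_0. }
    lra.
Qed.

Definition sqbox (a : C) (s : R) : C -> Prop := box (fst a - s) (fst a + s) (snd a - s) (snd a + s).
Definition osqbox (a : C) (s : R) : C -> Prop := obox (fst a - s) (fst a + s) (snd a - s) (snd a + s).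

Lemma osqbox_center (a : C) (s : R) : 0 < s -> osqbox a s a.
Proof. intros H. unfold osqbox. inbox. Qed.

Lemma locally_sqbox (a : C) (P : C -> Prop) : locally a P <-> exists s, 0 < s /\ forall z, sqbox a s z -> P z.
Proof.
split.
- intros H. apply locally_C_Cmod in H. destruct H as [d [Hd H]]. exists (d / 3). split; [lra|].
  intros z Hz. apply H. eapply Rle_lt_trans; [apply Cmod_le_sum|]. unfold sqbox, box in Hz.
  change (fst (z - a)%C) with (fst z - fst a). change (snd (z - a)%C) with (snd z - snd a).
  assert (Rabs (fst z - fst a) <= d / 3) by (apply Rabs_le; lra).
  assert (Rabs (snd z - snd a) <= d / 3) by (apply Rabs_le; lra). lra.
- intros [s [Hs H]]. apply locally_C_Cmod. exists s; split; auto. intros w Hw. apply H.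
  assert (F1 := Rabs_fst_le (w - a)). assert (F2 := Rabs_snd_le (w - a)).
  change (fst (w - a)%C) with (fst w - fst a) in F1. change (snd (w - a)%C) with (snd w - snd a) in F2.
  apply Rle_lt_trans with (2 := Hw) in F1. apply Rle_lt_trans with (2 := Hw) in F2.
  apply Rabs_def2 in F1. apply Rabs_def2 in F2. unfold sqbox. inbox.
Qed.

Lemma locally_obox (x1 x2 y1 y2 : R) (a : C) : obox x1 x2 y1 y2 a -> locally a (obox x1 x2 y1 y2).
Proof.
intros Ha. destruct (bdry_dist _ _ _ _ _ Ha) as [r [Hr [H _]]]. apply locally_C_Cmod. exists r; split; auto.
Qed.

Lemma holomorphic_at_sqbox (f : C -> C) (a : C) :
  holomorphic_at f a <-> exists s, 0 < s /\ holo_on (sqbox a s) f.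
Proof. apply locally_sqbox. Qed.

Lemma holomorphic_at_ex (f : C -> C) (a : C) : holomorphic_at f a -> exists l, CDer f a l.
Proof. intros H. exact (locally_singleton _ _ H). Qed.

Lemma holomorphic_at_ext (f g : C -> C) (a : C) : locally a (fun z => f z = g z) -> holomorphic_at f a -> holomorphic_at g a.
Proof.
intros H Hf. apply locally_locally in H. unfold holomorphic_at in *. generalize (filter_and _ _ H Hf).
apply filter_imp. intros z [Hz [l Hl]]. exists l.
apply (is_derive_ext_loc (V := C_NormedModule)) with f; auto. apply locally_C. exact Hz.
Qed.

Theorem holomorphic_at_derive (f : C -> C) (a : C) : holomorphic_at f a -> holomorphic_at (C_derive f) a.
Proof.
intros H. apply holomorphic_at_sqbox in H. destruct H as [s [Hs Hf]].
set (x1 := fst a - s) in *. set (x2 := fst a + s) in *. set (y1 := snd a - s) in *. set (y2 := snd a + s) in *.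
assert (Ha : obox x1 x2 y1 y2 a) by (apply osqbox_center; auto).
assert (Cb : cont_on (bdry x1 x2 y1 y2) f) by (apply cont_bdry, holo_cont, Hf).
assert (N2 : (RtoC (2 * PI) * Ci)%C <> RtoC 0).
{ apply Cmult_neq_0; [|apply Ci_nz]. intros E. apply RtoC_inj in E. pose proof PI_RGT_0. lra. }
assert (E : forall w, obox x1 x2 y1 y2 w -> f w = (/ (RtoC (2 * PI) * Ci) * rect_int (fun t => f t * / (t - w)) x1 x2 y1 y2)%C).
{ intros w Hw. change (fun t => f t * / (t - w))%C with (fun t => f t / (t - w))%C.
  rewrite Cauchy_formula; auto. field. split; [apply Ci_nz|]. intros E. apply RtoC_inj in E. pose proof PI_RGT_0. lra. }
assert (D : forall w, obox x1 x2 y1 y2 w ->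
   C_derive f w = (/ (RtoC (2 * PI) * Ci) * rect_int (fun t => f t * (/ (t - w) * / (t - w))) x1 x2 y1 y2)%C).
{ intros w Hw. apply is_C_derive_unique.
  apply (is_derive_ext_loc (V := C_NormedModule)) with (fun w => / (RtoC (2 * PI) * Ci) * rect_int (fun t => f t * / (t - w)) x1 x2 y1 y2)%C.
  - apply locally_C. generalize (locally_obox _ _ _ _ _ Hw). apply filter_imp. intros u Hu. symmetry. apply E; auto.
  - apply CDer_scal. exact (proj1 (rect_int_Cauchy_derive f x1 x2 y1 y2 w Hw Cb)). }
apply holomorphic_at_ext with (fun w => / (RtoC (2 * PI) * Ci) * rect_int (fun t => f t * (/ (t - w) * / (t - w))) x1 x2 y1 y2)%C.
- generalize (locally_obox _ _ _ _ _ Ha). apply filter_imp. intros u Hu. symmetry. apply D; auto.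
- unfold holomorphic_at. generalize (locally_obox _ _ _ _ _ Ha). apply filter_imp. intros u Hu.
  eexists. apply CDer_scal. exact (proj2 (rect_int_Cauchy_derive f x1 x2 y1 y2 u Hu Cb)).
Qed.

(** * Primitives and the maximum principle *)

Lemma CInt_swap (f : R -> C) (a b : R) : ex_CInt f a b -> CInt f b a = (- CInt f a b)%C.
Proof. intros H. symmetry. exact (opp_RInt_swap (V := C_R_CompleteNormedModule) f a b H). Qed.

Lemma ex_CInt_cont' (f : R -> C) (a b : R) : (forall s, Rmin a b <= s <= Rmax a b -> Pcont f s) -> ex_CInt f a b.
Proof. apply (ex_RInt_continuous (V := C_R_CompleteNormedModule)). Qed.

Lemma CInt_near_const (f : R -> C) (a b e : R) (c : C) :
  (forall s, Rmin a b <= s <= Rmax a b -> Pcont f s /\ Cmod (f s - c) <= e) ->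
  Cmod (CInt f a b - RtoC (b - a) * c) <= e * Rabs (b - a).
Proof.
assert (KK : forall a b, a <= b -> (forall s, a <= s <= b -> Pcont f s /\ Cmod (f s - c) <= e) ->
  Cmod (CInt f a b - RtoC (b - a) * c) <= e * (b - a)).
{ clear a b. intros a b Hab H.
  assert (E : CInt (fun _ => c) a b = (RtoC (b - a) * c)%C).
  { rewrite (RInt_const (V := C_R_CompleteNormedModule)). apply scal_R_Cmult. }
  rewrite <- E, <- CInt_minus.
  - apply CInt_bound; auto.
    + apply ex_CInt_cont; auto. intros s Hs. apply continuous_Cminus; [apply H; auto|apply continuous_const].
    + intros s Hs; apply H; auto.
  - apply ex_CInt_cont; auto. intros; apply H; auto.
  - apply ex_CInt_cont; auto. intros; apply continuous_const. }
intros H. destruct (Rle_or_lt a b) as [Hab|Hab].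
- rewrite Rmin_left, Rmax_right in H by auto. rewrite Rabs_pos_eq by lra. apply KK; auto.
- rewrite Rmin_right, Rmax_left in H by lra. rewrite Rabs_left by lra.
  rewrite (CInt_swap f b a), <- Cmod_opp by (apply ex_CInt_cont; [lra|]; intros; apply H; auto).
  replace (- (- CInt f b a - RtoC (b - a) * c))%C with (CInt f b a - RtoC (a - b) * c)%C.
  2:{ rewrite !RtoC_minus. ring. }
  replace (- (b - a)) with (a - b) by ring. apply KK; auto. lra.
Qed.

Lemma rect_int_swap_x (f : C -> C) (x1 x2 y1 y2 : R) :
  ex_CInt (fun s => f (s, y1)) x1 x2 -> ex_CInt (fun s => f (s, y2)) x1 x2 ->
  rect_int f x2 x1 y1 y2 = (- rect_int f x1 x2 y1 y2)%C.
Proof.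
intros. unfold rect_int. rewrite (CInt_swap (fun s => f (s, y1)) x1 x2), (CInt_swap (fun s => f (s, y2)) x1 x2); auto. ring.
Qed.

Lemma rect_int_swap_y (f : C -> C) (x1 x2 y1 y2 : R) :
  ex_CInt (fun s => Ci * f (x1, s))%C y1 y2 -> ex_CInt (fun s => Ci * f (x2, s))%C y1 y2 ->
  rect_int f x1 x2 y2 y1 = (- rect_int f x1 x2 y1 y2)%C.
Proof.
intros. unfold rect_int. rewrite (CInt_swap (fun s => Ci * f (x1, s))%C y1 y2), (CInt_swap (fun s => Ci * f (x2, s))%C y1 y2); auto. ring.
Qed.

(** The primitive integrates from the center, horizontally and then vertically. Its increment
    differs from the integrals over two short segments near the end point by a rectangle integral,
    which vanishes; continuity of f does the rest. *)
Theorem primitive_obox (f : C -> C) (a b c d : R) : cont_on (obox a b c d) f ->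
  (forall x1 x2 y1 y2, a < x1 -> x1 <= x2 -> x2 < b -> c < y1 -> y1 <= y2 -> y2 < d -> rect_int f x1 x2 y1 y2 = RtoC 0) ->
  exists F : C -> C, forall z, obox a b c d z -> CDer F z (f z).
Proof.
intros Hf H0.
assert (MM : forall p q u v s, p < u < q -> p < v < q -> Rmin u v <= s <= Rmax u v -> p < s < q).
{ intros p q u v s Hu Hv Hs. unfold Rmin, Rmax in Hs. destruct (Rle_dec u v) in Hs; lra. }
assert (EH : forall t u v, c < t < d -> a < u < b -> a < v < b -> ex_CInt (fun s => f (s, t)) u v).
{ intros t u v Ht Hu Hv. apply ex_CInt_cont'. intros s Hs. apply Pcont_horizontal, Hf. split; auto. exact (MM a b u v s Hu Hv Hs). }
assert (EV : forall t u v, a < t < b -> c < u < d -> c < v < d -> ex_CInt (fun s => Ci * f (t, s))%C u v).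
{ intros t u v Ht Hu Hv. apply ex_CInt_cont'. intros s Hs. apply Pcont_vertical_Ci, Hf. split; auto. exact (MM c d u v s Hu Hv Hs). }
assert (H : forall x1 x2 y1 y2, a < x1 < b -> a < x2 < b -> c < y1 < d -> c < y2 < d -> rect_int f x1 x2 y1 y2 = RtoC 0).
{ intros x1 x2 y1 y2 X1 X2 Y1 Y2.
  assert (O : (- RtoC 0 = RtoC 0)%C) by ring.
  destruct (Rle_or_lt x1 x2), (Rle_or_lt y1 y2).
  - apply H0; lra.
  - rewrite rect_int_swap_y, H0, O; auto; lra.
  - rewrite rect_int_swap_x, H0, O; auto; lra.
  - rewrite rect_int_swap_x, rect_int_swap_y, H0, !O; auto; lra. }
clear H0.
set (x0 := (a + b) / 2). set (y0 := (c + d) / 2).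
exists (fun z => CInt (fun s => f (s, y0)) x0 (fst z) + CInt (fun s => Ci * f (fst z, s)) y0 (snd z))%C.
intros [x y] [Hx Hy]. cbn [fst snd] in Hx, Hy.
assert (Hx0 : a < x0 < b) by (unfold x0; lra). assert (Hy0 : c < y0 < d) by (unfold y0; lra).
apply is_derive_C_eps. intros e He.
assert (He2 : 0 < e / 2) by lra.
assert (Cz : Ccont f (x, y)) by (apply Hf; split; auto).
apply continuous_C_eps with (e := e / 2) in Cz; auto.
assert (Lo : locally (x, y) (obox a b c d)) by (apply locally_obox; split; auto).
generalize (filter_and _ _ Cz Lo). clear Cz Lo. intros L. apply locally_sqbox in L. destruct L as [r [Hr L]].
exists r. split; auto. intros [x' y'] Hw.
assert (D1 : Rabs (x' - x) <= Cmod ((x', y') - (x, y))) by apply (Rabs_fst_le ((x', y') - (x, y))).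
assert (D2 : Rabs (y' - y) <= Cmod ((x', y') - (x, y))) by apply (Rabs_snd_le ((x', y') - (x, y))).
assert (D1' := Rle_lt_trans _ _ _ D1 Hw). assert (D2' := Rle_lt_trans _ _ _ D2 Hw).
apply Rabs_def2 in D1'. apply Rabs_def2 in D2'.
assert (Hw' : obox a b c d (x', y')).
{ apply L. unfold sqbox. inbox. }
destruct Hw' as [Hx' Hy']. cbn [fst snd] in *.
rewrite (CInt_Chasles (fun s => f (s, y0)) x0 x x'), (CInt_Chasles (fun s => Ci * f (x', s))%C y0 y y'); auto.
assert (R0 := H x x' y0 y Hx Hx' Hy0 Hy). unfold rect_int in R0.
replace (CInt (fun s => f (s, y0)) x0 x + CInt (fun s => f (s, y0)) x x' + (CInt (fun s => Ci * f (x', s)) y0 y + CInt (fun s => Ci * f (x', s)) y y')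
  - (CInt (fun s => f (s, y0)) x0 x + CInt (fun s => Ci * f (x, s)) y0 y) - ((x', y') - (x, y)) * f (x, y))%C with
 ((CInt (fun s => f (s, y)) x x' - RtoC (x' - x) * f (x, y)) + (CInt (fun s => Ci * f (x', s)) y y' - RtoC (y' - y) * (Ci * f (x, y)))
  + (CInt (fun s => f (s, y0)) x x' + CInt (fun s => Ci * f (x', s)) y0 y - CInt (fun s => f (s, y)) x x' - CInt (fun s => Ci * f (x, s)) y0 y))%C.
2:{ assert (E : ((x', y') - (x, y))%C = (RtoC (x' - x) + RtoC (y' - y) * Ci)%C).
    { unfold Cminus, Cplus, Copp, Cmult, RtoC, Ci; simpl; f_equal; ring. }
    rewrite E. ring. }
rewrite R0, Cplus_0_r.
assert (MM2 : forall u v s, Rabs (v - u) < r -> Rmin u v <= s <= Rmax u v -> u - r <= s <= u + r).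
{ intros u v s Huv Hs. apply Rabs_def2 in Huv. unfold Rmin, Rmax in Hs. destruct (Rle_dec u v) in Hs; lra. }
eapply Rle_trans; [apply Cmod_triangle|].
apply Rle_trans with (e / 2 * Rabs (x' - x) + e / 2 * Rabs (y' - y)).
- apply Rplus_le_compat; apply CInt_near_const; intros s Hs; split.
  + apply Pcont_horizontal, Hf. split; auto. exact (MM a b x x' s Hx Hx' Hs).
  + left; apply L. unfold sqbox. assert (T := MM2 x x' s ltac:(apply Rabs_def1; lra) Hs). inbox.
  + apply Pcont_vertical_Ci, Hf. split; auto. exact (MM c d y y' s Hy Hy' Hs).
  + replace (Ci * f (x', s) - Ci * f (x, y))%C with (Ci * (f (x', s) - f (x, y)))%C by ring.
    rewrite Cmod_mult, Cmod_Ci, Rmult_1_l. left; apply L. unfold sqbox.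
    assert (T := MM2 y y' s ltac:(apply Rabs_def1; lra) Hs). inbox.
- apply Rmult_le_compat_l with (r := e / 2) in D1, D2; lra.
Qed.

Lemma obox_box (a b c d x1 x2 y1 y2 : R) (z : C) : a < x1 -> x2 < b -> c < y1 -> y2 < d ->
  box x1 x2 y1 y2 z -> obox a b c d z.
Proof. intros; inbox. Qed.

Lemma primitive_holo (f : C -> C) (a b c d : R) : holo_on (obox a b c d) f ->
  exists F : C -> C, forall z, obox a b c d z -> CDer F z (f z).
Proof.
intros Hf. apply primitive_obox; [apply holo_cont; auto|].
intros. apply Goursat; auto. intros z Hz. apply Hf. revert Hz. apply obox_box; auto.
Qed.

(** Morera's argument: the rectangle integrals of the difference quotient vanish, so it has a
    primitive, and the derivative of that holomorphic primitive is holomorphic, at [a] included. *)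
Theorem holomorphic_at_dquot (f : C -> C) (a : C) : holomorphic_at f a -> holomorphic_at (dquot f a) a.
Proof.
intros H. apply holomorphic_at_sqbox in H. destruct H as [s [Hs Hf]].
assert (Ha : osqbox a s a) by (apply osqbox_center; auto).
assert (Sub : forall z, osqbox a s z -> sqbox a s z) by (intros z Hz; unfold sqbox, osqbox in *; inbox).
destruct (primitive_obox (dquot f a) (fst a - s) (fst a + s) (snd a - s) (snd a + s)) as [F HF].
- apply dquot_cont_on; auto. intros z Hz. apply Hf, Sub, Hz.
- intros x1 x2 y1 y2 X1 X X2 Y1 Y Y2. apply rect_int_dquot; auto.
  intros z Hz. apply Hf, Sub. revert Hz. apply obox_box; auto.
- apply holomorphic_at_ext with (C_derive F).
  + generalize (locally_obox _ _ _ _ _ Ha). apply filter_imp. intros u Hu. apply is_C_derive_unique, HF, Hu.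
  + apply holomorphic_at_derive. unfold holomorphic_at. generalize (locally_obox _ _ _ _ _ Ha). apply filter_imp.
    intros u Hu. eexists. apply HF, Hu.
Qed.

Lemma holomorphic_at_dquot' (f : C -> C) (a z : C) : holomorphic_at f a -> holomorphic_at f z -> holomorphic_at (dquot f a) z.
Proof.
intros Ha Hz. destruct (Ceq_dec z a) as [->|N]; [apply holomorphic_at_dquot; auto|].
unfold holomorphic_at in *.
assert (L : locally z (fun w => w <> a)).
{ apply locally_C_Cmod. exists (Cmod (z - a)). split. { apply Cmod_gt_0. intros E. apply N, Ceq_minus, E. }
  intros w Hw ->. rewrite <- Cmod_opp in Hw. replace (- (a - z))%C with (z - a)%C in Hw by ring. lra. }
generalize (filter_and _ _ Hz L). apply filter_imp. intros w [[l Hl] Hw]. exact (dquot_off f a w l Hw Hl).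
Qed.

Lemma Cpow_CDer (f : C -> C) (z l : C) (n : nat) : CDer f z l -> exists m, CDer (fun w => f w ^ n)%C z m.
Proof.
intros H. induction n as [|n [m IH]].
- exists (RtoC 0). apply (CDer_const (RtoC 1)).
- eexists. exact (CDer_mult _ _ _ _ _ H IH).
Qed.

Lemma pow_bounded_le1 (x K : R) : 0 <= x -> (forall n, x ^ n <= K) -> x <= 1.
Proof.
intros Hx H. destruct (Rle_or_lt x 1) as [|H1]; auto. exfalso.
destruct (Pow_x_infinity x) with (b := K + 1) as [N HN]; [rewrite Rabs_pos_eq; lra|].
specialize (HN N (Nat.le_refl N)). specialize (H N).
rewrite Rabs_pos_eq in HN by (apply pow_le; auto). lra.
Qed.

(* Landau's trick: Cauchy's formula for [f ^ n] loses a constant independent of [n]. *)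
Theorem max_principle (f : C -> C) (x1 x2 y1 y2 M : R) (a : C) : obox x1 x2 y1 y2 a ->
  holo_on (box x1 x2 y1 y2) f -> (forall z, bdry x1 x2 y1 y2 z -> Cmod (f z) <= M) -> Cmod (f a) <= M.
Proof.
intros Ha Hf HM. assert (Hx : x1 <= x2) by inbox. assert (Hy : y1 <= y2) by inbox.
destruct (bdry_dist _ _ _ _ _ Ha) as [r [Hr [_ HD]]].
assert (Z0 : Cmod (a - a) < r) by (replace (a - a)%C with (RtoC 0) by ring; rewrite Cmod_0; auto).
assert (M0 : 0 <= M).
{ eapply Rle_trans; [apply Cmod_ge_0|]. apply (HM (x1, y1)). inbdry. }
assert (KK : forall M', 0 < M' -> M <= M' -> Cmod (f a) <= M').
{ intros M' HM' HMM.
  set (P := 2 * ((x2 - x1) + (y2 - y1))).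
  assert (HP : 0 <= P) by (unfold P; lra).
  assert (Pi := PI_RGT_0).
  assert (B : forall n, (Cmod (f a) / M') ^ n <= / r * P / (2 * PI)).
  { intros n.
    assert (Hn : holo_on (box x1 x2 y1 y2) (fun w => f w ^ n)%C).
    { intros z Hz. destruct (Hf z Hz) as [l Hl]. apply Cpow_CDer with (1 := Hl). }
    assert (E := Cauchy_formula _ _ _ _ _ _ Ha Hn). apply (f_equal Cmod) in E.
    rewrite !Cmod_mult, Cmod_Ci, Cmod_R, Rabs_pos_eq, Rmult_1_r, Cmod_pow in E by lra.
    assert (B : Cmod (rect_int (fun z => f z ^ n / (z - a))%C x1 x2 y1 y2) <= M' ^ n * / r * P).
    { apply rect_int_bound; auto.
      - intros z Hz. apply continuous_Cdiv.
        + apply (cont_bdry _ _ _ _ _ (holo_cont _ _ Hn)); auto.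
        + apply continuous_Cminus; [apply continuous_id|apply continuous_const].
        + apply bdry_neq with (1 := Ha); auto.
      - intros z Hz. unfold Cdiv. rewrite Cmod_mult, Cmod_pow.
        apply Rmult_le_compat; auto using Cmod_ge_0.
        + apply pow_le, Cmod_ge_0.
        + apply pow_incr. split; [apply Cmod_ge_0|]. specialize (HM z Hz). lra.
        + apply Cinv_pow_bound; auto. }
    rewrite E in B. unfold Rdiv. rewrite Rpow_mult_distr, pow_inv.
    assert (PM : 0 < M' ^ n) by (apply pow_lt; auto).
    apply Rmult_le_reg_r with (M' ^ n * (2 * PI)); [apply Rmult_lt_0_compat; lra|].
    replace (Cmod (f a) ^ n * / M' ^ n * (M' ^ n * (2 * PI))) with (2 * PI * Cmod (f a) ^ n) by (field; lra).
    replace (/ r * P * / (2 * PI) * (M' ^ n * (2 * PI))) with (M' ^ n * / r * P) by (field; lra). exact B. }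
  apply pow_bounded_le1 in B.
  - apply Rmult_le_compat_r with (r := M') in B; [|lra]. unfold Rdiv in B. rewrite Rmult_assoc, Rinv_l in B; lra.
  - apply Rdiv_le_0_compat; [apply Cmod_ge_0|auto]. }
apply Rnot_lt_le. intros HL. specialize (KK ((M + Cmod (f a)) / 2) ltac:(lra) ltac:(lra)). lra.
Qed.

(** * Factorization by zeros *)

(** Compactness gives the squares on which P holds a uniform margin. The gauge is half the usable
    size of a square, because a point outside the box is reached through a point of the box, at the
    cost of a second gauge. *)
Lemma box_enlarge (P : C -> Prop) (x1 x2 y1 y2 : R) : x1 <= x2 -> y1 <= y2 ->
  (forall z, box x1 x2 y1 y2 z -> locally z P) ->
  exists e, 0 < e /\ forall z, obox (x1 - e) (x2 + e) (y1 - e) (y2 + e) z -> P z.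
Proof.
intros Hx12 Hy12 H.
assert (HD : forall u v, exists s : posreal, box x1 x2 y1 y2 (u, v) -> forall z, sqbox (u, v) (2 * s) z -> P z).
{ intros u v. destruct (classic (box x1 x2 y1 y2 (u, v))) as [B|B].
  - specialize (H _ B). apply locally_sqbox in H. destruct H as [s [Hs H]].
    assert (Hs2 : 0 < s / 2) by lra. exists (mkposreal _ Hs2). intros _ z Hz. apply H. simpl in Hz.
    replace (2 * (s / 2)) with s in Hz by field. exact Hz.
  - exists (mkposreal 1 Rlt_0_1). intros B'; contradiction. }
set (dl := fun u v => proj1_sig (constructive_indefinite_description _ (HD u v))).
destruct (compactness_value_2d x1 x2 y1 y2 dl) as [d Hd].
exists d. split; [apply cond_pos|]. intros [x y] [Hx Hy]. cbn [fst snd] in *.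
assert (PJ : forall p q t, p <= q -> p - d < t < q + d -> exists s, p <= s <= q /\ Rabs (t - s) < d).
{ intros p q t Hpq Ht. destruct (Rlt_le_dec t p); [exists p; split; [lra|apply Rabs_def1; lra]|].
  destruct (Rlt_le_dec q t); [exists q; split; [lra|apply Rabs_def1; lra]|].
  exists t; split; [lra|]. rewrite Rminus_diag, Rabs_R0. apply cond_pos. }
destruct (PJ x1 x2 x Hx12 Hx) as [x' [Hx' Dx]]. destruct (PJ y1 y2 y Hy12 Hy) as [y' [Hy' Dy]].
specialize (Hd x' y' Hx' Hy'). apply NNPP in Hd. destruct Hd as [u [v [Hu [Hv [Du [Dv Hle]]]]]].
unfold dl in *. destruct (constructive_indefinite_description _ (HD u v)) as [s Hs]; simpl in *.
apply Hs; [split; auto|]. apply Rabs_def2 in Dx. apply Rabs_def2 in Dy. apply Rabs_def2 in Du. apply Rabs_def2 in Dv.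
unfold sqbox. inbox.
Qed.

(* Zeros are handled as lists with repetitions: [f = prodz l * g] with [g] zero-free where it matters. *)
Fixpoint prodz (l : list C) (z : C) : C :=
  match l with nil => RtoC 1 | a :: l' => ((z - a) * prodz l' z)%C end.

Lemma prodz_root (l : list C) (a : C) : In a l -> prodz l a = RtoC 0.
Proof.
induction l as [|b l IH]; [intros []|]. intros [->|H]; simpl; [ring|rewrite IH by auto; ring].
Qed.

Lemma prodz_neq0 (l : list C) (a : C) : ~ In a l -> prodz l a <> RtoC 0.
Proof.
induction l as [|b l IH]; simpl; intros H; [apply C1_nz|]. apply Cmult_neq_0; [|tauto].
intros E. apply Ceq_minus in E. subst; tauto.
Qed.

Lemma prodz_CDer (l : list C) (z : C) : exists m, CDer (prodz l) z m.
Proof.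
induction l as [|a l [m IH]]; simpl.
- exists (RtoC 0). apply (CDer_const (RtoC 1)).
- eexists. apply (CDer_mult (fun w => w - a)%C (prodz l)); [|exact IH]. apply CDer_minus; [apply CDer_id|apply CDer_const].
Qed.

Lemma prodz_ratio (l : list C) (st : C -> C) (c : R) (z : C) : 0 <= c ->
  (forall a, In a l -> c * Cmod (z - a) <= Cmod (z - st a)) ->
  c ^ length l * Cmod (prodz l z) <= Cmod (prodz (map st l) z).
Proof.
intros Hc. induction l as [|a l IH]; intros H; simpl; [lra|]. rewrite !Cmod_mult.
replace (c * c ^ length l * (Cmod (z - a) * Cmod (prodz l z))) with ((c * Cmod (z - a)) * (c ^ length l * Cmod (prodz l z))) by ring.
apply Rmult_le_compat.
- apply Rmult_le_pos; auto using Cmod_ge_0.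
- apply Rmult_le_pos; [apply pow_le; auto|apply Cmod_ge_0].
- apply H; left; auto.
- apply IH. intros; apply H; right; auto.
Qed.

Lemma prodz_ratio' (l : list C) (st : C -> C) (c : R) (z : C) : 0 <= c ->
  (forall a, In a l -> Cmod (z - st a) <= c * Cmod (z - a)) ->
  Cmod (prodz (map st l) z) <= c ^ length l * Cmod (prodz l z).
Proof.
intros Hc. induction l as [|a l IH]; intros H; simpl; [lra|]. rewrite !Cmod_mult.
replace (c * c ^ length l * (Cmod (z - a) * Cmod (prodz l z))) with ((c * Cmod (z - a)) * (c ^ length l * Cmod (prodz l z))) by ring.
apply Rmult_le_compat; auto using Cmod_ge_0.
- apply H; left; auto.
- apply IH. intros; apply H; right; auto.
Qed.

Definition holo_lower (f : C -> C) : Prop := forall z : C, snd z <= 0 -> holomorphic_at f z.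

Lemma holo_lower_box (f : C -> C) (x1 x2 y1 y2 : R) : holo_lower f -> y2 <= 0 -> holo_on (box x1 x2 y1 y2) f.
Proof. intros H Hy z Hz. apply holomorphic_at_ex, H. inbox. Qed.

Lemma cont_neq0_locally (f : C -> C) (z : C) : Ccont f z -> f z <> RtoC 0 -> locally z (fun w => f w <> RtoC 0).
Proof.
intros Hf Hz. apply Cmod_gt_0 in Hz. generalize (proj1 (continuous_C_eps f z) Hf _ Hz). apply filter_imp.
intros w Hw E. rewrite E in Hw. replace (RtoC 0 - f z)%C with (- f z)%C in Hw by ring. rewrite Cmod_opp in Hw. lra.
Qed.

Lemma Cmod_sqr (z : C) : Cmod z * Cmod z = fst z * fst z + snd z * snd z.
Proof. assert (E := Cmod2_alt z). unfold Re, Im in E. lra. Qed.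

Lemma Cmod_le_of_sqr (z w : C) (c : R) : 0 <= c -> fst z * fst z + snd z * snd z <= c * c * (fst w * fst w + snd w * snd w) ->
  Cmod z <= c * Cmod w.
Proof.
intros Hc H. rewrite <- !Cmod_sqr in H. apply Rsqr_incr_0; unfold Rsqr.
- lra.
- apply Cmod_ge_0.
- apply Rmult_le_pos; auto using Cmod_ge_0.
Qed.

(* Divide [f] by the Blaschke factors [(z - a) / (z - st a)] of the half-plane [Im z < - d], where [st] is the
   reflection in its boundary; on a rectangle with three remote sides they are almost unimodular. *)
Lemma zeros_bounded (f : C -> C) (x1 x2 y1 : R) : holo_lower f -> (forall s : R, f (RtoC s) <> RtoC 0) ->
  x1 <= x2 -> y1 <= 0 ->
  exists N : nat, forall (l : list C) (g : C -> C), (forall a, In a l -> box x1 x2 y1 0 a) -> holo_lower g ->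
    (forall z, f z = (prodz l z * g z)%C) -> (length l <= N)%nat.
Proof.
intros Hf Hreal Hx Hy1.
destruct (box_enlarge (fun z => f z <> RtoC 0) x1 x2 0 0) as [e [He NZ]]; auto; [lra| |].
{ intros [a b] [Ha Hb]; cbn [fst snd] in *. replace b with 0 by lra.
  apply cont_neq0_locally; [|apply Hreal]. destruct (holomorphic_at_ex f (a, 0)) as [l Hl]; [apply Hf; simpl; lra|].
  apply CDer_continuous with (1 := Hl). }
(* The zeros of the box lie at depth at least 3d, the reflecting line is at depth d, and the test
   point [p] at depth 2d, where f does not vanish. *)
set (d := e / 3). assert (Hd : 0 < d) by (unfold d; lra).
set (Y := Rmax 1 (- y1)). assert (HY1 : 1 <= Y) by apply Rmax_l. assert (HY2 : - y1 <= Y) by apply Rmax_r.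
set (D := (x2 - x1) * (x2 - x1) + Y * Y). assert (HD : 1 <= D) by (unfold D; nra).
(* At [p] each ratio |z - st a| / |z - a| is at least 1 + h, because |p - st a|^2 exceeds |p - a|^2,
   itself at most [D], by at least 8 d^2. *)
set (h := Rmin 1 (8 * (d * d) / (3 * D))).
assert (Hh : 0 < h) by (apply Rmin_glb_lt; [lra|]; apply Rdiv_lt_0_compat; nra).
assert (Hh1 : h <= 1) by apply Rmin_l.
assert (Hh2 : 3 * h * D <= 8 * (d * d)).
{ apply Rle_trans with (3 * (8 * (d * d) / (3 * D)) * D); [|right; field; lra].
  apply Rmult_le_compat_r; [lra|]. apply Rmult_le_compat_l; [lra|apply Rmin_r]. }
(* At distance [B] from the zeros the same ratio is at most 1 + h / 2; on the side at depth d it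
   equals 1. By the maximum principle [lam ^ length l] is then bounded by M / |f p|. *)
set (B := 4 * Y / h + 2 * d). assert (HB : 4 * Y <= h * B).
{ unfold B. replace (h * (4 * Y / h + 2 * d)) with (4 * Y + h * (2 * d)) by (field; lra). nra. }
assert (HB0 : 2 * d < B). { unfold B. assert (0 < 4 * Y / h) by (apply Rdiv_lt_0_compat; lra). lra. }
set (p := (x1, - (2 * d)) : C).
assert (Hp : f p <> RtoC 0) by (apply NZ; unfold p, d; inbox).
assert (Hobox : obox (x1 - B) (x2 + B) (- (Y + B)) (- d) p) by (unfold p; inbox).
destruct (bdry_bounded f (x1 - B) (x2 + B) (- (Y + B)) (- d)) as [M [HM HMb]]; try lra.
{ apply cont_bdry, holo_cont, holo_lower_box; auto; lra. }
set (lam := (1 + h) / (1 + h / 2)).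
assert (Hlam : 1 < lam).
{ unfold lam. apply Rmult_lt_reg_r with (1 + h / 2); [lra|]. unfold Rdiv. rewrite Rmult_assoc, Rinv_l; lra. }
apply Cmod_gt_0 in Hp.
destruct (Pow_x_infinity lam) with (b := M / Cmod (f p) + 1) as [N HN]; [rewrite Rabs_pos_eq; lra|].
exists N. intros l g Hl Hg E. apply Nat.nlt_ge. intros HlN.
specialize (HN (length l) ltac:(lia)). rewrite Rabs_pos_eq in HN by (apply pow_le; lra).
assert (Ha : forall a, In a l -> x1 <= fst a <= x2 /\ - Y <= snd a <= - (3 * d)).
{ intros a Ha. destruct (Hl a Ha) as [Ha1 Ha2]. split; auto. split; [lra|].
  apply Rnot_lt_le. intros HL. apply (NZ a); [unfold d in *; inbox|]. rewrite E, prodz_root by auto. ring. }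
set (st := fun a : C => (fst a, - (2 * d) - snd a) : C).
set (k := fun z => (prodz (map st l) z * g z)%C).
assert (Hk : holo_on (box (x1 - B) (x2 + B) (- (Y + B)) (- d)) k).
{ intros z Hz. destruct (prodz_CDer (map st l) z) as [m1 H1]. destruct (holomorphic_at_ex g z) as [m2 H2]; [apply Hg; inbox|].
  eexists. exact (CDer_mult _ _ _ _ _ H1 H2). }
assert (Up : Cmod (k p) <= (1 + h / 2) ^ length l * M).
{ apply max_principle with (1 := Hobox); auto. intros z Hz. unfold k. rewrite Cmod_mult.
  apply Rle_trans with ((1 + h / 2) ^ length l * Cmod (f z)).
  2:{ apply Rmult_le_compat_l; [apply pow_le; lra|auto]. }
  rewrite E, Cmod_mult, <- Rmult_assoc. apply Rmult_le_compat_r; [apply Cmod_ge_0|].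
  apply prodz_ratio'; [lra|]. intros a Hal. destruct (Ha a Hal) as [A1 A2].
  destruct Hz as [[Z1 Z2] Hz]. destruct z as [u v]. destruct a as [s t]. cbn [fst snd] in *.
  assert (FAR : B <= Cmod ((u, v) - (s, t)) -> Cmod ((u, v) - st (s, t)) <= (1 + h / 2) * Cmod ((u, v) - (s, t))).
  { intros FB. replace ((u, v) - st (s, t))%C with (((u, v) - (s, t)) + RtoC (2 * (t + d)) * Ci)%C.
    2:{ unfold st, Cminus, Cplus, Copp, Cmult, RtoC, Ci; simpl; f_equal; ring. }
    eapply Rle_trans; [apply Cmod_triangle|]. rewrite Cmod_mult, Cmod_R, Cmod_Ci, Rabs_left by lra.
    assert (h * B <= h * Cmod ((u, v) - (s, t))) by (apply Rmult_le_compat_l; lra). lra. }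
  assert (F1 := Rabs_fst_le ((u, v) - (s, t))%C). assert (F2 := Rabs_snd_le ((u, v) - (s, t))%C).
  change (fst ((u, v) - (s, t))%C) with (u - s) in F1. change (snd ((u, v) - (s, t))%C) with (v - t) in F2.
  destruct Hz as [->|[->|[->| ->]]].
  - apply FAR. eapply Rle_trans; [|exact F1]. rewrite Rabs_left; lra.
  - apply FAR. eapply Rle_trans; [|exact F1]. rewrite Rabs_pos_eq; lra.
  - apply FAR. eapply Rle_trans; [|exact F2]. rewrite Rabs_left; lra.
  - apply Rle_trans with (1 * Cmod ((u, - d) - (s, t))); [|apply Rmult_le_compat_r; [apply Cmod_ge_0|lra]].
    apply Cmod_le_of_sqr; [lra|]. simpl. right; ring. }
assert (Lo : (1 + h) ^ length l * Cmod (f p) <= Cmod (k p)).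
{ unfold k. rewrite E, !Cmod_mult, <- Rmult_assoc. apply Rmult_le_compat_r; [apply Cmod_ge_0|].
  apply prodz_ratio; [lra|]. intros a Hal. destruct (Ha a Hal) as [A1 A2]. destruct a as [s t]. cbn [fst snd] in *.
  rewrite <- (Rmult_1_l (Cmod (p - st (s, t)))).
  replace (1 + h) with (/ / (1 + h)) by (field; lra).
  apply Rmult_le_reg_l with (/ (1 + h)); [apply Rinv_0_lt_compat; lra|].
  rewrite <- Rmult_assoc, Rinv_r, Rmult_1_l, Rmult_1_l by (apply Rinv_neq_0_compat; lra).
  apply Cmod_le_of_sqr; [left; apply Rinv_0_lt_compat; lra|].
  unfold p, st; simpl.
  apply Rmult_le_reg_l with ((1 + h) * (1 + h)); [nra|].
  replace ((1 + h) * (1 + h) * (/ (1 + h) * / (1 + h) * ((x1 + - s) * (x1 + - s) + (- (2 * d) + - (- (2 * d) - t)) * (- (2 * d) + - (- (2 * d) - t)))))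
    with ((x1 - s) * (x1 - s) + t * t) by (field; lra).
  assert (DD : (x1 + - s) * (x1 + - s) + (- (2 * d) + - t) * (- (2 * d) + - t) <= D).
  { unfold D. assert ((x1 + - s) * (x1 + - s) <= (x2 - x1) * (x2 - x1)) by nra.
    assert ((- (2 * d) + - t) * (- (2 * d) + - t) <= Y * Y) by nra. lra. }
  set (Q := (x1 + - s) * (x1 + - s) + (- (2 * d) + - t) * (- (2 * d) + - t)) in *.
  assert (Q0 : 0 <= Q) by (unfold Q; nra).
  assert (EQ : (x1 - s) * (x1 - s) + t * t = Q + 4 * d * (- t - d)) by (unfold Q; ring).
  rewrite EQ. assert (8 * (d * d) <= 4 * d * (- t - d)) by nra.
  assert ((1 + h) * (1 + h) * Q <= (1 + 3 * h) * Q) by (apply Rmult_le_compat_r; nra).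
  assert (3 * h * Q <= 3 * h * D) by (apply Rmult_le_compat_l; lra). lra. }
assert (KK : lam ^ length l * Cmod (f p) <= M).
{ unfold lam, Rdiv. rewrite Rpow_mult_distr, pow_inv.
  assert (0 < (1 + h * / 2) ^ length l) by (apply pow_lt; lra).
  apply Rmult_le_reg_l with ((1 + h * / 2) ^ length l); auto.
  replace ((1 + h * / 2) ^ length l * ((1 + h) ^ length l * / (1 + h * / 2) ^ length l * Cmod (f p))) with ((1 + h) ^ length l * Cmod (f p)) by (field; lra).
  unfold Rdiv in Up. lra. }
apply Rge_le in HN. apply Rmult_le_compat_r with (r := Cmod (f p)) in HN; [|lra].
replace ((M / Cmod (f p) + 1) * Cmod (f p)) with (M + Cmod (f p)) in HN by (field; lra). lra.
Qed.

(** Zeros are divided out one at a time by [dquot]. By [zeros_bounded] this must stop, and it can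
    only stop at a cofactor without zeros in the box. *)
Theorem zero_factorization (f : C -> C) (x1 x2 y1 : R) : holo_lower f -> (forall s : R, f (RtoC s) <> RtoC 0) ->
  x1 <= x2 -> y1 <= 0 ->
  exists (l : list C) (g : C -> C), (forall a, In a l -> box x1 x2 y1 0 a) /\ holo_lower g /\
    (forall z, f z = (prodz l z * g z)%C) /\ (forall z, box x1 x2 y1 0 z -> g z <> RtoC 0).
Proof.
intros Hf Hreal Hx Hy. destruct (zeros_bounded f x1 x2 y1 Hf Hreal Hx Hy) as [N HN].
apply NNPP. intros NE.
assert (KK : forall n, exists (l : list C) (g : C -> C), length l = n /\ (forall a, In a l -> box x1 x2 y1 0 a) /\ holo_lower g /\
    (forall z, f z = (prodz l z * g z)%C)).
{ induction n as [|n [l [g [Hn [Hl [Hg E]]]]]].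
  - exists nil, f. repeat split; auto; try (intros; contradiction). intros z; simpl; ring.
  - assert (Z : exists a, box x1 x2 y1 0 a /\ g a = RtoC 0).
    { apply NNPP. intros NZ. apply NE. exists l, g. repeat split; try apply Hl; auto. intros z Hz Ez. apply NZ. exists z; auto. }
    destruct Z as [a [Ha Za]]. exists (a :: l), (dquot g a).
    split; [simpl; congruence|]. split; [intros b [<-|Hb]; auto|]. split.
    + intros z Hz. apply holomorphic_at_dquot'; apply Hg; auto. inbox.
    + intros z. rewrite E. simpl. assert (Dq := dquot_mul g a z). rewrite Za in Dq.
      replace (g z) with (g z - RtoC 0)%C by ring. rewrite Dq. ring. }
destruct (KK (S N)) as [l [g [Hn [Hl [Hg E]]]]]. specialize (HN l g Hl Hg E). lia.
Qed.

(** * Counting zeros with multiplicity *)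

Definition indic (P : Prop) : R := if excluded_middle_informative P then 1 else 0.

Lemma indic_true (P : Prop) : P -> indic P = 1.
Proof. intros H. unfold indic. destruct excluded_middle_informative; tauto. Qed.

Lemma indic_false (P : Prop) : ~ P -> indic P = 0.
Proof. intros H. unfold indic. destruct excluded_middle_informative; tauto. Qed.

Lemma indic_bounds (P : Prop) : 0 <= indic P <= 1.
Proof. unfold indic. destruct excluded_middle_informative; lra. Qed.

Fixpoint sumR (phi : C -> R) (l : list C) : R :=
  match l with nil => 0 | a :: l' => phi a + sumR phi l' end.

Lemma sumR_le (phi psi : C -> R) (l : list C) : (forall a, In a l -> phi a <= psi a) -> sumR phi l <= sumR psi l.
Proof.
induction l as [|a l IH]; simpl; intros H; [lra|]. apply Rplus_le_compat; auto.
Qed.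

Lemma sumR_ext (phi psi : C -> R) (l : list C) : (forall a, In a l -> phi a = psi a) -> sumR phi l = sumR psi l.
Proof. induction l as [|a l IH]; simpl; intros H; auto. rewrite (H a), IH; auto. Qed.

Lemma sumR_plus (phi psi : C -> R) (l : list C) : sumR (fun a => phi a + psi a) l = sumR phi l + sumR psi l.
Proof. induction l as [|a l IH]; simpl; [lra|]. rewrite IH. ring. Qed.

Lemma sumR_scal (c : R) (phi : C -> R) (l : list C) : sumR (fun a => c * phi a) l = c * sumR phi l.
Proof. induction l as [|a l IH]; simpl; [lra|]. rewrite IH. ring. Qed.

Lemma sumR_nonneg (phi : C -> R) (l : list C) : (forall a, In a l -> 0 <= phi a) -> 0 <= sumR phi l.
Proof. induction l as [|a l IH]; simpl; intros H; [lra|]. apply Rplus_le_le_0_compat; auto. Qed.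

Lemma sum_count_occ (l zs : list C) : NoDup zs ->
  INR (list_sum (map (count_occ Ceq_dec l) zs)) = sumR (fun a => indic (In a zs)) l.
Proof.
intros Hz. induction l as [|a l IH].
- simpl. induction zs as [|z zs IHz]; simpl; auto. apply IHz. inversion Hz; auto.
- simpl sumR. rewrite <- IH. clear IH. induction zs as [|z zs IHz].
  + simpl. rewrite indic_false by tauto. lra.
  + inversion Hz as [|z' zs' Hn Hz']; subst. specialize (IHz Hz').
    cbn [map list_sum fold_right]. change (fold_right Nat.add 0%nat) with list_sum. rewrite !plus_INR, IHz.
    assert (E : INR (count_occ Ceq_dec (a :: l) z) + indic (In a zs) = indic (In a (z :: zs)) + INR (count_occ Ceq_dec l z)).
    { simpl. destruct (Ceq_dec a z) as [->|N].
      - rewrite S_INR, (indic_false (In z zs)), (indic_true (z = z \/ In z zs)) by auto. ring.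
      - destruct (classic (In a zs)) as [K|K].
        + rewrite !indic_true by auto. ring.
        + rewrite !indic_false by (auto; intros [?|?]; auto). ring. }
    lra.
Qed.

Lemma prodz_split (l : list C) (a z : C) :
  prodz l z = ((z - a) ^ count_occ Ceq_dec l a * prodz (remove Ceq_dec a l) z)%C.
Proof.
induction l as [|b l IH]; [simpl; ring|]. cbn [prodz count_occ remove].
destruct (Ceq_dec b a) as [->|N], (Ceq_dec a a) as [_|N']; try congruence.
- rewrite IH. cbn [Cpow]. ring.
- destruct (Ceq_dec a b) as [E|_]; [congruence|]. cbn [prodz]. rewrite IH. ring.
Qed.

Lemma holomorphic_at_mult (f g : C -> C) (z : C) : holomorphic_at f z -> holomorphic_at g z ->
  holomorphic_at (fun w => f w * g w)%C z.
Proof.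
intros Hf Hg. unfold holomorphic_at in *. generalize (filter_and _ _ Hf Hg). apply filter_imp.
intros w [[l Hl] [m Hm]]. eexists. exact (CDer_mult f g w l m Hl Hm).
Qed.

Lemma holomorphic_at_prodz (l : list C) (z : C) : holomorphic_at (prodz l) z.
Proof. unfold holomorphic_at. apply filter_forall. intros w. apply prodz_CDer. Qed.

Lemma holomorphic_at_cont (f : C -> C) (z : C) : holomorphic_at f z -> Ccont f z.
Proof. intros H. destruct (holomorphic_at_ex f z H) as [l Hl]. apply CDer_continuous with (1 := Hl). Qed.

(** If m < n, cancelling (w - z)^m shows that [g] equals (w - z)^(n - m) h away from z, and
    continuity forces [g z] to vanish. *)
Lemma zero_order_le (f : C -> C) (z : C) (m n : nat) : zero_order f z m -> zero_order f z n -> (n <= m)%nat.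
Proof.
intros [g [Hg [Ng Eg]]] [h [Hh [Nh Eh]]]. apply Nat.nlt_ge. intros Hmn. apply Ng.
set (k := fun w => (g w - (w - z) ^ (n - m) * h w)%C).
assert (Ck : Ccont k z).
{ apply continuous_Cminus; [apply holomorphic_at_cont; auto|]. apply continuous_Cmult; [|apply holomorphic_at_cont; auto].
  destruct (Cpow_CDer (fun w => w - z)%C z (RtoC 1 - RtoC 0)%C (n - m)) as [l Hl].
  - apply CDer_minus; [apply CDer_id|apply CDer_const].
  - apply CDer_continuous with (1 := Hl). }
assert (E0 : k z = g z).
{ unfold k. replace (n - m)%nat with (S (n - m - 1)) by lia. simpl. ring. }
rewrite <- E0. apply NNPP. intros Nk. apply cont_neq0_locally in Nk; auto.
assert (L := filter_and _ _ Nk (filter_and _ _ Eg Eh)). apply locally_sqbox in L. destruct L as [s [Hs L]].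
set (w := (fst z + s, snd z) : C).
destruct (L w) as [L1 [L2 L3]]. { unfold sqbox, w. inbox. }
apply L1. unfold k.
assert (Nw : (w - z)%C <> RtoC 0).
{ intros E. apply (f_equal fst) in E. unfold w in E. simpl in E. lra. }
rewrite L2 in L3. replace n with (m + (n - m))%nat in L3 by lia. rewrite Cpow_add_r in L3.
apply (f_equal (fun c => / ((w - z) ^ m) * c)%C) in L3.
assert (Np : ((w - z) ^ m)%C <> RtoC 0) by (apply Cpow_nz; auto).
replace (/ (w - z) ^ m * ((w - z) ^ m * g w))%C with (g w) in L3 by (field; auto).
rewrite L3. field. auto.
Qed.

Lemma zero_order_unique (f : C -> C) (z : C) (m n : nat) : zero_order f z m -> zero_order f z n -> m = n.
Proof. intros H1 H2. apply Nat.le_antisymm; eapply zero_order_le; eassumption. Qed.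

Lemma zero_order_count (f g : C -> C) (l : list C) (z : C) : holomorphic_at g z -> g z <> RtoC 0 ->
  (forall w, f w = (prodz l w * g w)%C) -> zero_order f z (count_occ Ceq_dec l z).
Proof.
intros Hg Nz E. exists (fun w => prodz (remove Ceq_dec z l) w * g w)%C. split; [|split].
- apply holomorphic_at_mult; auto. apply holomorphic_at_prodz.
- apply Cmult_neq_0; auto. apply prodz_neq0, remove_In.
- apply filter_forall. intros w. rewrite E, (prodz_split l z w). ring.
Qed.

Theorem zero_count_list (f g : C -> C) (l : list C) (t r : R) :
  (forall z, in_region t r z -> holomorphic_at g z /\ g z <> RtoC 0) ->
  (forall w, f w = (prodz l w * g w)%C) ->
  zero_count f t r = Finite (sumR (fun z => indic (in_region t r z)) l).
Proof.
intros Hg E. apply is_lub_Rbar_unique. split.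
- intros x [s [ND [Hs ->]]]. simpl.
  assert (Es : map snd s = map (count_occ Ceq_dec l) (map fst s)).
  { rewrite map_map. apply map_ext_in. intros [z m] Hzm. simpl. destruct (Hs z m Hzm) as [H1 [_ H3]].
    apply (zero_order_unique f z); auto. apply zero_order_count with g; auto; apply Hg; auto. }
  rewrite Es, sum_count_occ by auto. apply sumR_le. intros a Ha.
  destruct (classic (In a (map fst s))) as [K|K].
  + rewrite !indic_true; auto; [lra|]. apply in_map_iff in K. destruct K as [[z m] [<- K]]. apply (Hs z m K).
  + rewrite indic_false by auto. apply indic_bounds.
- intros b Hb. apply Hb.
  set (P := fun z => if excluded_middle_informative (in_region t r z) then true else false).
  set (zs := nodup Ceq_dec (filter P l)).
  assert (Hzs : forall z, In z zs <-> In z l /\ in_region t r z).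
  { intros z. unfold zs. rewrite nodup_In, filter_In. unfold P. destruct excluded_middle_informative; intuition discriminate. }
  exists (map (fun z => (z, count_occ Ceq_dec l z)) zs). split; [|split].
  + rewrite map_map. simpl. rewrite map_id. apply NoDup_nodup.
  + intros z m H. apply in_map_iff in H. destruct H as [z' [H1 H2]]. inversion H1; subst. apply Hzs in H2. destruct H2 as [H2 H3].
    split; auto. split.
    * rewrite E, prodz_root by auto. ring.
    * apply zero_order_count with g; auto; apply Hg; auto.
  + rewrite map_map. simpl. rewrite sum_count_occ by apply NoDup_nodup. apply sumR_ext. intros a Ha.
    unfold indic. destruct excluded_middle_informative as [K|K], excluded_middle_informative as [K'|K']; auto; exfalso.
    * apply K', Hzs; auto.
    * apply K, Hzs, K'.
Qed.

Lemma sumR_filter (phi : C -> R) (l : list C) :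
  sumR phi l = sumR phi (filter (fun z => if Req_EM_T (phi z) 0 then false else true) l).
Proof.
induction l as [|a l IH]; simpl; auto. destruct Req_EM_T as [E|E]; simpl; rewrite IH; lra.
Qed.

Lemma sumR_Permutation (phi : C -> R) (l l' : list C) : Permutation l l' -> sumR phi l = sumR phi l'.
Proof. induction 1; simpl; lra. Qed.

(** Wherever [phi] does not vanish, the multiplicities in both lists are orders of zeros of f, so
    the filtered lists are permutations of each other. Sums over zeros can thus be computed from the
    factorization on any sufficiently large box. *)
Lemma sumR_zeros_indep (f g g' : C -> C) (l l' : list C) (phi : C -> R) :
  (forall w, f w = (prodz l w * g w)%C) -> (forall w, f w = (prodz l' w * g' w)%C) ->
  (forall z, phi z <> 0 -> holomorphic_at g z /\ g z <> RtoC 0 /\ holomorphic_at g' z /\ g' z <> RtoC 0) ->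
  sumR phi l = sumR phi l'.
Proof.
intros E E' H. rewrite (sumR_filter phi l), (sumR_filter phi l'). apply sumR_Permutation.
apply (Permutation_count_occ Ceq_dec). intros z.
set (b := fun z => if Req_EM_T (phi z) 0 then false else true).
assert (F : forall k, count_occ Ceq_dec (filter b k) z = if b z then count_occ Ceq_dec k z else 0%nat).
{ induction k as [|a k IH]; simpl; [destruct (b z); auto|].
  destruct (b a) eqn:Ba; simpl; destruct (Ceq_dec a z) as [->|N]; rewrite ?IH, ?Ba; auto. }
rewrite !F. unfold b. destruct Req_EM_T as [Ez|Nz]; auto. destruct (H z Nz) as [H1 [H2 [H3 H4]]].
apply (zero_order_unique f z); [apply zero_order_count with g|apply zero_order_count with g']; auto.
Qed.

(** * Growth near the real axis *)

Definition ldiff (f : C -> C) (z : C) : C := (C_derive f z / f z)%C.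

Lemma is_derive_half_ln (p q : R -> R) (x a b : R) : is_derive p x a -> is_derive q x b -> 0 < p x * p x + q x * q x ->
  is_derive (fun s => / 2 * ln (p s * p s + q s * q s)) x ((a * p x + b * q x) / (p x * p x + q x * q x)).
Proof.
intros H1 H2 Q. auto_derive.
- repeat split; try (eexists; eassumption). exact Q.
- change (Derive (fun s => p s) x) with (Derive p x). change (Derive (fun s => q s) x) with (Derive q x).
  rewrite (is_derive_unique _ _ _ H1), (is_derive_unique _ _ _ H2). field. lra.
Qed.

Lemma is_derive_ln_Cmod (p : R -> C) (x : R) (m : C) : PDer p x m -> p x <> RtoC 0 ->
  is_derive (fun s => ln (Cmod (p s))) x (fst (m / p x)%C).
Proof.
intros Hp Hx. assert (H1 := PDer_fst p x m Hp). assert (H2 := PDer_snd p x m Hp).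
assert (E := Cmod_sqr (p x)). assert (P := proj1 (Cmod_gt_0 (p x)) Hx).
assert (Q : 0 < fst (p x) * fst (p x) + snd (p x) * snd (p x)) by nra.
apply is_derive_ext with (fun s => / 2 * ln (fst (p s) * fst (p s) + snd (p s) * snd (p s))).
- intros s. rewrite <- Cmod_sqr. pose proof (Cmod_ge_0 (p s)) as [H|H].
  + rewrite ln_mult by auto. simpl. lra.
  (* At a zero of [p] both sides reduce to [ln 0], whose default value is 0. *)
  + rewrite <- H, Rmult_0_r. unfold ln. destruct (Rlt_dec 0 0) as [T|T]; [exfalso; lra|simpl; ring].
- replace (fst (m / p x)%C) with ((fst m * fst (p x) + snd m * snd (p x)) / (fst (p x) * fst (p x) + snd (p x) * snd (p x))).
  2:{ destruct m as [a b], (p x) as [c d]. unfold Cdiv, Cmult, Cinv. cbn [fst snd] in *.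
      field. replace (c ^ 2 + d ^ 2) with (c * c + d * d) by ring. lra. }
  apply (is_derive_half_ln (fun s => fst (p s)) (fun s => snd (p s))); auto.
Qed.

Lemma continuous_ldiff (f : C -> C) (z : C) : holomorphic_at f z -> f z <> RtoC 0 -> Ccont (ldiff f) z.
Proof.
intros Hf Hz. apply continuous_Cdiv; auto; apply holomorphic_at_cont; auto. apply holomorphic_at_derive; auto.
Qed.

Lemma CDer_holo (f : C -> C) (z : C) : holomorphic_at f z -> CDer f z (C_derive f z).
Proof. intros H. destruct (holomorphic_at_ex f z H) as [l Hl]. rewrite (is_C_derive_unique f z l Hl). exact Hl. Qed.

Lemma PDer_RtoC (x : R) : PDer RtoC x (RtoC 1).
Proof. exact (PDer_horizontal 0 x). Qed.

Lemma Pcont_RtoC (g : C -> C) (x : R) : Ccont g (RtoC x) -> Pcont (fun s => g (RtoC s)) x.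
Proof. exact (Pcont_horizontal g x 0). Qed.

Lemma is_derive_ln_real (f : C -> C) (x : R) : holo_lower f -> f (RtoC x) <> RtoC 0 ->
  is_derive (fun s => ln (Cmod (f (RtoC s)))) x (fst (ldiff f (RtoC x))).
Proof.
intros Hf Hx. unfold ldiff.
replace (C_derive f (RtoC x) / f (RtoC x))%C with ((RtoC 1 * C_derive f (RtoC x)) / f (RtoC x))%C by (f_equal; ring).
apply (is_derive_ln_Cmod (fun s => f (RtoC s))); auto.
apply PDer_comp; [|apply PDer_RtoC]. apply CDer_holo, Hf. simpl; lra.
Qed.

(** Its real part is the variation of ln |f| from 0 to x, its imaginary part that of arg f, obtained
    without choosing a branch. *)
Definition ldiff_int (f : C -> C) (x : R) : C := CInt (fun s => ldiff f (RtoC s)) 0 x.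

Lemma ldiff_int_ex (f : C -> C) (x : R) : holo_lower f -> (forall s : R, f (RtoC s) <> RtoC 0) ->
  ex_CInt (fun s => ldiff f (RtoC s)) 0 x.
Proof.
intros Hf Hn. apply ex_CInt_cont'. intros s _. apply Pcont_RtoC, continuous_ldiff; auto. apply Hf; simpl; lra.
Qed.

Lemma ln_Lint (f : C -> C) (x : R) : holo_lower f -> (forall s : R, f (RtoC s) <> RtoC 0) ->
  ln (Cmod (f (RtoC x))) = ln (Cmod (f (RtoC 0))) + fst (ldiff_int f x).
Proof.
intros Hf Hn.
assert (H1 : is_RInt (fun s => fst (ldiff f (RtoC s))) 0 x (ln (Cmod (f (RtoC x))) - ln (Cmod (f (RtoC 0))))).
{ apply (is_RInt_derive (V := R_CompleteNormedModule) (fun s => ln (Cmod (f (RtoC s))))); intros s _.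
  - apply is_derive_ln_real; auto.
  - apply continuous_fst_C, Pcont_RtoC, continuous_ldiff; auto. apply Hf; simpl; lra. }
assert (H2 : is_RInt (fun s => fst (ldiff f (RtoC s))) 0 x (fst (ldiff_int f x))).
{ apply (is_RInt_fct_extend_fst (U := R_NormedModule) (V := R_NormedModule)).
  exact (RInt_correct (V := C_R_CompleteNormedModule) _ _ _ (ldiff_int_ex f x Hf Hn)). }
apply (is_RInt_unique (V := R_CompleteNormedModule)) in H1. apply (is_RInt_unique (V := R_CompleteNormedModule)) in H2. lra.
Qed.

Lemma ldiff_int_derive (f : C -> C) (x : R) : holo_lower f -> (forall s : R, f (RtoC s) <> RtoC 0) ->
  is_derive (fun s => snd (ldiff_int f s)) x (snd (ldiff f (RtoC x))).
Proof.
intros Hf Hn. apply PDer_snd.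
apply (is_derive_RInt (V := C_R_NormedModule) (fun s => ldiff f (RtoC s)) (ldiff_int f) 0 x).
- apply filter_forall. intros y. exact (RInt_correct (V := C_R_CompleteNormedModule) _ _ _ (ldiff_int_ex f y Hf Hn)).
- apply Pcont_RtoC, continuous_ldiff; auto. apply Hf; simpl; lra.
Qed.

Lemma class_F_holo (rho : nat) (f : C -> C) : class_F rho f -> holo_lower f /\ (forall s : R, f (RtoC s) <> RtoC 0).
Proof. intros [_ [H1 [_ [H2 _]]]]. split; auto. Qed.

Lemma exp_mono (x y : R) : x <= y -> exp x <= exp y.
Proof. intros [H| ->]; [left; apply exp_increasing; auto|lra]. Qed.

Lemma pow_ge1 (x : R) (n : nat) : 1 <= x -> 1 <= x ^ n.
Proof. intros H. apply pow_R1_Rle; auto. Qed.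

(** The order rho is written [S k], so that rho - 1 is [k]. The two estimates come from the real and
    imaginary parts of [ldiff_int]; the constant ln |f 0| is absorbed since x >= 1. *)
Lemma growth_real (k : nat) (f : C -> C) : class_F (S k) f ->
  exists A : R, 0 < A /\ exists x0, 1 <= x0 /\ forall x, x0 <= x ->
    Rabs (ln (Cmod (f (RtoC x)))) <= A * x ^ k /\ Rabs (snd (ldiff_int f x)) <= A * x ^ k.
Proof.
intros HF. destruct (class_F_holo _ _ HF) as [Hf Hn]. destruct HF as [_ [_ [_ [_ [_ [M [r0 HM]]]]]]].
set (c := Rabs (ln (Cmod (f (RtoC 0))))). assert (Hc : 0 <= c) by apply Rabs_pos.
exists (Rabs M + c + 1). pose proof (Rabs_pos M). split; [lra|].
exists (Rmax 1 r0). split; [apply Rmax_l|]. intros x Hx.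
pose proof (Rmax_l 1 r0). pose proof (Rmax_r 1 r0).
specialize (HM x). rewrite Rabs_pos_eq in HM by lra. specialize (HM ltac:(lra)).
change (Cmod (ldiff_int f x) <= M * x ^ (S k - 1)) in HM.
rewrite Nat.sub_succ, Nat.sub_0_r in HM.
assert (P := pow_ge1 x k ltac:(lra)).
assert (HM2 : M * x ^ k <= Rabs M * x ^ k) by (apply Rmult_le_compat_r; [lra|apply Rle_abs]).
split.
- rewrite ln_Lint by auto. eapply Rle_trans; [apply Rabs_triang|]. fold c.
  pose proof (Rabs_fst_le (ldiff_int f x)). nra.
- pose proof (Rabs_snd_le (ldiff_int f x)). nra.
Qed.

Lemma Cmod_exp_mult (c z : C) : Cmod (c * Cexp z) = Cmod c * exp (fst z).
Proof. rewrite Cmod_mult, Cmod_Cexp. reflexivity. Qed.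

(* The quadratic polynomial [P] has nonnegative real part on the top side of the square and real part at least 1 on
   the other sides, so that [exp (- B * P)] absorbs the growth of [f] there. *)
Theorem growth_strip (k : nat) (f : C -> C) : class_F (S k) f ->
  exists A : R, 0 < A /\ exists x0, 1 <= x0 /\ forall x y, x0 <= x -> 0 <= y < x / 2 ->
    Cmod (f (x, - y)) <= exp (A * x ^ k * (1 + y)).
Proof.
intros HF. destruct (class_F_holo _ _ HF) as [Hf Hn]. destruct (growth_real k f HF) as [A1 [HA1 [x1 [Hx1 H1]]]].
destruct HF as [_ [_ [[K [M [R0 HT]]] _]]].
set (B0 := (Rabs K + Rabs M) * 2 ^ S k).
assert (P2 := pow_ge1 2 (S k) ltac:(lra)). assert (P2k := pow_ge1 2 k ltac:(lra)).
pose proof (Rabs_pos K) as PK. pose proof (Rabs_pos M) as PM.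
assert (HB0 : 0 <= B0) by (unfold B0; nra).
exists (A1 * 2 ^ k + 4 * B0). split; [nra|].
exists (2 * Rmax x1 (Rabs R0 + 1)). pose proof (Rmax_l x1 (Rabs R0 + 1)). pose proof (Rmax_r x1 (Rabs R0 + 1)).
split; [lra|]. intros x y Hx Hy.
assert (X1 : x1 <= x / 2) by lra. assert (X2 : R0 < x / 2) by (pose proof (Rle_abs R0); lra).
set (X := x / 2) in *. set (B := B0 * x ^ S k).
assert (Px := pow_ge1 x (S k) ltac:(lra)). assert (Pxk := pow_ge1 x k ltac:(lra)).
assert (HB : 0 <= B) by (unfold B; nra).
assert (top : forall s, X <= s <= x + X -> Cmod (f (RtoC s)) <= exp (A1 * 2 ^ k * x ^ k)).
{ intros s Hs. destruct (H1 s ltac:(lra)) as [T _]. apply Rabs_le_between in T. destruct T as [_ T].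
  assert (Q := proj1 (Cmod_gt_0 _) (Hn s)). rewrite <- (exp_ln (Cmod (f (RtoC s)))) by auto.
  apply exp_mono. eapply Rle_trans; [exact T|]. rewrite Rmult_assoc, <- Rpow_mult_distr. apply Rmult_le_compat_l; [lra|].
  apply pow_incr. unfold X in *; lra. }
destruct (Rle_lt_or_eq_dec 0 y (proj1 Hy)) as [Hy0|<-].
2:{ rewrite Ropp_0. eapply Rle_trans; [apply top; unfold X; lra|]. apply exp_mono. rewrite Rplus_0_r, Rmult_1_r.
    apply Rmult_le_compat_r; nra. }
assert (side : forall z, box (x - X) (x + X) (- X) 0 z -> Cmod (f z) <= exp B).
{ intros z [Z1 Z2].
  assert (Zu : Cmod z <= 2 * x).
  { eapply Rle_trans; [apply Cmod_le_sum|]. rewrite (Rabs_pos_eq (fst z)), (Rabs_left1 (snd z)); unfold X in *; lra. }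
  assert (Zl : R0 < Cmod z).
  { eapply Rlt_le_trans; [exact X2|]. eapply Rle_trans; [|apply Rabs_fst_le]. rewrite Rabs_pos_eq; unfold X in *; lra. }
  eapply Rle_trans; [apply (HT z Zl); unfold Im; lra|].
  assert (E1 : M <= exp (Rabs M)).
  { pose proof (exp_ineq1_le (Rabs M)). pose proof (Rle_abs M). lra. }
  apply Rle_trans with (exp (Rabs M) * exp (K * Cmod z ^ S k)).
  { apply Rmult_le_compat_r; [left; apply exp_pos|auto]. }
  rewrite <- exp_plus. apply exp_mono. unfold B, B0.
  assert (Pz : 0 <= Cmod z ^ S k <= 2 ^ S k * x ^ S k).
  { split; [apply pow_le, Cmod_ge_0|]. rewrite <- Rpow_mult_distr. apply pow_incr; split; [apply Cmod_ge_0|auto]. }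
  assert (K * Cmod z ^ S k <= Rabs K * (2 ^ S k * x ^ S k)).
  { apply Rle_trans with (Rabs K * Cmod z ^ S k).
    - apply Rmult_le_compat_r; [apply Pz|apply Rle_abs].
    - apply Rmult_le_compat_l; [auto|apply Pz]. }
  assert (Rabs M * 1 <= Rabs M * (2 ^ S k * x ^ S k)).
  { apply Rmult_le_compat_l; auto. replace 1 with (1 * 1) by ring. apply Rmult_le_compat; lra. }
  lra. }
set (P := fun z : C => (RtoC (- B / (X * X)) * ((z - RtoC x) * (z - RtoC x) + RtoC (2 * X) * Ci * (z - RtoC x)))%C).
assert (RP : forall u v, fst (P (u, v)) = - B * (((u - x) * (u - x) - v * v - 2 * X * v) / (X * X))).
{ intros u v. unfold P. simpl. field. unfold X; lra. }
assert (XX : 0 < X * X) by (unfold X; nra).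
assert (DP : forall z, exists l, CDer P z l).
{ intros z. unfold P. eexists. apply CDer_scal, CDer_plus.
  - apply CDer_mult; (apply CDer_minus; [apply CDer_id|apply CDer_const]).
  - apply CDer_scal, CDer_minus; [apply CDer_id|apply CDer_const]. }
assert (Mx : Cmod (f (x, - y) * Cexp (P (x, - y))) <= exp (A1 * 2 ^ k * x ^ k)).
{ apply (max_principle (fun z => f z * Cexp (P z))%C (x - X) (x + X) (- X) 0).
  - inbox.
  - intros z Hz. destruct (holomorphic_at_ex f z) as [l Hl]; [apply Hf; inbox|].
    destruct (DP z) as [m Hm]. eexists. apply CDer_mult; [exact Hl|].
    exact (CDer_comp Cexp P z _ m (CDer_Cexp _) Hm).
  - intros [u v] [Hz Hz']. rewrite Cmod_exp_mult, RP. assert (Sd := side _ Hz). destruct Hz as [Z1 Z2]. cbn [fst snd] in *.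
    (* The numerator is (u - x)^2 - v (v + 2 X), a sum of two nonnegative terms: the first equals
       X^2 on the vertical sides, the second on the bottom one. *)
    assert (One : 1 <= ((u - x) * (u - x) - v * v - 2 * X * v) / (X * X) \/ v = 0).
    { assert (V : 0 <= - v * (v + 2 * X)) by (apply Rmult_le_pos; lra). pose proof (Rle_0_sqr (u - x)) as U. unfold Rsqr in U.
      destruct Hz' as [->|[->|[->| ->]]]; auto; left; apply Rmult_le_reg_r with (X * X); auto;
        unfold Rdiv; rewrite Rmult_assoc, Rinv_l, Rmult_1_r by lra; lra. }
    destruct One as [One| ->].
    + apply Rle_trans with (exp B * exp (- B)).
      * apply Rmult_le_compat; auto using Cmod_ge_0. left; apply exp_pos. apply exp_mono. nra.
      * rewrite <- exp_plus, Rplus_opp_r. apply exp_mono. repeat apply Rmult_le_pos; lra.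
    + rewrite <- (Rmult_1_r (exp (A1 * 2 ^ k * x ^ k))). apply Rmult_le_compat; auto using Cmod_ge_0.
      * left; apply exp_pos.
      * apply (top u). unfold X in *; lra.
      * rewrite <- exp_0. apply exp_mono.
        assert (Q : 0 <= ((u - x) * (u - x) - 0 * 0 - 2 * X * 0) / (X * X)).
        { apply Rdiv_le_0_compat; auto. pose proof (Rle_0_sqr (u - x)) as U. unfold Rsqr in U. lra. }
        pose proof (Rmult_le_pos _ _ HB Q). lra. }
rewrite Cmod_exp_mult, RP in Mx.
set (T := - B * _) in Mx.
(* The barrier is at least B, of order x^(k+1), on the remote sides, but at depth y below x it is
   only O(B y / x): this brings the exponent down from k + 1 to k. *)
assert (HTT : - T <= 4 * B0 * x ^ k * y).
{ unfold T, B. replace (x ^ S k) with (X * 2 * x ^ k) by (unfold X; simpl; field).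
  replace (- (- (B0 * (X * 2 * x ^ k)) * (((x - x) * (x - x) - - y * - y - 2 * X * - y) / (X * X))))
    with (4 * B0 * x ^ k * y - 2 * B0 * x ^ k * y * y * / X) by (field; unfold X; lra).
  assert (0 <= 2 * B0 * x ^ k * y * y * / X).
  { clearbody B0. apply Rdiv_le_0_compat; [repeat apply Rmult_le_pos; lra|unfold X; lra]. }
  lra. }
apply Rmult_le_reg_r with (exp T); [apply exp_pos|]. eapply Rle_trans; [exact Mx|].
rewrite <- exp_plus. apply exp_mono. clearbody T B0.
assert (0 <= A1 * 2 ^ k * x ^ k * y) by (repeat apply Rmult_le_pos; lra).
assert (0 <= 4 * B0 * x ^ k) by (repeat apply Rmult_le_pos; lra). lra.
Qed.

(** * The coordinates straightening a logarithmic curve *)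

(** The conformal map straightening the curve [Im z = - t ln |z|] to the real axis. *)
Definition wmap (t : R) (z : C) : C := (z + RtoC t * Ci * Clog z)%C.

Lemma wmap_fst (t : R) (z : C) : fst (wmap t z) = fst z - t * Arg z.
Proof. unfold wmap, Clog. simpl. ring. Qed.

Lemma wmap_snd (t : R) (z : C) : snd (wmap t z) = snd z + t * ln (Cmod z).
Proof. unfold wmap, Clog. simpl. ring. Qed.

Lemma Clog_lipschitz (m : R) (z1 z2 : C) : 0 < m -> m <= fst z1 -> m <= fst z2 ->
  Cmod (Clog z1 - Clog z2) <= / m * Cmod (z1 - z2).
Proof.
intros Hm H1 H2.
assert (S : forall s, 0 <= s <= 1 -> m <= fst (z2 + RtoC s * (z1 - z2))%C).
{ intros s Hs. replace (fst (z2 + RtoC s * (z1 - z2))%C) with ((1 - s) * fst z2 + s * fst z1) by (simpl; ring). nra. }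
assert (N : forall z : C, m <= fst z -> z <> RtoC 0).
{ intros z Hz E. rewrite E in Hz. simpl in Hz. lra. }
assert (CP : forall s, 0 <= s <= 1 -> Pcont (fun s => (z1 - z2) * / (z2 + RtoC s * (z1 - z2)))%C s).
{ intros s Hs. apply continuous_Cmult; [apply continuous_const|]. apply continuous_Cinv.
  - apply PDer_continuous with (1 := PDer_affine z2 (z1 - z2)%C s).
  - apply N, S, Hs. }
assert (I : is_CInt (fun s => (z1 - z2) * / (z2 + RtoC s * (z1 - z2)))%C 0 1
   (Clog (z2 + RtoC 1 * (z1 - z2)) - Clog (z2 + RtoC 0 * (z1 - z2)))%C).
{ apply (path_FTC Clog Cinv (fun s => z2 + RtoC s * (z1 - z2))%C (fun _ => (z1 - z2)%C)); [lra|].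
  intros s Hs. split; [|split; [apply PDer_affine|split; [|apply continuous_const]]].
  - apply CDer_Clog. left. specialize (S s Hs). lra.
  - apply continuous_Cinv; [|apply N, S, Hs]. apply PDer_continuous with (1 := PDer_affine z2 (z1 - z2)%C s). }
replace (z2 + RtoC 1 * (z1 - z2))%C with z1 in I by ring.
replace (z2 + RtoC 0 * (z1 - z2))%C with z2 in I by ring.
rewrite <- (CInt_unique _ _ _ _ I).
eapply Rle_trans; [apply CInt_bound with (M := / m * Cmod (z1 - z2))|lra]; [lra| |].
- apply ex_CInt_cont; [lra|exact CP].
- intros s Hs. rewrite Cmod_mult, Rmult_comm. apply Rmult_le_compat_r; [apply Cmod_ge_0|].
  apply Cinv_pow_bound; auto. eapply Rle_trans; [apply S; exact Hs|]. eapply Rle_trans; [apply Rle_abs|apply Rabs_fst_le].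
Qed.

(** On Re z >= 2 t + 1 the derivative of t log z has modulus at most 1 / 2, so that [wmap t] is the
    identity plus a contraction. *)
Definition zmin (t : R) : R := 2 * t + 1.
(** As |Arg z| <= 2 in the right half-plane, Re w >= 4 t + 1 leaves Re w + t Arg z, the real part of
    w - i t log z, above [zmin t]. *)
Definition umin (t : R) : R := 4 * t + 1.

Lemma Clog_contract (t : R) (z1 z2 : C) : 0 <= t -> zmin t <= fst z1 -> zmin t <= fst z2 ->
  Cmod (RtoC t * Ci * Clog z1 - RtoC t * Ci * Clog z2) <= / 2 * Cmod (z1 - z2).
Proof.
intros Ht H1 H2. unfold zmin in *.
replace (RtoC t * Ci * Clog z1 - RtoC t * Ci * Clog z2)%C with (RtoC t * Ci * (Clog z1 - Clog z2))%C by ring.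
rewrite !Cmod_mult, Cmod_R, Cmod_Ci, Rabs_pos_eq, Rmult_1_r by auto.
assert (L := Clog_lipschitz (2 * t + 1) z1 z2 ltac:(lra) H1 H2).
apply Rle_trans with (t * (/ (2 * t + 1) * Cmod (z1 - z2))); [apply Rmult_le_compat_l; auto|].
rewrite <- Rmult_assoc. apply Rmult_le_compat_r; [apply Cmod_ge_0|].
apply Rmult_le_reg_r with (2 * t + 1); [lra|]. rewrite Rmult_assoc, Rinv_l; lra.
Qed.

Lemma wmap_expand (t : R) (z1 z2 : C) : 0 <= t -> zmin t <= fst z1 -> zmin t <= fst z2 ->
  Cmod (wmap t z1 - wmap t z2 - (z1 - z2)) <= / 2 * Cmod (z1 - z2).
Proof.
intros Ht H1 H2. eapply Rle_trans; [|apply (Clog_contract t z1 z2 Ht H1 H2)]. right. f_equal. unfold wmap. ring.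
Qed.

Lemma wmap_lower (t : R) (z1 z2 : C) : 0 <= t -> zmin t <= fst z1 -> zmin t <= fst z2 ->
  Cmod (z1 - z2) <= 2 * Cmod (wmap t z1 - wmap t z2).
Proof.
intros Ht H1 H2. assert (E := wmap_expand t z1 z2 Ht H1 H2).
assert (T := Cmod_triangle (wmap t z1 - wmap t z2) (- (wmap t z1 - wmap t z2 - (z1 - z2)))%C).
rewrite Cmod_opp in T.
replace (wmap t z1 - wmap t z2 + - (wmap t z1 - wmap t z2 - (z1 - z2)))%C with (z1 - z2)%C in T by ring. lra.
Qed.

Lemma geometric_limit (a : nat -> R) (D : R) : 0 <= D -> (forall n, Rabs (a (S n) - a n) <= D * (/ 2) ^ n) ->
  exists l, forall n, Rabs (a n - l) <= 2 * D * (/ 2) ^ n.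
Proof.
intros HD H.
assert (Hs : forall n, - (D * (/ 2) ^ n) <= a (S n) - a n <= D * (/ 2) ^ n) by (intros; apply Rabs_le_between, H).
assert (P : forall n, 0 <= D * (/ 2) ^ n) by (intros; apply Rmult_le_pos; [auto|apply pow_le; lra]).
assert (Dec : forall n k, a (n + k)%nat + 2 * D * (/ 2) ^ (n + k) <= a n + 2 * D * (/ 2) ^ n).
{ intros n k. induction k as [|k IH]; [rewrite Nat.add_0_r; lra|]. rewrite Nat.add_succ_r. simpl.
  specialize (Hs (n + k)%nat). lra. }
destruct (ex_finite_lim_seq_incr (fun n => a n - 2 * D * (/ 2) ^ n) (a 0%nat + 2 * D)) as [l Hl].
- intros n. simpl. specialize (Hs n). lra.
- intros n. specialize (Dec 0%nat n). specialize (P n). simpl in Dec. lra.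
- exists l. intros n. apply Rabs_le. split.
  + enough (l <= a n + 2 * D * (/ 2) ^ n) by lra.
    apply (is_lim_seq_le (fun k => a (k + n)%nat - 2 * D * (/ 2) ^ (k + n)) (fun _ => a n + 2 * D * (/ 2) ^ n) l (a n + 2 * D * (/ 2) ^ n)).
    * intros k. specialize (Dec n k). rewrite (Nat.add_comm n k) in Dec. specialize (P (k + n)%nat). lra.
    * apply (is_lim_seq_incr_n (fun n => a n - 2 * D * (/ 2) ^ n) n l), Hl.
    * apply is_lim_seq_const.
  + enough (a n - 2 * D * (/ 2) ^ n <= l) by lra.
    apply (is_lim_seq_incr_compare (fun n => a n - 2 * D * (/ 2) ^ n) l Hl).
    intros k. simpl. specialize (Hs k). lra.
Qed.

Lemma Arg_right' (z : C) : 0 < fst z -> - 2 <= Arg z <= 2.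
Proof.
intros H. assert (A := Arg_right z ltac:(lra) ltac:(left; auto)). assert (P := PI_4). lra.
Qed.

Lemma half_pow_small (D e : R) : 0 < e -> exists n, D * (/ 2) ^ n < e.
Proof.
intros He. destruct (pow_lt_1_zero (/ 2)) with (y := e / (Rabs D + 1)) as [n Hn].
- rewrite Rabs_pos_eq; lra.
- apply Rdiv_lt_0_compat; auto. pose proof (Rabs_pos D); lra.
- exists n. specialize (Hn n (Nat.le_refl n)). pose proof (Rabs_pos D).
  assert (Q : 0 < (/ 2) ^ n) by (apply pow_lt; lra). rewrite (Rabs_pos_eq ((/ 2) ^ n)) in Hn by lra.
  apply Rle_lt_trans with (Rabs D * (/ 2) ^ n); [apply Rmult_le_compat_r; [lra|apply Rle_abs]|].
  apply Rmult_lt_compat_l with (r := Rabs D + 1) in Hn; [|lra].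
  replace ((Rabs D + 1) * (e / (Rabs D + 1))) with e in Hn by (field; lra). lra.
Qed.

(** Banach iteration for the equation z = w - i t log z, a contraction of ratio 1 / 2 on Re z >=
    [zmin t]. The limit is taken coordinate by coordinate. *)
Lemma wmap_surj (t : R) (w : C) : 0 <= t -> umin t <= fst w -> exists z, zmin t <= fst z /\ wmap t z = w.
Proof.
intros Ht Hw.
set (Phi := fun z => (w - RtoC t * Ci * Clog z)%C).
assert (HP : forall z, zmin t <= fst z -> zmin t <= fst (Phi z)).
{ intros z Hz. unfold zmin, umin in *. replace (fst (Phi z)) with (fst w + t * Arg z) by (unfold Phi, Clog; simpl; ring).
  assert (A := Arg_right' z ltac:(lra)). nra. }
set (s := nat_rect (fun _ => C) w (fun _ z => Phi z)).
assert (Hs : forall n, zmin t <= fst (s n)).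
{ induction n; [unfold zmin, umin in *; simpl; lra|]. apply HP; auto. }
assert (HD : forall n, Cmod (s (S n) - s n) <= Cmod (s 1%nat - s 0%nat) * (/ 2) ^ n).
{ induction n; [simpl pow; lra|].
  replace (s (S (S n)) - s (S n))%C with (- (RtoC t * Ci * Clog (s (S n)) - RtoC t * Ci * Clog (s n)))%C.
  2:{ change (s (S (S n))) with (Phi (s (S n))). change (s (S n)) with (Phi (s n)) at 3. unfold Phi. ring. }
  rewrite Cmod_opp. eapply Rle_trans; [apply Clog_contract; auto|]. simpl pow. lra. }
set (D := Cmod (s 1%nat - s 0%nat)) in *. assert (D0 : 0 <= D) by apply Cmod_ge_0.
destruct (geometric_limit (fun n => fst (s n)) D D0) as [x Hx].
{ intros n. eapply Rle_trans; [|apply HD]. apply (Rabs_fst_le (s (S n) - s n)). }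
destruct (geometric_limit (fun n => snd (s n)) D D0) as [y Hy].
{ intros n. eapply Rle_trans; [|apply HD]. apply (Rabs_snd_le (s (S n) - s n)). }
set (z := (x, y) : C).
assert (Hz : forall n, Cmod (s n - z) <= 4 * D * (/ 2) ^ n).
{ intros n. eapply Rle_trans; [apply Cmod_le_sum|]. specialize (Hx n). specialize (Hy n).
  change (fst (s n - z)%C) with (fst (s n) - x). change (snd (s n - z)%C) with (snd (s n) - y). lra. }
assert (Bz : zmin t <= fst z).
{ apply Rnot_lt_le. intros HL. destruct (half_pow_small (2 * D) (zmin t - fst z)) as [n Hn]; [lra|].
  specialize (Hx n). specialize (Hs n). apply Rabs_le_between in Hx. simpl in *. lra. }
exists z. split; auto.
assert (E : Phi z = z).
{ apply Ceq_minus, Cmod_eq_0. apply Rle_antisym; [|apply Cmod_ge_0]. apply Rnot_lt_le. intros HL.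
  destruct (half_pow_small (8 * D) (Cmod (Phi z - z))) as [n Hn]; auto.
  replace (Phi z - z)%C with ((RtoC t * Ci * Clog (s n) - RtoC t * Ci * Clog z) + (s (S n) - z))%C in Hn.
  2:{ change (s (S n)) with (Phi (s n)). unfold Phi. ring. }
  assert (T := Cmod_triangle (RtoC t * Ci * Clog (s n) - RtoC t * Ci * Clog z) (s (S n) - z)).
  assert (T2 := Clog_contract t (s n) z Ht (Hs n) Bz). assert (T3 := Hz n). assert (T4 := Hz (S n)). simpl pow in T4.
  assert (0 <= D * (/ 2) ^ n) by (apply Rmult_le_pos; [auto|apply pow_le; lra]). lra. }
unfold wmap. replace z with (Phi z) at 1 by auto. unfold Phi. ring.
Qed.

(** The inverse of [wmap t] on Re w >= [umin t]; elsewhere nothing is asserted about its value. *)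
Definition Zmap (t : R) (w : C) : C := epsilon (inhabits w) (fun z => zmin t <= fst z /\ wmap t z = w).

Lemma Zmap_spec (t : R) (w : C) : 0 <= t -> umin t <= fst w -> zmin t <= fst (Zmap t w) /\ wmap t (Zmap t w) = w.
Proof. intros Ht Hw. apply (epsilon_spec (inhabits w) (fun z => zmin t <= fst z /\ wmap t z = w)), wmap_surj; auto. Qed.

Lemma Zmap_wmap (t : R) (z : C) : 0 <= t -> zmin t <= fst z -> umin t <= fst (wmap t z) -> Zmap t (wmap t z) = z.
Proof.
intros Ht Hz Hw. destruct (Zmap_spec t (wmap t z) Ht Hw) as [H1 H2].
assert (L := wmap_lower t _ _ Ht H1 Hz). rewrite H2 in L.
replace (wmap t z - wmap t z)%C with (RtoC 0) in L by ring. rewrite Cmod_0 in L.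
apply Ceq_minus, Cmod_eq_0. pose proof (Cmod_ge_0 (Zmap t (wmap t z) - z)). lra.
Qed.

Lemma Zmap_lipschitz (t : R) (w1 w2 : C) : 0 <= t -> umin t <= fst w1 -> umin t <= fst w2 ->
  Cmod (Zmap t w1 - Zmap t w2) <= 2 * Cmod (w1 - w2).
Proof.
intros Ht H1 H2. destruct (Zmap_spec t w1 Ht H1) as [A1 B1]. destruct (Zmap_spec t w2 Ht H2) as [A2 B2].
assert (L := wmap_lower t _ _ Ht A1 A2). rewrite B1, B2 in L. exact L.
Qed.

Lemma CDer_wmap (t : R) (z : C) : slit z -> CDer (wmap t) z (RtoC 1 + RtoC t * Ci * / z)%C.
Proof.
intros H. apply (CDer_plus (fun w => w)); [apply CDer_id|]. apply CDer_scal, CDer_Clog, H.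
Qed.

Definition dZmap (t : R) (w : C) : C := (/ (RtoC 1 + RtoC t * Ci * / Zmap t w))%C.

Lemma wmap_der_neq0 (t : R) (z : C) : 0 <= t -> zmin t <= fst z -> / 2 <= Cmod (RtoC 1 + RtoC t * Ci * / z).
Proof.
intros Ht Hz. unfold zmin in Hz.
assert (N : Cmod (RtoC t * Ci * / z) <= / 2).
{ rewrite !Cmod_mult, Cmod_R, Cmod_Ci, Rabs_pos_eq, Rmult_1_r by auto.
  assert (B := Cinv_pow_bound z (2 * t + 1) ltac:(lra) ltac:(eapply Rle_trans; [|apply Rabs_fst_le]; eapply Rle_trans; [exact Hz|apply Rle_abs])).
  apply Rle_trans with (t * / (2 * t + 1)); [apply Rmult_le_compat_l; auto|].
  apply Rmult_le_reg_r with (2 * t + 1); [lra|]. rewrite Rmult_assoc, Rinv_l; lra. }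
assert (T := Cmod_triangle (RtoC 1 + RtoC t * Ci * / z) (- (RtoC t * Ci * / z))).
rewrite Cmod_opp in T. replace (RtoC 1 + RtoC t * Ci * / z + - (RtoC t * Ci * / z))%C with (RtoC 1) in T by ring.
rewrite Cmod_1 in T. lra.
Qed.

Lemma Zmap_cont (t : R) (w : C) : 0 <= t -> umin t < fst w -> Ccont (Zmap t) w.
Proof.
intros Ht Hw. apply continuous_C_eps. intros e He. apply locally_C_Cmod.
exists (Rmin (fst w - umin t) (e / 2)). split; [apply Rmin_glb_lt; lra|]. intros w' Hw'.
assert (W1 := Rlt_le_trans _ _ _ Hw' (Rmin_l _ _)). assert (W2 := Rlt_le_trans _ _ _ Hw' (Rmin_r _ _)).
assert (F := Rabs_fst_le (w' - w)). change (fst (w' - w)%C) with (fst w' - fst w) in F.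
apply Rle_lt_trans with (2 := W1) in F. apply Rabs_def2 in F.
assert (L := Zmap_lipschitz t w' w Ht ltac:(lra) ltac:(lra)). lra.
Qed.

Lemma CDer_Zmap (t : R) (w : C) : 0 <= t -> umin t < fst w -> CDer (Zmap t) w (dZmap t w).
Proof.
intros Ht Hw. destruct (Zmap_spec t w Ht (Rlt_le _ _ Hw)) as [Hz Ez].
assert (N := wmap_der_neq0 t _ Ht Hz). unfold dZmap.
assert (Dw := CDer_wmap t (Zmap t w) ltac:(left; unfold zmin in Hz; lra)).
set (z := Zmap t w) in *. set (d := (RtoC 1 + RtoC t * Ci * / z)%C) in *.
assert (Nd : d <> RtoC 0) by (apply Cmod_gt_0; lra).
apply is_derive_C_eps. intros e He. rewrite is_derive_C_eps in Dw.
destruct (Dw (e / 4)) as [r [Hr K]]; [lra|].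
exists (Rmin (fst w - umin t) (r / 2)). split; [apply Rmin_glb_lt; lra|]. intros w' Hw'.
assert (W1 := Rlt_le_trans _ _ _ Hw' (Rmin_l _ _)). assert (W2 := Rlt_le_trans _ _ _ Hw' (Rmin_r _ _)).
assert (F := Rabs_fst_le (w' - w)). change (fst (w' - w)%C) with (fst w' - fst w) in F.
apply Rle_lt_trans with (2 := W1) in F. apply Rabs_def2 in F.
assert (L := Zmap_lipschitz t w' w Ht ltac:(lra) ltac:(lra)). fold z in L.
destruct (Zmap_spec t w' Ht ltac:(lra)) as [Hz' Ez']. fold z. set (z' := Zmap t w') in *.
specialize (K z' ltac:(lra)). rewrite Ez', Ez in K.
replace (z' - z - (w' - w) * / d)%C with (- (w' - w - (z' - z) * d) * / d)%C by (field; auto).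
rewrite Cmod_mult, Cmod_opp.
assert (Id : Cmod (/ d) <= 2).
{ replace 2 with (/ / 2) by field. apply Cinv_pow_bound; lra. }
apply Rle_trans with ((e / 4 * Cmod (z' - z)) * 2).
- apply Rmult_le_compat; auto using Cmod_ge_0.
- assert (e / 4 * Cmod (z' - z) <= e / 4 * (2 * Cmod (w' - w))) by (apply Rmult_le_compat_l; lra). lra.
Qed.

Lemma dZmap_cont (t : R) (w : C) : 0 <= t -> umin t < fst w -> Ccont (dZmap t) w.
Proof.
intros Ht Hw. destruct (Zmap_spec t w Ht (Rlt_le _ _ Hw)) as [Hz _].
assert (N := wmap_der_neq0 t _ Ht Hz). apply continuous_Cinv; [|apply Cmod_gt_0; lra].
apply continuous_Cplus; [apply continuous_const|]. apply continuous_Cmult; [apply continuous_const|].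
apply continuous_Cinv; [apply Zmap_cont; auto|]. intros E. rewrite E in Hz. unfold zmin in Hz. simpl in Hz. lra.
Qed.

Lemma Arg_real (x : R) : 0 < x -> Arg (RtoC x) = 0.
Proof.
intros H. apply Rle_antisym; [apply Arg_neg|apply Arg_pos]; simpl; try lra; left; auto.
Qed.

Lemma wmap_real (t x : R) : 0 < x -> wmap t (RtoC x) = (x, t * ln x).
Proof.
intros H. apply injective_projections.
- rewrite wmap_fst, Arg_real by auto. simpl; ring.
- rewrite wmap_snd, Cmod_R, Rabs_pos_eq by lra. simpl; ring.
Qed.

Lemma Zmap_real (t x : R) : 0 <= t -> umin t <= x -> Zmap t (x, t * ln x) = RtoC x.
Proof.
intros Ht Hx. unfold umin in *. rewrite <- wmap_real by lra. apply Zmap_wmap; auto.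
- unfold zmin; simpl; lra.
- rewrite wmap_real by lra. unfold umin. simpl; lra.
Qed.

(** If Im z were positive, Arg z >= 0 would give u <= Re z <= |z|, hence v = Im z + t ln |z| > t ln
    u. *)
Lemma Zmap_lower (t u v : R) : 0 <= t -> umin t <= u -> v <= t * ln u -> snd (Zmap t (u, v)) <= 0.
Proof.
intros Ht Hu Hv. destruct (Zmap_spec t (u, v) Ht Hu) as [Hz Ez].
assert (E1 := wmap_fst t (Zmap t (u, v))). assert (E2 := wmap_snd t (Zmap t (u, v))). rewrite Ez in E1, E2. cbn [fst snd] in E1, E2.
set (z := Zmap t (u, v)) in *. unfold zmin, umin in *. apply Rnot_lt_le. intros Hy.
assert (A := Arg_pos z ltac:(left; lra) ltac:(lra)).
assert (u <= Cmod z).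
{ eapply Rle_trans; [|apply Rabs_fst_le]. eapply Rle_trans; [|apply Rle_abs]. nra. }
assert (ln u <= ln (Cmod z)) by (apply ln_le; lra). nra.
Qed.

(** The real point u has image (u, t ln u), at distance at most t ln u from (u, v), and [Zmap t] is
    Lipschitz with constant 2. *)
Lemma Zmap_near (t u v : R) : 0 <= t -> umin t <= u -> 0 <= v <= t * ln u -> Cmod (Zmap t (u, v) - RtoC u) <= 2 * t * ln u.
Proof.
intros Ht Hu Hv. rewrite <- (Zmap_real t u) by auto.
eapply Rle_trans; [apply Zmap_lipschitz; auto|].
eapply Rle_trans; [apply Rmult_le_compat_l; [lra|apply Cmod_le_sum]|].
change (Rabs (fst ((u, v) - (u, (t * ln u)%R))%C)) with (Rabs (u - u)). change (Rabs (snd ((u, v) - (u, (t * ln u)%R))%C)) with (Rabs (v - t * ln u)).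
rewrite Rminus_diag, Rabs_R0, Rabs_left1; lra.
Qed.

(** Boundary of the region between the curves [Im w = 0] and [Im z = 0], cut by [Re w = c1] and [Re w = c2],
    where [w = wmap t z]. *)
Definition cloop (t c1 c2 : R) : loop :=
  Loop (Arc (fun u => Zmap t (u, 0)) (fun u => dZmap t (u, 0)) c1 c2)
       (Arc (fun v => Zmap t (c2, v)) (fun v => Ci * dZmap t (c2, v))%C 0 (t * ln c2))
       (Arc RtoC (fun _ => RtoC 1) c1 c2)
       (Arc (fun v => Zmap t (c1, v)) (fun v => Ci * dZmap t (c1, v))%C 0 (t * ln c1)).

Lemma ln_nonneg (x : R) : 1 <= x -> 0 <= ln x.
Proof. intros H. rewrite <- ln_1. apply ln_le; lra. Qed.

Lemma cloop_ok (t c1 c2 : R) : 0 <= t -> umin t < c1 -> c1 <= c2 -> loop_ok (cloop t c1 c2).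
Proof.
intros Ht H1 H2.
assert (T1 : 0 <= t * ln c1) by (apply Rmult_le_pos; [auto|apply ln_nonneg; unfold umin in *; lra]).
assert (T2 : 0 <= t * ln c2) by (apply Rmult_le_pos; [auto|apply ln_nonneg; unfold umin in *; lra]).
assert (V : forall c, umin t < c -> forall s, PDer (fun v => Zmap t (c, v)) s (Ci * dZmap t (c, s))%C /\
   Pcont (fun v => Ci * dZmap t (c, v))%C s).
{ intros c Hc s. split.
  - apply (PDer_comp (Zmap t) (fun v => (c, v) : C)); [apply CDer_Zmap; auto|apply PDer_vertical].
  - apply Pcont_vertical_Ci, dZmap_cont; auto. }
split; [|split; [|split; [|split]]]; cbn [bot rgt top lft pt lo hi cloop].
- split; [|split; [|split]]; (split; [assumption|]); cbn [bot rgt top lft pt vel lo hi cloop]; intros s Hs.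
  + assert (umin t < s) by lra. split; [|apply Pcont_horizontal, dZmap_cont; auto].
    replace (dZmap t (s, 0)) with (RtoC 1 * dZmap t (s, 0))%C by apply Cmult_1_l.
    apply (PDer_comp (Zmap t) (fun u => (u, 0) : C)); [apply CDer_Zmap; auto|apply PDer_horizontal].
  + apply V; lra.
  + split; [apply PDer_RtoC|apply continuous_const].
  + apply V; lra.
- reflexivity.
- reflexivity.
- apply Zmap_real; auto; lra.
- apply Zmap_real; auto; lra.
Qed.

Lemma on_cloop (t c1 c2 : R) (z : C) : 0 <= t -> umin t < c1 -> c1 <= c2 -> on_loop (cloop t c1 c2) z ->
  exists w, z = Zmap t w /\ c1 <= fst w <= c2 /\ 0 <= snd w <= t * ln (fst w).
Proof.
intros Ht H1 H2 H. unfold umin in H1.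
destruct H as [[s [Hs ->]]|[[s [Hs ->]]|[[s [Hs ->]]|[s [Hs ->]]]]]; cbn [bot rgt top lft pt lo hi cloop] in *.
- exists (s, 0). cbn [fst snd]. split; auto. split; auto. split; [lra|]. apply Rmult_le_pos; auto. apply ln_nonneg; lra.
- exists (c2, s). cbn [fst snd]. split; auto. lra.
- exists (s, t * ln s). cbn [fst snd]. split; [symmetry; apply Zmap_real; unfold umin; lra|]. split; auto.
  split; [|lra]. apply Rmult_le_pos; auto. apply ln_nonneg; lra.
- exists (c1, s). cbn [fst snd]. split; auto. lra.
Qed.

Lemma cloop_box (t c1 c2 r : R) (z : C) : 0 <= t -> umin t < c1 -> c1 <= c2 -> c2 + 2 * t * ln c2 <= r ->
  on_loop (cloop t c1 c2) z -> box (zmin t) r (- r) 0 z.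
Proof.
intros Ht H1 H2 Hr Hz. destruct (on_cloop _ _ _ _ Ht H1 H2 Hz) as [[u v] [-> [Hu Hv]]]. cbn [fst snd] in *.
assert (N := Zmap_near t u v Ht ltac:(lra) Hv).
assert (L : ln u <= ln c2) by (apply ln_le; unfold umin in *; lra).
assert (L0 : 0 <= ln u) by (apply ln_nonneg; unfold umin in *; lra).
assert (F1 := Rabs_fst_le (Zmap t (u, v) - RtoC u)%C). assert (F2 := Rabs_snd_le (Zmap t (u, v) - RtoC u)%C).
change (fst (Zmap t (u, v) - RtoC u)%C) with (fst (Zmap t (u, v)) - u) in F1.
change (snd (Zmap t (u, v) - RtoC u)%C) with (snd (Zmap t (u, v)) - 0) in F2.
rewrite Rminus_0_r in F2.
assert (2 * t * ln u <= 2 * t * ln c2) by (apply Rmult_le_compat_l; lra).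
apply (Rle_trans _ _ _ F1) in N as N1. apply (Rle_trans _ _ _ F2) in N as N2.
apply Rabs_le_between in N1. apply Rabs_le_between in N2.
destruct (Zmap_spec t (u, v) Ht ltac:(simpl; lra)) as [S1 _].
assert (S2 := Zmap_lower t u v Ht ltac:(lra) ltac:(lra)). unfold umin in *. split; lra.
Qed.

(** * Winding number of the curved contour and sums over zeros *)

Definition inside (t c1 c2 : R) (a : C) : Prop :=
  zmin t <= fst a /\ c1 < fst (wmap t a) < c2 /\ 0 < snd (wmap t a).

(** Keeps a zero off the curved side and the two cross sides of the contour; the fourth side lies on
    the real axis, where f does not vanish. *)
Definition generic (t c1 c2 : R) (a : C) : Prop :=
  zmin t <= fst a -> 0 <= snd (wmap t a) -> fst (wmap t a) <> c1 /\ fst (wmap t a) <> c2 /\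
   (c1 <= fst (wmap t a) <= c2 -> snd (wmap t a) <> 0).

Lemma wmap_dir (t : R) (z a : C) : 0 <= t -> zmin t <= fst z -> zmin t <= fst a -> z <> a ->
  let p := (wmap t z - wmap t a)%C in let q := (z - a)%C in
  0 < fst q * fst q + snd q * snd q /\
  4 * ((fst p - fst q) * (fst p - fst q) + (snd p - snd q) * (snd p - snd q)) <= fst q * fst q + snd q * snd q.
Proof.
intros Ht Hz Ha N p q. assert (E := wmap_expand t z a Ht Hz Ha). fold p q in E.
assert (Q : 0 < Cmod q). { apply Cmod_gt_0. intros K. apply N, Ceq_minus, K. }
rewrite <- !Cmod_sqr. change (fst p - fst q) with (fst (p - q)%C). change (snd p - snd q) with (snd (p - q)%C).
rewrite <- Cmod_sqr. pose proof (Cmod_ge_0 (p - q)). split; nra.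
Qed.


(** Since p is within |q| / 2 of q, the sign of a coordinate of p keeps q off the opposite
    coordinate ray. With [wmap_dir], a side that is straight in the w coordinates thus avoids the
    ray issued from [a] that a straight side would avoid. *)
Lemma slit_of_dir (p q : C) : 0 < fst q * fst q + snd q * snd q ->
  4 * ((fst p - fst q) * (fst p - fst q) + (snd p - snd q) * (snd p - snd q)) <= fst q * fst q + snd q * snd q ->
  (snd p < 0 -> slit (Ci * q)%C) /\ (0 < fst p -> slit q) /\ (0 < snd p -> slit (- Ci * q)%C) /\ (fst p < 0 -> slit (- q)%C) /\
  (0 < fst p -> snd p < 0 -> 0 < fst q \/ snd q < 0) /\ (fst p < 0 -> snd p < 0 -> fst q < 0 \/ snd q < 0).
Proof.
destruct p as [a b], q as [x y]. unfold slit. simpl. intros Q H.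
repeat split; intros.
- destruct (Req_dec x 0) as [->|]; [left|right; lra]. nra.
- destruct (Req_dec y 0) as [->|]; [left|right; lra]. nra.
- destruct (Req_dec x 0) as [->|]; [left|right; lra]. nra.
- destruct (Req_dec y 0) as [->|]; [left|right; lra]. nra.
- destruct (Rlt_le_dec 0 x); auto. destruct (Rlt_le_dec y 0); auto. exfalso. nra.
- destruct (Rlt_le_dec x 0); auto. destruct (Rlt_le_dec y 0); auto. exfalso. nra.
Qed.

Lemma wmap_Zmap_on (t c1 c2 : R) (z : C) : 0 <= t -> umin t < c1 -> c1 <= c2 -> on_loop (cloop t c1 c2) z ->
  zmin t <= fst z /\ snd z <= 0 /\ c1 <= fst (wmap t z) <= c2 /\ 0 <= snd (wmap t z).
Proof.
intros Ht H1 H2 Hz. destruct (on_cloop _ _ _ _ Ht H1 H2 Hz) as [[u v] [-> [Hu Hv]]]. cbn [fst snd] in *.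
destruct (Zmap_spec t (u, v) Ht ltac:(simpl; lra)) as [S1 E].
assert (S2 := Zmap_lower t u v Ht ltac:(lra) ltac:(lra)). rewrite E. cbn [fst snd]. lra.
Qed.

(** When [a] is too far to the left, or its image lies beyond one of the lines bounding the
    straightened contour, the whole contour avoids a common ray and a single branch of the logarithm
    serves. Otherwise the four arcs avoid the four rays required by [lint_winding]. *)
Lemma cloop_winding (t c1 c2 : R) (a : C) : 0 <= t -> umin t < c1 -> c1 <= c2 -> snd a < 0 -> generic t c1 c2 a ->
  lint (fun z => / (z - a))%C (cloop t c1 c2) = (RtoC (2 * PI * indic (inside t c1 c2 a)) * Ci)%C.
Proof.
intros Ht H1 H2 Ha G. assert (Lk := cloop_ok t c1 c2 Ht H1 H2).
assert (On := fun z => wmap_Zmap_on t c1 c2 z Ht H1 H2).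
assert (Zero : (RtoC 0 = RtoC (2 * PI * 0) * Ci)%C) by (rewrite Rmult_0_r; ring).
destruct (Rlt_le_dec (fst a) (zmin t)) as [L|L].
{ rewrite indic_false, <- Zero by (unfold inside; lra).
  apply (lint_no_winding (RtoC 1)); auto; [apply Cmod_1|]. intros z Hz. destruct (On z Hz) as [O1 _].
  rewrite Cmult_1_l. left. change (fst (z - a)%C) with (fst z - fst a). lra. }
assert (NA : forall z, on_loop (cloop t c1 c2) z -> z <> a).
{ intros z Hz ->. destruct (On a Hz) as [O1 [O2 [O3 O4]]]. destruct (G L O4) as [G1 [G2 G3]].
  destruct (on_cloop _ _ _ _ Ht H1 H2 Hz) as [[u v] [Ea [Hu Hv]]]. cbn [fst snd] in *.
  destruct Hz as [[s [Hs Es]]|[[s [Hs Es]]|[[s [Hs Es]]|[s [Hs Es]]]]]; cbn [bot rgt top lft pt lo hi cloop] in *.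
  - apply G3; auto. rewrite Es, (proj2 (Zmap_spec t (s, 0) Ht ltac:(simpl; lra))). reflexivity.
  - apply G2. rewrite Es, (proj2 (Zmap_spec t (c2, s) Ht ltac:(simpl; lra))). reflexivity.
  - rewrite Es in Ha. simpl in Ha. lra.
  - apply G1. rewrite Es, (proj2 (Zmap_spec t (c1, s) Ht ltac:(simpl; lra))). reflexivity. }
assert (DIR : forall z, on_loop (cloop t c1 c2) z -> let p := (wmap t z - wmap t a)%C in let q := (z - a)%C in
  (snd p < 0 -> slit (Ci * q)%C) /\ (0 < fst p -> slit q) /\ (0 < snd p -> slit (- Ci * q)%C) /\ (fst p < 0 -> slit (- q)%C) /\
  (0 < fst p -> snd p < 0 -> 0 < fst q \/ snd q < 0) /\ (fst p < 0 -> snd p < 0 -> fst q < 0 \/ snd q < 0)).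
{ intros z Hz p q. destruct (On z Hz) as [O1 _]. destruct (wmap_dir t z a Ht O1 L (NA z Hz)). apply slit_of_dir; auto. }
assert (Fm : forall z, fst (wmap t z - wmap t a)%C = fst (wmap t z) - fst (wmap t a)) by reflexivity.
assert (Sm : forall z, snd (wmap t z - wmap t a)%C = snd (wmap t z) - snd (wmap t a)) by reflexivity.
destruct (Rlt_le_dec (snd (wmap t a)) 0) as [V|V].
{ rewrite indic_false, <- Zero by (unfold inside; lra).
  apply (lint_no_winding (- Ci)); auto; [rewrite Cmod_opp; apply Cmod_Ci|]. intros z Hz.
  apply (DIR z Hz). rewrite Sm. destruct (On z Hz) as [_ [_ [_ O]]]. lra. }
destruct (G L V) as [G1 [G2 G3]].
destruct (Rlt_le_dec (fst (wmap t a)) c1) as [U1|U1].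
{ rewrite indic_false, <- Zero by (unfold inside; lra).
  apply (lint_no_winding (RtoC 1)); auto; [apply Cmod_1|]. intros z Hz. rewrite Cmult_1_l.
  apply (DIR z Hz). rewrite Fm. destruct (On z Hz) as [_ [_ [O _]]]. lra. }
destruct (Rlt_le_dec c2 (fst (wmap t a))) as [U2|U2].
{ rewrite indic_false, <- Zero by (unfold inside; lra).
  apply (lint_no_winding (- RtoC 1)); auto; [rewrite Cmod_opp; apply Cmod_1|]. intros z Hz.
  replace (- RtoC 1 * (z - a))%C with (- (z - a))%C by ring.
  apply (DIR z Hz). rewrite Fm. destruct (On z Hz) as [_ [_ [O _]]]. lra. }
specialize (G3 (conj U1 U2)).
assert (V' : 0 < snd (wmap t a)) by (destruct V; [auto|congruence]).
assert (U1' : c1 < fst (wmap t a)) by (destruct U1; [auto|congruence]).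
assert (U2' : fst (wmap t a) < c2) by (destruct U2; [auto|congruence]).
rewrite indic_true by (unfold inside; lra). rewrite Rmult_1_r.
assert (W : forall u v, umin t <= u -> wmap t (Zmap t (u, v)) = (u, v)) by (intros u v Hu; apply (Zmap_spec t (u, v) Ht Hu)).
assert (Ends : forall g, arc_ok g -> on_arc g (pt g (lo g)) /\ on_arc g (pt g (hi g))).
{ intros g [Hg _]. split; eexists; split; try reflexivity; lra. }
destruct (Ends _ (proj1 (proj1 Lk))) as [E1 E2].
apply lint_winding; auto.
- intros z Hz. assert (Hz' : on_loop (cloop t c1 c2) z) by (left; auto). apply (DIR z Hz').
  destruct Hz as [s [Hs ->]]. cbn [bot rgt top lft pt lo hi cloop] in *. rewrite Sm, W by lra. cbn [fst snd]. lra.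
- intros z Hz. assert (Hz' : on_loop (cloop t c1 c2) z) by (right; left; auto). apply (DIR z Hz').
  destruct Hz as [s [Hs ->]]. cbn [bot rgt top lft pt lo hi cloop] in *. rewrite Fm, W by lra. cbn [fst snd]. lra.
- intros z [s [Hs ->]]. cbn [bot rgt top lft pt lo hi cloop] in *. left. destruct a; simpl in *. lra.
- intros z Hz. assert (Hz' : on_loop (cloop t c1 c2) z) by (right; right; right; auto). apply (DIR z Hz').
  destruct Hz as [s [Hs ->]]. cbn [bot rgt top lft pt lo hi cloop] in *. rewrite Fm, W by lra. cbn [fst snd]. lra.
- assert (E2' : on_loop (cloop t c1 c2) (pt (bot (cloop t c1 c2)) (hi (bot (cloop t c1 c2))))) by (left; auto).
  apply (DIR _ E2'); cbn [bot rgt top lft pt lo hi cloop]; rewrite ?Fm, ?Sm, W by lra; cbn [fst snd]; lra.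
- right. cbn [bot rgt top lft pt lo hi cloop]. destruct a; simpl in *. lra.
- right. cbn [bot rgt top lft pt lo hi cloop]. destruct a; simpl in *. lra.
- assert (E1' : on_loop (cloop t c1 c2) (pt (bot (cloop t c1 c2)) (lo (bot (cloop t c1 c2))))) by (left; auto).
  apply (DIR _ E1'); cbn [bot rgt top lft pt lo hi cloop]; rewrite ?Fm, ?Sm, W by lra; cbn [fst snd]; lra.
Qed.

Lemma lint_holo (h : C -> C) (L : loop) (x1 x2 y1 y2 : R) : loop_ok L -> x1 <= x2 -> y1 <= y2 ->
  (forall z, on_loop L z -> box x1 x2 y1 y2 z) -> (forall z, box x1 x2 y1 y2 z -> holomorphic_at h z) -> lint h L = RtoC 0.
Proof.
intros HL Hx Hy HB Hh. destruct (box_enlarge _ x1 x2 y1 y2 Hx Hy Hh) as [e [He HO]].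
destruct (primitive_holo h (x1 - e) (x2 + e) (y1 - e) (y2 + e)) as [F HF]; [intros z Hz; apply (HO z Hz)|].
assert (Sub : forall z, on_loop L z -> obox (x1 - e) (x2 + e) (y1 - e) (y2 + e) z).
{ intros z Hz. specialize (HB z Hz). inbox. }
apply (lint_primitive F); auto. intros z Hz. destruct (HO z (Sub z Hz)) as [l Hl]. apply CDer_continuous with (1 := Hl).
Qed.

Fixpoint logsum (l : list C) (z : C) : C :=
  match l with nil => RtoC 0 | a :: l' => (/ (z - a) + logsum l' z)%C end.

Lemma logsum_prodz (l : list C) (z : C) : ~ In z l -> CDer (prodz l) z (prodz l z * logsum l z)%C.
Proof.
induction l as [|a l IH]; simpl; intros H.
- eapply CDer_eq; [apply (CDer_const (RtoC 1))|ring].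
- assert (N : (z - a)%C <> RtoC 0). { intros E. apply Ceq_minus in E. subst; tauto. }
  eapply CDer_eq.
  + apply (CDer_mult (fun w => w - a)%C (prodz l)); [apply CDer_minus; [apply CDer_id|apply CDer_const]|apply IH; tauto].
  + cbv beta. field. auto.
Qed.

Lemma ldiff_prodz (f g : C -> C) (l : list C) (z : C) : (forall w, f w = (prodz l w * g w)%C) ->
  holomorphic_at g z -> g z <> RtoC 0 -> ~ In z l -> ldiff f z = (logsum l z + ldiff g z)%C.
Proof.
intros E Hg Ng Nl. unfold ldiff.
assert (D : CDer f z (prodz l z * logsum l z * g z + prodz l z * C_derive g z)%C).
{ apply (is_derive_ext (V := C_NormedModule)) with (fun w => prodz l w * g w)%C; [intros; symmetry; apply E|].
  apply CDer_mult; [apply logsum_prodz; auto|apply CDer_holo; auto]. }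
rewrite (is_C_derive_unique _ _ _ D), E. field. split; auto. apply prodz_neq0; auto.
Qed.

Lemma holomorphic_at_inv (f : C -> C) (z : C) : holomorphic_at f z -> f z <> RtoC 0 -> holomorphic_at (fun w => / f w)%C z.
Proof.
intros Hf N. assert (L := cont_neq0_locally f z (holomorphic_at_cont f z Hf) N). unfold holomorphic_at in *.
generalize (filter_and _ _ Hf L). apply filter_imp. intros w [[l Hl] Nw].
eexists. exact (CDer_comp Cinv f w _ l (CDer_inv _ Nw) Hl).
Qed.

Lemma holomorphic_at_ldiff (f : C -> C) (z : C) : holomorphic_at f z -> f z <> RtoC 0 -> holomorphic_at (ldiff f) z.
Proof.
intros Hf N. apply holomorphic_at_mult; [apply holomorphic_at_derive; auto|apply holomorphic_at_inv; auto].
Qed.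

Definition entire (F F' : C -> C) : Prop := forall z, CDer F z (F' z) /\ Ccont F' z.

Lemma holomorphic_at_wmap (F F' : C -> C) (t : R) (z : C) : entire F F' -> 0 < fst z -> holomorphic_at (fun z => F (wmap t z)) z.
Proof.
intros HF Hz. unfold holomorphic_at.
assert (L : locally z (fun w => 0 < fst w)).
{ apply locally_sqbox. exists (fst z / 2). split; [lra|]. intros w Hw. unfold sqbox in Hw. inbox. }
generalize L. apply filter_imp. intros w Hw. eexists. apply CDer_comp; [apply HF|]. apply CDer_wmap. left; auto.
Qed.

Lemma holomorphic_at_pole (a z : C) : z <> a -> holomorphic_at (fun z => / (z - a))%C z.
Proof.
intros N. apply (holomorphic_at_inv (fun z => z - a)%C).
- unfold holomorphic_at. apply filter_forall. intros w. eexists. apply CDer_minus; [apply CDer_id|apply CDer_const].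
- intros E. apply N, Ceq_minus, E.
Qed.

(** A residue computation with f = prodz l * g: the part of f'/f due to [g] is holomorphic near the
    contour and its box, and each 1 / (z - a) is treated as in Cauchy's formula. The real part of 2
    PI i F is - 2 PI Im F, whence the sign. *)
Theorem contour_zeros (f g F F' : C -> C) (l : list C) (t c1 c2 r : R) : 0 <= t -> umin t < c1 -> c1 <= c2 ->
  c2 + 2 * t * ln c2 <= r -> holo_lower f -> (forall s : R, f (RtoC s) <> RtoC 0) ->
  (forall a, In a l -> box 0 r (- r) 0 a) -> holo_lower g ->
  (forall z, f z = (prodz l z * g z)%C) -> (forall z, box 0 r (- r) 0 z -> g z <> RtoC 0) ->
  (forall a, In a l -> generic t c1 c2 a) -> entire F F' ->
  (forall z, on_loop (cloop t c1 c2) z -> f z <> RtoC 0) /\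
  fst (lint (fun z => F (wmap t z) * ldiff f z)%C (cloop t c1 c2)) =
    - (2 * PI * sumR (fun a => indic (inside t c1 c2 a) * snd (F (wmap t a))) l).
Proof.
intros Ht H1 H2 Hr Hf Hn Hl Hg E Ng Gen HF. set (L := cloop t c1 c2).
assert (Lk : loop_ok L) by (apply cloop_ok; auto).
assert (HB : forall z, on_loop L z -> box (zmin t) r (- r) 0 z) by (intros z Hz; apply (cloop_box t c1 c2 r); auto).
assert (Hzr : zmin t <= r).
{ unfold zmin, umin in *. assert (0 <= ln c2) by (apply ln_nonneg; lra). nra. }
assert (Hr0 : 0 <= r) by (unfold zmin in *; lra).
assert (Sub : forall z, box (zmin t) r (- r) 0 z -> box 0 r (- r) 0 z) by (intros z Hz; unfold zmin in *; inbox).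
assert (Neg : forall a, In a l -> snd a < 0).
{ intros a Ha. destruct (Hl a Ha) as [_ [_ Ha2]]. destruct Ha2 as [|E0]; auto. exfalso. apply (Hn (fst a)).
  replace (RtoC (fst a)) with a by (apply injective_projections; simpl; auto). rewrite E, prodz_root by auto. ring. }
assert (NI : forall z, on_loop L z -> ~ In z l).
{ intros z Hz Hin. destruct (wmap_Zmap_on _ _ _ _ Ht H1 H2 Hz) as [O1 [O2 [O3 O4]]].
  destruct (Gen z Hin O1 O4) as [G1 [G2 G3]]. specialize (G3 O3). specialize (Neg z Hin).
  destruct Hz as [[s [Hs Es]]|[[s [Hs Es]]|[[s [Hs Es]]|[s [Hs Es]]]]]; cbn [bot rgt top lft pt lo hi cloop L] in *.
  - apply G3. rewrite Es, (proj2 (Zmap_spec t (s, 0) Ht ltac:(simpl; lra))). reflexivity.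
  - apply G2. rewrite Es, (proj2 (Zmap_spec t (c2, s) Ht ltac:(simpl; lra))). reflexivity.
  - rewrite Es in Neg. simpl in Neg. lra.
  - apply G1. rewrite Es, (proj2 (Zmap_spec t (c1, s) Ht ltac:(simpl; lra))). reflexivity. }
split.
{ intros z Hz. rewrite E. apply Cmult_neq_0; [apply prodz_neq0, NI, Hz|apply Ng, Sub, HB, Hz]. }
assert (Pos : forall z, box (zmin t) r (- r) 0 z -> 0 < fst z) by (intros z Hz; unfold zmin in Hz; inbox).
assert (HW : forall z, box (zmin t) r (- r) 0 z -> holomorphic_at (fun z => F (wmap t z)) z).
{ intros z Hz. apply holomorphic_at_wmap with F'; auto. }
assert (CW : cont_on (on_loop L) (fun z => F (wmap t z))).
{ intros z Hz. apply holomorphic_at_cont, HW, HB, Hz. }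
assert (CP : forall a, In a l -> cont_on (on_loop L) (fun z => / (z - a))%C).
{ intros a Ha z Hz. apply holomorphic_at_cont, holomorphic_at_pole. intros ->. exact (NI a Hz Ha). }
assert (One : forall a, In a l -> lint (fun z => F (wmap t z) * / (z - a))%C L =
   (RtoC (2 * PI * indic (inside t c1 c2 a)) * Ci * F (wmap t a))%C).
{ intros a Ha. destruct (Rlt_le_dec (fst a) (zmin t)) as [La|La].
  (* A zero to the left of [zmin t] is outside the box that contains the contour, so the integrand
     is holomorphic on that box. *)
  - rewrite indic_false by (unfold inside; lra). rewrite Rmult_0_r.
    transitivity (RtoC 0); [|ring]. apply (lint_holo _ L (zmin t) r (- r) 0); auto; [lra|].
    intros z Hz. apply holomorphic_at_mult; auto. apply holomorphic_at_pole. intros ->. inbox.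
  - assert (Ba : box (zmin t) r (- r) 0 a) by (specialize (Hl a Ha); inbox).
    rewrite (lint_ext _ (fun z => dquot (fun z => F (wmap t z)) a z + F (wmap t a) * / (z - a))%C); auto.
    2:{ intros z Hz. assert (Dq := dquot_mul (fun z => F (wmap t z)) a z). cbv beta in Dq.
        replace (F (wmap t z)) with (F (wmap t z) - F (wmap t a) + F (wmap t a))%C by ring. rewrite Dq.
        field. intros K. apply Ceq_minus in K. subst. exact (NI a Hz Ha). }
    assert (HD : forall z, box (zmin t) r (- r) 0 z -> holomorphic_at (dquot (fun z => F (wmap t z)) a) z).
    { intros z Hz. apply holomorphic_at_dquot'; auto. }
    rewrite lint_plus, lint_scal, (lint_holo (dquot _ a) L (zmin t) r (- r) 0); auto; try lra.
    + unfold L. rewrite cloop_winding; auto. ring.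
    + intros z Hz. apply holomorphic_at_cont, HD, HB, Hz.
    + intros z Hz. apply continuous_Cmult; [apply continuous_const|apply CP; auto]. }
rewrite (lint_ext _ (fun z => F (wmap t z) * logsum l z + F (wmap t z) * ldiff g z)%C); auto.
2:{ intros z Hz. rewrite (ldiff_prodz f g l z); [ring|exact E|apply Hg, HB, Hz|apply Ng, Sub, HB, Hz|apply NI, Hz]. }
assert (HgW : forall z, box (zmin t) r (- r) 0 z -> holomorphic_at (fun z => F (wmap t z) * ldiff g z)%C z).
{ intros z Hz. apply holomorphic_at_mult; auto. apply holomorphic_at_ldiff; [apply Hg; inbox|apply Ng, Sub, Hz]. }
assert (CL : forall k, (forall a, In a k -> In a l) -> cont_on (on_loop L) (fun z => F (wmap t z) * logsum k z)%C).
{ intros k Hk z Hz. apply continuous_Cmult; [apply CW, Hz|].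
  induction k as [|a k IH]; simpl; [apply continuous_const|]. apply continuous_Cplus.
  - apply (CP a); auto. apply Hk; left; auto.
  - apply IH. intros b Hb; apply Hk; right; auto. }
rewrite lint_plus; auto.
2:{ intros z Hz. apply holomorphic_at_cont, HgW, HB, Hz. }
rewrite (lint_holo (fun z => F (wmap t z) * ldiff g z)%C L (zmin t) r (- r) 0), Cplus_0_r; auto; try lra.
assert (Ind : forall k, (forall a, In a k -> In a l) -> fst (lint (fun z => F (wmap t z) * logsum k z)%C L) =
    - (2 * PI * sumR (fun a => indic (inside t c1 c2 a) * snd (F (wmap t a))) k)).
{ induction k as [|a k IH]; intros Hk.
  - rewrite (lint_holo _ L (zmin t) r (- r) 0); auto; [simpl; ring|lra|].
    intros z Hz. apply holomorphic_at_mult; auto. unfold holomorphic_at. apply filter_forall. intros w.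
    exists (RtoC 0). apply (CDer_const (RtoC 0)).
  - rewrite (lint_ext _ (fun z => F (wmap t z) * / (z - a) + F (wmap t z) * logsum k z)%C); auto.
    2:{ intros z Hz. simpl. ring. }
    rewrite lint_plus; auto.
    + rewrite One by (apply Hk; left; auto). simpl sumR.
      change (fst (?p + ?q)%C) with (fst p + fst q). rewrite IH by (intros b Hb; apply Hk; right; auto).
      simpl. ring.
    + intros z Hz. apply continuous_Cmult; [apply CW, Hz|apply CP; auto; apply Hk; left; auto].
    + apply CL. intros b Hb; apply Hk; right; auto. }
apply Ind; auto.
Qed.

(** * Carleman's formulas *)

Notation Rcont := (@continuous R_UniformSpace R_UniformSpace).

Lemma fst_CInt (f : R -> C) (a b : R) : ex_CInt f a b -> fst (CInt f a b) = RInt (fun s => fst (f s)) a b.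
Proof.
intros H. symmetry. apply (is_RInt_unique (V := R_CompleteNormedModule)).
apply (is_RInt_fct_extend_fst (U := R_NormedModule) (V := R_NormedModule)).
exact (RInt_correct (V := C_R_CompleteNormedModule) _ _ _ H).
Qed.

Lemma ex_RInt_cont (f : R -> R) (a b : R) : a <= b -> (forall s, a <= s <= b -> Rcont f s) -> ex_RInt f a b.
Proof.
intros Hab H. apply (ex_RInt_continuous (V := R_CompleteNormedModule)).
rewrite Rmin_left, Rmax_right by exact Hab. exact H.
Qed.

Lemma Rcont_mult (f g : R -> R) (x : R) : Rcont f x -> Rcont g x -> Rcont (fun s => f s * g s) x.
Proof. exact (continuous_mult (K := R_AbsRing) f g x). Qed.

Lemma is_derive_cont (f : R -> R) (x l : R) : is_derive f x l -> Rcont f x.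
Proof. intros H. apply (ex_derive_continuous (V := R_NormedModule)). exists l; exact H. Qed.

Lemma RInt_parts (f g f' g' : R -> R) (a b : R) : a <= b ->
  (forall s, a <= s <= b -> is_derive f s (f' s) /\ is_derive g s (g' s) /\ Rcont f' s /\ Rcont g' s) ->
  RInt (fun s => f s * g' s) a b = f b * g b - f a * g a - RInt (fun s => f' s * g s) a b.
Proof.
intros Hab H.
assert (Cf : forall s, a <= s <= b -> Rcont f s) by (intros s Hs; destruct (H s Hs) as [H1 _]; apply is_derive_cont with (1 := H1)).
assert (Cg : forall s, a <= s <= b -> Rcont g s) by (intros s Hs; destruct (H s Hs) as [_ [H1 _]]; apply is_derive_cont with (1 := H1)).
assert (I : is_RInt (fun s => f' s * g s + f s * g' s) a b (f b * g b - f a * g a)).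
{ apply (is_RInt_derive (V := R_CompleteNormedModule) (fun s => f s * g s)); rewrite Rmin_left, Rmax_right by auto; intros s Hs;
    destruct (H s Hs) as [H1 [H2 [H3 H4]]].
  - apply Derive.is_derive_mult; auto.
  - apply (continuous_plus (V := R_NormedModule)); apply Rcont_mult; auto. }
apply (is_RInt_unique (V := R_CompleteNormedModule)) in I.
assert (P := RInt_plus (V := R_CompleteNormedModule) (fun s => f' s * g s) (fun s => f s * g' s) a b).
change (plus ?x ?y) with (x + y) in P. rewrite P in I; [lra|..];
  apply ex_RInt_cont; auto; intros s Hs; destruct (H s Hs) as [H1 [H2 [H3 H4]]]; apply Rcont_mult; auto.
Qed.

Lemma is_derive_ln_path (f : C -> C) (p : R -> C) (s : R) (m : C) : holomorphic_at f (p s) -> f (p s) <> RtoC 0 ->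
  PDer p s m -> is_derive (fun s => ln (Cmod (f (p s)))) s (fst (m * ldiff f (p s))%C).
Proof.
intros Hf N Hp.
replace (m * ldiff f (p s))%C with ((m * C_derive f (p s)) / f (p s))%C by (unfold ldiff, Cdiv; ring).
apply (is_derive_ln_Cmod (fun s => f (p s))); auto. apply PDer_comp; auto. apply CDer_holo; auto.
Qed.

(** Where the weight is real, only the real part of f'/f dz contributes, which is d ln |f|;
    integration by parts moves the derivative to the weight, and arg f never enters. *)
Lemma aint_ldiff_real (f G : C -> C) (g : arc) (phi phi' : R -> R) : arc_ok g ->
  (forall z, on_arc g z -> holomorphic_at f z /\ f z <> RtoC 0) ->
  (forall s, lo g <= s <= hi g -> G (pt g s) = RtoC (phi s) /\ is_derive phi s (phi' s) /\ Rcont phi' s) ->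
  fst (aint (fun z => G z * ldiff f z)%C g) =
   phi (hi g) * ln (Cmod (f (pt g (hi g)))) - phi (lo g) * ln (Cmod (f (pt g (lo g))))
   - RInt (fun s => phi' s * ln (Cmod (f (pt g s)))) (lo g) (hi g).
Proof.
intros Hg Hf Hphi. assert (Hab := proj1 Hg).
assert (On : forall s, lo g <= s <= hi g -> on_arc g (pt g s)) by (intros s Hs; exists s; auto).
set (d := fun s => fst (vel g s * ldiff f (pt g s))%C).
assert (Cd : forall s, lo g <= s <= hi g -> Pcont (fun s => vel g s * ldiff f (pt g s))%C s).
{ apply arc_cont; auto. intros z Hz. apply continuous_ldiff; apply Hf; auto. }
assert (E : forall s, lo g <= s <= hi g ->
   (vel g s * (G (pt g s) * ldiff f (pt g s)))%C = (RtoC (phi s) * (vel g s * ldiff f (pt g s)))%C).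
{ intros s Hs. rewrite (proj1 (Hphi s Hs)). ring. }
unfold aint. rewrite (CInt_ext _ _ _ _ Hab E), fst_CInt.
- rewrite (RInt_ext _ (fun s => phi s * d s)).
  2:{ intros s _. unfold d. simpl. ring. }
  rewrite (RInt_parts phi (fun s => ln (Cmod (f (pt g s)))) phi' d); auto.
  intros s Hs. destruct (Hphi s Hs) as [_ [H2 H3]]. destruct (proj2 Hg s Hs) as [H4 H5]. destruct (Hf _ (On s Hs)) as [H6 H7].
  split; [auto|]. split; [apply is_derive_ln_path; auto|]. split; [auto|].
  apply continuous_fst_C, Cd, Hs.
- apply ex_CInt_cont; auto. intros s Hs. apply continuous_Cmult; [|apply Cd, Hs]. apply continuous_RtoC.
  apply is_derive_cont with (phi' s). apply Hphi; auto.
Qed.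

Lemma ldiff_int_derive_ln (f : C -> C) (x : R) : holo_lower f -> (forall s : R, f (RtoC s) <> RtoC 0) ->
  is_derive (fun s => ln (Cmod (f (RtoC s)))) x (fst (ldiff f (RtoC x))) /\
  is_derive (fun s => snd (ldiff_int f s)) x (snd (ldiff f (RtoC x))) /\
  Rcont (fun s => fst (ldiff f (RtoC s))) x /\ Rcont (fun s => snd (ldiff f (RtoC s))) x.
Proof.
intros Hf Hn. assert (Cl : Pcont (fun s => ldiff f (RtoC s)) x).
{ apply Pcont_RtoC, continuous_ldiff; auto. apply Hf; simpl; lra. }
split; [apply is_derive_ln_real; auto|]. split; [apply ldiff_int_derive; auto|].
split; [apply continuous_fst_C, Cl|apply continuous_snd_C, Cl].
Qed.

(** On the real axis the weight P + i Q may be complex: P pairs with ln |f| and Q with the variation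
    of arg f, the imaginary part of [ldiff_int]. *)
Lemma aint_ldiff_top (f G : C -> C) (a b : R) (P Q P' Q' : R -> R) : a <= b ->
  holo_lower f -> (forall s : R, f (RtoC s) <> RtoC 0) ->
  (forall s, a <= s <= b -> G (RtoC s) = (P s, Q s) /\ is_derive P s (P' s) /\ is_derive Q s (Q' s) /\ Rcont P' s /\ Rcont Q' s) ->
  fst (aint (fun z => G z * ldiff f z)%C (Arc RtoC (fun _ => RtoC 1) a b)) =
   (P b * ln (Cmod (f (RtoC b))) - P a * ln (Cmod (f (RtoC a))) - RInt (fun s => P' s * ln (Cmod (f (RtoC s)))) a b)
   - (Q b * snd (ldiff_int f b) - Q a * snd (ldiff_int f a) - RInt (fun s => Q' s * snd (ldiff_int f s)) a b).
Proof.
intros Hab Hf Hn H.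
assert (D := fun s => ldiff_int_derive_ln f s Hf Hn).
rewrite <- (RInt_parts P (fun s => ln (Cmod (f (RtoC s)))) P' (fun s => fst (ldiff f (RtoC s)))); auto.
2:{ intros s Hs. destruct (D s) as [D1 [D2 [D3 D4]]]. destruct (H s Hs) as [_ [H1 [H2 [H3 H4]]]]. auto. }
rewrite <- (RInt_parts Q (fun s => snd (ldiff_int f s)) Q' (fun s => snd (ldiff f (RtoC s)))); auto.
2:{ intros s Hs. destruct (D s) as [D1 [D2 [D3 D4]]]. destruct (H s Hs) as [_ [H1 [H2 [H3 H4]]]]. auto. }
assert (CP : forall s, a <= s <= b -> Rcont P s) by (intros s Hs; apply is_derive_cont with (P' s); apply H; auto).
assert (CQ : forall s, a <= s <= b -> Rcont Q s) by (intros s Hs; apply is_derive_cont with (Q' s); apply H; auto).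
assert (M := RInt_minus (V := R_CompleteNormedModule) (fun s => P s * fst (ldiff f (RtoC s))) (fun s => Q s * snd (ldiff f (RtoC s))) a b).
change (minus ?x ?y) with (x - y) in M. rewrite <- M.
2,3: apply ex_RInt_cont; auto; intros s Hs; destruct (D s) as [D1 [D2 [D3 D4]]]; apply Rcont_mult; auto.
unfold aint. cbn [lo hi pt vel].
assert (E : forall s, a <= s <= b -> (RtoC 1 * (G (RtoC s) * ldiff f (RtoC s)))%C = ((P s, Q s) * ldiff f (RtoC s))%C).
{ intros s Hs. rewrite (proj1 (H s Hs)). ring. }
rewrite (CInt_ext _ _ _ _ Hab E), fst_CInt.
- reflexivity.
- apply ex_CInt_cont; auto. intros s Hs. apply continuous_Cmult.
  + apply continuous_pair_C; auto.
  + apply Pcont_RtoC, continuous_ldiff; auto. apply Hf; simpl; lra.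
Qed.

Definition lnf (t : R) (f : C -> C) (u v : R) : R := ln (Cmod (f (Zmap t (u, v)))).

Definition zeros_data (f g : C -> C) (l : list C) (r : R) : Prop :=
  (forall a, In a l -> box 0 r (- r) 0 a) /\ holo_lower g /\
  (forall z, f z = (prodz l z * g z)%C) /\ (forall z, box 0 r (- r) 0 z -> g z <> RtoC 0).

Lemma wZ (t u v : R) : 0 <= t -> umin t <= u -> wmap t (Zmap t (u, v)) = (u, v).
Proof. intros Ht Hu. exact (proj2 (Zmap_spec t (u, v) Ht Hu)). Qed.

Lemma continuous_prod_C (f g : R -> R) (z : C) : continuity f -> continuity g ->
  @continuous C_UniformSpace R_UniformSpace (fun z => f (fst z) * g (snd z)) z.
Proof.
intros Hf Hg. destruct z as [a b].
exact (proj1 (continuity_2d_pt_filterlim (fun x y => f x * g y) a b) (continuity_2d_pt_prod f g a b Hf Hg)).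
Qed.

(** With al = PI / (2 h), sin (al (w - c)) is real on the lower side and on the two cross sides,
    where it is cosh or - cosh of al v, and its imaginary part is nonnegative inside. The corner
    terms in ln |f| cancel around the contour, those in arg f vanish because cos (PI / 2) = 0.
    Dropping the nonnegative sum over the zeros leaves an inequality. *)
Theorem Carleman_sine (f g : C -> C) (l : list C) (t c h r : R) : 0 <= t -> umin t < c - h -> 0 < h ->
  c + h + 2 * t * ln (c + h) <= r -> holo_lower f -> (forall s : R, f (RtoC s) <> RtoC 0) ->
  zeros_data f g l r -> (forall a, In a l -> generic t (c - h) (c + h) a) ->
  let al := PI / (2 * h) in
  let L := fun s => al * t * ln s in
  0 <= RInt (fun u => al * cos (al * (u - c)) * lnf t f u 0) (c - h) (c + h)
     + RInt (fun v => al * sinh (al * v) * lnf t f (c + h) v) 0 (t * ln (c + h))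
     - RInt (fun v => - (al * sinh (al * v)) * lnf t f (c - h) v) 0 (t * ln (c - h))
     - RInt (fun x => (al * cos (al * (x - c)) * cosh (L x) + sin (al * (x - c)) * (al * t / x) * sinh (L x)) * ln (Cmod (f (RtoC x)))) (c - h) (c + h)
     + RInt (fun x => (- (al * sin (al * (x - c)) * sinh (L x)) + cos (al * (x - c)) * (al * t / x) * cosh (L x)) * snd (ldiff_int f x)) (c - h) (c + h).
Proof.
intros Ht Hc1 Hh Hr Hf Hn [Hl [Hg [E Ng]]] Gen al L. set (c1 := c - h) in *. set (c2 := c + h) in *.
assert (H12 : c1 <= c2) by (unfold c1, c2; lra).
assert (Hal : 0 < al). { unfold al. pose proof PI_RGT_0. apply Rdiv_lt_0_compat; lra. }
set (F := fun w => Csin (RtoC al * (w - RtoC c))%C).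
set (F' := fun w => (RtoC al * Ccos (RtoC al * (w - RtoC c)))%C).
assert (HF : entire F F').
{ intros w. assert (D : forall w, CDer (fun w => RtoC al * (w - RtoC c))%C w (RtoC al)).
  { intros z. eapply CDer_eq; [apply CDer_scal, CDer_minus; [apply CDer_id|apply CDer_const]|ring]. }
  split; [apply (CDer_comp Csin (fun w => RtoC al * (w - RtoC c))%C); [apply CDer_Csin|apply D]|].
  apply continuous_Cmult; [apply continuous_const|].
  apply (continuous_comp (fun w => RtoC al * (w - RtoC c))%C Ccos); [apply CDer_continuous with (1 := D w)|].
  apply continuous_pair_C.
  - apply continuous_prod_C; [apply continuity_cos|apply continuity_cosh].
  - apply (continuous_opp (V := R_NormedModule)), continuous_prod_C; [apply continuity_sin|apply continuity_sinh]. }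
destruct (contour_zeros f g F F' l t c1 c2 r Ht Hc1 H12 Hr Hf Hn Hl Hg E Ng Gen HF) as [NL CZ].
assert (FE : forall u v, F (u, v) = (sin (al * (u - c)) * cosh (al * v), cos (al * (u - c)) * sinh (al * v))).
{ intros u v. unfold F, Csin. f_equal; f_equal; f_equal; simpl; ring. }
assert (Lk := cloop_ok t c1 c2 Ht Hc1 H12). destruct Lk as [[K1 [K2 [K3 K4]]] _].
assert (HL : forall z, on_loop (cloop t c1 c2) z -> holomorphic_at f z /\ f z <> RtoC 0).
{ intros z Hz. split; [|apply NL, Hz]. apply Hf. apply (wmap_Zmap_on t c1 c2 z); auto. }
assert (A2 : al * (c2 - c) = PI / 2) by (unfold al, c2; field; lra).
assert (A1 : al * (c1 - c) = - (PI / 2)) by (unfold al, c1; field; lra).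
unfold lint in CZ. change (fst (?a + ?b - ?d - ?e)%C) with (fst a + fst b - fst d - fst e) in CZ.
rewrite (aint_ldiff_real f (fun z => F (wmap t z)) (bot (cloop t c1 c2)) (fun u => sin (al * (u - c))) (fun u => al * cos (al * (u - c)))) in CZ; auto.
2:{ intros z Hz; apply HL; left; auto. }
2:{ cbn [bot cloop lo hi pt]. intros u Hu. split; [|split].
    - rewrite wZ, FE by lra. rewrite Rmult_0_r, cosh_0, sinh_0. unfold RtoC. f_equal; ring.
    - auto_derive; auto. unfold Rminus; ring.
    - apply is_derive_cont with (- (al * (al * sin (al * (u - c))))). auto_derive; auto. unfold Rminus; ring. }
rewrite (aint_ldiff_real f (fun z => F (wmap t z)) (rgt (cloop t c1 c2)) (fun v => cosh (al * v)) (fun v => al * sinh (al * v))) in CZ; auto.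
2:{ intros z Hz; apply HL; right; left; auto. }
2:{ cbn [rgt cloop lo hi pt]. intros v Hv. split; [|split].
    - rewrite wZ, FE, A2, sin_PI2, cos_PI2 by lra. unfold RtoC. f_equal; ring.
    - unfold cosh, sinh. auto_derive; auto. unfold Rminus; field.
    - apply is_derive_cont with (al * (al * cosh (al * v))). unfold cosh, sinh. auto_derive; auto. unfold Rminus; field. }
rewrite (aint_ldiff_real f (fun z => F (wmap t z)) (lft (cloop t c1 c2)) (fun v => - cosh (al * v)) (fun v => - (al * sinh (al * v)))) in CZ; auto.
2:{ intros z Hz; apply HL; right; right; right; auto. }
2:{ cbn [lft cloop lo hi pt]. intros v Hv. split; [|split].
    - rewrite wZ, FE, A1, sin_neg, cos_neg, sin_PI2, cos_PI2 by lra. unfold RtoC. f_equal; ring.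
    - unfold cosh, sinh. auto_derive; auto. unfold Rminus; field.
    - apply is_derive_cont with (- (al * (al * cosh (al * v)))). unfold cosh, sinh. auto_derive; auto. unfold Rminus; field. }
cbn [top cloop] in CZ.
rewrite (aint_ldiff_top f (fun z => F (wmap t z)) c1 c2 (fun x => sin (al * (x - c)) * cosh (L x)) (fun x => cos (al * (x - c)) * sinh (L x))
  (fun x => al * cos (al * (x - c)) * cosh (L x) + sin (al * (x - c)) * (al * t / x) * sinh (L x))
  (fun x => - (al * sin (al * (x - c)) * sinh (L x)) + cos (al * (x - c)) * (al * t / x) * cosh (L x))) in CZ; auto.
2:{ intros x Hx. assert (X0 : 0 < x) by (unfold umin in *; lra). split; [|split; [|split; [|split]]].
    - rewrite wmap_real, FE by auto. unfold L. rewrite <- Rmult_assoc. reflexivity.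
    - unfold L, cosh, sinh. auto_derive; auto. unfold Rminus; field. lra.
    - unfold L, cosh, sinh. auto_derive; auto. unfold Rminus; field. lra.
    - apply (ex_derive_continuous (V := R_NormedModule)). unfold L, cosh, sinh. auto_derive. repeat split; auto; lra.
    - apply (ex_derive_continuous (V := R_NormedModule)). unfold L, cosh, sinh. auto_derive. repeat split; auto; lra. }
assert (S0 : 0 <= 2 * PI * sumR (fun a => indic (inside t c1 c2 a) * snd (F (wmap t a))) l).
{ apply Rmult_le_pos; [pose proof PI_RGT_0; lra|]. apply sumR_nonneg. intros a _. unfold indic.
  destruct excluded_middle_informative as [[I1 [I2 I3]]|]; [|lra]. rewrite Rmult_1_l.
  destruct (wmap t a) as [u v]. cbn [fst snd] in *. rewrite FE. cbn [snd].
  apply Rmult_le_pos.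
  - apply cos_ge_0; [rewrite <- A1|rewrite <- A2]; apply Rmult_le_compat_l; lra.
  - rewrite <- sinh_0. left. apply sinh_lt. apply Rmult_lt_0_compat; lra. }
cbn [bot rgt lft cloop lo hi pt] in CZ. rewrite !Zmap_real in CZ by (auto; lra).
rewrite A1, A2, sin_neg, cos_neg, sin_PI2, cos_PI2, Rmult_0_r, cosh_0 in CZ.
assert (EL : forall x, al * (t * ln x) = L x) by (intros x; unfold L; ring).
rewrite !EL in CZ. unfold lnf. lra.
Qed.

Lemma Rabs_le_sum4 (a b c d A B C0 D : R) : Rabs a <= A -> Rabs b <= B -> Rabs c <= C0 -> Rabs d <= D ->
  Rabs (a - b + c + d) <= A + B + C0 + D.
Proof. intros. apply Rabs_le. repeat match goal with H : Rabs _ <= _ |- _ => apply Rabs_le_between in H end. lra. Qed.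

(* The weight [Im (w - w ^ 2 / (2 * c2)) = v * (1 - u / c2)] vanishes on [v = 0] and on [u = c2]. *)
Theorem Carleman_linear (f : C -> C) (t c1 : R) : 0 <= t -> umin t < c1 -> holo_lower f -> (forall s : R, f (RtoC s) <> RtoC 0) ->
  exists K : R, forall (g : C -> C) (l : list C) (c2 r : R), c1 <= c2 -> c2 + 2 * t * ln c2 <= r ->
  zeros_data f g l r -> (forall a, In a l -> generic t c1 c2 a) ->
  Rabs (2 * PI * sumR (fun a => indic (inside t c1 c2 a) * (snd (wmap t a) * (1 - fst (wmap t a) / c2))) l
     - (RInt (fun u => (1 - u / c2) * lnf t f u 0) c1 c2 + RInt (fun v => v / c2 * lnf t f c2 v) 0 (t * ln c2)
        - RInt (fun x => (1 - (x - t * t * ln x / x) / c2) * ln (Cmod (f (RtoC x)))) c1 c2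
        + RInt (fun x => (t / x * (1 - x / c2) - t * ln x / c2) * snd (ldiff_int f x)) c1 c2)) <= K.
Proof.
intros Ht Hc1 Hf Hn.
(* The left arc depends on t and c1 only, and on it the weight is w - w^2 / (2 c2), with bounded
   coefficients as c2 >= 1. Hence the constant can be fixed before c2 and the list of zeros. *)
set (gl := lft (cloop t c1 c1)).
set (k1 := Rabs (fst (aint (fun z => wmap t z * ldiff f z)%C gl))).
set (k2 := Rabs (fst (aint (fun z => (wmap t z * wmap t z) * ldiff f z)%C gl))).
set (u0 := Rabs (lnf t f c1 0)). set (f0 := Rabs (ln (Cmod (f (RtoC c1))))). set (a0 := Rabs (snd (ldiff_int f c1))).
assert (C1 : 1 <= c1) by (unfold umin in *; lra).
assert (L1 : 0 <= ln c1) by (apply ln_nonneg; auto).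
exists ((c1 + c1 * c1) * u0 + (c1 + c1 * c1 + t * t * (ln c1 * ln c1)) * f0 + t * ln c1 * a0 + (k1 + k2)).
intros g l c2 r H12 Hr [Hl [Hg [E Ng]]] Gen.
assert (C2 : 1 <= c2) by lra. assert (I2 : 0 < / (2 * c2) <= 1).
{ split; [apply Rinv_0_lt_compat; lra|]. rewrite <- Rinv_1. apply Rinv_le_contravar; lra. }
assert (I3 : 0 < / c2 <= 1).
{ split; [apply Rinv_0_lt_compat; lra|]. rewrite <- Rinv_1. apply Rinv_le_contravar; lra. }
set (F := fun w => (w - RtoC (/ (2 * c2)) * (w * w))%C).
set (F' := fun w => (RtoC 1 - RtoC (/ (2 * c2)) * (w + w))%C).
assert (HF : entire F F').
{ intros w. split.
  - eapply CDer_eq; [apply CDer_minus; [apply CDer_id|apply CDer_scal, CDer_mult; apply CDer_id]|]. cbv beta. unfold F'. ring.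
  - apply continuous_Cminus; [apply continuous_const|]. apply continuous_Cmult; [apply continuous_const|].
    apply continuous_Cplus; apply continuous_id. }
destruct (contour_zeros f g F F' l t c1 c2 r Ht Hc1 H12 Hr Hf Hn Hl Hg E Ng Gen HF) as [NL CZ].
assert (FE : forall u v, F (u, v) = (u - (u * u - v * v) / (2 * c2), v * (1 - u / c2))).
{ intros u v. unfold F. apply injective_projections; simpl; field; lra. }
assert (Lk := cloop_ok t c1 c2 Ht Hc1 H12). destruct Lk as [[K1 [K2 [K3 K4]]] _].
assert (HL : forall z, on_loop (cloop t c1 c2) z -> holomorphic_at f z /\ f z <> RtoC 0).
{ intros z Hz. split; [|apply NL, Hz]. apply Hf. apply (wmap_Zmap_on t c1 c2 z); auto. }
rewrite (sumR_ext _ (fun a => indic (inside t c1 c2 a) * snd (F (wmap t a)))).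
2:{ intros a _. destruct (wmap t a) as [u v]. rewrite FE. reflexivity. }
unfold lint in CZ. change (fst (?a + ?b - ?d - ?e)%C) with (fst a + fst b - fst d - fst e) in CZ.
rewrite (aint_ldiff_real f (fun z => F (wmap t z)) (bot (cloop t c1 c2)) (fun u => u - u * u / (2 * c2)) (fun u => 1 - u / c2)) in CZ; auto.
2:{ intros z Hz; apply HL; left; auto. }
2:{ cbn [bot cloop lo hi pt]. intros u Hu. split; [|split].
    - rewrite wZ, FE by lra. unfold RtoC. f_equal; field; lra.
    - auto_derive; auto. field. lra.
    - apply is_derive_cont with (- / c2). auto_derive; auto. field. lra. }
rewrite (aint_ldiff_real f (fun z => F (wmap t z)) (rgt (cloop t c1 c2)) (fun v => c2 / 2 + v * v / (2 * c2)) (fun v => v / c2)) in CZ; auto.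
2:{ intros z Hz; apply HL; right; left; auto. }
2:{ cbn [rgt cloop lo hi pt]. intros v Hv. split; [|split].
    - rewrite wZ, FE by lra. unfold RtoC. f_equal; field; lra.
    - auto_derive; auto. field. lra.
    - apply is_derive_cont with (/ c2). auto_derive; auto. field. lra. }
cbn [top cloop] in CZ.
rewrite (aint_ldiff_top f (fun z => F (wmap t z)) c1 c2 (fun x => x - (x * x - t * ln x * (t * ln x)) / (2 * c2)) (fun x => t * ln x * (1 - x / c2))
  (fun x => 1 - (x - t * t * ln x / x) / c2) (fun x => t / x * (1 - x / c2) - t * ln x / c2)) in CZ; auto.
2:{ intros x Hx. assert (X0 : 0 < x) by lra. split; [|split; [|split; [|split]]].
    - rewrite wmap_real, FE by auto. reflexivity.
    - auto_derive; auto. field. lra.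
    - auto_derive; auto. field. lra.
    - apply (ex_derive_continuous (V := R_NormedModule)). auto_derive. repeat split; auto; lra.
    - apply (ex_derive_continuous (V := R_NormedModule)). auto_derive. repeat split; auto; lra. }
assert (Cw : cont_on (on_arc gl) (wmap t)).
{ intros z Hz. assert (Hz' : on_loop (cloop t c1 c2) z) by (right; right; right; exact Hz).
  destruct (wmap_Zmap_on t c1 c2 z Ht Hc1 H12 Hz') as [O _]. unfold zmin in O.
  apply CDer_continuous with (1 := CDer_wmap t z ltac:(left; lra)). }
assert (Cd : cont_on (on_arc gl) (ldiff f)).
{ intros z Hz. destruct (HL z) as [H1 H2]; [right; right; right; exact Hz|]. apply continuous_ldiff; auto. }
change (lft (cloop t c1 c2)) with gl in CZ.
assert (LF : fst (aint (fun z => F (wmap t z) * ldiff f z)%C gl) =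
   fst (aint (fun z => wmap t z * ldiff f z)%C gl) - / (2 * c2) * fst (aint (fun z => (wmap t z * wmap t z) * ldiff f z)%C gl)).
{ rewrite (aint_ext _ (fun z => wmap t z * ldiff f z + RtoC (- / (2 * c2)) * ((wmap t z * wmap t z) * ldiff f z))%C); auto.
  - rewrite aint_plus, aint_scal; auto.
    + simpl. ring.
    + intros z Hz. apply continuous_Cmult; [apply continuous_Cmult|]; auto.
    + intros z Hz. apply continuous_Cmult; auto.
    + intros z Hz. apply continuous_Cmult; [apply continuous_const|]. apply continuous_Cmult; [apply continuous_Cmult|]; auto.
  - intros z Hz. unfold F. rewrite RtoC_opp. ring. }
rewrite LF in CZ. cbn [bot rgt cloop lo hi pt] in CZ. rewrite !Zmap_real in CZ by (auto; lra).
fold (lnf t f c1 0) in CZ. fold (lnf t f c2 0) in CZ.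
assert (B1 : Rabs ((c1 - c1 * c1 / (2 * c2)) * lnf t f c1 0) <= (c1 + c1 * c1) * u0).
{ rewrite Rabs_mult. apply Rmult_le_compat_r; [apply Rabs_pos|]. unfold Rdiv. apply Rabs_le. nra. }
assert (B2 : Rabs ((c1 - (c1 * c1 - t * ln c1 * (t * ln c1)) / (2 * c2)) * ln (Cmod (f (RtoC c1)))) <= (c1 + c1 * c1 + t * t * (ln c1 * ln c1)) * f0).
{ rewrite Rabs_mult. apply Rmult_le_compat_r; [apply Rabs_pos|]. unfold Rdiv.
  assert (0 <= t * t * (ln c1 * ln c1)) by (apply Rmult_le_pos; nra).
  replace (t * ln c1 * (t * ln c1)) with (t * t * (ln c1 * ln c1)) by ring. set (q := t * t * (ln c1 * ln c1)) in *.
  apply Rabs_le. nra. }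
assert (B3 : Rabs ((t * ln c1 * (1 - c1 / c2)) * snd (ldiff_int f c1)) <= t * ln c1 * a0).
{ rewrite Rabs_mult. apply Rmult_le_compat_r; [apply Rabs_pos|].
  assert (0 <= t * ln c1) by (apply Rmult_le_pos; auto).
  assert (0 <= c1 / c2 <= 1).
  { split; [apply Rdiv_le_0_compat; lra|]. apply Rmult_le_reg_r with c2; [lra|]. unfold Rdiv. rewrite Rmult_assoc, Rinv_l; lra. }
  rewrite Rabs_pos_eq; nra. }
assert (B4 : Rabs (fst (aint (fun z => wmap t z * ldiff f z)%C gl) - / (2 * c2) * fst (aint (fun z => (wmap t z * wmap t z) * ldiff f z)%C gl)) <= k1 + k2).
{ unfold Rminus. eapply Rle_trans; [apply Rabs_triang|]. apply Rplus_le_compat_l. rewrite Rabs_Ropp, Rabs_mult, (Rabs_pos_eq (/ (2 * c2))) by lra.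
  fold k2. assert (0 <= k2) by apply Rabs_pos. nra. }
eapply Rle_trans; [|apply (Rabs_le_sum4 _ _ _ _ _ _ _ _ B1 B2 B3 B4)]. right. f_equal.
unfold lnf in *.
assert (R1 : c2 - c2 * c2 / (2 * c2) = c2 / 2 + 0 * 0 / (2 * c2)) by (field; lra).
assert (R2 : c2 / 2 + t * ln c2 * (t * ln c2) / (2 * c2) = c2 - (c2 * c2 - t * ln c2 * (t * ln c2)) / (2 * c2)) by (field; lra).
assert (R3 : t * ln c2 * (1 - c2 / c2) = 0) by (field; lra).
rewrite R1, R2, R3 in CZ. lra.
Qed.

(** * Asymptotics of the boundary integrals *)

Notation ev := (Rbar_locally p_infty).

Lemma ev_ge (a : R) : ev (fun x => a <= x).
Proof. exists a. intros x Hx. lra. Qed.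

Lemma ln_le_pred (y : R) : 0 < y -> ln y <= y - 1.
Proof. intros H. pose proof (exp_ineq1_le (ln y)) as E. rewrite exp_ln in E by auto. lra. Qed.

Lemma ev_ln_le (e : R) : 0 < e -> ev (fun x => ln x <= e * x).
Proof.
intros He. exists (Rmax 1 (2 / e * ln (2 / e))). intros x Hx.
assert (X1 := Rle_lt_trans _ _ _ (Rmax_l _ _) Hx). assert (X2 := Rle_lt_trans _ _ _ (Rmax_r _ _) Hx).
assert (P2 : 0 < 2 / e) by (apply Rdiv_lt_0_compat; lra).
replace x with ((e * x / 2) * (2 / e)) at 1 by (field; lra).
assert (0 < e * x / 2) by (apply Rdiv_lt_0_compat; nra).
rewrite ln_mult by auto.
assert (L := ln_le_pred (e * x / 2) ltac:(auto)).
apply Rmult_lt_compat_l with (r := e / 2) in X2; [|lra].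
replace (e / 2 * (2 / e * ln (2 / e))) with (ln (2 / e)) in X2 by (field; lra). lra.
Qed.

Lemma ev_ln_ge (a : R) : ev (fun x => a <= ln x).
Proof.
exists (exp a). intros x Hx. rewrite <- (ln_exp a). apply ln_le; [apply exp_pos|lra].
Qed.

Lemma Arg_lower (z : C) : 0 < fst z -> snd z <= 0 -> - 2 <= Arg z <= 0.
Proof.
intros H1 H2. split; [apply Arg_right'; auto|apply Arg_neg; auto; left; auto].
Qed.

(** The condition 0 <= B covers the case c = 0, where [ln 0] is 0 by default. *)
Lemma ln_pos_Cmod (c : C) (B : R) : 0 <= B -> Cmod c <= exp B -> ln (Cmod c) <= B.
Proof.
intros HB H. destruct (Rle_lt_or_eq_dec 0 _ (Cmod_ge_0 c)) as [P|<-].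
- rewrite <- (ln_exp B). apply ln_le; auto.
- unfold ln. destruct (Rlt_dec 0 0) as [T|T]; [exfalso; lra|exact HB].
Qed.

(** The points in question have abscissa at most u and depth at most 2 t ln u, so that the factor 1
    + y of [growth_strip] becomes a logarithm. *)
Lemma lnf_upper (k : nat) (f : C -> C) (t : R) : class_F (S k) f -> 0 <= t ->
  exists C0, 0 < C0 /\ ev (fun u => forall v, 0 <= v <= t * ln u -> lnf t f u v <= C0 * (u ^ k * ln u)).
Proof.
intros HF Ht. destruct (growth_strip k f HF) as [A [HA [x0 [Hx0 HG]]]].
exists (A * (1 + 2 * t)). split; [nra|].
assert (E1 : 0 < / (8 * (t + 1))) by (apply Rinv_0_lt_compat; lra).
generalize (filter_and _ _ (ev_ln_le _ E1) (filter_and _ _ (ev_ln_ge 1) (ev_ge (8 * t + 2 * x0 + 2)))).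
apply filter_imp. intros u [L1 [L2 L3]] v Hv.
assert (T1 : t * ln u <= u / 8).
{ apply Rmult_le_compat_l with (r := t) in L1; auto. eapply Rle_trans; [exact L1|].
  replace (t * (/ (8 * (t + 1)) * u)) with (t / (t + 1) * (u / 8)) by (field; lra).
  rewrite <- (Rmult_1_l (u / 8)) at 2. apply Rmult_le_compat_r; [lra|].
  apply Rmult_le_reg_r with (t + 1); [lra|]. unfold Rdiv. rewrite Rmult_assoc, Rinv_l; lra. }
assert (Hu : umin t <= u) by (unfold umin; lra).
assert (N := Zmap_near t u v Ht Hu Hv). destruct (Zmap_spec t (u, v) Ht Hu) as [S1 S2].
assert (S3 := Zmap_lower t u v Ht Hu ltac:(lra)).
assert (F2 := Rle_trans _ _ _ (Rabs_snd_le _) N). change (snd (Zmap t (u, v) - RtoC u)%C) with (snd (Zmap t (u, v)) - 0) in F2.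
rewrite Rminus_0_r, Rabs_left1 in F2 by auto.
assert (E := wmap_fst t (Zmap t (u, v))). rewrite S2 in E. cbn [fst] in E.
unfold zmin in S1. assert (S0 : 0 < fst (Zmap t (u, v))) by lra. assert (Ar := Arg_lower _ S0 S3).
unfold lnf. set (z := Zmap t (u, v)) in *.
assert (Hx : u - 2 * t <= fst z <= u) by nra.
apply ln_pos_Cmod.
- repeat apply Rmult_le_pos; try lra. apply pow_le; lra.
- assert (K := HG (fst z) (- snd z) ltac:(lra) ltac:(lra)).
  rewrite Ropp_involutive, <- surjective_pairing in K. eapply Rle_trans; [exact K|]. apply exp_mono.
  assert (PP : fst z ^ k <= u ^ k) by (apply pow_incr; lra).
  assert (P0 : 0 <= fst z ^ k) by (apply pow_le; lra).
  replace (A * (1 + 2 * t) * (u ^ k * ln u)) with (A * u ^ k * (ln u + 2 * t * ln u)) by ring.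
  apply Rmult_le_compat; [apply Rmult_le_pos; lra|lra| |lra].
  apply Rmult_le_compat_l; lra.
Qed.

Lemma is_lim_mult_fin (f g : R -> R) (a b : R) : is_lim f p_infty a -> is_lim g p_infty b ->
  is_lim (fun u => f u * g u) p_infty (a * b).
Proof. intros Hf Hg. exact (is_lim_mult f g p_infty a b Hf Hg I). Qed.

Lemma is_lim_pow_1 (q : R -> R) (k : nat) : is_lim q p_infty 1 -> is_lim (fun u => q u ^ k) p_infty 1.
Proof.
intros H. induction k as [|k IH]; simpl; [apply is_lim_const|].
replace (Finite 1) with (Finite (1 * 1)) by (f_equal; ring). apply is_lim_mult_fin; auto.
Qed.

(** At a zero of f [growth] takes the value [m_infty], so a finite limit excludes zeros far out on
    the curve. *)
Lemma growth_eps (k : nat) (f : C -> C) (t l : R) :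
  filterlim (growth (S k) f) (log_curve t) (Rbar_nbhds (Finite l)) ->
  forall e, 0 < e -> exists M, forall z, M < Cmod z -> 0 < fst z -> snd (wmap t z) = 0 ->
    f z <> RtoC 0 /\ Rabs (ln (Cmod (f z)) / (Cmod z ^ k * ln (Cmod z)) - l) < e.
Proof.
intros H e He.
assert (HP : Rbar_nbhds (Finite l) (fun y => exists x, y = Finite x /\ Rabs (x - l) < e)).
{ exists (mkposreal e He). intros y Hy. exists y. split; auto. }
specialize (H _ HP). destruct H as [M HM]. exists (Rmax 1 M). intros z Hz Hx Hw.
assert (Z1 := Rle_lt_trans _ _ _ (Rmax_l _ _) Hz). assert (Z2 := Rle_lt_trans _ _ _ (Rmax_r _ _) Hz).
rewrite wmap_snd in Hw.
destruct (HM z Z2) as [x [Ex Dx]]. { split; [unfold Im; lra|exact Hx]. }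
unfold growth, log_abs in Ex. rewrite Nat.sub_succ, Nat.sub_0_r in Ex.
assert (Pd : 0 < Cmod z ^ k * ln (Cmod z)).
{ apply Rmult_lt_0_compat; [apply pow_lt; lra|]. rewrite <- ln_1. apply ln_increasing; lra. }
assert (Pi := Rinv_0_lt_compat _ Pd).
destruct (Req_EM_T (Cmod (f z)) 0) as [E0|N0].
- exfalso. unfold Rbar_div, Rbar_inv, Rbar_mult, Rbar_mult' in Ex.
  destruct (Rle_dec 0 (/ (Cmod z ^ k * ln (Cmod z)))) as [h|h]; [|lra].
  destruct (Rle_lt_or_eq_dec 0 (/ (Cmod z ^ k * ln (Cmod z))) h) as [h'|h']; [discriminate|lra].
- split. { intros E. apply N0. rewrite E. apply Cmod_0. }
  simpl in Ex. injection Ex as Ex. unfold Rdiv. rewrite Ex. exact Dx.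
Qed.

(** The hypothesis is normalized by |z| and the integrals by u = Re w; both normalizations have the
    same limit because |z| - u = O(ln u). *)
Lemma lnf_bottom (k : nat) (f : C -> C) (t l : R) : 0 <= t ->
  filterlim (growth (S k) f) (log_curve t) (Rbar_nbhds (Finite l)) ->
  is_lim (fun u => lnf t f u 0 / (u ^ k * ln u)) p_infty l.
Proof.
intros Ht H. assert (G := growth_eps k f t l H).
set (m := fun u => Cmod (Zmap t (u, 0))).
assert (Near : ev (fun u => u - 2 * t * ln u <= m u <= u + 2 * t * ln u /\ 1 <= ln u /\ umin t <= u)).
{ generalize (filter_and _ _ (ev_ge (umin t)) (ev_ln_ge 1)). apply filter_imp. intros u [Hu Hl]. split; auto.
  assert (N := Zmap_near t u 0 Ht Hu ltac:(split; [lra|apply Rmult_le_pos; lra])).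
  assert (T1 := Cmod_triangle (Zmap t (u, 0) - RtoC u) (RtoC u)).
  replace (Zmap t (u, 0) - RtoC u + RtoC u)%C with (Zmap t (u, 0)) in T1 by ring.
  assert (T2 := Cmod_triangle (- (Zmap t (u, 0) - RtoC u)) (Zmap t (u, 0))). rewrite Cmod_opp in T2.
  replace (- (Zmap t (u, 0) - RtoC u) + Zmap t (u, 0))%C with (RtoC u) in T2 by ring.
  rewrite Cmod_R, Rabs_pos_eq in T1, T2 by (unfold umin in *; lra). unfold m. lra. }
assert (Q : is_lim (fun u => m u / u) p_infty 1).
{ assert (LL : is_lim (fun u => 2 * t * (ln u / u)) p_infty 0).
  { replace (Finite 0) with (Rbar_mult (2 * t) 0) by (simpl; f_equal; ring). apply is_lim_scal_l, is_lim_div_ln_p. }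
  apply (is_lim_le_le_loc (fun u => 1 - 2 * t * (ln u / u)) (fun u => 1 + 2 * t * (ln u / u))).
  - generalize Near. apply filter_imp. intros u [[N1 N2] [_ N3]]. unfold umin in N3.
    split; apply Rmult_le_reg_r with u; try lra; unfold Rdiv; rewrite ?Rmult_plus_distr_r, ?Rmult_minus_distr_r;
      rewrite ?Rmult_assoc, ?Rinv_l by lra; lra.
  - replace (Finite 1) with (Finite (1 - 0)) by (f_equal; ring). apply is_lim_minus'; [apply is_lim_const|exact LL].
  - replace (Finite 1) with (Finite (1 + 0)) by (f_equal; ring). apply is_lim_plus'; [apply is_lim_const|exact LL]. }
assert (LQ : is_lim (fun u => ln (m u / u)) p_infty 0).
{ rewrite <- ln_1. apply (is_lim_comp_continuous (fun u => m u / u) ln p_infty 1); [exact Q|].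
  apply continuity_pt_filterlim. apply derivable_continuous_pt. exists (/ 1). apply derivable_pt_lim_ln; lra. }
assert (LI : is_lim (fun u => / ln u) p_infty 0).
{ apply (is_lim_inv ln p_infty p_infty); [apply is_lim_ln_p|discriminate]. }
assert (LR : is_lim (fun u => 1 + ln (m u / u) * / ln u) p_infty 1).
{ replace (Finite 1) with (Finite (1 + 0 * 0)) by (f_equal; ring). apply is_lim_plus'; [apply is_lim_const|].
  apply is_lim_mult_fin; auto. }
assert (LG : is_lim (fun u => lnf t f u 0 / (m u ^ k * ln (m u))) p_infty l).
{ apply is_lim_spec. intros e. destruct (G e (cond_pos e)) as [M HM].
  assert (Big : ev (fun u => M < m u)).
  { assert (I4 : 0 < / (4 * (t + 1))) by (apply Rinv_0_lt_compat; lra).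
    generalize (filter_and _ _ Near (filter_and _ _ (ev_ln_le _ I4) (ev_ge (2 * Rabs M + 2)))).
    apply filter_imp. intros u [[[N1 _] [N2 N3]] [N4 N5]].
    apply Rmult_le_compat_l with (r := 2 * (t + 1)) in N4; [|lra].
    replace (2 * (t + 1) * (/ (4 * (t + 1)) * u)) with (u / 2) in N4 by (field; lra).
    pose proof (Rle_abs M). lra. }
  generalize (filter_and _ _ Near Big). apply filter_imp. intros u [[_ [_ Hu]] HB].
  destruct (Zmap_spec t (u, 0) Ht Hu) as [S1 S2]. unfold zmin in S1.
  destruct (HM (Zmap t (u, 0)) HB ltac:(lra)) as [_ D]; [rewrite S2; reflexivity|]. exact D. }
apply is_lim_ext_loc with (fun u => lnf t f u 0 / (m u ^ k * ln (m u)) * ((m u / u) ^ k * (1 + ln (m u / u) * / ln u))).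
- apply is_lim_spec in Q. specialize (Q (mkposreal (/ 2) ltac:(lra))). cbn [pos] in Q.
  assert (Big : ev (fun u => 1 < m u)).
  { generalize (filter_and _ _ Q (ev_ge 4)). apply filter_imp. intros u [Qu Hu]. simpl in Qu. apply Rabs_def2 in Qu.
    assert (m u / u * u > / 2 * u) by (apply Rmult_gt_compat_r; lra). unfold Rdiv in H0. rewrite Rmult_assoc, Rinv_l in H0; lra. }
  generalize (filter_and _ _ Near Big). apply filter_imp. intros u [[_ [N2 N3]] HB]. unfold umin in N3.
  assert (0 < ln (m u)) by (rewrite <- ln_1; apply ln_increasing; lra).
  assert (E : ln (m u / u) = ln (m u) - ln u).
  { unfold Rdiv. rewrite ln_mult, ln_Rinv by (try apply Rinv_0_lt_compat; lra). ring. }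
  rewrite E. unfold Rdiv. rewrite Rpow_mult_distr, pow_inv. field.
  repeat split; try lra; apply pow_nonzero; lra.
- replace (Finite l) with (Finite (l * (1 * 1))) by (f_equal; ring).
  apply is_lim_mult_fin; auto. apply is_lim_mult_fin; auto. apply is_lim_pow_1; auto.
Qed.

(** * Estimate of the right side of the contour *)

Lemma avoid (s : list R) : forall a b, a < b -> exists c, a < c < b /\ ~ In c s.
Proof.
induction s as [|x s IH]; intros a b Hab.
- exists ((a + b) / 2). split; [lra|intros []].
- destruct (Rle_or_lt x ((a + b) / 2)) as [H|H].
  + destruct (IH ((a + b) / 2) b) as [c [Hc1 Hc2]]; [lra|]. exists c. split; [lra|]. intros [E|E]; [lra|auto].
  + destruct (IH a ((a + b) / 2)) as [c [Hc1 Hc2]]; [lra|]. exists c. split; [lra|]. intros [E|E]; [lra|auto].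
Qed.

Lemma ev_sqrt (P : R -> Prop) : ev P -> ev (fun r => P (sqrt r)).
Proof.
intros [M HM]. exists (M * M). intros r Hr. apply HM.
destruct (Rlt_le_dec M 0) as [L|L]; [pose proof (sqrt_pos r); lra|].
rewrite <- (sqrt_square M) by auto. apply sqrt_lt_1; nra.
Qed.

Lemma RInt_le_cst (f : R -> R) (a b M : R) : a <= b -> ex_RInt f a b -> (forall s, a <= s <= b -> f s <= M) ->
  RInt f a b <= M * (b - a).
Proof.
intros Hab Hf H.
assert (E : RInt (fun _ => M) a b = M * (b - a)).
{ rewrite (RInt_const (V := R_CompleteNormedModule)). unfold scal; simpl. unfold mult; simpl. ring. }
rewrite <- E. apply RInt_le; auto. apply ex_RInt_const. intros; apply H; lra.
Qed.

Lemma RInt_ge_cst (f : R -> R) (a b M : R) : a <= b -> ex_RInt f a b -> (forall s, a <= s <= b -> M <= f s) ->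
  M * (b - a) <= RInt f a b.
Proof.
intros Hab Hf H.
assert (E : RInt (fun _ => M) a b = M * (b - a)).
{ rewrite (RInt_const (V := R_CompleteNormedModule)). unfold scal; simpl. unfold mult; simpl. ring. }
rewrite <- E. apply RInt_le; auto. apply ex_RInt_const. intros; apply H; lra.
Qed.

Lemma RInt_abs_cst (f : R -> R) (a b M : R) : a <= b -> ex_RInt f a b -> (forall s, a <= s <= b -> Rabs (f s) <= M) ->
  Rabs (RInt f a b) <= M * (b - a).
Proof.
intros Hab Hf H. apply Rabs_le. split.
- rewrite Ropp_mult_distr_l. apply RInt_ge_cst; auto. intros s Hs. specialize (H s Hs). apply Rabs_le_between in H. lra.
- apply RInt_le_cst; auto. intros s Hs. specialize (H s Hs). apply Rabs_le_between in H. lra.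
Qed.

Lemma lnf_cont (f : C -> C) (t u v : R) : 0 <= t -> holo_lower f -> umin t < u -> v <= t * ln u -> f (Zmap t (u, v)) <> RtoC 0 ->
  Rcont (fun s => lnf t f s v) u /\ Rcont (fun s => lnf t f u s) v.
Proof.
intros Ht Hf Hu Hv N. assert (Hl := Hf _ (Zmap_lower t u v Ht (Rlt_le _ _ Hu) Hv)).
assert (D : CDer (Zmap t) (u, v) (dZmap t (u, v))) by (apply CDer_Zmap; auto).
split.
- exact (is_derive_cont _ _ _ (is_derive_ln_path f (fun s => Zmap t (s, v)) u _ Hl N
    (PDer_comp (Zmap t) (fun s => (s, v) : C) u _ _ D (PDer_horizontal v u)))).
- exact (is_derive_cont _ _ _ (is_derive_ln_path f (fun s => Zmap t (u, s)) v _ Hl N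
    (PDer_comp (Zmap t) (fun s => (u, s) : C) v _ _ D (PDer_vertical u v)))).
Qed.

Lemma cloop_lnf_cont (f g : C -> C) (l : list C) (t c1 c2 r : R) : 0 <= t -> umin t < c1 -> c1 <= c2 ->
  c2 + 2 * t * ln c2 <= r -> holo_lower f -> (forall s : R, f (RtoC s) <> RtoC 0) ->
  zeros_data f g l r -> (forall a, In a l -> generic t c1 c2 a) ->
  (forall u, c1 <= u <= c2 -> Rcont (fun s => lnf t f s 0) u) /\
  (forall v, 0 <= v <= t * ln c2 -> Rcont (fun s => lnf t f c2 s) v) /\
  (forall v, 0 <= v <= t * ln c1 -> Rcont (fun s => lnf t f c1 s) v).
Proof.
intros Ht H1 H2 Hr Hf Hn [Hl [Hg [E Ng]]] Gen.
destruct (contour_zeros f g (fun w => w) (fun _ => RtoC 1) l t c1 c2 r Ht H1 H2 Hr Hf Hn Hl Hg E Ng Gen) as [NL _].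
{ intros z. split; [apply CDer_id|apply continuous_const]. }
unfold umin in H1.
split; [|split]; intros s Hs.
- apply (lnf_cont f t s 0); auto; try (unfold umin; lra).
  + apply Rmult_le_pos; auto. apply ln_nonneg; lra.
  + apply NL. left. exists s; auto.
- apply (lnf_cont f t c2 s); auto; try (unfold umin; lra). apply NL. right; left. exists s; auto.
- apply (lnf_cont f t c1 s); auto; try (unfold umin; lra). apply NL. right; right; right. exists s; auto.
Qed.

Lemma sinh_ge (x : R) : 0 <= x -> x <= sinh x.
Proof.
intros [H| <-]; [|rewrite sinh_0; lra].
destruct (MVT_gen (fun y => sinh y - y) 0 x (fun y => cosh y - 1)) as [y [Hy E]].
- intros y _. unfold sinh, cosh. auto_derive; auto. field.
- intros y _. apply derivable_continuous_pt. apply derivable_pt_minus; [apply derivable_pt_sinh|apply derivable_pt_id].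
- rewrite sinh_0 in E. assert (1 <= cosh y).
  { unfold cosh. assert (P := exp_pos y). rewrite exp_Ropp.
    assert (exp y * / exp y = 1) by (apply Rinv_r; lra). assert (0 < / exp y) by (apply Rinv_0_lt_compat; auto).
    pose proof (Rle_0_sqr (exp y - / exp y)) as Q. unfold Rsqr in Q. nra. }
  nra.
Qed.

Lemma cosh_sinh_le2 (x : R) : 0 <= x <= 1 -> 0 <= sinh x <= 2 /\ 0 <= cosh x <= 2.
Proof.
intros H. assert (E1 : exp x <= 3) by (eapply Rle_trans; [apply exp_mono; apply H|apply exp_le_3]).
assert (E2 : exp (- x) <= 1) by (rewrite <- exp_0; apply exp_mono; lra).
pose proof (exp_pos x). pose proof (exp_pos (- x)). pose proof (sinh_ge x ltac:(lra)). unfold sinh, cosh in *. lra.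
Qed.

Lemma pow_ln_mono (k : nat) (x y : R) : 1 <= x <= y -> x ^ k * ln x <= y ^ k * ln y.
Proof.
intros H. apply Rmult_le_compat; [apply pow_le; lra|apply ln_nonneg; lra|apply pow_incr; lra|apply ln_le; lra].
Qed.

(** Non-vanishing of f on the curve beyond the abscissa [cs], which makes the curved side a
    legitimate path; a finite limit of [growth] provides it. *)
Definition curve_free (f : C -> C) (t cs : R) : Prop :=
  forall z, zmin t <= fst z -> cs <= fst (wmap t z) -> snd (wmap t z) = 0 -> f z <> RtoC 0.

(* The sum over the zeros in Carleman_sine is nonnegative and every other term is bounded above by a multiple of
   [r ^ k * ln r]; hence so is minus the integral over the right side. *)
Lemma side_bound (k : nat) (f : C -> C) (t cs : R) : class_F (S k) f -> 0 <= t -> curve_free f t cs ->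
  exists C3, 0 < C3 /\ ev (fun r => forall R l g, r + 2 * t * ln r <= R -> zeros_data f g l R ->
    (forall a, In a l -> zmin t <= fst a -> 0 <= snd (wmap t a) -> fst (wmap t a) <> r) ->
    Rabs (RInt (fun v => v / r * lnf t f r v) 0 (t * ln r)) <= C3 * (r ^ k * ln r)).
Proof.
intros HF Ht HC. destruct (class_F_holo _ _ HF) as [Hf Hn].
destruct (lnf_upper k f t HF Ht) as [C0 [HC0 [X1 HU]]].
destruct (growth_real k f HF) as [A [HA [X2 [HX2 HR]]]].
(* The multiples 4, 2, 2 of [C0] come from the lower, right and left sides, and 16 + 16 multiples of
   [A] from the real axis. The factor 2 exceeds 16 / 9, since al^2 r >= 9 / 16. *)
exists (2 * (8 * C0 + 32 * A)). split; [lra|].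
assert (I4 : 0 < / (4 * (t + 1))) by (apply Rinv_0_lt_compat; lra).
set (X0 := 1 + Rabs X1 + X2 + Rabs cs + umin t).
generalize (filter_and _ _ (ev_sqrt _ (filter_and _ _ (ev_ln_le _ I4) (ev_ge 8))) (filter_and _ _ (ev_ge (2 * X0)) (ev_ln_ge 1))).
apply filter_imp. intros r [[S1 S2] [R1 R2]] R l g HRr HZ Gr.
pose proof (Rle_abs X1). pose proof (Rle_abs cs). pose proof (Rabs_pos X1). pose proof (Rabs_pos cs).
assert (U1 : 1 <= umin t) by (unfold umin; lra). unfold X0 in R1.
set (s := sqrt r) in *. assert (Es : s * s = r) by (apply sqrt_sqrt; lra).
assert (T1 : t * ln r <= s / 2).
{ rewrite <- Es at 1. rewrite ln_mult by lra.
  apply Rmult_le_compat_l with (r := 4 * (t + 1)) in S1; [|lra].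
  replace (4 * (t + 1) * (/ (4 * (t + 1)) * s)) with s in S1 by (field; lra).
  assert (0 <= ln s) by (apply ln_nonneg; lra). lra. }
assert (T0 : 0 <= t * ln r) by (apply Rmult_le_pos; lra).
(* A half-width h of order sqrt r meets two demands: al t ln r <= 1, so that sinh and cosh stay
   bounded, and al^2 r bounded below, so that the weight v / r can be recovered from al sinh (al v).
   The values avoided would put a zero on the line u = r - 2 h. *)
destruct (avoid (map (fun a => (r - fst (wmap t a)) / 2) l) s (2 * s)) as [h [Hh Av]]; [lra|].
set (al := PI / (2 * h)).
assert (Pi1 : 3 <= PI) by (pose proof PI2_3_2; lra). assert (Pi2 := PI_4).
assert (Hal : al * (2 * h) = PI) by (unfold al; field; lra).
assert (Hal0 : 0 < al) by (apply Rdiv_lt_0_compat; lra).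
assert (Hal1 : al * s <= 2) by nra.
assert (Hal2 : 9 <= 16 * (al * al * r)).
{ rewrite <- Es. assert (3 <= 4 * (al * s)) by nra. nra. }
assert (HV : al * (t * ln r) <= 1) by nra.
assert (Hc : r - 2 * h >= r / 2) by nra.
set (G := r ^ k * ln r).
assert (Pk : 1 <= r ^ k) by (apply pow_ge1; lra).
assert (HG : r ^ k <= G) by (unfold G; nra).
assert (Gen : forall a, In a l -> generic t (r - h - h) (r - h + h) a).
{ intros a Ha La Va. replace (r - h + h) with r by ring. split; [|split; [apply Gr; auto|]].
  - intros E. apply Av. apply in_map_iff. exists a. split; auto. rewrite E. field.
  - intros Hu E. apply (HC a); auto; [lra|]. destruct HZ as [_ [_ [EE _]]]. rewrite EE, prodz_root by auto. ring. }
assert (Hr' : r - h + h + 2 * t * ln (r - h + h) <= R) by (replace (r - h + h) with r by ring; exact HRr).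
assert (Hum : umin t < r - h - h) by lra.
assert (CS := Carleman_sine f g l t (r - h) h R Ht Hum ltac:(lra) Hr' Hf Hn HZ Gen).
destruct (cloop_lnf_cont f g l t (r - h - h) (r - h + h) R Ht Hum ltac:(lra) Hr' Hf Hn HZ Gen) as [Cb [Cr Cl]].
cbv zeta in CS. fold al in CS. clearbody al. replace (r - h + h) with r in * by ring. set (c1 := r - h - h) in *.
assert (Hc1 : r / 2 <= c1 <= r) by (unfold c1; lra).
assert (UB : forall u v, c1 <= u <= r -> 0 <= v <= t * ln u -> lnf t f u v <= C0 * G).
{ intros u v Hu Hv. eapply Rle_trans; [apply HU; [lra|auto]|]. apply Rmult_le_compat_l; [lra|]. apply pow_ln_mono; lra. }
assert (LM : forall u, c1 <= u <= r -> 0 <= ln u <= ln r).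
{ intros u Hu. split; [apply ln_nonneg; lra|apply ln_le; lra]. }
assert (AR : forall x, c1 <= x <= r -> Rabs (ln (Cmod (f (RtoC x)))) <= A * G /\ Rabs (snd (ldiff_int f x)) <= A * G).
{ intros x Hx. destruct (HR x ltac:(lra)) as [K1 K2].
  assert (A * x ^ k <= A * G); [|lra]. apply Rmult_le_compat_l; [lra|]. eapply Rle_trans; [apply pow_incr|exact HG]. lra. }
assert (TG : forall x, c1 <= x <= r -> 0 <= al * t * ln x <= 1 /\ 0 <= t / x <= 1 /\
   0 <= sinh (al * t * ln x) <= 2 /\ 0 <= cosh (al * t * ln x) <= 2).
{ intros x Hx. destruct (LM x Hx) as [L1 L2].
  assert (K : 0 <= al * t * ln x <= 1).
  { split; [repeat apply Rmult_le_pos; lra|]. apply Rle_trans with (al * (t * ln r)); [|exact HV].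
    rewrite Rmult_assoc. apply Rmult_le_compat_l; [lra|]. apply Rmult_le_compat_l; lra. }
  split; [exact K|]. split; [|apply cosh_sinh_le2; exact K].
  split; [apply Rdiv_le_0_compat; lra|]. apply Rmult_le_reg_r with x; [lra|]. unfold Rdiv. rewrite Rmult_assoc, Rinv_l; unfold umin in *; lra. }
assert (Gpos : 0 <= G) by lra. assert (CG : 0 <= C0 * G) by (apply Rmult_le_pos; lra). assert (AG : 0 <= A * G) by (apply Rmult_le_pos; lra).
set (B1 := RInt _ c1 r) in CS.
assert (Bd1 : B1 <= 4 * (C0 * G)).
{ apply Rle_trans with (al * (C0 * G) * (r - c1)).
  - apply RInt_le_cst; [lra| |].
    + apply ex_RInt_cont; [lra|]. intros u Hu. apply Rcont_mult; [|apply Cb; auto].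
      apply (ex_derive_continuous (V := R_NormedModule)). auto_derive. auto.
    + intros u Hu. assert (Co : 0 <= cos (al * (u - (r - h))) <= 1).
      { split; [apply cos_ge_0; unfold c1 in *; nra|apply COS_bound]. }
      destruct (LM u Hu) as [LL _].
      specialize (UB u 0 Hu ltac:(split; [lra|apply Rmult_le_pos; auto])).
      apply Rle_trans with (al * cos (al * (u - (r - h))) * (C0 * G)).
      * apply Rmult_le_compat_l; auto. apply Rmult_le_pos; lra.
      * rewrite !Rmult_assoc. apply Rmult_le_compat_l; [lra|]. nra.
  - replace (al * (C0 * G) * (r - c1)) with (al * (2 * h) * (C0 * G)) by (unfold c1; ring). rewrite Hal.
    apply Rmult_le_compat_r; lra. }
clearbody B1. set (B2 := RInt _ 0 (t * ln r)) in CS. set (I := RInt (fun v => v / r * lnf t f r v) 0 (t * ln r)).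
assert (Ex2 : ex_RInt (fun v => v / r * lnf t f r v) 0 (t * ln r)).
{ apply ex_RInt_cont; auto. intros v Hv. apply Rcont_mult; [|apply Cr; auto].
  apply (ex_derive_continuous (V := R_NormedModule)). auto_derive. auto. }
(* The excess sinh x - x lies between 0 and 2 here, and ln |f| is bounded above, so replacing sinh
   (al v) by al v costs only a multiple of [C0 * G]. *)
assert (Bd2 : B2 <= al * al * r * I + 2 * (C0 * G)).
{ assert (P := RInt_plus (V := R_CompleteNormedModule) (fun v => al * al * r * (v / r * lnf t f r v)) (fun _ => 2 * al * (C0 * G)) 0 (t * ln r)).
  assert (Q := RInt_scal (V := R_CompleteNormedModule) (fun v => v / r * lnf t f r v) 0 (t * ln r) (al * al * r) Ex2).
  assert (Ex3 : ex_RInt (fun v => al * al * r * (v / r * lnf t f r v)) 0 (t * ln r)).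
  { apply (ex_RInt_scal (V := R_NormedModule)); auto. }
  specialize (P Ex3 (ex_RInt_const _ _ _)). rewrite RInt_const in P.
  change (RInt (fun v => al * al * r * (v / r * lnf t f r v)) 0 (t * ln r) = al * al * r * I) in Q.
  rewrite Q in P. change (scal ?x ?y) with (x * y) in P. change (plus ?x ?y) with (x + y) in P.
  apply Rle_trans with (al * al * r * I + (t * ln r - 0) * (2 * al * (C0 * G))).
  - rewrite <- P. apply RInt_le; auto.
    + apply ex_RInt_cont; auto. intros v Hv. apply Rcont_mult; [|apply Cr; auto].
      apply (ex_derive_continuous (V := R_NormedModule)). unfold sinh. auto_derive. auto.
    + apply (ex_RInt_plus (V := R_NormedModule)); auto. apply ex_RInt_const.
    + intros v Hv. specialize (UB r v ltac:(lra) ltac:(lra)). set (y := lnf t f r v) in *.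
      assert (K : 0 <= al * v <= 1) by (split; nra).
      assert (Sg := sinh_ge (al * v) ltac:(lra)). destruct (cosh_sinh_le2 _ K) as [Sl _].
      replace (al * al * r * (v / r * y)) with (al * ((al * v) * y)) by (field; lra).
      assert (sinh (al * v) * y <= al * v * y + 2 * (C0 * G)) by nra. nra.
  - assert (al * (t * ln r) * (2 * (C0 * G)) <= 1 * (2 * (C0 * G))) by (apply Rmult_le_compat_r; lra). lra. }
clearbody B2. set (B3 := RInt _ 0 (t * ln c1)) in CS.
destruct (LM c1 ltac:(lra)) as [Lc1 Lc2].
assert (Hc1V : 0 <= t * ln c1 <= t * ln r) by (split; [apply Rmult_le_pos; auto|apply Rmult_le_compat_l; auto]).
assert (Bd3 : - (2 * (C0 * G)) <= B3).
{ apply Rle_trans with (- (2 * al * (C0 * G)) * (t * ln c1 - 0)).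
  - assert (al * (t * ln c1) * (2 * (C0 * G)) <= 1 * (2 * (C0 * G))) by (apply Rmult_le_compat_r; nra). lra.
  - apply RInt_ge_cst; [lra| |].
    + apply ex_RInt_cont; [lra|]. intros v Hv. apply Rcont_mult; [|apply Cl; auto].
      apply (ex_derive_continuous (V := R_NormedModule)). unfold sinh. auto_derive. auto.
    + intros v Hv. specialize (UB c1 v ltac:(lra) ltac:(lra)). set (y := lnf t f c1 v) in *.
      assert (K : 0 <= al * v <= 1) by (split; nra). destruct (cosh_sinh_le2 _ K) as [Sl _].
      assert (al * sinh (al * v) * y <= al * 2 * (C0 * G)); [|lra].
      apply Rle_trans with (al * sinh (al * v) * (C0 * G)).
      * apply Rmult_le_compat_l; auto. apply Rmult_le_pos; lra.
      * apply Rmult_le_compat_r; auto. apply Rmult_le_compat_l; lra. }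
clearbody B3. set (B4 := RInt _ c1 r) in CS. set (B5 := RInt _ c1 r) in CS.
assert (EX : forall x, c1 <= x <= r -> forall p q, Rabs p <= 1 -> Rabs q <= 1 -> forall m n, 0 <= m <= 2 -> 0 <= n <= 2 ->
   Rabs (al * p * m + q * (al * t / x) * n) <= 4 * al).
{ intros x Hx p q Hp Hq m n Hm Hn'. destruct (TG x Hx) as [_ [Tx _]].
  replace (al * p * m + q * (al * t / x) * n) with (al * (p * m + q * (t / x) * n)) by (field; lra).
  rewrite Rabs_mult, (Rabs_pos_eq al), Rmult_comm by lra. apply Rmult_le_compat_r; [lra|].
  eapply Rle_trans; [apply Rabs_triang|]. rewrite !Rabs_mult, (Rabs_pos_eq m), (Rabs_pos_eq n), (Rabs_pos_eq (t / x)) by lra.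
  pose proof (Rabs_pos p). pose proof (Rabs_pos q).
  assert (Rabs p * m <= 1 * 2) by (apply Rmult_le_compat; lra).
  assert (Rabs q * (t / x) * n <= 1 * 1 * 2).
  { apply Rmult_le_compat; try lra. apply Rmult_le_pos; lra. apply Rmult_le_compat; lra. }
  lra. }
assert (SB : forall y, Rabs (sin y) <= 1) by (intros y; apply Rabs_le, SIN_bound).
assert (CB : forall y, Rabs (cos y) <= 1) by (intros y; apply Rabs_le, COS_bound).
assert (LEN : 4 * al * (A * G) * (r - c1) <= 16 * (A * G)).
{ replace (4 * al * (A * G) * (r - c1)) with (4 * (al * (2 * h)) * (A * G)) by (unfold c1; ring). rewrite Hal.
  apply Rmult_le_compat_r; lra. }
assert (Bd4 : Rabs B4 <= 16 * (A * G)).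
{ eapply Rle_trans; [|exact LEN]. apply RInt_abs_cst; [lra| |].
  - apply ex_RInt_cont; [lra|]. intros x Hx. apply Rcont_mult.
    + apply (ex_derive_continuous (V := R_NormedModule)). unfold sinh, cosh. auto_derive. repeat split; auto; lra.
    + apply is_derive_cont with (1 := proj1 (ldiff_int_derive_ln f x Hf Hn)).
  - intros x Hx. rewrite Rabs_mult. apply Rmult_le_compat; try apply Rabs_pos; [|apply AR; auto].
    destruct (TG x Hx) as [_ [_ [K1 K2]]]. apply EX; auto. }
assert (Bd5 : Rabs B5 <= 16 * (A * G)).
{ eapply Rle_trans; [|exact LEN]. apply RInt_abs_cst; [lra| |].
  - apply ex_RInt_cont; [lra|]. intros x Hx. apply Rcont_mult.
    + apply (ex_derive_continuous (V := R_NormedModule)). unfold sinh, cosh. auto_derive. repeat split; auto; lra.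
    + apply is_derive_cont with (1 := proj1 (proj2 (ldiff_int_derive_ln f x Hf Hn))).
  - intros x Hx. rewrite Rabs_mult. apply Rmult_le_compat; try apply Rabs_pos; [|apply AR; auto].
    destruct (TG x Hx) as [_ [_ [K1 K2]]].
    replace (- (al * sin (al * (x - (r - h))) * sinh (al * t * ln x))) with (al * (- sin (al * (x - (r - h)))) * sinh (al * t * ln x)) by ring.
    apply EX; auto. rewrite Rabs_Ropp; auto. }
clearbody B4 B5. apply Rabs_le_between in Bd4. apply Rabs_le_between in Bd5.
fold G. apply Rabs_le. split.
- assert (Low : - ((8 * C0 + 32 * A) * G) <= al * al * r * I) by lra.
  apply Rnot_lt_le. intros HI. assert (Ineg : I < 0) by nra.
  assert (9 * I >= 16 * (al * al * r) * I) by nra. nra.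
- apply Rle_trans with (C0 * G * (t * ln r / r) * (t * ln r - 0)).
  + apply RInt_le_cst; auto. intros v Hv. specialize (UB r v ltac:(lra) ltac:(lra)).
    assert (Pv : 0 <= v / r <= t * ln r / r).
    { split; [apply Rdiv_le_0_compat; lra|]. apply Rmult_le_compat_r; [left; apply Rinv_0_lt_compat; lra|lra]. }
    apply Rle_trans with (v / r * (C0 * G)); [apply Rmult_le_compat_l; lra|]. rewrite (Rmult_comm (C0 * G)). apply Rmult_le_compat_r; lra.
  + assert (t * ln r / r * (t * ln r - 0) <= 1).
    { apply Rmult_le_reg_r with r; [lra|]. replace (t * ln r / r * (t * ln r - 0) * r) with (t * ln r * (t * ln r)) by (field; lra). nra. }
    rewrite Rmult_assoc. nra.
Qed.

(** Explicit primitives give the leading terms r^(k+1) ln r / (k + 1) and r^(k+1) ln r / (k + 2);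
    their difference is the origin of the product (k + 1) (k + 2), and the rest is O(r^(k+1)). *)
Lemma RInt_weight (k : nat) (c : R) : 1 <= c -> exists K, 0 <= K /\ forall r, c <= r ->
  Rabs (RInt (fun u => (1 - u / r) * (u ^ k * ln u)) c r - r ^ S k * ln r / (INR (S k) * INR (S (S k)))) <= K * r ^ S k.
Proof.
intros Hc. set (p := INR (S k)). set (q := INR (S (S k))).
assert (Hq : q = p + 1) by (unfold q, p; apply S_INR).
assert (Hp : 1 <= p) by (unfold p; rewrite S_INR; pose proof (pos_INR k); lra).
set (H1 := fun u => u ^ S k / p * ln u - u ^ S k / (p * p)).
set (H2 := fun u => u ^ S (S k) / q * ln u - u ^ S (S k) / (q * q)).
assert (Ep : match k with 0%nat => 1 | S _ => INR k + 1 end = p) by reflexivity.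
assert (D1 : forall u, 0 < u -> is_derive H1 u (u ^ k * ln u)).
{ intros u Hu. unfold H1. auto_derive; auto. rewrite Ep. field. lra. }
assert (D2 : forall u, 0 < u -> is_derive H2 u (u * (u ^ k * ln u))).
{ intros u Hu. unfold H2. auto_derive; auto. rewrite Ep, Hq. field. lra. }
exists (1 + Rabs (H1 c) + Rabs (H2 c)). pose proof (Rabs_pos (H1 c)). pose proof (Rabs_pos (H2 c)).
split; [lra|]. intros r Hr.
assert (P := pow_ge1 r (S k) ltac:(lra)).
assert (I : RInt (fun u => (1 - u / r) * (u ^ k * ln u)) c r = (H1 r - / r * H2 r) - (H1 c - / r * H2 c)).
{ apply (is_RInt_unique (V := R_CompleteNormedModule)).
  apply (is_RInt_derive (V := R_CompleteNormedModule) (fun u => H1 u - / r * H2 u)); rewrite Rmin_left, Rmax_right by auto; intros u Hu.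
  - replace ((1 - u / r) * (u ^ k * ln u)) with (u ^ k * ln u - / r * (u * (u ^ k * ln u))) by (field; lra).
    apply (is_derive_minus (V := R_NormedModule)); [apply D1; lra|].
    apply (is_derive_scal (fun u => H2 u)). apply D2; lra.
  - apply (ex_derive_continuous (V := R_NormedModule)). auto_derive. lra. }
rewrite I.
replace (H1 r - / r * H2 r - (H1 c - / r * H2 c) - r ^ S k * ln r / (p * q)) with
  (- (r ^ S k * (/ (p * p) - / (q * q))) + (- H1 c) + / r * H2 c).
2:{ unfold H1, H2. rewrite Hq. simpl. field. lra. }
assert (R1 : 0 < / r <= 1) by (split; [apply Rinv_0_lt_compat; lra|rewrite <- Rinv_1; apply Rinv_le_contravar; lra]).
assert (Q1 : 0 <= / (p * p) - / (q * q) <= 1).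
{ assert (0 < / (q * q)) by (apply Rinv_0_lt_compat; nra). assert (/ (p * p) <= 1) by (rewrite <- Rinv_1; apply Rinv_le_contravar; nra).
  assert (/ (q * q) <= / (p * p)) by (apply Rinv_le_contravar; nra). lra. }
eapply Rle_trans; [apply Rabs_triang|]. eapply Rle_trans; [apply Rplus_le_compat_r, Rabs_triang|].
rewrite !Rabs_Ropp, !Rabs_mult, (Rabs_pos_eq (r ^ S k)), (Rabs_pos_eq (/ r)), (Rabs_pos_eq (/ (p * p) - / (q * q))) by lra.
assert (r ^ S k * (/ (p * p) - / (q * q)) <= r ^ S k * 1) by (apply Rmult_le_compat_l; lra).
assert (/ r * Rabs (H2 c) <= 1 * Rabs (H2 c)) by (apply Rmult_le_compat_r; lra). nra.
Qed.

(** The crude bound |E| <= G serves up to [u1] and the small one beyond; the contribution of the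
    first part does not grow with r. *)
Lemma RInt_approx (E G : R -> R) (c u1 r e : R) : 0 <= c -> c <= u1 -> u1 <= r -> 0 < r -> 0 <= e ->
  (forall u, c <= u <= r -> Rcont E u /\ Rcont G u) ->
  (forall u v, c <= u <= v -> 0 <= G u <= G v) ->
  (forall u, c <= u <= u1 -> Rabs (E u) <= G u) -> (forall u, u1 <= u <= r -> Rabs (E u) <= e * G u) ->
  Rabs (RInt (fun u => (1 - u / r) * E u) c r) <= u1 * G u1 + e * (r * G r).
Proof.
intros Hc H1 H2 Hr He HC HG HE1 HE2.
assert (Cw : forall u, c <= u <= r -> Rcont (fun u => (1 - u / r) * E u) u).
{ intros u Hu. apply Rcont_mult; [|apply HC; auto]. apply (ex_derive_continuous (V := R_NormedModule)). auto_derive. auto. }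
rewrite <- (RInt_Chasles (V := R_CompleteNormedModule) (fun u => (1 - u / r) * E u) c u1 r); try (apply ex_RInt_cont; [lra|]; intros; apply Cw; lra).
change (plus ?x ?y) with (x + y). eapply Rle_trans; [apply Rabs_triang|].
assert (W : forall u, c <= u <= r -> Rabs (1 - u / r) <= 1).
{ intros u Hu. assert (0 <= u / r <= 1); [|rewrite Rabs_pos_eq; lra].
  split; [apply Rdiv_le_0_compat; lra|]. apply Rmult_le_reg_r with r; [lra|]. unfold Rdiv. rewrite Rmult_assoc, Rinv_l; lra. }
apply Rplus_le_compat.
- apply Rle_trans with (G u1 * (u1 - c)).
  + apply RInt_abs_cst; auto. { apply ex_RInt_cont; [lra|]. intros; apply Cw; lra. }
    intros u Hu. rewrite Rabs_mult, <- (Rmult_1_l (G u1)). apply Rmult_le_compat; try apply Rabs_pos; [apply W; lra|].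
    eapply Rle_trans; [apply HE1; auto|]. apply HG; lra.
  + destruct (HG u1 u1 ltac:(lra)). nra.
- apply Rle_trans with (e * G r * (r - u1)).
  + apply RInt_abs_cst; auto. { apply ex_RInt_cont; [lra|]. intros; apply Cw; lra. }
    intros u Hu. rewrite Rabs_mult, <- (Rmult_1_l (e * G r)). apply Rmult_le_compat; try apply Rabs_pos; [apply W; lra|].
    eapply Rle_trans; [apply HE2; auto|]. apply Rmult_le_compat_l; auto. apply HG; lra.
  + destruct (HG r r ltac:(lra)). assert (0 <= e * G r) by (apply Rmult_le_pos; auto). nra.
Qed.

Lemma ln_linear (t s : R) : 0 <= t -> 0 < s -> t * ln s <= s / 2 + t * ln (2 * t + 1).
Proof.
intros Ht Hs. replace s with (s / (2 * t + 1) * (2 * t + 1)) at 1 by (field; lra).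
assert (P : 0 < s / (2 * t + 1)) by (apply Rdiv_lt_0_compat; lra). rewrite ln_mult by lra.
assert (L := ln_le_pred _ P).
assert (t * (s / (2 * t + 1)) <= s / 2).
{ replace (t * (s / (2 * t + 1))) with (s * (t / (2 * t + 1))) by (field; lra).
  unfold Rdiv at 2. apply Rmult_le_compat_l; [lra|]. apply Rmult_le_reg_r with (2 * t + 1); [lra|].
  unfold Rdiv. rewrite Rmult_assoc, Rinv_l; lra. }
assert (t * ln (s / (2 * t + 1)) <= t * (s / (2 * t + 1))) by (apply Rmult_le_compat_l; lra). lra.
Qed.

(** For a point above the curve with 0 < Re a <= U, |a| <= U + t ln |a| <= U + |a| / 2 + t ln (2 t +
    1); solving for |a| gives this value. *)
Definition curve_bound (t U : R) : R := 2 * U + 2 * t * ln (2 * t + 1).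

Lemma Cmod_le_Bnd (t U : R) (a : C) : 0 <= t -> 0 < fst a -> fst a <= U -> snd a <= 0 -> 0 <= snd (wmap t a) ->
  Cmod a <= curve_bound t U.
Proof.
intros Ht H1 H2 H3 H4. rewrite wmap_snd in H4.
assert (P : 0 < Cmod a). { eapply Rlt_le_trans; [|apply Rabs_fst_le]. rewrite Rabs_pos_eq; lra. }
assert (L := ln_linear t (Cmod a) Ht P). assert (T := Cmod_le_sum a). rewrite Rabs_pos_eq, Rabs_left1 in T by lra.
unfold curve_bound. lra.
Qed.

Lemma zeros_data_mem (f g : C -> C) (l : list C) (R0 : R) (a : C) : zeros_data f g l R0 -> f a = RtoC 0 -> box 0 R0 (- R0) 0 a -> In a l.
Proof.
intros [_ [_ [E N]]] Ha B. apply NNPP. intros NI. apply (Cmult_neq_0 (prodz l a) (g a)).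
- apply prodz_neq0; auto.
- apply N; auto.
- rewrite <- E. exact Ha.
Qed.

Lemma zeros_data_root (f g : C -> C) (l : list C) (R0 : R) (a : C) : zeros_data f g l R0 -> In a l -> f a = RtoC 0.
Proof. intros [_ [_ [E N]]] Ha. rewrite E, prodz_root by auto. ring. Qed.

Lemma zeros_data_snd (f g : C -> C) (l : list C) (R0 : R) (a : C) : (forall s : R, f (RtoC s) <> RtoC 0) ->
  zeros_data f g l R0 -> In a l -> snd a < 0.
Proof.
intros Hn Z Ha. destruct (proj1 Z a Ha) as [_ [_ [H|H]]]; auto. exfalso.
apply (Hn (fst a)). replace (RtoC (fst a)) with a by (apply injective_projections; simpl; auto).
exact (zeros_data_root f g l R0 a Z Ha).
Qed.

Lemma box_Cmod (R0 : R) (a : C) : 0 <= fst a -> snd a <= 0 -> Cmod a <= R0 -> box 0 R0 (- R0) 0 a.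
Proof.
intros H1 H2 H3. assert (F1 := Rabs_fst_le a). assert (F2 := Rabs_snd_le a).
rewrite Rabs_pos_eq in F1 by auto. rewrite Rabs_left1 in F2 by auto. split; lra.
Qed.

Lemma zeros_data_ex (f : C -> C) (R0 : R) : holo_lower f -> (forall s : R, f (RtoC s) <> RtoC 0) -> 0 <= R0 ->
  exists l g, zeros_data f g l R0.
Proof.
intros Hf Hn HR. destruct (zero_factorization f 0 R0 (- R0) Hf Hn HR ltac:(lra)) as [l [g H]]. exists l, g. exact H.
Qed.

Definition Carleman_sum (t c1 r : R) (l : list C) : R :=
  sumR (fun a => indic (inside t c1 r a) * (snd (wmap t a) * (1 - fst (wmap t a) / r))) l.

(** Of the integrals in [Carleman_linear] only the one over the curve reaches the order r^(k+1) ln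
    r: those over the axis are O(r^(k+1)) and the one over the right side is O(r^k ln r). The left
    end [c1] is fixed before e and r. *)
Theorem Carleman_sum_asymp (k : nat) (f : C -> C) (t cs ell0 : R) : class_F (S k) f -> 0 <= t -> curve_free f t cs ->
  is_lim (fun u => lnf t f u 0 / (u ^ k * ln u)) p_infty ell0 ->
  exists c1, umin t < c1 /\ forall e, 0 < e -> ev (fun r => forall R0 l g, curve_bound t r + 2 * t * ln r <= R0 -> zeros_data f g l R0 ->
    (forall a, In a l -> zmin t <= fst a -> 0 <= snd (wmap t a) -> fst (wmap t a) <> r) ->
    Rabs (2 * PI * Carleman_sum t c1 r l - ell0 * (r ^ S k * ln r / (INR (S k) * INR (S (S k))))) <= e * (r ^ S k * ln r)).
Proof.
intros HF Ht HC HL. destruct (class_F_holo _ _ HF) as [Hf Hn].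
destruct (side_bound k f t cs HF Ht HC) as [C3 [HC3 HS]].
destruct (growth_real k f HF) as [A [HA [X2 [HX2 HR]]]].
apply is_lim_spec in HL.
assert (HL1 : forall e, 0 < e -> ev (fun u => Rabs (lnf t f u 0 - ell0 * (u ^ k * ln u)) <= e * (u ^ k * ln u))).
{ intros e He. generalize (filter_and _ _ (HL (mkposreal e He)) (filter_and _ _ (ev_ln_ge 1) (ev_ge 1))). apply filter_imp.
  intros u [K [L U]]. simpl in K. assert (P := pow_ge1 u k U).
  assert (PG : 0 < u ^ k * ln u) by (apply Rmult_lt_0_compat; lra).
  replace (lnf t f u 0 - ell0 * (u ^ k * ln u)) with ((lnf t f u 0 / (u ^ k * ln u) - ell0) * (u ^ k * ln u)) by (field; lra).
  rewrite Rabs_mult, (Rabs_pos_eq (u ^ k * ln u)) by lra. apply Rmult_le_compat_r; lra. }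
destruct (HL1 1 Rlt_0_1) as [X3 HX3].
set (cc := 1 + umin t + Rabs cs + X2 + Rabs X3).
pose proof (Rabs_pos cs). pose proof (Rabs_pos X3). pose proof (Rle_abs cs). pose proof (Rle_abs X3).
assert (U1 : 1 <= umin t) by (unfold umin; lra).
assert (LB : 0 <= 2 * t * ln (2 * t + 1)) by (apply Rmult_le_pos; [lra|apply ln_nonneg; lra]).
(* Every zero above the curve whose image has abscissa at most cc + 1 belongs to [l0], so that one
   choice of [c1] avoids all of them, whatever r is. *)
destruct (zeros_data_ex f (curve_bound t (cc + 1)) Hf Hn) as [l0 [g0 Z0]]; [unfold curve_bound, cc; lra|].
destruct (avoid (map (fun a => fst (wmap t a)) l0) cc (cc + 1)) as [c1 [Hc1 Av]]; [lra|].
assert (Hcc : cc = 1 + umin t + Rabs cs + X2 + Rabs X3) by reflexivity. clearbody cc.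
exists c1. split; [lra|].
destruct (Carleman_linear f t c1 Ht ltac:(lra) Hf Hn) as [K HK].
destruct (RInt_weight k c1 ltac:(lra)) as [K1 [HK1 HW]].
intros e He. assert (He4 : 0 < e / 4) by lra.
destruct (HL1 (e / 4) He4) as [u0 Hu0]. set (u1 := Rmax c1 (u0 + 1)).
assert (Hu1 : c1 <= u1) by apply Rmax_l. assert (Hu1' : u0 < u1) by (pose proof (Rmax_r c1 (u0 + 1)); unfold u1; lra).
(* [KT] collects the constants and the errors of order r^(k+1); they are absorbed once ln r exceeds
   KT * (4 / e). *)
set (G := fun u => u ^ k * ln u). set (KT := Rabs ell0 * K1 + u1 * G u1 + Rabs K + (1 + t * t) * A + 2 * t * A).
assert (KT0 : 0 <= KT).
{ unfold KT. assert (0 <= G u1) by (apply Rmult_le_pos; [apply pow_le; lra|apply ln_nonneg; lra]). pose proof (Rabs_pos ell0). pose proof (Rabs_pos K).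
  repeat apply Rplus_le_le_0_compat; try apply Rmult_le_pos; try nra; try lra. }
generalize (filter_and _ _ HS (filter_and _ _ (ev_ge (u1 + C3 * (4 / e))) (ev_ln_ge (1 + KT * (4 / e))))). apply filter_imp.
intros r [S1 [S2 S3]] R0 l g HR0 HZ Gr.
assert (P4 : 0 < 4 / e) by (apply Rdiv_lt_0_compat; lra).
assert (0 <= C3 * (4 / e)) by (apply Rmult_le_pos; lra). assert (0 <= KT * (4 / e)) by (apply Rmult_le_pos; lra).
assert (Hr : u1 <= r) by lra.
assert (HRr : r + 2 * t * ln r <= R0) by (unfold curve_bound in HR0; lra).
assert (Gen : forall a, In a l -> generic t c1 r a).
{ intros a Ha La Va. assert (Sa := zeros_data_snd f g l R0 a Hn HZ Ha). assert (Ra := zeros_data_root f g l R0 a HZ Ha).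
  split; [|split; [apply Gr; auto|]].
  - intros E. apply Av. apply in_map_iff. exists a. split; auto. apply (zeros_data_mem f g0 l0 (curve_bound t (cc + 1))); auto.
    assert (F := wmap_fst t a). unfold zmin in La. assert (Ar := Arg_lower a ltac:(lra) ltac:(lra)).
    apply box_Cmod; try lra. apply Cmod_le_Bnd; auto; try lra. nra.
  - intros Hu E. apply (HC a); auto. lra. }
specialize (HK g l r R0 ltac:(lra) HRr HZ Gen). fold (Carleman_sum t c1 r l) in HK.
destruct (cloop_lnf_cont f g l t c1 r R0 Ht ltac:(lra) ltac:(lra) HRr Hf Hn HZ Gen) as [Cb _].
assert (I2 := S1 R0 l g HRr HZ Gr). fold (G r) in I2.
set (J1 := RInt (fun u => (1 - u / r) * lnf t f u 0) c1 r) in *.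
set (J2 := RInt (fun v => v / r * lnf t f r v) 0 (t * ln r)) in *.
set (J3 := RInt _ c1 r) in HK. set (J4 := RInt _ c1 r) in HK.
assert (Pr := pow_ge1 r k ltac:(lra)). assert (PrS := pow_ge1 r (S k) ltac:(lra)).
assert (LM : forall x, c1 <= x <= r -> 0 <= ln x <= ln r) by (intros x Hx; split; [apply ln_nonneg; lra|apply ln_le; lra]).
assert (AR : forall x, c1 <= x <= r -> Rabs (ln (Cmod (f (RtoC x)))) <= A * r ^ k /\ Rabs (snd (ldiff_int f x)) <= A * r ^ k).
{ intros x Hx. destruct (HR x ltac:(lra)) as [Q1 Q2].
  assert (A * x ^ k <= A * r ^ k); [|lra]. apply Rmult_le_compat_l; [lra|]. apply pow_incr. lra. }
assert (DV : forall x y, 0 <= x <= y -> 0 < y -> 0 <= x / y <= 1).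
{ intros x y Hx Hy. split; [apply Rdiv_le_0_compat; lra|]. apply Rmult_le_reg_r with y; [lra|]. unfold Rdiv. rewrite Rmult_assoc, Rinv_l; lra. }
assert (LX : forall x, c1 <= x -> ln x <= x) by (intros x Hx; pose proof (ln_le_pred x ltac:(lra)); lra).
assert (RS : r ^ S k = r * r ^ k) by reflexivity.
assert (AP : 0 <= A * r ^ k) by (apply Rmult_le_pos; lra).
assert (B3 : Rabs J3 <= (1 + t * t) * A * r ^ S k).
{ apply Rle_trans with ((1 + t * t) * (A * r ^ k) * (r - c1)).
  - apply RInt_abs_cst; [lra| |].
    + apply ex_RInt_cont; [lra|]. intros x Hx. apply Rcont_mult.
      * apply (ex_derive_continuous (V := R_NormedModule)). auto_derive. repeat split; auto; lra.
      * apply is_derive_cont with (1 := proj1 (ldiff_int_derive_ln f x Hf Hn)).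
    + intros x Hx. rewrite Rabs_mult. apply Rmult_le_compat; try apply Rabs_pos; [|apply AR; auto].
      assert (D1 := DV x r ltac:(lra) ltac:(lra)). destruct (LM x Hx). assert (D2 := DV (ln x) x ltac:(split; [lra|apply LX; lra]) ltac:(lra)).
      assert (Ir : 0 < / r <= 1) by (split; [apply Rinv_0_lt_compat; lra|rewrite <- Rinv_1; apply Rinv_le_contravar; lra]).
      replace (1 - (x - t * t * ln x / x) / r) with (1 - x / r + t * t * (ln x / x) * / r) by (field; lra).
      assert (0 <= t * t) by nra.
      assert (0 <= t * t * (ln x / x) * / r <= t * t * 1 * 1).
      { split; [apply Rmult_le_pos; [apply Rmult_le_pos|]; lra|]. apply Rmult_le_compat; try lra. apply Rmult_le_pos; lra. apply Rmult_le_compat_l; lra. }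
      rewrite Rabs_pos_eq; lra.
  - rewrite RS. replace ((1 + t * t) * A * (r * r ^ k)) with ((1 + t * t) * (A * r ^ k) * r) by ring.
    apply Rmult_le_compat_l; [|lra]. apply Rmult_le_pos; nra. }
assert (B4 : Rabs J4 <= 2 * t * A * r ^ S k).
{ apply Rle_trans with (2 * t * (A * r ^ k) * (r - c1)).
  - apply RInt_abs_cst; [lra| |].
    + apply ex_RInt_cont; [lra|]. intros x Hx. apply Rcont_mult.
      * apply (ex_derive_continuous (V := R_NormedModule)). auto_derive. repeat split; auto; lra.
      * apply is_derive_cont with (1 := proj1 (proj2 (ldiff_int_derive_ln f x Hf Hn))).
    + intros x Hx. rewrite Rabs_mult. apply Rmult_le_compat; try apply Rabs_pos; [|apply AR; auto].
      assert (D1 := DV x r ltac:(lra) ltac:(lra)). destruct (LM x Hx). assert (D2 := DV (ln x) r ltac:(split; [lra|]; pose proof (LX r ltac:(lra)); lra) ltac:(lra)).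
      assert (Ix : 0 < / x <= 1) by (split; [apply Rinv_0_lt_compat; lra|rewrite <- Rinv_1; apply Rinv_le_contravar; lra]).
      replace (t / x * (1 - x / r) - t * ln x / r) with (t * (/ x * (1 - x / r) - ln x / r)) by (field; lra).
      assert (0 <= / x * (1 - x / r) <= 1 * 1) by (split; [apply Rmult_le_pos; lra|apply Rmult_le_compat; lra]).
      rewrite Rabs_mult, (Rabs_pos_eq t), (Rmult_comm 2) by lra. apply Rmult_le_compat_l; [lra|]. apply Rabs_le; lra.
  - rewrite RS. replace (2 * t * A * (r * r ^ k)) with (2 * t * (A * r ^ k) * r) by ring.
    apply Rmult_le_compat_l; [|lra]. apply Rmult_le_pos; nra. }
assert (CG : forall u, c1 <= u <= r -> Rcont G u).
{ intros u Hu. apply (ex_derive_continuous (V := R_NormedModule)). unfold G. auto_derive. lra. }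
assert (B1 : Rabs (RInt (fun u => (1 - u / r) * (lnf t f u 0 - ell0 * G u)) c1 r) <= u1 * G u1 + e / 4 * (r * G r)).
{ apply RInt_approx; try lra.
  - intros u Hu. split; [|auto]. apply (continuous_minus (V := R_NormedModule)); [apply Cb; auto|].
    apply Rcont_mult; [apply continuous_const|auto].
  - intros u v Huv. split; [apply Rmult_le_pos; [apply pow_le; lra|apply ln_nonneg; lra]|apply pow_ln_mono; lra].
  - intros u Hu. rewrite <- (Rmult_1_l (G u)) at 2. apply HX3. lra.
  - intros u Hu. apply Hu0. lra. }
assert (EJ : RInt (fun u => (1 - u / r) * (lnf t f u 0 - ell0 * G u)) c1 r = J1 - ell0 * RInt (fun u => (1 - u / r) * G u) c1 r).
{ assert (W : forall h : R -> R, (forall u, c1 <= u <= r -> Rcont h u) -> ex_RInt (fun u => (1 - u / r) * h u) c1 r).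
  { intros h Hh. apply ex_RInt_cont; [lra|]. intros u Hu. apply Rcont_mult; auto.
    apply (ex_derive_continuous (V := R_NormedModule)). auto_derive. auto. }
  assert (Q := RInt_scal (V := R_CompleteNormedModule) (fun u => (1 - u / r) * G u) c1 r ell0 (W G CG)).
  change (scal ell0 ?y) with (ell0 * y) in Q. rewrite <- Q.
  assert (M := RInt_minus (V := R_CompleteNormedModule) (fun u => (1 - u / r) * lnf t f u 0) (fun u => ell0 * ((1 - u / r) * G u)) c1 r).
  change (minus ?x ?y) with (x - y) in M. unfold J1.
  transitivity (RInt (fun u => (1 - u / r) * lnf t f u 0 - ell0 * ((1 - u / r) * G u)) c1 r).
  - apply RInt_ext. intros; simpl; ring.
  - apply M; [apply (W (fun u => lnf t f u 0)); auto|]. apply (ex_RInt_scal (V := R_NormedModule) (fun u => (1 - u / r) * G u)), W, CG. }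
rewrite EJ in B1. specialize (HW r ltac:(lra)). fold (G) in HW.
set (J0 := RInt (fun u => (1 - u / r) * G u) c1 r) in *.
change (RInt (fun u => (1 - u / r) * (u ^ k * ln u)) c1 r) with J0 in HW.
set (N := r ^ S k * ln r / (INR (S k) * INR (S (S k)))) in *.
assert (B0 : Rabs (ell0 * (J0 - N)) <= Rabs ell0 * K1 * r ^ S k).
{ rewrite Rabs_mult, Rmult_assoc. apply Rmult_le_compat_l; [apply Rabs_pos|exact HW]. }
assert (RG : r * G r = r ^ S k * ln r) by (unfold G; simpl; ring).
assert (F1 : KT * r ^ S k <= e / 4 * (r ^ S k * ln r)).
{ assert (KT <= e / 4 * ln r); [|nra]. apply Rmult_le_reg_l with (4 / e); auto.
  replace (4 / e * (e / 4 * ln r)) with (ln r) by (field; lra). lra. }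
assert (F2 : C3 * G r <= e / 4 * (r ^ S k * ln r)).
{ rewrite <- RG. assert (C3 <= e / 4 * r).
  { apply Rmult_le_reg_l with (4 / e); auto. replace (4 / e * (e / 4 * r)) with r by (field; lra). lra. }
  assert (0 <= G r) by (apply Rmult_le_pos; lra). nra. }
assert (F3 : Rabs K + u1 * G u1 <= (Rabs K + u1 * G u1) * r ^ S k).
{ assert (0 <= u1 * G u1). { apply Rmult_le_pos; [lra|]. apply Rmult_le_pos; [apply pow_le; lra|apply ln_nonneg; lra]. }
  pose proof (Rabs_pos K). nra. }
assert (F4 := Rle_abs K).
rewrite RG in B1. unfold KT in F1.
clearbody J0 J1 J2 J3 J4 N. clear - HK B0 B1 I2 B3 B4 F1 F2 F3 F4.
apply Rabs_le_between in HK. apply Rabs_le_between in B0. apply Rabs_le_between in B1. apply Rabs_le_between in I2.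
apply Rabs_le_between in B3. apply Rabs_le_between in B4. apply Rabs_le.
set (a := Rabs ell0) in *. set (b := Rabs K) in *. set (x := r ^ S k) in *. clearbody a b x. lra.
Qed.

(** * The twice integrated zero count *)

(** If |a| > 1, the zero lies above the curve of slope s exactly when s ln |a| >= - Im a;
    integrating ln |a| over these s up to t gives the positive part of t ln |a| + Im a. *)
Definition slope_weight (t : R) (a : C) : R := indic (0 < fst a /\ snd a <= 0) * Rmax 0 (t * ln (Cmod a) + snd a).

(* Summed over the zeros, this is the zero count integrated over slopes up to [t], with density [ln |a|], and over
   radii up to [r]. *)
Definition list_mass (t r : R) (l : list C) : R := sumR (fun a => slope_weight t a * Rmax 0 (r - Cmod a)) l.

Lemma slope_weight_nonneg (t : R) (a : C) : 0 <= slope_weight t a.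
Proof. apply Rmult_le_pos; [apply indic_bounds|apply Rmax_l]. Qed.

Lemma Rmax0_nonneg (x : R) : 0 <= Rmax 0 x.
Proof. apply Rmax_l. Qed.

Lemma slope_weight_pos (t : R) (a : C) : 0 < slope_weight t a ->
  0 < fst a /\ snd a <= 0 /\ 0 < snd (wmap t a) /\ slope_weight t a = snd (wmap t a).
Proof.
unfold slope_weight, indic. rewrite wmap_snd. destruct excluded_middle_informative as [[H1 H2]|H]; [|lra].
rewrite Rmult_1_l. unfold Rmax. destruct Rle_dec; intros; repeat split; lra.
Qed.

Lemma wmap_fst_bounds (t : R) (a : C) : 0 <= t -> 0 < fst a -> snd a <= 0 -> fst a <= fst (wmap t a) <= fst a + 2 * t.
Proof. intros Ht H1 H2. rewrite wmap_fst. destruct (Arg_lower a H1 H2). split; nra. Qed.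

Lemma zeros_sum_indep (f g g' : C -> C) (l l' : list C) (R0 R1 B : R) (phi : C -> R) : zeros_data f g l R0 -> zeros_data f g' l' R1 ->
  B <= R0 -> B <= R1 -> (forall a, phi a <> 0 -> 0 < fst a /\ snd a <= 0 /\ Cmod a <= B) -> sumR phi l = sumR phi l'.
Proof.
intros [_ [G1 [E1 N1]]] [_ [G2 [E2 N2]]] H1 H2 H. apply (sumR_zeros_indep f g g'); auto.
intros z Hz. destruct (H z Hz) as [A1 [A2 A3]]. repeat split; auto.
- apply N1, box_Cmod; lra.
- apply N2, box_Cmod; lra.
Qed.

Lemma pow_near_1 (n : nat) (e : R) : 0 < e -> exists d, 0 < d /\ forall x, Rabs (x - 1) < d -> Rabs (x ^ n - 1) < e.
Proof.
intros He. assert (Cp : continuity_pt (fun x => x ^ n) 1) by apply derivable_continuous_pt, derivable_pt_pow.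
destruct (Cp e He) as [d [Hd K]]. exists d. split; auto. intros x Hx.
destruct (Req_dec x 1) as [->|N]; [rewrite pow1, Rminus_diag, Rabs_R0; auto|].
assert (Q := K x). simpl in Q. unfold R_dist in Q. rewrite pow1 in Q. apply Q. split; [|exact Hx].
split; [exact I|auto].
Qed.

(** A shift of the radius by O(ln r) makes the ratio r' / r tend to 1, which does not affect the
    asymptotics of r^m ln r. *)
Lemma pow_ln_near (m : nat) (c e : R) : 0 < e ->
  ev (fun r => forall r', Rabs (r' - r) <= c * ln r -> Rabs (r' ^ m * ln r' - r ^ m * ln r) <= e * (r ^ m * ln r)).
Proof.
intros He. destruct (pow_near_1 (S m) e He) as [d [Hd K]].
set (h := Rmin (/ 2) (d / 4)). assert (Hh : 0 < h) by (apply Rmin_glb_lt; lra).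
assert (Hh1 : h <= / 2) by apply Rmin_l. assert (Hh2 : h <= d / 4) by apply Rmin_r.
assert (Hc : 0 < h / (Rabs c + 1)) by (apply Rdiv_lt_0_compat; [lra|pose proof (Rabs_pos c); lra]).
generalize (filter_and _ _ (ev_ln_le _ Hc) (filter_and _ _ (ev_ln_ge 1) (ev_ge 2))). apply filter_imp.
intros r [L1 [L2 L3]] r' Hr'.
assert (D : Rabs (r' - r) <= h * r).
{ eapply Rle_trans; [exact Hr'|]. pose proof (Rabs_pos c). pose proof (Rle_abs c).
  apply Rmult_le_compat_l with (r := Rabs c + 1) in L1; [|lra].
  replace ((Rabs c + 1) * (h / (Rabs c + 1) * r)) with (h * r) in L1 by (field; lra). nra. }
apply Rabs_le_between in D. assert (Pr : 0 < r') by nra.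
set (x := r' / r). assert (Ex : r' = x * r) by (unfold x; field; lra).
assert (Hx : 1 - h <= x <= 1 + h) by (split; apply Rmult_le_reg_r with r; lra).
assert (Pm : 0 < r ^ m) by (apply pow_lt; lra).
assert (LX : ln r' = ln x + ln r) by (rewrite Ex, ln_mult; lra).
assert (LU : ln x <= h) by (pose proof (ln_le_pred x ltac:(lra)); lra).
assert (LL : - (2 * h) <= ln x).
{ assert (Q := ln_le_pred (/ x) ltac:(apply Rinv_0_lt_compat; lra)). rewrite ln_Rinv in Q by lra.
  assert (/ x <= 1 + 2 * h); [|lra]. apply Rmult_le_reg_l with x; [lra|]. rewrite Rinv_r by lra. nra. }
assert (PM : 0 < r ^ m * ln r) by (apply Rmult_lt_0_compat; lra).
replace (r' ^ m) with (x ^ m * r ^ m) by (rewrite Ex, Rpow_mult_distr; ring). rewrite LX.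
assert (Px : 0 < x ^ m) by (apply pow_lt; lra).
assert (KU := K (1 + h) ltac:(rewrite Rabs_pos_eq; lra)). assert (KL := K (1 - 2 * h) ltac:(rewrite Rabs_left; lra)).
apply Rabs_def2 in KU. apply Rabs_def2 in KL. simpl in KU, KL.
assert (XU : x ^ m <= (1 + h) ^ m) by (apply pow_incr; lra).
assert (XL : (1 - 2 * h) ^ m <= x ^ m) by (apply pow_incr; lra).
assert (PL : 0 <= (1 - 2 * h) ^ m) by (apply pow_le; lra).
assert (YU : ln x + ln r <= (1 + h) * ln r) by nra.
assert (YL : (1 - 2 * h) * ln r <= ln x + ln r) by nra.
assert (ZU : x ^ m * (ln x + ln r) <= (1 + h) ^ m * ((1 + h) * ln r)).
{ apply Rmult_le_compat; try lra. }
assert (ZL : (1 - 2 * h) ^ m * ((1 - 2 * h) * ln r) <= x ^ m * (ln x + ln r)).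
{ apply Rmult_le_compat; try lra. apply Rmult_le_pos; lra. }
replace (x ^ m * r ^ m * (ln x + ln r) - r ^ m * ln r) with (r ^ m * (x ^ m * (ln x + ln r) - ln r)) by ring.
replace (e * (r ^ m * ln r)) with (r ^ m * (e * ln r)) by ring.
rewrite Rabs_mult, (Rabs_pos_eq (r ^ m)) by lra. apply Rmult_le_compat_l; [lra|].
apply Rabs_le. split.
- assert ((1 - e) * ln r <= (1 - 2 * h) * (1 - 2 * h) ^ m * ln r) by (apply Rmult_le_compat_r; lra). lra.
- assert ((1 + h) * (1 + h) ^ m * ln r <= (1 + e) * ln r) by (apply Rmult_le_compat_r; lra). lra.
Qed.

(** A zero is weighed by r - |a| in [list_mass], and by r' - Re (wmap a) in r' times the Carleman
    sum at r'. Above the curve Re a <= Re (wmap a) <= Re a + 2 t and |a| <= Re a + t ln |a|, so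
    radii r' at distance O(ln r) from r give an upper and a lower sum with the same asymptotics. *)
Theorem list_mass_asymp (k : nat) (f : C -> C) (t cs ell0 : R) : class_F (S k) f -> 0 <= t -> curve_free f t cs ->
  is_lim (fun u => lnf t f u 0 / (u ^ k * ln u)) p_infty ell0 ->
  forall e, 0 < e -> ev (fun r => forall R0 l g, r <= R0 -> zeros_data f g l R0 ->
    Rabs (2 * PI * list_mass t r l - ell0 * (r ^ S (S k) * ln r / (INR (S k) * INR (S (S k))))) <= e * (r ^ S (S k) * ln r)).
Proof.
intros HF Ht HC HL. destruct (class_F_holo _ _ HF) as [Hf Hn].
destruct (Carleman_sum_asymp k f t cs ell0 HF Ht HC HL) as [c1 [Hc1 HS]].
set (pq := INR (S k) * INR (S (S k))) in *.
assert (Hpq : 1 <= pq).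
{ unfold pq. rewrite !S_INR. pose proof (pos_INR k). nra. }
set (B1 := curve_bound t (c1 + zmin t)).
assert (LB : 0 <= 2 * t * ln (2 * t + 1)) by (apply Rmult_le_pos; [lra|apply ln_nonneg; lra]).
assert (U1 : 1 <= umin t) by (unfold umin; lra). assert (Z1 : 1 <= zmin t) by (unfold zmin; lra).
assert (HB1 : 0 <= B1) by (unfold B1, curve_bound; lra).
destruct (zeros_data_ex f B1 Hf Hn HB1) as [lB [gB ZB]].
(* The zeros above the curve that the contour omits at its left end have modulus at most [B1];
   together they contribute at most [r * D0]. *)
set (near := fun a => indic (Cmod a <= B1) * slope_weight t a).
set (D0 := sumR near lB).
assert (HD0 : 0 <= D0).
{ apply sumR_nonneg. intros a _. apply Rmult_le_pos; [apply indic_bounds|apply slope_weight_nonneg]. }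
assert (Pi1 := PI_RGT_0).
intros e He.
set (e1 := e / 8). assert (He1 : 0 < e1) by (unfold e1; lra).
set (e2 := Rmin 1 (e / (4 * (Rabs ell0 + 1)))). assert (Hell := Rabs_pos ell0).
assert (He2 : 0 < e2) by (apply Rmin_glb_lt; [lra|apply Rdiv_lt_0_compat; lra]).
assert (He2' : e2 <= 1) by apply Rmin_l.
assert (He2'' : Rabs ell0 * e2 <= e / 4).
{ apply Rle_trans with ((Rabs ell0 + 1) * (e / (4 * (Rabs ell0 + 1)))); [|right; field; lra].
  apply Rmult_le_compat; try lra. apply Rmin_r. }
destruct (HS e1 He1) as [X HX].
assert (NE := pow_ln_near (S (S k)) (2 * t + 1) e2 He2).
assert (Ht4 : 0 < / (2 * (2 * t + 1))) by (apply Rinv_0_lt_compat; lra).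
generalize (filter_and _ _ NE (filter_and _ _ (ev_ln_le _ Ht4) (filter_and _ _ (ev_ln_ge 1)
  (ev_ge (2 * Rabs X + 4 + 2 * t * ln (2 * t + 1) + 2 * (c1 + B1) + 8 * PI * D0 * / e))))).
apply filter_imp. intros r [N1 [L1 [L2 L3]]] R0 l g HR0 HZ.
assert (HX1 := Rle_abs X). assert (HX2 := Rabs_pos X).
assert (HDe : 0 <= 8 * PI * D0 * / e) by (apply Rmult_le_pos; [apply Rmult_le_pos; lra|left; apply Rinv_0_lt_compat; lra]).
assert (Lr : (2 * t + 1) * ln r <= r / 2).
{ apply Rmult_le_compat_l with (r := 2 * t + 1) in L1; [|lra].
  replace ((2 * t + 1) * (/ (2 * (2 * t + 1)) * r)) with (r / 2) in L1 by (field; lra). exact L1. }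
assert (L2' : 2 * t + 1 <= (2 * t + 1) * ln r).
{ rewrite <- (Rmult_1_r (2 * t + 1)) at 1. apply Rmult_le_compat_l; lra. }
(* A zero above the curve with 0 < Re a <= r satisfies |a| <= Re a + Tb. *)
set (Tb := t * ln (curve_bound t r)).
assert (HTb : 0 <= Tb /\ Tb + 1 <= (2 * t + 1) * ln r).
{ assert (BB : 1 <= curve_bound t r <= r * r) by (unfold curve_bound; split; nra).
  assert (0 <= ln (curve_bound t r) <= 2 * ln r).
  { split; [apply ln_nonneg; lra|]. replace (2 * ln r) with (ln (r * r)) by (rewrite ln_mult; lra). apply ln_le; lra. }
  unfold Tb. split; nra. }
set (H := r ^ S (S k) * ln r) in *.
assert (Pk : 1 <= r ^ k) by (apply pow_ge1; lra).
assert (HH : r * r <= H).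
{ unfold H. simpl. assert (r * r <= r * (r * r ^ k)) by nra. nra. }
(* A box large enough for all the radii in play, so that the single list [l1] serves the mass, both
   Carleman sums and [D0]. *)
set (R1 := r + 2 * t + 1 + B1 + (curve_bound t (r + 2 * t + 1) + 2 * t * ln (r + 2 * t + 1))).
assert (Lp : 0 <= 2 * t * ln (r + 2 * t + 1)) by (apply Rmult_le_pos; [lra|apply ln_nonneg; lra]).
assert (BdR : 0 <= curve_bound t (r + 2 * t + 1)) by (unfold curve_bound; lra).
destruct (zeros_data_ex f R1 Hf Hn) as [l1 [g1 HZ1]]; [unfold R1; lra|].
assert (EM : list_mass t r l = list_mass t r l1).
{ apply (zeros_sum_indep f g g1 l l1 R0 R1 r); auto; [unfold R1; lra|]. intros a Ha.
  assert (Pa : 0 < slope_weight t a) by (pose proof (slope_weight_nonneg t a) as [Q|Q]; [auto|rewrite <- Q in Ha; lra]).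
  destruct (slope_weight_pos t a Pa) as [P1 [P2 _]]. split; [auto|split; [auto|]].
  apply Rnot_lt_le. intros Q. apply Ha. rewrite Rmax_left by lra. ring. }
assert (ED : sumR near l1 = D0).
{ apply (zeros_sum_indep f g1 gB l1 lB R1 B1 B1); auto; [unfold R1; lra|lra|]. intros a Ha. unfold near in Ha.
  assert (Pa : 0 < slope_weight t a) by (pose proof (slope_weight_nonneg t a) as [Q|Q]; [auto|rewrite <- Q in Ha; lra]).
  destruct (slope_weight_pos t a Pa) as [P1 [P2 _]]. split; [auto|split; [auto|]].
  apply NNPP. intros Q. apply Ha. rewrite indic_false by auto. ring. }
rewrite EM.
assert (Sn : forall a, In a l1 -> snd a < 0) by (intros a Ha; apply (zeros_data_snd f g1 l1 R1 a Hn HZ1 Ha)).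
assert (Use : forall r', Rabs (r' - r) <= (2 * t + 1) * ln r -> X < r' -> 1 <= r' -> r' <= r + 2 * t + 1 -> ~ In r' (map (fun a => fst (wmap t a)) l1) ->
   Rabs (2 * PI * (r' * Carleman_sum t c1 r' l1) - ell0 * (H / pq)) <= e / 4 * H + e / 4 * H).
{ intros r' D1 D2 D3 D4 D5. specialize (N1 r' D1).
  assert (HRR : curve_bound t r' + 2 * t * ln r' <= R1).
  { assert (ln r' <= ln (r + 2 * t + 1)) by (apply ln_le; lra).
    assert (2 * t * ln r' <= 2 * t * ln (r + 2 * t + 1)) by (apply Rmult_le_compat_l; lra). unfold R1, curve_bound in *. lra. }
  assert (S1 := HX r' D2 R1 l1 g1 HRR HZ1 (fun a Ha _ _ E => D5 (proj2 (in_map_iff _ _ _) (ex_intro _ a (conj E Ha))))).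
  set (H' := r' ^ S (S k) * ln r') in *.
  assert (EH : r' * (r' ^ S k * ln r') = H') by (unfold H'; simpl; ring).
  assert (Pi0 : 0 < / pq <= 1) by (split; [apply Rinv_0_lt_compat; lra|rewrite <- Rinv_1; apply Rinv_le_contravar; lra]).
  assert (S2 : Rabs (2 * PI * (r' * Carleman_sum t c1 r' l1) - ell0 * (H' / pq)) <= e1 * H').
  { rewrite <- EH. replace (2 * PI * (r' * Carleman_sum t c1 r' l1) - ell0 * (r' * (r' ^ S k * ln r') / pq)) with
      (r' * (2 * PI * Carleman_sum t c1 r' l1 - ell0 * (r' ^ S k * ln r' / pq))) by (unfold Rdiv; ring).
    rewrite Rabs_mult, (Rabs_pos_eq r') by lra. replace (e1 * (r' * (r' ^ S k * ln r'))) with (r' * (e1 * (r' ^ S k * ln r'))) by ring.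
    apply Rmult_le_compat_l; lra. }
  replace (2 * PI * (r' * Carleman_sum t c1 r' l1) - ell0 * (H / pq)) with
    ((2 * PI * (r' * Carleman_sum t c1 r' l1) - ell0 * (H' / pq)) + ell0 * / pq * (H' - H)) by (unfold Rdiv; ring).
  eapply Rle_trans; [apply Rabs_triang|]. apply Rplus_le_compat.
  - eapply Rle_trans; [exact S2|]. apply Rabs_le_between in N1. unfold e1.
    assert (P0 : 0 <= H) by (apply Rle_trans with (r * r); [apply Rmult_le_pos; lra|exact HH]).
    assert (e2 * H <= 1 * H) by (apply Rmult_le_compat_r; lra). assert (e / 8 * H' <= e / 8 * (2 * H)) by (apply Rmult_le_compat_l; lra). lra.
  - rewrite !Rabs_mult, (Rabs_pos_eq (/ pq)) by lra.
    apply Rle_trans with (Rabs ell0 * 1 * (e2 * H)).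
    + apply Rmult_le_compat; try apply Rabs_pos; auto. { apply Rmult_le_pos; lra. } apply Rmult_le_compat_l; lra.
    + assert (0 <= H) by (apply Rle_trans with (r * r); [apply Rmult_le_pos; lra|exact HH]). rewrite Rmult_1_r, <- Rmult_assoc. apply Rmult_le_compat_r; lra. }
(* The Carleman sum at [rp], completed by the zeros near the origin, dominates the mass term by
   term; the one at [rm] is dominated by it. *)
destruct (avoid (map (fun a => fst (wmap t a)) l1) (r + 2 * t) (r + 2 * t + 1)) as [rp [Hrp Avp]]; [lra|].
destruct (avoid (map (fun a => fst (wmap t a)) l1) (r - Tb - 1) (r - Tb)) as [rm [Hrm Avm]]; [lra|].
assert (Up := Use rp ltac:(rewrite Rabs_pos_eq; lra) ltac:(lra) ltac:(lra) ltac:(lra) Avp).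
assert (Lo := Use rm ltac:(rewrite Rabs_left1; lra) ltac:(lra) ltac:(lra) ltac:(lra) Avm).
apply Rabs_le_between in Up. apply Rabs_le_between in Lo.
assert (MU : list_mass t r l1 <= rp * Carleman_sum t c1 rp l1 + r * D0).
{ rewrite <- ED. unfold list_mass, Carleman_sum. rewrite <- !sumR_scal, <- sumR_plus. apply sumR_le. intros a Ha.
  assert (P0 := slope_weight_nonneg t a).
  assert (Q0 : 0 <= rp * (indic (inside t c1 rp a) * (snd (wmap t a) * (1 - fst (wmap t a) / rp)))).
  { unfold indic. destruct excluded_middle_informative as [[I1 [I2 I3]]|]; [|lra].
    replace (rp * (1 * (snd (wmap t a) * (1 - fst (wmap t a) / rp)))) with (snd (wmap t a) * (rp - fst (wmap t a))) by (field; lra). nra. }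
  assert (Q1 : 0 <= r * near a) by (apply Rmult_le_pos; [lra|apply Rmult_le_pos; [apply indic_bounds|auto]]).
  destruct P0 as [P0|P0]; [|rewrite <- P0; lra]. destruct (slope_weight_pos t a P0) as [P1 [P2 [P3 P4]]].
  destruct (Rle_or_lt r (Cmod a)) as [Ra|Ra]; [rewrite Rmax_left by lra; lra|].
  rewrite Rmax_right by lra. assert (F := wmap_fst_bounds t a Ht P1 P2).
  assert (F1 := Rabs_fst_le a). rewrite Rabs_pos_eq in F1 by lra. pose proof (Cmod_ge_0 a) as Pa.
  destruct (classic (inside t c1 rp a)) as [In|NIn].
  - rewrite indic_true by auto. rewrite P4.
    replace (rp * (1 * (snd (wmap t a) * (1 - fst (wmap t a) / rp)))) with (snd (wmap t a) * (rp - fst (wmap t a))) by (field; lra).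
    assert (snd (wmap t a) * (r - Cmod a) <= snd (wmap t a) * (rp - fst (wmap t a))) by (apply Rmult_le_compat_l; lra). lra.
  - assert (Fa : fst a <= c1 + zmin t).
    { destruct (Rlt_le_dec (fst a) (zmin t)); [lra|]. destruct (Rle_or_lt (fst (wmap t a)) c1); [lra|].
      exfalso. apply NIn. split; [auto|split; [lra|auto]]. }
    assert (Na := Cmod_le_Bnd t (c1 + zmin t) a Ht P1 Fa P2 (Rlt_le _ _ P3)). fold B1 in Na.
    unfold near. rewrite (indic_true (Cmod a <= B1)) by auto. nra. }
assert (ML : rm * Carleman_sum t c1 rm l1 <= list_mass t r l1).
{ unfold list_mass, Carleman_sum. rewrite <- sumR_scal. apply sumR_le. intros a Ha. assert (Sa := Sn a Ha).
  assert (P0 := slope_weight_nonneg t a). assert (M0 := Rmax0_nonneg (r - Cmod a)).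
  destruct (classic (inside t c1 rm a)) as [[I1 [I2 I3]]|NIn].
  2:{ rewrite indic_false by auto. rewrite Rmult_0_l, Rmult_0_r. apply Rmult_le_pos; auto. }
  rewrite indic_true by (split; auto). assert (Pf : 0 < fst a) by lra.
  assert (Ep : slope_weight t a = snd (wmap t a)).
  { unfold slope_weight. rewrite indic_true by (split; lra). rewrite wmap_snd in I3 |- *. rewrite Rmax_right by lra. ring. }
  assert (F := wmap_fst_bounds t a Ht Pf ltac:(lra)).
  assert (Ba := Cmod_le_Bnd t r a Ht Pf ltac:(lra) ltac:(lra) ltac:(lra)).
  assert (T := Cmod_le_sum a). rewrite Rabs_pos_eq, Rabs_left1 in T by lra.
  assert (Pc : 0 < Cmod a). { eapply Rlt_le_trans; [|apply Rabs_fst_le]. rewrite Rabs_pos_eq; lra. }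
  assert (Lc : t * ln (Cmod a) <= Tb) by (apply Rmult_le_compat_l; [auto|apply ln_le; auto]).
  assert (I3' := I3). rewrite wmap_snd in I3'.
  replace (rm * (1 * (snd (wmap t a) * (1 - fst (wmap t a) / rm)))) with (snd (wmap t a) * (rm - fst (wmap t a))) by (field; lra).
  rewrite Ep. apply Rmult_le_compat_l; [lra|]. eapply Rle_trans; [|apply Rmax_r]. lra. }
assert (ML' := Rmult_le_compat_l (2 * PI) _ _ ltac:(lra) ML).
assert (MU' := Rmult_le_compat_l (2 * PI) _ _ ltac:(lra) MU).
assert (DD : 2 * PI * (r * D0) <= e / 4 * H).
{ assert (Q : 8 * PI * D0 * / e <= r) by lra.
  apply Rmult_le_compat_r with (r := e) in Q; [|lra]. rewrite Rmult_assoc, Rinv_l, Rmult_1_r in Q by lra.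
  assert (8 * PI * D0 * r <= r * e * r) by (apply Rmult_le_compat_r; lra). nra. }
assert (0 <= H) by nra. assert (0 <= e * H) by (apply Rmult_le_pos; lra).
apply Rabs_le. lra.
Qed.

(** * Recovering the zero count by double differences *)

(** A chosen zero list for the box of size r; sums over it of functions supported in the relevant
    points with |a| <= r do not depend on the choice, by [zeros_sum_indep]. *)
Definition zlist (f : C -> C) (r : R) : list C :=
  epsilon (inhabits nil) (fun l => exists g, zeros_data f g l r).

Definition mass (f : C -> C) (t r : R) : R := list_mass t r (zlist f r).

Definition zeros_below (f : C -> C) (t r : R) : R := sumR (fun a => indic (in_region t r a)) (zlist f r).

Lemma zlist_spec (f : C -> C) (r : R) : holo_lower f -> (forall s : R, f (RtoC s) <> RtoC 0) -> 0 <= r ->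
  exists g, zeros_data f g (zlist f r) r.
Proof.
intros Hf Hn Hr. destruct (zeros_data_ex f r Hf Hn Hr) as [l [g H]].
apply (epsilon_spec (inhabits nil) (fun l => exists g, zeros_data f g l r)). exists l, g. exact H.
Qed.

Lemma mass_eq (f g : C -> C) (l : list C) (t r R0 : R) : holo_lower f -> (forall s : R, f (RtoC s) <> RtoC 0) ->
  0 <= r <= R0 -> zeros_data f g l R0 -> mass f t r = list_mass t r l.
Proof.
intros Hf Hn Hr HZ. destruct (zlist_spec f r Hf Hn (proj1 Hr)) as [g' HZ'].
apply (zeros_sum_indep f g' g _ _ r R0 r); auto; [lra|lra|]. intros a Ha.
assert (Pa : 0 < slope_weight t a) by (pose proof (slope_weight_nonneg t a) as [Q|Q]; [auto|rewrite <- Q in Ha; lra]).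
destruct (slope_weight_pos t a Pa) as [P1 [P2 _]]. split; [auto|split; [auto|]].
apply Rnot_lt_le. intros Q. apply Ha. rewrite Rmax_left by lra. ring.
Qed.

Lemma zeros_below_eq (f g : C -> C) (l : list C) (t r R0 : R) : holo_lower f -> (forall s : R, f (RtoC s) <> RtoC 0) ->
  0 <= r <= R0 -> zeros_data f g l R0 -> zeros_below f t r = sumR (fun a => indic (in_region t r a)) l.
Proof.
intros Hf Hn Hr HZ. destruct (zlist_spec f r Hf Hn (proj1 Hr)) as [g' HZ'].
apply (zeros_sum_indep f g' g _ _ r R0 r); auto; [lra|lra|]. intros a Ha.
destruct (classic (in_region t r a)) as [[I1 [I2 I3]]|N]; [|rewrite indic_false in Ha by auto; lra].
split; [exact I1|split; [apply I2|lra]].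
Qed.

Lemma zero_count_zeros_below (f : C -> C) (t r : R) : holo_lower f -> (forall s : R, f (RtoC s) <> RtoC 0) -> 0 <= r ->
  zero_count f t r = Finite (zeros_below f t r).
Proof.
intros Hf Hn Hr. destruct (zlist_spec f r Hf Hn Hr) as [g [Z1 [Z2 [Z3 Z4]]]].
apply (zero_count_list f g); auto. intros z [I1 [I2 I3]]. split; [apply Z2; apply I2|].
apply Z4, box_Cmod; [left; exact I1|apply I2|lra].
Qed.

Definition mass_diff (f : C -> C) (t1 t2 r1 r2 : R) : R := mass f t2 r2 - mass f t1 r2 - mass f t2 r1 + mass f t1 r1.

Lemma mass_diff_sum (f g : C -> C) (l : list C) (t1 t2 r1 r2 R0 : R) : holo_lower f -> (forall s : R, f (RtoC s) <> RtoC 0) ->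
  0 <= r1 -> r1 <= r2 -> r2 <= R0 -> zeros_data f g l R0 ->
  mass_diff f t1 t2 r1 r2 = sumR (fun a => (slope_weight t2 a - slope_weight t1 a) * (Rmax 0 (r2 - Cmod a) - Rmax 0 (r1 - Cmod a))) l.
Proof.
intros Hf Hn H0 H1 H2 HZ. unfold mass_diff.
rewrite !(mass_eq f g l _ _ R0) by (auto; lra). unfold list_mass.
clear. induction l as [|a l IH]; simpl; [lra|]. rewrite <- IH. ring.
Qed.

Lemma slope_weight_incr (t1 t2 : R) (a : C) : 0 <= t1 -> t1 <= t2 -> slope_weight t1 a <= slope_weight t2 a.
Proof.
intros H0 H1. unfold slope_weight, indic. destruct excluded_middle_informative as [[P1 P2]|_]; [|lra]. rewrite !Rmult_1_l.
apply Rmax_lub; [apply Rmax_l|]. destruct (Rle_or_lt 0 (ln (Cmod a))).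
- eapply Rle_trans; [|apply Rmax_r]. nra.
- eapply Rle_trans; [|apply Rmax_l]. nra.
Qed.

Lemma Rmax0_incr (x r1 r2 : R) : r1 <= r2 -> 0 <= Rmax 0 (r2 - x) - Rmax 0 (r1 - x) <= r2 - r1.
Proof. intros H. unfold Rmax. repeat destruct Rle_dec; lra. Qed.

(** In the double difference a zero contributes its slope increment, at most d ln |a|, times its
    radius increment, at most h. The product is 0 unless the zero is counted, and then ln |a| <= ln
    r. *)
Lemma count_lower (f : C -> C) (t d r h : R) : holo_lower f -> (forall s : R, f (RtoC s) <> RtoC 0) ->
  0 < d <= t -> 1 <= r -> 0 <= h <= r -> mass_diff f (t - d) t (r - h) r <= d * ln r * h * zeros_below f t r.
Proof.
intros Hf Hn Hd Hr Hh. destruct (zlist_spec f r Hf Hn ltac:(lra)) as [g HZ].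
rewrite (mass_diff_sum f g (zlist f r) _ _ _ _ r) by (auto; lra). unfold zeros_below. rewrite <- sumR_scal. apply sumR_le. intros a _.
assert (Q := Rmax0_incr (Cmod a) (r - h) r ltac:(lra)). assert (I := slope_weight_incr (t - d) t a ltac:(lra) ltac:(lra)).
assert (B : 0 <= d * ln r * h * indic (in_region t r a)).
{ apply Rmult_le_pos; [|apply indic_bounds]. apply Rmult_le_pos; [|lra]. apply Rmult_le_pos; [lra|apply ln_nonneg; lra]. }
destruct (Rle_or_lt r (Cmod a)) as [Ra|Ra]; [rewrite !Rmax_left by lra; lra|].
pose proof (slope_weight_nonneg (t - d) a) as P0. pose proof (slope_weight_nonneg t a) as [P1|P1]; [|replace (slope_weight (t - d) a) with 0 by lra; rewrite <- P1; lra].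
destruct (slope_weight_pos t a P1) as [X1 [X2 [X3 X4]]]. rewrite wmap_snd in X3, X4.
assert (L0 : 0 < ln (Cmod a)) by (apply Rnot_le_lt; intros Q'; nra).
assert (Pc : 0 < Cmod a). { eapply Rlt_le_trans; [|apply Rabs_fst_le]. rewrite Rabs_pos_eq; lra. }
assert (L1 : ln (Cmod a) <= ln r) by (apply ln_le; lra).
rewrite indic_true.
- assert (E : (t - d) * ln (Cmod a) + snd a <= slope_weight (t - d) a).
  { unfold slope_weight. rewrite indic_true by auto. rewrite Rmult_1_l. apply Rmax_r. }
  rewrite Rmult_1_r. apply Rmult_le_compat; try lra. nra.
- split; [exact X1|split; [|lra]]. split; [|exact X2].
  assert (ln (Cmod a) <= ln (1 + Cmod a)) by (apply ln_le; lra). unfold Im. nra.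
Qed.

(** Reconciles ln (1 + |z|) in the definition of the region with ln |z| in that of the curve: far
    enough out the difference is covered by an extra slope d. *)
Lemma ln_succ_le (t d s x : R) : 0 <= t -> 0 < d -> t / d <= s -> 1 <= s -> 1 <= ln s -> s <= x -> t * ln (1 + x) <= (t + d) * ln x.
Proof.
intros Ht Hd H1 H2 H3 H4.
assert (Px : 0 < / x) by (apply Rinv_0_lt_compat; lra).
assert (E : ln (1 + x) = ln x + ln (1 + / x)).
{ rewrite <- ln_mult by lra. f_equal. field. lra. }
assert (L := ln_le_pred (1 + / x) ltac:(lra)). assert (L2 : ln s <= ln x) by (apply ln_le; lra).
assert (t * / x <= d).
{ apply Rmult_le_reg_r with x; [lra|]. rewrite Rmult_assoc, Rinv_l, Rmult_1_r by lra.
  apply Rmult_le_compat_l with (r := d) in H1; [|lra]. replace (d * (t / d)) with t in H1 by (field; lra). nra. }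
rewrite E. nra.
Qed.

(** A counted zero with s <= |a| < r lies above the curve of slope t + d, so that all positive parts
    are active and it contributes exactly d ln |a| h, at least d ln s h. The other zeros contribute
    nonnegative terms. *)
Lemma count_upper (f : C -> C) (t d s r h : R) : holo_lower f -> (forall s : R, f (RtoC s) <> RtoC 0) ->
  0 <= t -> 0 < d -> t / d <= s -> 1 <= s -> 1 <= ln s -> s <= r -> 0 <= h ->
  d * ln s * h * (zeros_below f t r - zeros_below f t s) <= mass_diff f (t + d) (t + 2 * d) r (r + h).
Proof.
intros Hf Hn Ht Hd H1 H2 H3 H4 Hh. destruct (zlist_spec f (r + h) Hf Hn ltac:(lra)) as [g HZ]. set (l := zlist f (r + h)) in *.
rewrite (mass_diff_sum f g l _ _ _ _ (r + h)) by (auto; lra). rewrite !(zeros_below_eq f g l t _ (r + h)) by (auto; lra).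
replace (sumR (fun a => indic (in_region t r a)) l - sumR (fun a => indic (in_region t s a)) l) with
  (sumR (fun a => indic (in_region t r a) + (-1) * indic (in_region t s a)) l) by (rewrite sumR_plus, sumR_scal; ring).
rewrite <- sumR_scal. apply sumR_le. intros a _.
assert (Q := Rmax0_incr (Cmod a) r (r + h) ltac:(lra)). assert (I := slope_weight_incr (t + d) (t + 2 * d) a ltac:(lra) ltac:(lra)).
assert (B : 0 <= (slope_weight (t + 2 * d) a - slope_weight (t + d) a) * (Rmax 0 (r + h - Cmod a) - Rmax 0 (r - Cmod a))) by (apply Rmult_le_pos; lra).
assert (B2 : 0 <= d * ln s * h) by (apply Rmult_le_pos; [|lra]; apply Rmult_le_pos; lra).
destruct (classic (in_region t r a)) as [Y|N].
2:{ rewrite (indic_false _ N). pose proof (indic_bounds (in_region t s a)). nra. }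
rewrite (indic_true _ Y). destruct Y as [Y1 [[Y2 Y2'] Y3]].
destruct (Rlt_le_dec (Cmod a) s) as [L|L].
{ rewrite indic_true by (split; [exact Y1|split; [split; auto|auto]]). replace (1 + -1 * 1) with 0 by ring. lra. }
rewrite indic_false by (intros [_ [_ Z]]; lra).
assert (K := ln_succ_le t d s (Cmod a) Ht Hd H1 H2 H3 L).
assert (L2 : ln s <= ln (Cmod a)) by (apply ln_le; lra). unfold Im in Y2, Y2'. unfold Re in Y1.
rewrite !Rmax_right by lra. unfold slope_weight. rewrite !indic_true by auto. rewrite !Rmax_right by nra.
replace ((1 * ((t + 2 * d) * ln (Cmod a) + snd a) - 1 * ((t + d) * ln (Cmod a) + snd a)) * (r + h - Cmod a - (r - Cmod a)))
  with (d * ln (Cmod a) * h) by ring.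
replace (d * ln s * h * (1 + -1 * 0)) with (d * ln s * h) by ring.
apply Rmult_le_compat_r; [auto|]. apply Rmult_le_compat_l; lra.
Qed.

Lemma growth_curve_free (k : nat) (f : C -> C) (t L : R) : 0 <= t ->
  filterlim (growth (S k) f) (log_curve t) (Rbar_nbhds (Finite L)) -> exists cs, curve_free f t cs.
Proof.
intros Ht HL. destruct (growth_eps k f t L HL 1 ltac:(lra)) as [M HM]. exists (M + 2 * t + 1). intros z H1 H2 H3.
unfold zmin in H1. rewrite wmap_fst in H2. destruct (Arg_right' z ltac:(lra)).
apply HM; auto; [|lra]. eapply Rlt_le_trans; [|apply Rabs_fst_le]. rewrite Rabs_pos_eq by lra. nra.
Qed.

(** * Limits of the double differences *)

Lemma mass_lim (k : nat) (f : C -> C) (t L : R) : class_F (S k) f -> 0 <= t ->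
  filterlim (growth (S k) f) (log_curve t) (Rbar_nbhds (Finite L)) ->
  is_lim (fun r => mass f t r / (r ^ S (S k) * ln r)) p_infty (L / (2 * PI * (INR (S k) * INR (S (S k))))).
Proof.
intros HF Ht HL. destruct (class_F_holo _ _ HF) as [Hf Hn].
destruct (growth_curve_free k f t L Ht HL) as [cs HC].
assert (HM := list_mass_asymp k f t cs L HF Ht HC (lnf_bottom k f t L Ht HL)).
assert (K1 : 0 < INR (S k)) by (apply lt_0_INR; lia). assert (K2 : 0 < INR (S (S k))) by (apply lt_0_INR; lia).
assert (Pi1 := PI_RGT_0). assert (Pi2 := PI2_1).
intros P [e He]. change (ev (fun r => P (mass f t r / (r ^ S (S k) * ln r)))).
generalize (filter_and _ _ (HM e (cond_pos e)) (filter_and _ _ (ev_ge 2) (ev_ln_ge 1))).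
apply filter_imp. intros r [H1 [H2 H3]]. apply He.
destruct (zlist_spec f r Hf Hn ltac:(lra)) as [g HZ]. specialize (H1 r _ g (Rle_refl r) HZ). fold (mass f t r) in H1.
assert (Hp : 0 < r ^ S (S k) * ln r) by (apply Rmult_lt_0_compat; [apply pow_lt; lra|lra]).
set (H := r ^ S (S k) * ln r) in *. change (Rabs (mass f t r / H - L / (2 * PI * (INR (S k) * INR (S (S k))))) < e).
replace (mass f t r / H - L / (2 * PI * (INR (S k) * INR (S (S k))))) with
  ((2 * PI * mass f t r - L * (H / (INR (S k) * INR (S (S k))))) * / (2 * PI * H)) by (field; repeat split; lra).
assert (P0 : 0 < 2 * PI * H) by (apply Rmult_lt_0_compat; lra).
rewrite Rabs_mult, (Rabs_pos_eq (/ _)) by (left; apply Rinv_0_lt_compat; auto).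
assert (E0 := cond_pos e). apply Rmult_lt_reg_r with (2 * PI * H); [auto|]. rewrite Rmult_assoc, Rinv_l, Rmult_1_r by lra.
eapply Rle_lt_trans; [exact H1|]. assert (1 * H < 2 * PI * H) by (apply Rmult_lt_compat_r; lra).
apply Rmult_lt_compat_l; lra.
Qed.

Lemma ln_scale_lim (c : R) : 0 < c -> is_lim (fun r => ln (c * r) / ln r) p_infty 1.
Proof.
intros Hc P [e He]. change (ev (fun r => P (ln (c * r) / ln r))). assert (E0 := cond_pos e).
generalize (filter_and _ _ (ev_ge 2) (filter_and _ _ (ev_ln_ge 1) (ev_ln_ge (2 * Rabs (ln c) / e)))).
apply filter_imp. intros r [H1 [H2 H3]]. apply He. change (Rabs (ln (c * r) / ln r - 1) < e).
rewrite ln_mult by lra. replace ((ln c + ln r) / ln r - 1) with (ln c / ln r) by (field; lra).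
unfold Rdiv at 1. rewrite Rabs_mult, (Rabs_pos_eq (/ _)) by (left; apply Rinv_0_lt_compat; lra).
apply Rmult_lt_reg_r with (ln r); [lra|]. rewrite Rmult_assoc, Rinv_l, Rmult_1_r by lra.
apply Rmult_le_compat_r with (r := e) in H3; [|lra]. unfold Rdiv in H3. rewrite Rmult_assoc, Rinv_l in H3 by lra.
pose proof (Rabs_pos (ln c)). nra.
Qed.

Lemma is_lim_p_scale (q : R -> R) (c l : R) : 0 < c -> is_lim q p_infty l -> is_lim (fun r => q (c * r)) p_infty l.
Proof.
intros Hc Hq P HP. destruct (Hq P HP) as [M HM]. exists (M / c). intros r Hr. apply HM.
apply Rmult_lt_compat_l with (r := c) in Hr; [|lra]. replace (c * (M / c)) with M in Hr by (field; lra). exact Hr.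
Qed.

Lemma mass_lim_scale (m : nat) (f : C -> C) (t L c : R) : 0 < c ->
  is_lim (fun r => mass f t r / (r ^ m * ln r)) p_infty L ->
  is_lim (fun r => mass f t (c * r) / (r ^ m * ln r)) p_infty (L * c ^ m).
Proof.
intros Hc HL.
apply is_lim_ext_loc with (fun r => mass f t (c * r) / ((c * r) ^ m * ln (c * r)) * (c ^ m * (ln (c * r) / ln r))).
- generalize (filter_and _ _ (ev_ln_ge (1 - ln c)) (filter_and _ _ (ev_ge 1) (ev_ln_ge 1))). apply filter_imp. intros r [H1 [H2 H3]].
  rewrite Rpow_mult_distr. assert (ln (c * r) <> 0) by (rewrite ln_mult; lra).
  field. repeat split; try lra; apply pow_nonzero; lra.
- apply is_lim_mult_fin; [exact (is_lim_p_scale (fun r => mass f t r / (r ^ m * ln r)) c L Hc HL)|].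
  replace (Finite (c ^ m)) with (Finite (c ^ m * 1)) by (f_equal; ring).
  apply is_lim_mult_fin; [apply is_lim_const|apply ln_scale_lim; auto].
Qed.

Lemma mass_diff_lim (m : nat) (f : C -> C) (t1 t2 L1 L2 c1 c2 : R) : 0 < c1 -> 0 < c2 ->
  is_lim (fun r => mass f t1 r / (r ^ m * ln r)) p_infty L1 ->
  is_lim (fun r => mass f t2 r / (r ^ m * ln r)) p_infty L2 ->
  is_lim (fun r => mass_diff f t1 t2 (c1 * r) (c2 * r) / (r ^ m * ln r)) p_infty ((L2 - L1) * (c2 ^ m - c1 ^ m)).
Proof.
intros H1 H2 HL1 HL2.
apply is_lim_ext with (fun r => mass f t2 (c2 * r) / (r ^ m * ln r) - mass f t1 (c2 * r) / (r ^ m * ln r)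
  - (mass f t2 (c1 * r) / (r ^ m * ln r) - mass f t1 (c1 * r) / (r ^ m * ln r))).
{ intros r. unfold mass_diff, Rdiv. ring. }
replace (Finite ((L2 - L1) * (c2 ^ m - c1 ^ m))) with (Finite (L2 * c2 ^ m - L1 * c2 ^ m - (L2 * c1 ^ m - L1 * c1 ^ m))) by (f_equal; ring).
repeat apply is_lim_minus'; apply mass_lim_scale; auto.
Qed.

Lemma zeros_below_nonneg (f : C -> C) (t r : R) : 0 <= zeros_below f t r.
Proof. apply sumR_nonneg. intros. apply indic_bounds. Qed.

Lemma ev_ln_comp (P : R -> Prop) : ev P -> ev (fun r => P (ln r)).
Proof.
intros [M HM]. exists (exp M). intros r Hr. apply HM. rewrite <- (ln_exp M). apply ln_increasing; [apply exp_pos|auto].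
Qed.

Lemma is_lim_ev (q : R -> R) (l e : R) : is_lim q p_infty l -> 0 < e -> ev (fun r => Rabs (q r - l) < e).
Proof. intros H He. exact (H _ (ex_intro _ (mkposreal e He) (fun y Hy => Hy))). Qed.

Lemma ev_is_lim (q : R -> R) (l : R) : (forall e, 0 < e -> ev (fun r => Rabs (q r - l) < e)) -> is_lim q p_infty l.
Proof.
intros H P [e He]. change (ev (fun r => P (q r))). generalize (H e (cond_pos e)). apply filter_imp.
intros r Hr. apply He. exact Hr.
Qed.

(* Zeros of modulus below [cut r] are negligible in the count up to [r], while [ln (cut r)] is asymptotic to [ln r]. *)
Definition cut (r : R) : R := r / (ln r * ln r).

Lemma ln_cut (e : R) : 0 < e -> ev (fun r => (1 - e) * ln r <= ln (cut r) <= ln r).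
Proof.
intros He. assert (He2 : 0 < e / 2) by lra.
generalize (filter_and _ _ (ev_ln_comp _ (ev_ln_le (e / 2) He2)) (filter_and _ _ (ev_ge 1) (ev_ln_ge 1))).
apply filter_imp. intros r [H1 [H2 H3]].
assert (L : 0 <= ln (ln r)) by (apply ln_nonneg; auto).
unfold cut. rewrite ln_div, ln_mult by (try lra; apply Rmult_lt_0_compat; lra). lra.
Qed.

Lemma ev_cut (P : R -> Prop) : ev P -> ev (fun r => P (cut r)).
Proof.
intros [M HM]. assert (I2 : 0 < / 2) by lra. generalize (filter_and _ _ (ln_cut (/ 2) I2) (filter_and _ _ (ev_ge 1) (ev_ln_ge (2 * ln (Rabs M + 2) + 1)))).
apply filter_imp. intros r [H1 [H2 H3]]. apply HM. pose proof (Rabs_pos M). pose proof (Rle_abs M).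
assert (0 <= ln (Rabs M + 2)) by (apply ln_nonneg; lra).
assert (0 < cut r) by (apply Rdiv_lt_0_compat; [lra|apply Rmult_lt_0_compat; lra]).
assert (Rabs M + 2 < cut r) by (apply ln_lt_inv; lra). lra.
Qed.

Lemma ln_cut_lim : is_lim (fun r => ln r / ln (cut r)) p_infty 1.
Proof.
apply ev_is_lim. intros e He. set (d := Rmin (/ 2) (e / 4)).
assert (Hd : 0 < d) by (apply Rmin_glb_lt; lra). assert (D1 : d <= / 2) by apply Rmin_l. assert (D2 : d <= e / 4) by apply Rmin_r.
generalize (filter_and _ _ (ln_cut d Hd) (ev_ln_ge 1)). apply filter_imp. intros r [[H1 H2] H3].
assert (P : 0 < ln (cut r)) by nra.
replace (ln r / ln (cut r) - 1) with ((ln r - ln (cut r)) * / ln (cut r)) by (field; lra).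
rewrite Rabs_pos_eq by (apply Rmult_le_pos; [lra|left; apply Rinv_0_lt_compat; lra]).
apply Rmult_lt_reg_r with (ln (cut r)); [auto|]. rewrite Rmult_assoc, Rinv_l, Rmult_1_r by lra. nra.
Qed.

(** With a fixed cutoff s the bound loses a factor ln r. This is harmless for its use at [cut r],
    since (cut r)^(k+1) ln r is o(r^(k+1)). *)
Lemma zeros_below_bound (k : nat) (f : C -> C) (t d L1 L2 : R) : holo_lower f -> (forall s : R, f (RtoC s) <> RtoC 0) ->
  0 <= t -> 0 < d ->
  is_lim (fun r => mass f (t + d) r / (r ^ S (S k) * ln r)) p_infty L1 ->
  is_lim (fun r => mass f (t + 2 * d) r / (r ^ S (S k) * ln r)) p_infty L2 ->
  exists B, 0 <= B /\ ev (fun r => zeros_below f t r <= B * (r ^ S k * ln r)).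
Proof.
intros Hf Hn Ht Hd H1 H2. set (s := t / d + 3).
assert (Htd : 0 <= t / d) by (apply Rmult_le_pos; [lra|left; apply Rinv_0_lt_compat; lra]).
assert (Ls : 1 <= ln s).
{ rewrite <- (ln_exp 1). apply ln_le; [apply exp_pos|]. pose proof exp_le_3. unfold s. lra. }
assert (DL := is_lim_ev _ _ 1 (mass_diff_lim (S (S k)) f (t + d) (t + 2 * d) L1 L2 1 2 ltac:(lra) ltac:(lra) H1 H2) ltac:(lra)).
set (V := (L2 - L1) * (2 ^ S (S k) - 1 ^ S (S k))) in *.
pose proof (zeros_below_nonneg f t s) as N0. pose proof (Rabs_pos V).
assert (Pd : 0 < / d) by (apply Rinv_0_lt_compat; lra).
exists (zeros_below f t s + (Rabs V + 1) * / d). split. { apply Rplus_le_le_0_compat; [auto|apply Rmult_le_pos; lra]. }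
generalize (filter_and _ _ DL (filter_and _ _ (ev_ge s) (ev_ln_ge 1))). apply filter_imp. intros r [D [R1 R2]].
assert (Rs : 3 <= r) by (unfold s in R1; lra).
assert (K := count_upper f t d s r r Hf Hn Ht Hd ltac:(unfold s; lra) ltac:(unfold s; lra) Ls R1 ltac:(lra)).
assert (Pk : 1 <= r ^ S k) by (apply pow_ge1; lra).
rewrite Rmult_1_l in D. replace (r + r) with (2 * r) in K by ring.
set (X := mass_diff f (t + d) (t + 2 * d) r (2 * r)) in *. change (r ^ S (S k)) with (r * r ^ S k) in D. set (p := r ^ S k) in *.
assert (Pp : 1 <= p * ln r) by nra.
assert (XB : X <= (Rabs V + 1) * (r * (p * ln r))).
{ apply Rabs_def2 in D. pose proof (Rle_abs V). assert (E : X / (r * p * ln r) <= Rabs V + 1) by lra.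
  assert (P0 : 0 < r * (p * ln r)) by (apply Rmult_lt_0_compat; lra).
  apply Rmult_le_compat_r with (r := r * (p * ln r)) in E; [|lra].
  replace (X / (r * p * ln r) * (r * (p * ln r))) with X in E by (field; split; [lra|split; [|lra]]; lra). exact E. }
destruct (Rle_or_lt (zeros_below f t r) (zeros_below f t s)) as [Q|Q].
- assert (0 <= (Rabs V + 1) * / d * (p * ln r)) by (apply Rmult_le_pos; [apply Rmult_le_pos; lra|lra]). assert (zeros_below f t s * 1 <= zeros_below f t s * (p * ln r)) by (apply Rmult_le_compat_l; lra). lra.
- assert (E : d * r * (zeros_below f t r - zeros_below f t s) <= X).
  { eapply Rle_trans; [|exact K]. apply Rmult_le_compat_r; [lra|]. rewrite (Rmult_assoc d (ln s) r).
    apply Rmult_le_compat_l; [lra|]. rewrite <- (Rmult_1_l r) at 1. apply Rmult_le_compat_r; lra. }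
  assert (E2 : zeros_below f t r - zeros_below f t s <= (Rabs V + 1) * / d * (p * ln r)).
  { apply Rmult_le_reg_l with (d * r); [apply Rmult_lt_0_compat; lra|].
    replace (d * r * ((Rabs V + 1) * / d * (p * ln r))) with ((Rabs V + 1) * (r * (p * ln r))) by (field; lra). lra. }
  assert (zeros_below f t s * 1 <= zeros_below f t s * (p * ln r)) by (apply Rmult_le_compat_l; lra). lra.
Qed.

(** [count_upper] with the moving cutoff [cut r]: the zeros below it number o(r^(k+1)), and ln r /
    ln (cut r) tends to 1, so the constant is not degraded. *)
Lemma zeros_below_upper (k : nat) (f : C -> C) (t d eta L1 L2 : R) : holo_lower f -> (forall s : R, f (RtoC s) <> RtoC 0) ->
  0 <= t -> 0 < d -> 0 < eta ->
  is_lim (fun r => mass f (t + d) r / (r ^ S (S k) * ln r)) p_infty L1 ->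
  is_lim (fun r => mass f (t + 2 * d) r / (r ^ S (S k) * ln r)) p_infty L2 ->
  forall e, 0 < e -> ev (fun r => zeros_below f t r / r ^ S k <= (L2 - L1) / d * (((1 + eta) ^ S (S k) - 1) / eta) + e).
Proof.
intros Hf Hn Ht Hd He H1 H2 e E0.
destruct (zeros_below_bound k f t d L1 L2 Hf Hn Ht Hd H1 H2) as [B [HB NB]].
assert (DL := mass_diff_lim (S (S k)) f (t + d) (t + 2 * d) L1 L2 1 (1 + eta) ltac:(lra) ltac:(lra) H1 H2).
assert (UL := is_lim_ev _ _ (e / 2) (is_lim_mult_fin _ _ _ _ (is_lim_mult_fin _ _ _ _ DL (is_lim_const (/ (d * eta)) p_infty)) ln_cut_lim) ltac:(lra)).
cbv beta in UL. rewrite pow1 in UL.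
replace ((L2 - L1) * ((1 + eta) ^ S (S k) - 1) * / (d * eta) * 1) with ((L2 - L1) / d * (((1 + eta) ^ S (S k) - 1) / eta)) in UL by (field; lra).
set (W := (L2 - L1) / d * (((1 + eta) ^ S (S k) - 1) / eta)) in *.
assert (I2 : 0 < / 2) by lra.
generalize (filter_and _ _ UL (filter_and _ _ (ev_cut _ NB) (filter_and _ _ (ev_cut _ (filter_and _ _ (ev_ge (t / d)) (filter_and _ _ (ev_ge 1) (ev_ln_ge 1))))
  (filter_and _ _ (ln_cut (/ 2) I2) (filter_and _ _ (ev_ge 1) (ev_ln_ge (1 + 2 * B / e))))))).
apply filter_imp. intros r [U [N [[C1 [C2 C3]] [[S1 S2] [R1 R2]]]]].
assert (B0 : 0 <= 2 * B / e) by (apply Rmult_le_pos; [lra|left; apply Rinv_0_lt_compat; lra]).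
assert (Hc : cut r * (ln r * ln r) = r) by (unfold cut; field; lra).
assert (1 <= ln r * ln r) by (rewrite <- (Rmult_1_l 1); apply Rmult_le_compat; lra).
assert (Hs : cut r <= r) by nra.
assert (K := count_upper f t d (cut r) r (eta * r) Hf Hn Ht Hd C1 C2 C3 Hs ltac:(apply Rmult_le_pos; lra)).
rewrite Rmult_1_l in U. replace (r + eta * r) with ((1 + eta) * r) in K by ring.
set (X := mass_diff f (t + d) (t + 2 * d) r ((1 + eta) * r)) in *. change (r ^ S (S k)) with (r * r ^ S k) in U.
assert (Pp : 1 <= r ^ S k) by (apply pow_ge1; lra).
(* As cut r * ln^2 r = r, one logarithm pays for the crude bound and the other makes the result
   small. *)
assert (NC : zeros_below f t (cut r) <= e / 2 * r ^ S k).
{ eapply Rle_trans; [exact N|]. assert (Q : cut r ^ S k * (ln r * ln r) <= r ^ S k).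
  { assert (cut r ^ k <= r ^ k) by (apply pow_incr; lra).
    change (cut r ^ S k) with (cut r * cut r ^ k). change (r ^ S k) with (r * r ^ k).
    replace (cut r * cut r ^ k * (ln r * ln r)) with (cut r * (ln r * ln r) * cut r ^ k) by ring. rewrite Hc.
    apply Rmult_le_compat_l; lra. }
  assert (P1 : 0 < cut r ^ S k) by (apply pow_lt; lra).
  assert (BL : B <= e / 2 * ln r).
  { assert (Q2 : 2 * B / e <= ln r) by lra. apply Rmult_le_compat_r with (r := e) in Q2; [|lra].
    replace (2 * B / e * e) with (2 * B) in Q2 by (field; lra). lra. }
  apply Rle_trans with (e / 2 * ln r * (cut r ^ S k * ln r)).
  - apply Rmult_le_compat; try lra. apply Rmult_le_pos; lra. apply Rmult_le_compat_l; lra.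
  - replace (e / 2 * ln r * (cut r ^ S k * ln r)) with (e / 2 * (cut r ^ S k * (ln r * ln r))) by ring.
    apply Rmult_le_compat_l; lra. }
set (p := r ^ S k) in *. apply Rabs_def2 in U.
assert (Lc : 0 < ln (cut r)) by lra.
replace (X / (r * p * ln r) * / (d * eta) * (ln r / ln (cut r))) with (X / (d * ln (cut r) * (eta * r)) / p) in U
  by (field; repeat split; lra).
assert (P2 : 0 < d * ln (cut r) * (eta * r)) by (repeat apply Rmult_lt_0_compat; lra).
assert (E : zeros_below f t r - zeros_below f t (cut r) <= X / (d * ln (cut r) * (eta * r))).
{ apply Rmult_le_reg_l with (d * ln (cut r) * (eta * r)); [auto|]. eapply Rle_trans; [exact K|]. right. field. repeat split; lra. }
apply Rmult_le_reg_r with p; [lra|]. unfold Rdiv at 1. rewrite Rmult_assoc, Rinv_l, Rmult_1_r by lra.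
assert (U2 : X / (d * ln (cut r) * (eta * r)) / p * p <= (W + e / 2) * p) by (apply Rmult_le_compat_r; lra).
unfold Rdiv at 1 in U2. rewrite Rmult_assoc, Rinv_l, Rmult_1_r in U2 by lra. lra.
Qed.

(** The logarithms of the moduli of the zeros counted are at most ln r, so [count_lower] yields the
    sharp constant directly. *)
Lemma zeros_below_lower (k : nat) (f : C -> C) (t d eta L1 L2 : R) : holo_lower f -> (forall s : R, f (RtoC s) <> RtoC 0) ->
  0 < d <= t -> 0 < eta < 1 ->
  is_lim (fun r => mass f (t - d) r / (r ^ S (S k) * ln r)) p_infty L1 ->
  is_lim (fun r => mass f t r / (r ^ S (S k) * ln r)) p_infty L2 ->
  forall e, 0 < e -> ev (fun r => (L2 - L1) / d * ((1 - (1 - eta) ^ S (S k)) / eta) - e <= zeros_below f t r / r ^ S k).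
Proof.
intros Hf Hn Hd He H1 H2 e E0.
assert (DL := mass_diff_lim (S (S k)) f (t - d) t L1 L2 (1 - eta) 1 ltac:(lra) ltac:(lra) H1 H2).
assert (UL := is_lim_ev _ _ e (is_lim_mult_fin _ _ _ _ DL (is_lim_const (/ (d * eta)) p_infty)) E0).
cbv beta in UL. rewrite pow1 in UL.
replace ((L2 - L1) * (1 - (1 - eta) ^ S (S k)) * / (d * eta)) with ((L2 - L1) / d * ((1 - (1 - eta) ^ S (S k)) / eta)) in UL by (field; lra).
set (W := (L2 - L1) / d * ((1 - (1 - eta) ^ S (S k)) / eta)) in *.
generalize (filter_and _ _ UL (filter_and _ _ (ev_ge 1) (ev_ln_ge 1))).
apply filter_imp. intros r [U [R1 R2]].
assert (K := count_lower f t d r (eta * r) Hf Hn Hd R1 ltac:(split; [apply Rmult_le_pos; lra|nra])).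
rewrite Rmult_1_l in U. replace (r - eta * r) with ((1 - eta) * r) in K by ring.
set (X := mass_diff f (t - d) t ((1 - eta) * r) r) in *. change (r ^ S (S k)) with (r * r ^ S k) in U.
assert (Pp : 1 <= r ^ S k) by (apply pow_ge1; lra).
set (p := r ^ S k) in *. apply Rabs_def2 in U.
apply Rle_trans with (X / (r * p * ln r) * / (d * eta)); [lra|].
assert (P2 : 0 < d * ln r * (eta * r)) by (repeat apply Rmult_lt_0_compat; lra).
assert (P3 : 0 < d * ln r * (eta * r) * p) by (apply Rmult_lt_0_compat; lra).
apply Rmult_le_reg_l with (d * ln r * (eta * r) * p); [auto|].
replace (d * ln r * (eta * r) * p * (X / (r * p * ln r) * / (d * eta))) with X by (field; repeat split; lra).
replace (d * ln r * (eta * r) * p * (zeros_below f t r / p)) with (d * ln r * (eta * r) * zeros_below f t r) by (field; lra). exact K.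
Qed.

Lemma prod_close (x0 y0 e : R) : 0 < e ->
  exists d, 0 < d /\ forall x y, Rabs (x - x0) <= d -> Rabs (y - y0) <= d -> Rabs (x * y - x0 * y0) <= e.
Proof.
intros He. pose proof (Rabs_pos x0) as X0. pose proof (Rabs_pos y0) as Y0.
assert (Q : 0 < e / (Rabs x0 + Rabs y0 + 1)) by (apply Rdiv_lt_0_compat; lra).
exists (Rmin 1 (e / (Rabs x0 + Rabs y0 + 1))). split; [apply Rmin_glb_lt; lra|].
set (d := Rmin _ _). assert (D1 : d <= 1) by apply Rmin_l. assert (D2 : d <= e / (Rabs x0 + Rabs y0 + 1)) by apply Rmin_r.
intros x y Hx Hy. replace (x * y - x0 * y0) with ((x - x0) * (y - y0) + (x0 * (y - y0) + y0 * (x - x0))) by ring.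
assert (Px := Rabs_pos (x - x0)). assert (Py := Rabs_pos (y - y0)).
assert (E : d * (Rabs x0 + Rabs y0 + 1) <= e).
{ apply Rmult_le_compat_r with (r := Rabs x0 + Rabs y0 + 1) in D2; [|lra].
  replace (e / (Rabs x0 + Rabs y0 + 1) * (Rabs x0 + Rabs y0 + 1)) with e in D2 by (field; lra). exact D2. }
eapply Rle_trans; [apply Rabs_triang|]. eapply Rle_trans; [apply Rplus_le_compat_l, Rabs_triang|]. rewrite !Rabs_mult.
assert (Rabs (x - x0) * Rabs (y - y0) <= d * 1) by (apply Rmult_le_compat; lra).
assert (Rabs x0 * Rabs (y - y0) <= Rabs x0 * d) by (apply Rmult_le_compat_l; lra).
assert (Rabs y0 * Rabs (x - x0) <= Rabs y0 * d) by (apply Rmult_le_compat_l; lra). lra.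
Qed.

Lemma pow_diff_quot (m : nat) (e : R) : 0 < e -> exists eta, 0 < eta < 1 /\
  Rabs (((1 + eta) ^ m - 1) / eta - INR m) <= e /\ Rabs ((1 - (1 - eta) ^ m) / eta - INR m) <= e.
Proof.
intros He. assert (D := derivable_pt_lim_pow 1 m). rewrite pow1, Rmult_1_r in D.
destruct (D e He) as [d Hd]. assert (Pd := cond_pos d). set (eta := Rmin (/ 2) (d / 2)).
assert (E0 : 0 < eta) by (apply Rmin_glb_lt; lra). assert (E1 : eta <= / 2) by apply Rmin_l. assert (E2 : eta <= d / 2) by apply Rmin_r.
exists eta. split; [lra|split].
- assert (Q := Hd eta ltac:(lra) ltac:(rewrite Rabs_pos_eq; lra)). rewrite pow1 in Q. lra.
- assert (Q := Hd (- eta) ltac:(lra) ltac:(rewrite Rabs_left; lra)). rewrite pow1 in Q.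
  replace ((1 - (1 - eta) ^ m) / eta) with (((1 + - eta) ^ m - 1) / - eta); [lra|].
  change (1 - eta) with (1 + - eta). field. lra.
Qed.

(** The bounds on both sides are difference quotients of [G] in the slope times difference quotients
    of x^(k+2) at 1, close to D and k + 2. The increments d and eta are fixed before r tends to
    infinity, so pointwise limits in the slope suffice. *)
Theorem zeros_below_lim (k : nat) (f : C -> C) (t d0 D : R) (G : R -> R) : holo_lower f -> (forall s : R, f (RtoC s) <> RtoC 0) ->
  0 < t -> 0 < d0 ->
  (forall u, Rabs (u - t) < d0 -> is_lim (fun r => mass f u r / (r ^ S (S k) * ln r)) p_infty (G u)) ->
  derivable_pt_lim G t D ->
  is_lim (fun r => zeros_below f t r / r ^ S k) p_infty (D * INR (S (S k))).
Proof.
intros Hf Hn Ht Hd0 HL HD. apply ev_is_lim. intros e He.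
destruct (prod_close D (INR (S (S k))) (e / 3) ltac:(lra)) as [x [Hx X]].
destruct (pow_diff_quot (S (S k)) x Hx) as [eta [Heta [Y1 Y2]]].
(* With q the difference quotient based at t, the quotient between t + d and t + 2 d is 2 q(2 d) -
   q(d), with error at most 2 (x / 3) + x / 3; only the derivative at t is involved. *)
destruct (HD (x / 3) ltac:(lra)) as [d1 K]. assert (Pd1 := cond_pos d1).
set (d := Rmin (t / 2) (Rmin (d0 / 3) (d1 / 3))).
assert (Hd : 0 < d) by (repeat apply Rmin_glb_lt; lra).
assert (D1 : d <= t / 2) by apply Rmin_l.
assert (D2 : d <= d0 / 3) by (eapply Rle_trans; [apply Rmin_r|apply Rmin_l]).
assert (D3 : d <= d1 / 3) by (eapply Rle_trans; [apply Rmin_r|apply Rmin_r]).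
assert (Km := K (- d) ltac:(lra) ltac:(rewrite Rabs_left; lra)).
assert (Kp := K d ltac:(lra) ltac:(rewrite Rabs_pos_eq; lra)).
assert (K2 := K (2 * d) ltac:(lra) ltac:(rewrite Rabs_pos_eq; lra)).
assert (S1 : Rabs ((G t - G (t - d)) / d - D) <= x).
{ replace ((G t - G (t - d)) / d) with ((G (t + - d) - G t) / - d); [lra|]. change (t - d) with (t + - d). field. lra. }
assert (S2 : Rabs ((G (t + 2 * d) - G (t + d)) / d - D) <= x).
{ replace ((G (t + 2 * d) - G (t + d)) / d - D) with
    (2 * ((G (t + 2 * d) - G t) / (2 * d) - D) + - ((G (t + d) - G t) / d - D)) by (field; lra).
  eapply Rle_trans; [apply Rabs_triang|]. rewrite Rabs_mult, Rabs_Ropp, (Rabs_pos_eq 2) by lra. lra. }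
assert (Lm := HL (t - d) ltac:(rewrite Rabs_left; lra)). assert (L0 := HL t ltac:(rewrite Rminus_diag, Rabs_R0; lra)).
assert (Lp := HL (t + d) ltac:(rewrite Rabs_pos_eq; lra)). assert (L2 := HL (t + 2 * d) ltac:(rewrite Rabs_pos_eq; lra)).
assert (He3 : 0 < e / 3) by lra.
assert (Hdt : 0 < d <= t) by lra.
generalize (filter_and _ _ (zeros_below_lower k f t d eta _ _ Hf Hn Hdt Heta Lm L0 _ He3)
  (zeros_below_upper k f t d eta _ _ Hf Hn (Rlt_le _ _ Ht) Hd (proj1 Heta) Lp L2 _ He3)).
apply filter_imp. intros r [A B].
assert (X1 := X _ _ S1 Y2). assert (X2 := X _ _ S2 Y1). apply Rabs_le_between in X1. apply Rabs_le_between in X2.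
apply Rabs_def1; lra.
Qed.

(** Finiteness of [ell] near t is part of the meaning of its differentiability: [real] sends
    infinite values to 0, and [ex_derive] alone would not exclude them. The interval may be
    unbounded, hence [b] in [Rbar]. *)
Theorem theorem1p3 (f : C -> C) (rho : nat) (a : R) (b : Rbar)
  (Hf : class_F rho f)
  (Ha : 0 <= a)
  (Hlim : forall t : R, a < t -> Rbar_lt t b ->
     filterlim (growth rho f) (log_curve t) (Rbar_nbhds (ell rho f t))) :
  forall t : R, a < t -> Rbar_lt t b ->
    locally t (fun u : R => is_finite (ell rho f u)) ->
    ex_derive (fun u : R => real (ell rho f u)) t ->
    filterlim (fun r : R => Rbar_div (zero_count f t r) (Finite (r ^ rho)))
      (Rbar_locally p_infty)
      (Rbar_nbhds
         (Finite (Derive (fun u : R => real (ell rho f u)) t / (2 * PI * INR rho)))).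
Proof.
intros t Ht1 Ht2 Hfin Hder.
destruct rho as [|k]; [destruct Hf as [H _]; lia|].
destruct (class_F_holo _ _ Hf) as [Hh Hn].
assert (Pi1 := PI_RGT_0).
assert (K1 : 0 < INR (S k)) by (apply lt_0_INR; lia). assert (K2 : 0 < INR (S (S k))) by (apply lt_0_INR; lia).
set (L := fun u : R => real (ell (S k) f u)) in *.
(* The normalized mass at slope u tends to [L u * c]; the factor k + 2 from the radial difference
   quotient turns [c] into 1 / (2 PI rho). *)
set (c := / (2 * PI * (INR (S k) * INR (S (S k))))).
assert (Near : locally t (fun u => a < u /\ Rbar_lt u b /\ is_finite (ell (S k) f u))).
{ apply filter_and; [|apply filter_and; auto].
  - exact (open_gt a t Ht1).
  - destruct b as [b| |]; simpl in *; [exact (open_lt b t Ht2)|apply filter_true|contradiction]. }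
destruct Near as [d0 Near].
assert (Lim : is_lim (fun r => zeros_below f t r / r ^ S k) p_infty ((Derive L t * c) * INR (S (S k)))).
{ apply zeros_below_lim with (d0 := d0) (G := fun u => L u * c); auto; [lra|apply cond_pos| |].
  - intros u Hu. destruct (Near u Hu) as [A1 [A2 A3]]. apply mass_lim; [auto|lra|].
    assert (Q := Hlim u A1 A2). rewrite <- A3 in Q. exact Q.
  - apply is_derive_Reals, (is_derive_ext (fun u => scal c (L u))); [intros u; apply Rmult_comm|].
    rewrite Rmult_comm. apply (is_derive_scal L t c). apply Derive_correct; auto. }
replace (Derive L t / (2 * PI * INR (S k))) with (Derive L t * c * INR (S (S k))) by (unfold c; field; repeat split; lra).
intros P HP. assert (Q : ev (fun r => P (Finite (zeros_below f t r / r ^ S k)))) by exact (Lim _ HP).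
change (ev (fun r => P (Rbar_div (zero_count f t r) (r ^ S k)))).
generalize (filter_and _ _ Q (ev_ge 1)). apply filter_imp. intros r [H1 H2].
rewrite zero_count_zeros_below by (auto; lra). exact H1.
Qed.
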